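(* Let $1\le p\le n$ and $N\ge 2$, and let $M$ be one of the geometric means $\mathrm{alm}$ or $\mathrm{ls}$ on $\mathrm{P}_p$. Let $\mathcal D$ be the set of $N$-tuples $(A_1,\dots,A_N)$ of elements of $\mathrm{S}^+(p,n)$ such that $\mathrm{span}(A_1),\dots,\mathrm{span}(A_N)$ all lie in some geodesic ball of radius less than $\pi/(4\sqrt2)$ in $\mathrm{Gr}(p,n)$. Then the mean $A_1\circ\cdots\circ A_N$ described in the context is well defined on $\mathcal D$ (it does not depend on any of the choices made in its construction) with values in $\mathrm{S}^+(p,n)$, and it satisfies the following properties, for all tuples in $\mathcal D$: (PP1') If $A_1,\dots,A_N$ commute pairwise and all have the same range, then $A_1\circ\cdots\circ A_N=(A_1A_2\cdots A_N)^{1/N}$. (PP2) For all $\alpha_1,\dots,\alpha_N>0$, $(\alpha_1A_1)\circ\cdots\circ(\alpha_NA_N)=(\alpha_1\cdots\alpha_N)^{1/N}\,(A_1\circ\cdots\circ A_N)$. (PP3) $A_{\pi(1)}\circ\cdots\circ A_{\pi(N)}=A_1\circ\cdots\circ A_N$ for every permutation $\pi$ of $\{1,\dots,N\}$. (PP4) If $A_i\le A_i^0$ with $A_i^0\in\mathrm{S}^+(p,n)$ for each $i$, then $A_1\circ\cdots\circ A_N\le A_1^0\circ\cdots\circ A_N^0$. (PP5) If for each $i$, $(A_i^{(m)})_{m\ge1}$ is a monotonically decreasing sequence in $\mathrm{S}^+(p,n)$ converging to $A_i\in\mathrm{S}^+(p,n)$, then $\lim_{m\to\infty}A_1^{(m)}\circ\cdots\circ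 A_N^{(m)}=A_1\circ\cdots\circ A_N$. (PP6') For all $\mu>0$ and $P\in\mathrm{O}(n)$, $(\mu P^TA_1\mu P)\circ\cdots\circ(\mu P^TA_N\mu P)=\mu P^T(A_1\circ\cdots\circ A_N)\mu P$. (PP7') $(A_1\circ\cdots\circ A_N)^\dagger=A_1^\dagger\circ\cdots\circ A_N^\dagger$, where $\dagger$ denotes the Moore–Penrose pseudo-inverse.
   Context: Notation. $\mathrm{P}_p$ is the set of real symmetric positive definite $p\times p$ matrices; $\mathrm{S}^+(p,n)$ is the set of real symmetric positive semidefinite $n\times n$ matrices of rank $p$; $\le$ is the Löwner order ($A\le B$ iff $B-A$ is positive semidefinite); $\mathrm{span}(A)$ is the column space of $A$. $\mathrm{St}(p,n)=\{U\in\mathbb R^{n\times p}:U^TU=I_p\}$, with the canonical Riemannian metric coming from $\mathrm{St}(p,n)=\mathrm{O}(n)/\mathrm{O}(n-p)$, i.e. $\langle\Delta,\Delta\rangle_U=\mathrm{Tr}(\Delta^T(I-\tfrac12UU^T)\Delta)$, and geodesic distance $d_{\mathrm{St}(p,n)}$. $\mathrm{Gr}(p,n)=\mathrm{St}(p,n)/\mathrm{O}(p)$ is the Grassmann manifold of $p$-dimensional subspaces of $\mathbb R^n$ with its natural Riemannian metric, for which $U\mapsto\mathrm{span}(U)$ is a Riemannian submersion and $d_{\mathrm{Gr}(p,n)}(S,S')^2$ is the sum of the squares of the $p$ principal angles between $S$ and $S'$. The Karcher mean of $S_1,\dots,S_N\in\mathrm{Gr}(p,n)$ is the minimizer of $X\mapsto\sum_i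 d_{\mathrm{Gr}(p,n)}(X,S_i)^2$; it exists and is unique when the $S_i$ lie in a geodesic ball of radius less than $\pi/(4\sqrt2)$. Means on $\mathrm{P}_p$. For $A,B\in\mathrm{P}_p$, $A\#B=A^{1/2}(A^{-1/2}BA^{-1/2})^{1/2}A^{1/2}$. The mean $\mathrm{ls}(T_1,\dots,T_N)$ is the unique minimizer over $X\in\mathrm{P}_p$ of $\sum_i d(X,T_i)^2$ with $d(A,B)=\|\log(A^{-1/2}BA^{-1/2})\|_F$. The mean $\mathrm{alm}$ (Ando–Li–Mathias) is defined inductively: $\mathrm{alm}(T_1,T_2)=T_1\#T_2$; for $N\ge3$, put $T_i^{(0)}=T_i$ and $T_i^{(r+1)}=\mathrm{alm}\big((T_j^{(r)})_{j\ne i}\big)$; the $N$ sequences $(T_i^{(r)})_r$ converge to a common limit, which is $\mathrm{alm}(T_1,\dots,T_N)$. Both $\mathrm{alm}$ and $\mathrm{ls}$ are known to satisfy, on $\mathrm{P}_p$: consistency with scalars (value $(T_1\cdots T_N)^{1/N}$ for commuting matrices), joint homogeneity, permutation invariance, monotonicity, continuity from above, congruence invariance under $\mathrm{Gl}(p)$, and self-duality under inversion. The mean on $\mathrm{S}^+(p,n)$. Let $A_1,\dots,A_N\in\mathrm{S}^+(p,n)$ have ranges in a geodesic ball of radius less than $\pi/(4\sqrt2)$ in $\mathrm{Gr}(p,n)$. Write $A_i=U_iR_i^2U_i^T$ with $U_i\in\mathrm{St}(p,n)$ and $R_i^2\in\mathrm{P}_p$. (1) Let $W\in\mathrm{St}(p,n)$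 be an orthonormal basis of the Karcher mean of the subspaces $\mathrm{span}(U_i)$. (2) For each $i$, choose bases $Y_i\in U_i\mathrm{O}(p)$ of $\mathrm{span}(U_i)$ and $W_i\in W\mathrm{O}(p)$ of $\mathrm{span}(W)$ with $d_{\mathrm{St}(p,n)}(Y_i,W_i)=d_{\mathrm{Gr}(p,n)}(\mathrm{span}(U_i),\mathrm{span}(W))$ (such bases are obtained from a singular value decomposition $U_i^TW=O_i(\cos\Sigma_i)(O_i^W)^T$, with $O_i,O_i^W\in\mathrm{O}(p)$ and $\Sigma_i$ the diagonal matrix of principal angles, by $Y_i=U_iO_i$, $W_i=WO_i^W$). Put $S_i^2=Y_i^TA_iY_i$. (3) Fix a basis $W_0\in\mathrm{St}(p,n)$ of $\mathrm{span}(W)$, put $T_i^2=W_0^TW_iS_i^2W_i^TW_0\in\mathrm{P}_p$, and define $$A_1\circ\cdots\circ A_N=W_0\,M(T_1^2,\dots,T_N^2)\,W_0^T.$$ *)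

(* Defs.v *)
From HB Require Import structures.
From mathcomp Require Import all_boot all_order all_algebra all_fingroup.
From mathcomp Require Import all_classical all_reals all_analysis.
Set Implicit Arguments.
Unset Strict Implicit.
Unset Printing Implicit Defensive.
Import Order.TTheory GRing.Theory Num.Theory.
Import numFieldNormedType.Exports.
Local Open Scope classical_set_scope.
Local Open Scope ring_scope.

(* The predicates below are used with [xget]: [xget d P] is an element of P if
   P is nonempty, and the default d otherwise. *)

Section Symmetric.
Variable R : realType.

Definition psd n (A : 'M[R]_n) : Prop :=
  A^T = A /\ forall x : 'cV[R]_n, 0 <= (x^T *m A *m x) 0 0.

Definition Pos p (A : 'M[R]_p) : Prop :=
  A^T = A /\ forall x : 'cV[R]_p, x != 0 -> 0 < (x^T *m A *m x) 0 0.

Definition Splus p n (A : 'M[R]_n) : Prop := psd A /\ \rank A = p.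

Definition loewner n (A B : 'M[R]_n) : Prop := psd (B - A).

Definition Stiefel p n (U : 'M[R]_(n, p)) : Prop := U^T *m U = 1%:M.

Definition Orth p (O : 'M[R]_p) : Prop := Stiefel O.

(* Functional calculus f(A) of a real symmetric matrix; the value does not
   depend on the chosen diagonalization. *)
Definition symfun (f : R -> R) n (A : 'M[R]_n) : 'M[R]_n :=
  xget 0 [set B | exists (O : 'M[R]_n) (d : 'rV[R]_n),
    [/\ Orth O, A = O *m diag_mx d *m O^T
      & B = O *m diag_mx (map_mx f d) *m O^T]].

Definition sqrtmx n (A : 'M[R]_n) := symfun Num.sqrt A.
Definition logmx n (A : 'M[R]_n) := symfun (@ln R) A.
Definition powmx n (A : 'M[R]_n) (a : R) := symfun (fun x => x `^ a) A.

Definition frobenius n (A : 'M[R]_n) : R := Num.sqrt (\tr (A^T *m A)).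

Definition penrose n (A X : 'M[R]_n) : Prop :=
  [/\ A *m X *m A = A, X *m A *m X = X,
      (A *m X)^T = A *m X & (X *m A)^T = X *m A].

(* MathComp's [pinvmx] is only some partial inverse, not the Moore-Penrose
   pseudo-inverse. *)
Definition mppinv n (A : 'M[R]_n) : 'M[R]_n := xget 0 [set X | penrose A X].

Definition unique_minimizer (T : Type) (D : set T) (f : T -> R) (x : T) : Prop :=
  D x /\ forall y, D y -> y <> x -> f x < f y.

End Symmetric.

Section MeansOnPos.
Variables (R : realType) (p : nat).
Implicit Types A B : 'M[R]_p.

Definition sharp A B : 'M[R]_p :=
  let C := sqrtmx A in
  C *m sqrtmx (invmx C *m B *m invmx C) *m C.

Definition distPos A B : R :=
  let C := invmx (sqrtmx A) in frobenius (logmx (C *m B *m C)).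

Definition ls N (T : 'I_N -> 'M[R]_p) : 'M[R]_p :=
  xget 0 [set X | unique_minimizer (@Pos R p)
                    (fun X => \sum_(i < N) distPos X (T i) ^+ 2) X].

(* [alm_rec k] is the mean of k + 2 matrices; [fun j => S (lift i j)] is the
   tuple S with its i-th entry removed.  Outside of the case where all the
   sequences converge to a common limit, the value is the junk matrix 0. *)
Fixpoint alm_rec (k : nat) : ('I_k.+2 -> 'M[R]_p) -> 'M[R]_p :=
  match k return ('I_k.+2 -> 'M[R]_p) -> 'M[R]_p with
  | 0 => fun T => sharp (T ord0) (T ord_max)
  | k'.+1 => fun T =>
      let step (S : 'I_k'.+3 -> 'M[R]_p) (i : 'I_k'.+3) :=
        alm_rec (fun j : 'I_k'.+2 => S (lift i j)) in
      xget 0 [set L : 'M[R]_p | forall i : 'I_k'.+3,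
        (fun r : nat => iter r step T i) @ \oo --> L]
  end.

Definition alm (N : nat) : ('I_N -> 'M[R]_p) -> 'M[R]_p :=
  match N return ('I_N -> 'M[R]_p) -> 'M[R]_p with
  | k.+2 => @alm_rec k
  | _ => fun=> 0
  end.

End MeansOnPos.

Section Manifolds.
Variables (R : realType) (p n : nat).

Definition colspan m (A : 'M[R]_(n, m)) : {vspace 'cV[R]_n} :=
  <<[seq col j A | j <- enum 'I_m]>>%VS.

Definition Gr : set {vspace 'cV[R]_n} := [set V | \dim V = p].

(* theta lists the p principal angles between V and V'. *)
Definition principal_angles (V V' : {vspace 'cV[R]_n}) (theta : 'rV[R]_p) : Prop :=
  exists (U U' : 'M[R]_(n, p)) (O O' : 'M[R]_p),
    [/\ Stiefel U /\ colspan U = V, Stiefel U' /\ colspan U' = V',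
        Orth O /\ Orth O',
        forall i, 0 <= theta 0 i <= pi / 2
      & U^T *m U' = O *m diag_mx (map_mx cos theta) *m O'^T].

Definition dGr (V V' : {vspace 'cV[R]_n}) : R :=
  xget 0 [set r : R | exists2 theta, principal_angles V V' theta
                      & r = Num.sqrt (\sum_(i < p) theta 0 i ^+ 2)].

Definition karcher N (S : 'I_N -> {vspace 'cV[R]_n}) (X : {vspace 'cV[R]_n}) : Prop :=
  unique_minimizer Gr (fun Z => \sum_(i < N) dGr Z (S i) ^+ 2) X.

Definition velocity (g : R -> 'M[R]_(n, p)) (t : R) : 'M[R]_(n, p) :=
  \matrix_(i, j) derive1 (fun s => g s i j) t.

Definition St_metric (U D : 'M[R]_(n, p)) : R :=
  \tr (D^T *m (1%:M - 2^-1 *: (U *m U^T)) *m D).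

(* Curves parametrized by [0, 1]; a C^1 curve on [0, 1] is the restriction of a
   C^1 map from R to matrices.  The velocity may vanish, so every piecewise C^1
   curve becomes C^1, with the same length, after reparametrization. *)
Definition St_curve (Y W : 'M[R]_(n, p)) (g : R -> 'M[R]_(n, p)) : Prop :=
  [/\ g 0 = Y, g 1 = W, forall t, 0 <= t <= 1 -> Stiefel (g t)
    & forall i j, (forall t, derivable (fun s => g s i j) t 1) /\
                  continuous (derive1 (fun s => g s i j))].

Definition St_length (g : R -> 'M[R]_(n, p)) : \bar R :=
  (\int[lebesgue_measure]_(t in `[0%R, 1%R])
     (Num.sqrt (St_metric (g t) (velocity g t)))%:E)%E.

(* Extended-real valued: the distance is +oo between the two connected
   components of St(n, n). *)
Definition dSt (Y W : 'M[R]_(n, p)) : \bar R :=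
  ereal_inf [set St_length g | g in St_curve Y W].

End Manifolds.

Section MeanOnSplus.
Variables (R : realType) (p n N : nat).
Variable M : ('I_N -> 'M[R]_p) -> 'M[R]_p.

(* B is an outcome of the construction, for some choice of the U i, of the
   orthonormal basis W of the Karcher mean, of the pairs of bases Y i, Wi i,
   and of the common basis W0. *)
Definition is_gmean (A : 'I_N -> 'M[R]_n) (B : 'M[R]_n) : Prop :=
  exists (U : 'I_N -> 'M[R]_(n, p)) (R2 : 'I_N -> 'M[R]_p)
         (W : 'M[R]_(n, p)) (Y Wi : 'I_N -> 'M[R]_(n, p)) (W0 : 'M[R]_(n, p)),
  [/\ forall i, [/\ Stiefel (U i), Pos (R2 i) & A i = U i *m R2 i *m (U i)^T],
      Stiefel W /\ karcher p (fun i => colspan (U i)) (colspan W),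
      forall i, [/\ exists2 O : 'M[R]_p, Orth O & Y i = U i *m O,
                    exists2 O : 'M[R]_p, Orth O & Wi i = W *m O
                  & dSt (Y i) (Wi i)
                    = (dGr p (colspan (U i)) (colspan W))%:E],
      Stiefel W0 /\ colspan W0 = colspan W
    & let S2 i := (Y i)^T *m A i *m Y i in
      let T2 i := W0^T *m Wi i *m S2 i *m (Wi i)^T *m W0 in
      B = W0 *m M T2 *m W0^T].

Definition gmean (A : 'I_N -> 'M[R]_n) : 'M[R]_n := xget 0 [set B | is_gmean A B].

Definition gmean_dom (A : 'I_N -> 'M[R]_n) : Prop :=
  (forall i, Splus p (A i)) /\
  exists (C : {vspace 'cV[R]_n}) (r : R),
    [/\ Gr p C, r < pi / (4 * Num.sqrt 2)
      & forall i, dGr p C (colspan (A i)) < r].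

End MeanOnSplus.

(* Main.v *)
(* Every choice in the construction is a rotation, and the rotations cancel:
   if U i is the orthonormal basis of span (A i) for which (U i)^T W is positive
   semidefinite, W being a basis of the Karcher mean, then the mean equals
   W M(..., (U i)^T (A i) (U i), ...) W^T, and each property is inherited from
   the same property of M on P_p.  Four facts support this reduction.
   - alm: by monotonicity and homogeneity, a step of the iteration over N
     matrices divides Thompson's metric by N - 1, so it converges, and the
     properties pass from N - 1 to N matrices.
   - ls: by the exponential metric increasing property, a solution X of the
     Karcher equation sum_i log(X^-1/2 T_i X^-1/2) = 0 is the unique minimizer;
     a solution is a decreasing limit of power means with parameters 2^-k, from
     which it inherits monotonicity.
   - The Karcher mean on Gr(p,n): at short range the distance to a
     point satisfies a midpoint inequality, proved by reflecting the point
     through the midpoint; it makes the distance convex along short geodesics,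
     so the minimizer stays in the ball and is unique.
   - The Stiefel distance: the canonical length of a curve controls at once the
     Grassmann distance of its ends and, up to a small factor, the distance of
     its ends in the product of p unit spheres, for every rotation of the
     frames; hence dSt (Y, W) = dGr (Y, W) forces Y^T W to be positive
     semidefinite. *)
Require Import Defs.
From HB Require Import structures.
From mathcomp Require Import all_boot all_order all_algebra all_fingroup.
From mathcomp Require Import all_classical all_reals all_analysis.
From mathcomp Require Import ring lra.
Set Implicit Arguments.
Unset Strict Implicit.
Unset Printing Implicit Defensive.
Import Order.TTheory GRing.Theory Num.Theory.
Import numFieldNormedType.Exports.
Local Open Scope classical_set_scope.
Local Open Scope ring_scope.

(** [is_gm] collects what is used of [alm] and [ls], which are treated together from there on;
    continuity from above is derived from monotonicity and homogeneity ([gm_cvg_dec]). Geodesics of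
    the Grassmannian are closed formulas in the functional calculus, and convexity rests on
    reflections, triangle inequalities and an upper first variation estimate with explicit error.
    The obstacle in the midpoint inequality is that principal angles lie in [0, pi / 2], while a
    doubled angle can pass this bound. The sign of a determinant detects the folding of one angle;
    the folding of two angles costs a length sqrt 2 * pi. The radius pi / (4 sqrt 2) keeps the sums
    of distances in question below that. The obstacle in the Stiefel distance is that the canonical
    metric halves the weight of the part of the velocity that rotates the basis within its span, so
    the columns may move faster than the canonical speed. Weighting the column distance by a small l
    leaves an excess of order l^2 only, which disappears after division by l. *)

Section Dot.
Variable R : realType.

Definition dot n (x y : 'cV[R]_n) : R := (x^T *m y) 0 0.

Lemma dotE n (x y : 'cV[R]_n) : dot x y = \sum_i x i 0 * y i 0.
Proof. by rewrite /dot mxE; apply: eq_bigr => i _; rewrite mxE. Qed.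

Lemma dotC n (x y : 'cV[R]_n) : dot x y = dot y x.
Proof. by rewrite !dotE; apply: eq_bigr => i _; rewrite mulrC. Qed.

Lemma dotDl n (x y z : 'cV[R]_n) : dot (x + y) z = dot x z + dot y z.
Proof. by rewrite /dot raddfD mulmxDl mxE. Qed.

Lemma dotDr n (x y z : 'cV[R]_n) : dot z (x + y) = dot z x + dot z y.
Proof. by rewrite /dot mulmxDr mxE. Qed.

Lemma dotZl n a (x y : 'cV[R]_n) : dot (a *: x) y = a * dot x y.
Proof. by rewrite /dot linearZ -scalemxAl mxE. Qed.

Lemma dotZr n a (x y : 'cV[R]_n) : dot y (a *: x) = a * dot y x.
Proof. by rewrite /dot -scalemxAr mxE. Qed.

Lemma dotNl n (x y : 'cV[R]_n) : dot (- x) y = - dot x y.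
Proof. by rewrite -scaleN1r dotZl mulN1r. Qed.

Lemma dotNr n (x y : 'cV[R]_n) : dot y (- x) = - dot y x.
Proof. by rewrite -scaleN1r dotZr mulN1r. Qed.

Lemma dotBl n (x y z : 'cV[R]_n) : dot (x - y) z = dot x z - dot y z.
Proof. by rewrite dotDl dotNl. Qed.

Lemma dotBr n (x y z : 'cV[R]_n) : dot z (x - y) = dot z x - dot z y.
Proof. by rewrite dotDr dotNr. Qed.

Lemma dot0l n (x : 'cV[R]_n) : dot 0 x = 0.
Proof. by rewrite /dot trmx0 mul0mx mxE. Qed.

Lemma dot0r n (x : 'cV[R]_n) : dot x 0 = 0.
Proof. by rewrite dotC dot0l. Qed.

Lemma dot_ge0 n (x : 'cV[R]_n) : 0 <= dot x x.
Proof. by rewrite dotE sumr_ge0 // => i _; rewrite -expr2 sqr_ge0. Qed.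

Lemma dot_eq0 n (x : 'cV[R]_n) : (dot x x == 0) = (x == 0).
Proof.
apply/idP/eqP => [|->]; last by rewrite dot0l.
rewrite dotE psumr_eq0; last by move=> i _; rewrite -expr2 sqr_ge0.
move=> /allP h; apply/colP => i; rewrite mxE.
by have := h i (mem_index_enum _); rewrite /= -expr2 sqrf_eq0 => /eqP.
Qed.

Lemma dot_gt0 n (x : 'cV[R]_n) : (0 < dot x x) = (x != 0).
Proof. by rewrite lt_def dot_ge0 andbT dot_eq0. Qed.

Lemma dot_mull m n (A : 'M[R]_(m, n)) x y : dot (A *m x) y = dot x (A^T *m y).
Proof. by rewrite /dot trmx_mul mulmxA. Qed.

Lemma dot_mulr m n (A : 'M[R]_(m, n)) x y : dot x (A *m y) = dot (A^T *m x) y.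
Proof. by rewrite dot_mull trmxK. Qed.

Lemma quadE n (A : 'M[R]_n) x : (x^T *m A *m x) 0 0 = dot x (A *m x).
Proof. by rewrite /dot mulmxA. Qed.

Lemma dot_delta n (A : 'M[R]_n) i j :
  dot (delta_mx i 0) (A *m delta_mx j 0) = A i j.
Proof.
rewrite -colE dotE (bigD1 i) //= big1 ?addr0; first by rewrite !mxE !eqxx mul1r.
by move=> k ki; rewrite !mxE (negbTE ki) mul0r.
Qed.

Lemma dot_CS n (x y : 'cV[R]_n) : dot x y ^+ 2 <= dot x x * dot y y.
Proof.
have [->|y0] := eqVneq y 0; first by rewrite !dot0r expr0n mulr0.
have yy : 0 < dot y y by rewrite dot_gt0.
have := dot_ge0 (dot y y *: x - dot x y *: y).
rewrite !(dotBl, dotBr, dotZl, dotZr) (dotC y x) => h.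
rewrite -subr_ge0 -(pmulr_rge0 _ yy).
by apply: le_trans h _; rewrite le_eqVlt; apply/orP; left; apply/eqP; ring.
Qed.

Lemma stiefel_dot n p (U : 'M[R]_(n, p)) x y :
  Stiefel U -> dot (U *m x) (U *m y) = dot x y.
Proof. by move=> sU; rewrite dot_mull mulmxA sU mul1mx. Qed.

Lemma orth_trmx n (O : 'M[R]_n) : Orth O -> Orth O^T.
Proof. by rewrite /Orth /Stiefel trmxK => /mulmx1C. Qed.

Lemma orth_mulV n (O : 'M[R]_n) : Orth O -> O *m O^T = 1%:M.
Proof. exact: mulmx1C. Qed.

Lemma stiefel_mul n p q (U : 'M[R]_(n, p)) (V : 'M[R]_(p, q)) :
  Stiefel U -> Stiefel V -> Stiefel (U *m V).
Proof.
by rewrite /Stiefel => sU sV; rewrite trmx_mul mulmxA -(mulmxA V^T) sU mulmx1.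
Qed.

Lemma orth_mul n (O Q : 'M[R]_n) : Orth O -> Orth Q -> Orth (O *m Q).
Proof. exact: stiefel_mul. Qed.

Lemma orth1 n : Orth (1%:M : 'M[R]_n).
Proof. by rewrite /Orth /Stiefel trmx1 mulmx1. Qed.

Lemma orth_unit n (O : 'M[R]_n) : Orth O -> O \in unitmx.
Proof. by move=> /mulmx1_unit[]. Qed.

Lemma orth_inv n (O : 'M[R]_n) : Orth O -> invmx O = O^T.
Proof.
move=> oO; have u := orth_unit oO.
by rewrite -[LHS]mul1mx -oO -mulmxA mulmxV // mulmx1.
Qed.

End Dot.

(** * Entrywise convergence and compactness of matrices *)

Section Compact.
Variable R : realType.

Lemma mx_cvgP (T : Type) (F : set_system T) {FF : Filter F} m n
    (u : T -> 'M[R]_(m, n)) (A : 'M[R]_(m, n)) :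
  (u @ F --> A) <-> (forall i j, (fun k => u k i j) @ F --> A i j).
Proof.
split=> [h i j|h].
  exact: (@cvg_comp _ _ _ u (fun M : 'M[R]_(m, n) => M i j) F _ _ h
    (@coord_continuous _ _ _ i j A)).
move=> X [P AP sPX]; rewrite nbhs_filterE /=.
have : \forall k \near F, forall i j, P i j (u k i j).
  apply: filter_forall => i; apply: filter_forall => j.
  exact: (h i j (P i j) (AP i j)).
by apply: filterS => k hk; apply: sPX.
Qed.

(** The map [vec_mx] is continuous and sends a box of row vectors, compact by [rV_compact], onto the
    matrices with bounded entries. *)
Lemma mx_compact m n (A : set 'M[R]_(m, n)) (c : R) :
  closed A -> (forall M, A M -> forall i j, `|M i j| <= c) -> compact A.
Proof.
move=> clA bA.
pose B := [set v : 'rV[R]_(m * n) | forall i, v ord0 i \in `[- c, c]].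
have cB : compact B.
  apply: (@rV_compact _ _ (fun=> `[- c, c]%classic)) => i.
  exact: segment_compact.
have cont : continuous (@vec_mx R m n).
  move=> v; apply/(@mx_cvgP _ (nbhs v) (nbhs_filter v)) => i j.
  rewrite (_ : (fun k : 'rV_(m * n) => vec_mx k i j) =
    fun k : 'rV_(m * n) => k ord0 (mxvec_index i j)); last first.
    by apply/funext => k; rewrite mxE.
  by rewrite mxE; apply: coord_continuous.
have cA : compact (@vec_mx R m n @` B).
  by apply: continuous_compact cB; apply: continuous_subspaceT.
apply: subclosed_compact clA cA _ => M /bA h.
exists (mxvec M); last by rewrite mxvecK.
by move=> k; case/mxvec_indexP: k => i j; rewrite mxvecE in_itv /= -ler_norml.
Qed.

End Compact.
Section CvgMx.
Variables (R : realType) (T : Type) (F : set_system T).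
Context {FF : Filter F}.

Lemma cvg_sumr (I : Type) (r : seq I) (P : pred I) (f : I -> T -> R) (a : I -> R) :
  (forall i, P i -> f i @ F --> a i) ->
  (fun t => \sum_(i <- r | P i) f i t) @ F --> \sum_(i <- r | P i) a i.
Proof.
move=> h; elim: r => [|x r IH].
  rewrite big_nil (_ : (fun _ => _) = fun=> 0); first exact: cvg_cst.
  by apply/funext => t; rewrite big_nil.
rewrite big_cons; case: ifP => [Px|nPx].
  rewrite (_ : (fun _ => _) = (fun t => f x t + \sum_(i <- r | P i) f i t)).
    by apply: cvgD IH; exact: h.
  by apply/funext => t; rewrite big_cons Px.
rewrite (_ : (fun _ => _) = (fun t => \sum_(i <- r | P i) f i t)) //.
by apply/funext => t; rewrite big_cons nPx.
Qed.

Lemma cvg_mulmx m n p (f : T -> 'M[R]_(m, n)) (g : T -> 'M[R]_(n, p))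
    (A : 'M[R]_(m, n)) (B : 'M[R]_(n, p)) :
  f @ F --> A -> g @ F --> B -> (fun t => f t *m g t) @ F --> A *m B.
Proof.
move=> /mx_cvgP hf /mx_cvgP hg; apply/mx_cvgP => i j.
rewrite mxE (_ : (fun k => _) = (fun k => \sum_l f k i l * g k l j)); last first.
  by apply/funext => k; rewrite mxE.
apply: cvg_sumr => l _.
by apply: cvgM; [exact: hf|exact: hg].
Qed.

Lemma cvg_trmx m n (f : T -> 'M[R]_(m, n)) (A : 'M[R]_(m, n)) :
  f @ F --> A -> (fun t => (f t)^T) @ F --> A^T.
Proof.
move=> /mx_cvgP hf; apply/mx_cvgP => i j; rewrite mxE.
rewrite (_ : (fun k => _) = (fun k => f k j i)); first exact: hf.
by apply/funext => k; rewrite mxE.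
Qed.

Lemma cvg_dot n (f g : T -> 'cV[R]_n) (x y : 'cV[R]_n) :
  f @ F --> x -> g @ F --> y -> (fun t => dot (f t) (g t)) @ F --> dot x y.
Proof.
by move=> hf hg; have /mx_cvgP := cvg_mulmx (cvg_trmx hf) hg; exact.
Qed.

End CvgMx.

(** * Functional calculus of symmetric matrices *)

Section Spectral.
Variable R : realType.

(** The quadratic form attains its maximum on the compact unit sphere, which is nonempty at size
    n.+1; scaling extends the bound to all vectors. *)
Lemma sphere_max n (A : 'M[R]_n.+1) :
  exists x, dot x x = 1 /\ forall y, dot y (A *m y) <= dot x (A *m x) * dot y y.
Proof.
pose S := [set x : 'cV[R]_n.+1 | dot x x = 1].
have cdot (B : 'M[R]_n.+1) : continuous (fun x : 'cV[R]_n.+1 => dot x (B *m x)).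
  move=> x; apply: (@cvg_dot R _ (nbhs x) _ _ id (mulmx B)); first exact: cvg_id.
  apply: (@cvg_mulmx R _ (nbhs x) _ _ _ _ (fun=> B) id); last exact: cvg_id.
  exact: cvg_cst.
have clS : closed S.
  rewrite (_ : S = (fun x => dot x (1%:M *m x)) @^-1` [set 1]); last first.
    by rewrite eqEsubset; split=> x; rewrite /S /= mul1mx.
  by apply: closed_comp (@closed_eq _ _) => x _; exact: cdot.
have cS : compact S.
  apply: (@mx_compact _ _ _ _ 1) => // x xS i j.
  rewrite (ord1 j) -(@expr_le1 _ 2) // real_normK ?num_real //.
  rewrite -[leRHS]xS dotE (bigD1 i) //= -expr2 lerDl sumr_ge0 // => k _.
  by rewrite -expr2 sqr_ge0.
have S0 : S !=set0.
  exists (delta_mx 0 0); rewrite /S /= -[X in dot _ X]mul1mx dot_delta mxE eqxx.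
  by [].
have [x xS hx] := @compact_EVT_max _ _ (fun x => dot x (A *m x)) S S0 cS
  (continuous_subspaceT (cdot A)).
rewrite inE in xS; exists x; split => // y.
have [->|y0] := eqVneq y 0; first by rewrite !dot0l mulr0.
have yy : 0 < dot y y by rewrite dot_gt0.
pose c := (Num.sqrt (dot y y))^-1.
have c2 : c * c * dot y y = 1.
  by rewrite -expr2 /c exprVn sqr_sqrtr ?(ltW yy) // mulVf ?gt_eqF.
have /hx : c *: y \in S by rewrite inE /S /= dotZl dotZr mulrA.
rewrite -scalemxAr dotZl dotZr mulrA -(ler_pM2r yy).
by rewrite mulrAC c2 mul1r.
Qed.

(** A nonnegative form that vanishes at x is stationary there: along x + t z with z = A x it is a
    polynomial in t whose linear coefficient 2 |z|^2 must vanish. *)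
Lemma psd_dot0 n (A : 'M[R]_n) x : psd A -> dot x (A *m x) = 0 -> A *m x = 0.
Proof.
move=> [sA pA] x0; apply/eqP; rewrite -dot_eq0; apply/eqP.
set z := A *m x; set a := dot z z; set b := dot z (A *m z).
have b0 : 0 <= b by rewrite /b -quadE.
have a0 : 0 <= a by exact: dot_ge0.
have h t : 0 <= t * a *+ 2 + t ^+ 2 * b.
  have := pA (x + t *: z); rewrite quadE mulmxDr -scalemxAr.
  rewrite !(dotDl, dotDr, dotZl, dotZr) x0 -/a -/b dot_mulr sA -/z -/a => h.
  by move: h; rewrite (_ : _ + _ = t * a *+ 2 + t ^+ 2 * b) //; ring.
have [->|an0] := eqVneq a 0; first by [].
have {an0}a1 : 0 < a by rewrite lt_def an0.
have b1 : 0 < b + 1 by lra.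
(* A t for which the linear term dominates; the 1 keeps the denominator positive when b = 0. *)
have := h (- (a / (b + 1))).
rewrite (_ : _ + _ = - (a ^+ 2 / (b + 1)) * (2 - b / (b + 1))); last first.
  by field; rewrite gt_eqF.
have h1 : 0 < a ^+ 2 / (b + 1) by rewrite divr_gt0 // exprn_gt0.
have h2 : b / (b + 1) < 1 by rewrite ltr_pdivrMr //; lra.
set u := a ^+ 2 / _ in h1 *; set v := b / _ in h2 *.
by move=> h3; exfalso; clear -h1 h2 h3; nra.
Qed.

Lemma psdE n (A : 'M[R]_n) :
  psd A <-> A^T = A /\ forall x, 0 <= dot x (A *m x).
Proof. by split=> -[sA h]; split=> // x; move: (h x); rewrite quadE. Qed.

Lemma PosE n (A : 'M[R]_n) :
  Pos A <-> A^T = A /\ forall x, x != 0 -> 0 < dot x (A *m x).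
Proof.
by split=> -[sA h]; split=> // x x0; move: (h x x0); rewrite quadE.
Qed.

(** The form of l 1 - A is nonnegative and vanishes at the maximizer x, so [psd_dot0] puts x in the
    kernel. *)
Lemma sym_eigen_max n (A : 'M[R]_n.+1) : A^T = A ->
  exists x l, [/\ dot x x = 1, A *m x = l *: x
    & forall y, dot y (A *m y) <= l * dot y y].
Proof.
move=> sA; have [x [x1 hx]] := sphere_max A.
exists x, (dot x (A *m x)); set l := dot x _ in hx *; split=> //.
apply/eqP; rewrite eq_sym -subr_eq0 -mul_scalar_mx -mulmxBl; apply/eqP.
apply: psd_dot0; last by rewrite mulmxBl mul_scalar_mx dotBr dotZr x1 mulr1 subrr.
apply/psdE; split; first by rewrite raddfB /= tr_scalar_mx sA.
by move=> y; rewrite mulmxBl mul_scalar_mx dotBr dotZr subr_ge0.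
Qed.

(** The reflection along e - x exchanges the unit vectors e and x. *)
Lemma householder n (x : 'cV[R]_n.+1) : dot x x = 1 ->
  exists2 H : 'M[R]_n.+1, Orth H & H *m delta_mx 0 0 = x.
Proof.
move=> x1; pose e : 'cV[R]_n.+1 := delta_mx 0 0; pose v : 'cV[R]_n.+1 := e - x.
have e1 : dot e e = 1 by rewrite -[X in dot _ X]mul1mx dot_delta mxE eqxx.
have [v0|v0] := eqVneq v 0.
  exists 1%:M; first exact: orth1.
  by rewrite mul1mx; apply/eqP; rewrite -subr_eq0; apply/eqP.
have vv : 0 < dot v v by rewrite dot_gt0.
pose c := 2 / dot v v; pose H : 'M[R]_n.+1 := 1%:M - c *: (v *m v^T).
have sH : H^T = H.
  by rewrite /H raddfB /= trmx1 linearZ /= trmx_mul trmxK.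
have vTv : v^T *m v = (dot v v)%:M by apply/matrixP=> i j; rewrite !ord1 [RHS]mxE eqxx.
exists H.
  rewrite /Orth /Stiefel sH /H mulmxBl mul1mx mulmxBr mulmx1.
  rewrite -scalemxAl -scalemxAr mulmxA -(mulmxA v) vTv mul_mx_scalar -scalemxAl.
  rewrite !scalerA (_ : c * (c * dot v v) = c + c); last first.
    by rewrite /c; field; rewrite gt_eqF.
  by rewrite scalerDl opprB addrK subrK.
rewrite -/e /H mulmxBl mul1mx -scalemxAl -mulmxA.
rewrite (_ : v^T *m e = (dot v e)%:M); last first.
  by apply/matrixP=> i j; rewrite !ord1 [RHS]mxE eqxx.
rewrite mul_mx_scalar scalerA (_ : c * dot v e = 1) ?scale1r.
  by rewrite /v opprB addrC subrK.
have ve : dot v e = dot v v / 2.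
  by rewrite /v !(dotBl, dotBr) x1 e1 (dotC x e); field.
by rewrite ve /c; field; rewrite gt_eqF.
Qed.

Lemma orth_block n (O : 'M[R]_n) : Orth O -> Orth (block_mx (1%:M : 'M[R]_1) 0 0 O).
Proof.
rewrite /Orth /Stiefel => oO.
by rewrite tr_block_mx !trmx0 trmx1 mulmx_block !(mul0mx, mulmx0, addr0, add0r)
  oO mulmx1 -scalar_mx_block.
Qed.

Definition sorted_row n (d : 'rV[R]_n) := forall i j : 'I_n, (i <= j)%N -> d 0 j <= d 0 i.

Lemma sorted_row_mx n (l : R) (d : 'rV[R]_n) : sorted_row d ->
  (forall i, d 0 i <= l) -> sorted_row (row_mx (l%:M : 'M[R]_1) d).
Proof.
move=> sd hl i j ij; rewrite !mxE.
case: (splitP j) => a ja; case: (splitP i) => b ib.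
- by rewrite (ord1 a) (ord1 b).
- by move: ij; rewrite ja ib (ord1 a).
- by rewrite (ord1 b) mxE eqxx mulr1n.
- by apply: sd; move: ij; rewrite ja ib leq_add2l.
Qed.

Lemma block_corner n (B : 'M[R]_(1 + n)) l :
  (forall i, B i 0 = l * (i == 0)%:R) -> (forall i, B 0 i = l * (i == 0)%:R) ->
  B = block_mx (l%:M : 'M[R]_1) 0 0 (drsubmx B).
Proof.
move=> Bcol Brow.
have e0 i : @lshift 1 n i = 0 by apply: val_inj; rewrite /= (ord1 i).
have s0 i : (@rshift 1 n i == 0) = false by [].
rewrite -[LHS]submxK; congr block_mx; apply/matrixP => i j; rewrite !mxE.
- by rewrite !ord1 !e0 Brow !eqxx mulr1.
- by rewrite e0 Brow s0 mulr0.
- by rewrite e0 Bcol s0 mulr0.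
Qed.

Lemma block_corner_diag n (P Q : 'M[R]_n) l d :
  block_mx (l%:M : 'M[R]_1) 0 0 (P *m diag_mx d *m Q^T) =
  block_mx (1%:M : 'M[R]_1) 0 0 P *m diag_mx (row_mx (l%:M : 'M[R]_1) d)
    *m (block_mx (1%:M : 'M[R]_1) 0 0 Q)^T.
Proof.
rewrite tr_block_mx !trmx0 trmx1 diag_mx_row !mulmx_block.
rewrite !(mulmx0, mul0mx, addr0, add0r, mulmx1, mul1mx).
congr block_mx; apply/matrixP=> i j.
by rewrite !ord1 !mxE !eqxx !mulr1n.
Qed.

Lemma dot_eigen n (O : 'M[R]_n) d i : Orth O ->
  dot (O *m delta_mx i 0) (O *m diag_mx d *m O^T *m (O *m delta_mx i 0)) = d 0 i.
Proof.
move=> oO; rewrite -!mulmxA (mulmxA O^T) oO mul1mx stiefel_dot //.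
by rewrite dot_delta mxE eqxx mulr1n.
Qed.

(** Deflation: a top eigenvector is rotated to the first basis vector and the induction continues on
    the complement. The largest eigenvalue is split off each time, so the diagonal is decreasing, as
    [interlace] requires. *)
Theorem spectral n (A : 'M[R]_n) : A^T = A ->
  exists (O : 'M[R]_n) (d : 'rV[R]_n),
    [/\ Orth O, A = O *m diag_mx d *m O^T & sorted_row d].
Proof.
elim: n A => [|n IH] A sA.
  exists 1%:M, 0; split; [exact: orth1|by rewrite [A]flatmx0 flatmx0|by case].
have [x [l [x1 Ax hl]]] := sym_eigen_max sA.
have [H oH Hx] := householder x1.
pose B : 'M[R]_n.+1 := H^T *m A *m H.
have sB : B^T = B by rewrite /B !trmx_mul trmxK sA mulmxA.
have Be : B *m delta_mx 0 0 = l *: (delta_mx 0 0 : 'cV[R]_n.+1).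
  rewrite /B -mulmxA Hx -mulmxA Ax -scalemxAr -[x in H^T *m x]Hx mulmxA.
  by rewrite [H^T *m H]oH mul1mx.
have eA : A = H *m B *m H^T.
  by rewrite /B !mulmxA orth_mulV // mul1mx -mulmxA orth_mulV // mulmx1.
clearbody B.
have Bcol i : B i 0 = l * (i == 0)%:R.
  by have := congr1 (fun M : 'cV_ _ => M i 0) Be; rewrite /= -colE !mxE eqxx andbT.
have Brow i : B 0 i = l * (i == 0)%:R by rewrite -[B]sB mxE Bcol.
have sB' : (drsubmx (B : 'M[R]_(1 + n)))^T = drsubmx (B : 'M[R]_(1 + n)).
  by apply/matrixP => i j; rewrite !mxE -[in LHS]sB mxE.
have [Q [d' [oQ hB' sd']]] := IH _ sB'.
have defB := block_corner Bcol Brow.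
exists (H *m block_mx (1%:M : 'M[R]_1) 0 0 Q), (row_mx (l%:M : 'M[R]_1) d').
have oO : Orth (H *m block_mx (1%:M : 'M[R]_1) 0 0 Q).
  by apply: orth_mul => //; exact: orth_block.
have defA : A = (H *m block_mx (1%:M : 'M[R]_1) 0 0 Q)
    *m diag_mx (row_mx (l%:M : 'M[R]_1) d') *m (H *m block_mx (1%:M : 'M[R]_1) 0 0 Q)^T.
  by rewrite {1}eA {1}defB hB' block_corner_diag trmx_mul !mulmxA.
split=> //; apply: sorted_row_mx => // i.
have := hl (H *m block_mx (1%:M : 'M[R]_1) 0 0 Q *m delta_mx (rshift 1 i) 0).
rewrite {1}defA dot_eigen // stiefel_dot // -[X in dot _ X]mul1mx dot_delta.
by rewrite [leLHS]row_mxEr [X in _ * X]mxE eqxx mulr1.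
Qed.

(** Deflation again: y is a top eigenvector of N^T N and x is N y normalized. Then N y = k x and N^T
    x = k y, so two reflections isolate the corner k. *)
Theorem svd n (N : 'M[R]_n) :
  exists (O Q : 'M[R]_n) (s : 'rV[R]_n),
    [/\ Orth O, Orth Q, N = O *m diag_mx s *m Q^T & forall i, 0 <= s 0 i].
Proof.
elim: n N => [|n IH] N.
  exists 1%:M, 1%:M, 0; split; try exact: orth1; last by case.
  by rewrite [N]flatmx0 flatmx0.
have sA : (N^T *m N)^T = N^T *m N by rewrite trmx_mul trmxK.
have [y [l [y1 Ay hl]]] := sym_eigen_max sA.
have hN z : dot (N *m z) (N *m z) = dot z (N^T *m N *m z) by rewrite dot_mull mulmxA.
have l0 : 0 <= l by have := dot_ge0 (N *m y); rewrite hN Ay dotZr y1 mulr1.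
have [l00|ln0] := eqVneq l 0.
  have N0 : N = 0.
    apply/matrixP => i j; rewrite mxE -dot_delta.
    have := hl (delta_mx j 0); rewrite -hN l00 mul0r => h.
    have /eqP : dot (N *m delta_mx j 0) (N *m delta_mx j 0) == 0.
      by rewrite eq_le h dot_ge0.
    by move/eqP; rewrite dot_eq0 => /eqP ->; rewrite dot0r.
  exists 1%:M, 1%:M, 0; split; try exact: orth1; last by move=> i; rewrite mxE.
  by rewrite N0 mul1mx trmx1 mulmx1 linear0.
have {ln0}lp : 0 < l by rewrite lt_def ln0.
pose k := Num.sqrt l; have kp : 0 < k by rewrite sqrtr_gt0.
have kk : k * k = l by rewrite -expr2 sqr_sqrtr.
pose x := k^-1 *: (N *m y).
have x1 : dot x x = 1.
  rewrite dotZl dotZr hN Ay dotZr y1 -kk; field; exact: lt0r_neq0.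
have [H oH Hx] := householder x1; have [G oG Gy] := householder y1.
pose B : 'M[R]_n.+1 := H^T *m N *m G.
have eN : N = H *m B *m G^T.
  by rewrite /B !mulmxA orth_mulV // mul1mx -mulmxA orth_mulV // mulmx1.
have Be : B *m delta_mx 0 0 = k *: (delta_mx 0 0 : 'cV[R]_n.+1).
  rewrite /B -mulmxA Gy -mulmxA (_ : N *m y = k *: x); last first.
    by rewrite scalerA divff ?scale1r // lt0r_neq0.
  by rewrite -scalemxAr -Hx mulmxA oH mul1mx.
have Be' : B^T *m delta_mx 0 0 = k *: (delta_mx 0 0 : 'cV[R]_n.+1).
  rewrite /B !trmx_mul trmxK -!mulmxA Hx (_ : N^T *m x = k *: y); last first.
    rewrite /x -scalemxAr mulmxA Ay scalerA -kk; congr (_ *: _).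
    by field; exact: lt0r_neq0.
  by rewrite -scalemxAr -Gy mulmxA oG mul1mx.
clearbody B.
have Bcol i : B i 0 = k * (i == 0)%:R.
  by have := congr1 (fun M : 'cV_ _ => M i 0) Be; rewrite /= -colE !mxE eqxx andbT.
have Brow i : B 0 i = k * (i == 0)%:R.
  by have := congr1 (fun M : 'cV_ _ => M i 0) Be'; rewrite /= -colE !mxE eqxx andbT.
have [P [Q [s [oP oQ hB s0]]]] := IH (drsubmx (B : 'M[R]_(1 + n))).
have defB := block_corner Bcol Brow.
exists (H *m block_mx (1%:M : 'M[R]_1) 0 0 P), (G *m block_mx (1%:M : 'M[R]_1) 0 0 Q),
  (row_mx (k%:M : 'M[R]_1) s).
split; try by apply: orth_mul => //; exact: orth_block.
  by rewrite {1}eN {1}defB hB block_corner_diag trmx_mul !mulmxA.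
move=> i; rewrite mxE; case: splitP => j _ //.
by rewrite (ord1 j) mxE eqxx ltW.
Qed.

(** If N = P s Q^T, the rotation Q P^T turns N into P s P^T. *)
Lemma polar n (N : 'M[R]_n) : exists2 O : 'M[R]_n, Orth O & psd (N *m O).
Proof.
have [P [Q [s [oP oQ -> s0]]]] := svd N.
exists (Q *m P^T); first by apply: orth_mul => //; exact: orth_trmx.
rewrite -!mulmxA (mulmxA Q^T) oQ mul1mx; apply/psdE; split.
  by rewrite !trmx_mul trmxK tr_diag_mx mulmxA.
move=> x; rewrite -mulmxA dot_mulr -mulmxA mul_diag_mx dotE sumr_ge0 // => i _.
by rewrite [X in _ * X]mxE mulrCA -expr2 mulr_ge0 // sqr_ge0.
Qed.

End Spectral.

(** * Functional calculus, the Loewner order and square roots *)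

Section SymFun.
Variable R : realType.

Lemma map_diagE (f : R -> R) n (d : 'rV[R]_n) i : map_mx f d 0 i = f (d 0 i).
Proof. by rewrite mxE. Qed.

(** At the entry (i, j) either X vanishes or a_i = b_j. [symfun_conj] and [symfun_intertwine] rest
    on this. *)
Lemma diag_intertwine (f : R -> R) m n (a : 'rV[R]_m) (b : 'rV[R]_n) X :
  diag_mx a *m X = X *m diag_mx b ->
  diag_mx (map_mx f a) *m X = X *m diag_mx (map_mx f b).
Proof.
move=> h; apply/matrixP => i j; rewrite mul_diag_mx mul_mx_diag !mxE.
have := congr1 (fun M : 'M[R]_(m, n) => M i j) h.
rewrite /= mul_diag_mx mul_mx_diag !mxE => e.
have [->|x0] := eqVneq (X i j) 0; first by rewrite mulr0 mul0r.
by rewrite mulrC; congr (_ * f _); apply: (mulfI x0); rewrite -e mulrC.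
Qed.

Lemma diag_sym n (O : 'M[R]_n) d : (O *m diag_mx d *m O^T)^T = O *m diag_mx d *m O^T.
Proof. by rewrite !trmx_mul trmxK tr_diag_mx mulmxA. Qed.

(** P may be any invertible matrix, because the simultaneous diagonalization of a commuting family
    in [codiag_Pos] does not deliver an orthogonal one. *)
Lemma symfun_conj (f : R -> R) n (A P : 'M[R]_n) d : A^T = A -> P \in unitmx ->
  A = P *m diag_mx d *m invmx P ->
  symfun f A = P *m diag_mx (map_mx f d) *m invmx P.
Proof.
move=> sA uP eA; rewrite /symfun; case: xgetP => [B _|h].
  case=> O [e [oO eA' ->]].
  have h : diag_mx e *m (O^T *m P) = (O^T *m P) *m diag_mx d.
    have : A *m P = P *m diag_mx d by rewrite eA mulmxKV.
    rewrite {1}eA' => /(congr1 (mulmx O^T)).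
    by rewrite -!mulmxA (mulmxA O^T) oO mul1mx.
  have /(congr1 (mulmx O)) := diag_intertwine f h.
  rewrite !mulmxA orth_mulV // mul1mx => <-.
  by rewrite -!mulmxA mulmxV // mulmx1.
have [ O [e [oO e1 _]]] := spectral sA.
by exfalso; apply: (h (O *m diag_mx (map_mx f e) *m O^T)); exists O, e; split.
Qed.

Lemma symfun_orth (f : R -> R) n (O : 'M[R]_n) d : Orth O ->
  symfun f (O *m diag_mx d *m O^T) = O *m diag_mx (map_mx f d) *m O^T.
Proof.
move=> oO; rewrite (@symfun_conj f _ _ O d) ?orth_inv ?orth_unit //.
exact: diag_sym.
Qed.

Lemma symfun_spec n (A : 'M[R]_n) : A^T = A -> exists (O : 'M[R]_n) d,
  [/\ Orth O, A = O *m diag_mx d *m O^T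
    & forall f, symfun f A = O *m diag_mx (map_mx f d) *m O^T].
Proof.
move=> /spectral[ O [d [oO eA _]]]; exists O, d; split=> // f.
by rewrite eA symfun_orth.
Qed.

Lemma symfun_sym (f : R -> R) n (A : 'M[R]_n) : A^T = A -> (symfun f A)^T = symfun f A.
Proof. by move=> /symfun_spec[ O [d [_ _ ->]]]; rewrite diag_sym. Qed.

Lemma symfun_intertwine (f : R -> R) m n (A : 'M[R]_m) (B : 'M[R]_n) X :
  A^T = A -> B^T = B -> A *m X = X *m B -> symfun f A *m X = X *m symfun f B.
Proof.
move=> /symfun_spec[ O [a [oO eA ->]]] /symfun_spec[Q [b [oQ eB ->]]] h.
have e : diag_mx a *m (O^T *m X *m Q) = (O^T *m X *m Q) *m diag_mx b.
  have := congr1 (fun M => O^T *m M *m Q) h.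
  rewrite eA eB -!mulmxA oQ mulmx1 (mulmxA O^T O) oO mul1mx => ->.
  by rewrite !mulmxA.
have /(congr1 (fun M => O *m M *m Q^T)) := diag_intertwine f e.
rewrite !mulmxA (orth_mulV oO) mul1mx => <-.
by rewrite -!mulmxA (orth_mulV oQ) mulmx1.
Qed.

Lemma symfun_comp (g f : R -> R) n (A : 'M[R]_n) : A^T = A ->
  symfun g (symfun f A) = symfun (g \o f) A.
Proof.
move=> /symfun_spec[ O [d [oO _ e]]]; rewrite !e symfun_orth //.
by congr (_ *m diag_mx _ *m _); apply/rowP => i; rewrite !mxE.
Qed.

Lemma diag_mulE n (a b : 'rV[R]_n) :
  diag_mx a *m diag_mx b = diag_mx (\row_i (a 0 i * b 0 i)).
Proof. exact: mulmx_diag. Qed.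

Lemma symfun_mul (f g : R -> R) n (A : 'M[R]_n) : A^T = A ->
  symfun f A *m symfun g A = symfun (fun x => f x * g x) A.
Proof.
move=> /symfun_spec[ O [d [oO _ e]]]; rewrite !e -!mulmxA (mulmxA O^T) oO mul1mx.
rewrite (mulmxA (diag_mx _)) diag_mulE !mulmxA.
by congr (_ *m diag_mx _ *m _); apply/rowP => i; rewrite !mxE.
Qed.

Lemma symfun_add (f g : R -> R) n (A : 'M[R]_n) : A^T = A ->
  symfun f A + symfun g A = symfun (fun x => f x + g x) A.
Proof.
move=> /symfun_spec[ O [d [oO _ e]]]; rewrite !e -mulmxDl -mulmxDr -raddfD.
by congr (_ *m diag_mx _ *m _); apply/rowP => i; rewrite !mxE.
Qed.

Lemma symfun_scale (f : R -> R) c n (A : 'M[R]_n) : A^T = A ->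
  c *: symfun f A = symfun (fun x => c * f x) A.
Proof.
move=> /symfun_spec[ O [d [oO _ e]]]; rewrite !e scalemxAl scalemxAr -linearZ.
by congr (_ *m diag_mx _ *m _); apply/rowP => i; rewrite !mxE.
Qed.

Lemma symfun_scaler (f : R -> R) c n (A : 'M[R]_n) : A^T = A ->
  symfun f (c *: A) = symfun (fun x => f (c * x)) A.
Proof.
move=> /symfun_spec[ O [d [oO eA e]]]; rewrite e eA scalemxAl scalemxAr -linearZ.
rewrite symfun_orth //.
by congr (_ *m diag_mx _ *m _); apply/rowP => i; rewrite !mxE.
Qed.

Lemma symfun_cst c n (A : 'M[R]_n) : A^T = A -> symfun (fun=> c) A = c%:M.
Proof.
move=> /symfun_spec[ O [d [oO _ ->]]].
rewrite (_ : map_mx _ d = const_mx c); last by apply/rowP => i; rewrite !mxE.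
by rewrite diag_const_mx mul_mx_scalar -scalemxAl orth_mulV // scalemx1.
Qed.

Lemma symfun_id n (A : 'M[R]_n) : A^T = A -> symfun id A = A.
Proof.
move=> /symfun_spec[ O [d [oO eA ->]]]; rewrite [RHS]eA.
by congr (_ *m diag_mx _ *m _); apply/rowP => i; rewrite !mxE.
Qed.

Lemma orth_diag_psd n (O : 'M[R]_n) (d : 'rV[R]_n) : Orth O ->
  (forall i, 0 <= d 0 i) -> psd (O *m diag_mx d *m O^T).
Proof.
move=> oO d0; apply/psdE; split; first exact: diag_sym.
move=> x; rewrite -!mulmxA dot_mulr mul_diag_mx dotE sumr_ge0 // => i _.
by rewrite [X in _ * X]mxE mulrCA -expr2 mulr_ge0 // sqr_ge0.
Qed.

Lemma Pos_psd n (A : 'M[R]_n) : Pos A -> psd A.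
Proof.
move=> /PosE[sA h]; apply/psdE; split=> // x.
by have [->|/h/ltW//] := eqVneq x 0; rewrite dot0l.
Qed.

Lemma Pos_unit n (A : 'M[R]_n) : Pos A -> A \in unitmx.
Proof.
move=> /PosE[sA h]; rewrite -unitmx_tr unitmxE unitfE; apply/det0P => -[v v0 vA].
have : v^T != 0 by rewrite trmx_eq0.
move=> /h; rewrite /dot trmxK mulmxA.
by rewrite -[in v *m A]sA vA mul0mx mxE ltxx.
Qed.

Lemma psd_unit_Pos n (A : 'M[R]_n) : psd A -> A \in unitmx -> Pos A.
Proof.
move=> pA uA; have /psdE[sA h] := pA; apply/PosE; split=> // x x0.
rewrite lt_def h andbT; apply/eqP => /(psd_dot0 pA) /(congr1 (mulmx (invmx A))).
by rewrite mulKmx // mulmx0; apply/eqP.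
Qed.

Lemma orth_diag_Pos n (O : 'M[R]_n) (d : 'rV[R]_n) : Orth O ->
  (forall i, 0 < d 0 i) -> Pos (O *m diag_mx d *m O^T).
Proof.
move=> oO d0; apply: psd_unit_Pos; first by apply: orth_diag_psd => // i; exact: ltW.
rewrite !unitmx_mul unitmx_tr orth_unit //= andbT unitmxE det_diag unitfE.
by apply/prodf_neq0 => i _; rewrite gt_eqF.
Qed.

Lemma psd_spec n (A : 'M[R]_n) : psd A -> exists (O : 'M[R]_n) d,
  [/\ Orth O, A = O *m diag_mx d *m O^T, forall i, 0 <= d 0 i
    & forall f, symfun f A = O *m diag_mx (map_mx f d) *m O^T].
Proof.
move=> /psdE[sA h]; have [ O [d [oO eA e]]] := symfun_spec sA.
exists O, d; split=> // i; rewrite -(dot_eigen d i oO) -eA; exact: h.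
Qed.

Lemma Pos_spec n (A : 'M[R]_n) : Pos A -> exists (O : 'M[R]_n) d,
  [/\ Orth O, A = O *m diag_mx d *m O^T, forall i, 0 < d 0 i
    & forall f, symfun f A = O *m diag_mx (map_mx f d) *m O^T].
Proof.
move=> /PosE[sA h]; have [ O [d [oO eA e]]] := symfun_spec sA.
exists O, d; split=> // i; rewrite -(dot_eigen d i oO) -eA; apply: h.
apply/eqP => /(congr1 (mulmx O^T)); rewrite mulmxA oO mul1mx mulmx0.
by move=> /matrixP/(_ i 0)/eqP; rewrite !mxE !eqxx oner_eq0.
Qed.

Lemma symfun_eq_pos (f g : R -> R) n (A : 'M[R]_n) : Pos A ->
  (forall x, 0 < x -> f x = g x) -> symfun f A = symfun g A.
Proof.
move=> /Pos_spec[ O [d [_ _ d0 e]]] fg; rewrite !e.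
by congr (_ *m diag_mx _ *m _); apply/rowP => i; rewrite !mxE fg.
Qed.

Lemma symfun_eq_psd (f g : R -> R) n (A : 'M[R]_n) : psd A ->
  (forall x, 0 <= x -> f x = g x) -> symfun f A = symfun g A.
Proof.
move=> /psd_spec[ O [d [_ _ d0 e]]] fg; rewrite !e.
by congr (_ *m diag_mx _ *m _); apply/rowP => i; rewrite !mxE fg.
Qed.

Lemma symfun_Pos (f : R -> R) n (A : 'M[R]_n) : Pos A ->
  (forall x, 0 < x -> 0 < f x) -> Pos (symfun f A).
Proof.
move=> /Pos_spec[ O [d [oO _ d0 e]]] f0; rewrite !e.
by apply: orth_diag_Pos => // i; rewrite mxE f0.
Qed.

Lemma Pos_sym n (A : 'M[R]_n) : Pos A -> A^T = A. Proof. by case. Qed.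
Lemma psd_sym n (A : 'M[R]_n) : psd A -> A^T = A. Proof. by case. Qed.

Lemma symfun_inv n (A : 'M[R]_n) : Pos A -> symfun GRing.inv A = invmx A.
Proof.
move=> pA; have uA := Pos_unit pA; have sA := Pos_sym pA.
rewrite -[LHS]mulmx1 -(mulmxV uA) mulmxA -{2}(symfun_id sA) symfun_mul //.
rewrite (@symfun_eq_pos _ (fun=> 1)) ?symfun_cst ?mul1mx // => x x0.
by rewrite mulVf ?gt_eqF.
Qed.

Lemma Pos_inv n (A : 'M[R]_n) : Pos A -> Pos (invmx A).
Proof.
by move=> pA; rewrite -symfun_inv //; apply: symfun_Pos => // x; rewrite invr_gt0.
Qed.

Lemma psd_congr m n (P : 'M[R]_(m, n)) (A : 'M[R]_n) : psd A -> psd (P *m A *m P^T).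
Proof.
move=> /psdE[sA h]; apply/psdE; split; first by rewrite !trmx_mul trmxK sA mulmxA.
by move=> x; rewrite -!mulmxA dot_mulr; exact: h.
Qed.

Lemma Pos_congr n (P : 'M[R]_n) (A : 'M[R]_n) : P \in unitmx ->
  Pos A -> Pos (P *m A *m P^T).
Proof.
move=> uP pA; apply: psd_unit_Pos; first exact/psd_congr/Pos_psd.
by rewrite !unitmx_mul unitmx_tr uP Pos_unit.
Qed.

Lemma Pos_congr_stiefel n p (P : 'M[R]_(n, p)) (A : 'M[R]_n) :
  Stiefel P -> Pos A -> Pos (P^T *m A *m P).
Proof.
move=> sP /PosE[sA h]; apply/PosE; split; first by rewrite !trmx_mul trmxK sA mulmxA.
move=> x x0; rewrite -!mulmxA dot_mulr trmxK; apply: h.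
by rewrite -dot_gt0 stiefel_dot // dot_gt0.
Qed.

Lemma Pos_scale c n (A : 'M[R]_n) : 0 < c -> Pos A -> Pos (c *: A).
Proof.
move=> c0 /PosE[sA h]; apply/PosE; split; first by rewrite linearZ /= sA.
by move=> x x0; rewrite -scalemxAl dotZr mulr_gt0 // h.
Qed.

Lemma psd_scale c n (A : 'M[R]_n) : 0 <= c -> psd A -> psd (c *: A).
Proof.
move=> c0 /psdE[sA h]; apply/psdE; split; first by rewrite linearZ /= sA.
by move=> x; rewrite -scalemxAl dotZr mulr_ge0 // h.
Qed.

Lemma psd_add n (A B : 'M[R]_n) : psd A -> psd B -> psd (A + B).
Proof.
move=> /psdE[sA hA] /psdE[sB hB]; apply/psdE; split; first by rewrite raddfD /= sA sB.
by move=> x; rewrite mulmxDl dotDr addr_ge0.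
Qed.

Lemma psd0 n : psd (0 : 'M[R]_n).
Proof. by apply/psdE; split; [rewrite trmx0|move=> x; rewrite mul0mx dot0r]. Qed.

Lemma Pos_add_psd n (A B : 'M[R]_n) : Pos A -> psd B -> Pos (A + B).
Proof.
move=> /PosE[sA hA] /psdE[sB hB]; apply/PosE; split; first by rewrite raddfD /= sA sB.
by move=> x x0; rewrite mulmxDl dotDr ltr_pwDl // hA.
Qed.

Lemma Pos_scalar n (c : R) : 0 < c -> Pos (c%:M : 'M[R]_n).
Proof.
move=> c0; apply/PosE; split; first by rewrite tr_scalar_mx.
by move=> x x0; rewrite mul_scalar_mx dotZr mulr_gt0 // dot_gt0.
Qed.

Lemma loewnerE n (A B : 'M[R]_n) : loewner A B <->
  (B - A)^T = B - A /\ forall x, dot x (A *m x) <= dot x (B *m x).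
Proof.
rewrite /loewner psdE; split=> -[s h]; split=> // x.
  by have := h x; rewrite mulmxBl dotBr subr_ge0.
by rewrite mulmxBl dotBr subr_ge0.
Qed.

Lemma loewner_sym n (A B : 'M[R]_n) : A^T = A -> B^T = B ->
  (forall x, dot x (A *m x) <= dot x (B *m x)) -> loewner A B.
Proof. by move=> sA sB h; apply/loewnerE; split=> //; rewrite raddfB /= sA sB. Qed.

Lemma loewner_dot n (A B : 'M[R]_n) x : loewner A B -> dot x (A *m x) <= dot x (B *m x).
Proof. by move=> /loewnerE[_]. Qed.

Lemma loewner_refl n (A : 'M[R]_n) : loewner A A.
Proof. by rewrite /loewner subrr; exact: psd0. Qed.

Lemma loewner_trans n (B A C : 'M[R]_n) : loewner A B -> loewner B C -> loewner A C.
Proof.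
by move=> h1 h2; rewrite /loewner -(subrK B C) -addrA; apply: psd_add.
Qed.

Lemma loewner_anti n (A B : 'M[R]_n) : loewner A B -> loewner B A -> A = B.
Proof.
move=> h1 h2; apply/eqP; rewrite -subr_eq0; apply/eqP/matrixP => i j.
have /psdE[s1 p1] := h1; have /psdE[s2 p2] := h2.
have e x : dot x ((A - B) *m x) = 0.
  apply/eqP; rewrite eq_le p2 andbT -[A - B]opprB mulNmx dotNr.
  by rewrite oppr_le0 p1.
by rewrite -dot_delta (psd_dot0 h2 (e _)) dot0r mxE.
Qed.

Lemma loewner_add n (A B C D : 'M[R]_n) :
  loewner A B -> loewner C D -> loewner (A + C) (B + D).
Proof. by move=> h1 h2; rewrite /loewner opprD addrACA; apply: psd_add. Qed.

Lemma loewner_scale c n (A B : 'M[R]_n) : 0 <= c -> loewner A B -> loewner (c *: A) (c *: B).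
Proof. by move=> c0 h; rewrite /loewner -scalerBr; exact: psd_scale. Qed.

Lemma loewner_sum n N (A B : 'I_N -> 'M[R]_n) : (forall i, loewner (A i) (B i)) ->
  loewner (\sum_i A i) (\sum_i B i).
Proof.
move=> h; elim/big_ind2: _ => //; first exact: loewner_refl.
by move=> *; exact: loewner_add.
Qed.

Lemma loewner_congr m n (P : 'M[R]_(m, n)) A B :
  loewner A B -> loewner (P *m A *m P^T) (P *m B *m P^T).
Proof. by move=> h; rewrite /loewner -mulmxBl -mulmxBr; exact: psd_congr. Qed.

Lemma Pos_loewner n (A B : 'M[R]_n) : Pos A -> loewner A B -> Pos B.
Proof. by move=> pA h; rewrite -(subrK A B) addrC; exact: Pos_add_psd. Qed.

Lemma sqrtmx_Pos n (A : 'M[R]_n) : Pos A -> Pos (sqrtmx A).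
Proof. by move=> pA; apply: symfun_Pos => // x; rewrite sqrtr_gt0. Qed.

Lemma sqrtmx_sqr n (A : 'M[R]_n) : psd A -> sqrtmx A *m sqrtmx A = A.
Proof.
move=> pA; have sA := psd_sym pA; rewrite symfun_mul // -[RHS](symfun_id sA).
by apply: symfun_eq_psd => // x x0; rewrite -expr2 sqr_sqrtr.
Qed.

Lemma sqrtmx_uniq n (S : 'M[R]_n) : psd S -> sqrtmx (S *m S) = S.
Proof.
move=> pS; have sS := psd_sym pS; rewrite -{1 2}(symfun_id sS) symfun_mul //.
rewrite /sqrtmx symfun_comp // -[RHS](symfun_id sS).
by apply: symfun_eq_psd => // x x0 /=; rewrite -expr2 sqrtr_sqr ger0_norm.
Qed.

(** If x is an eigenvector of b - a for d, the form of B - A at x equals d (<x, b x> + <x, a x>). It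
    is nonnegative and the second factor is positive, so d >= 0. *)
Lemma loewner_sqrtmx n (A B : 'M[R]_n) : Pos A -> Pos B -> loewner A B ->
  loewner (sqrtmx A) (sqrtmx B).
Proof.
move=> pA pB hAB; set a := sqrtmx A; set b := sqrtmx B.
have pa : Pos a by exact: sqrtmx_Pos.
have pb : Pos b by exact: sqrtmx_Pos.
have sS : (b - a)^T = b - a by rewrite raddfB /= !Pos_sym.
have [ O [d [oO eS _]]] := spectral sS.
rewrite /loewner eS; apply: orth_diag_psd => // i.
pose x : 'cV[R]_n := O *m delta_mx i 0.
have Sx : (b - a) *m x = d 0 i *: x.
  rewrite eS /x -!mulmxA (mulmxA O^T) oO mul1mx scalemxAr; congr (_ *m _).
  apply/matrixP => k j; rewrite mul_diag_mx !mxE.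
  by case: eqP => [->|]; rewrite ?mulr0.
have x0 : x != 0.
  rewrite -dot_gt0 stiefel_dot // -[X in dot _ X]mul1mx dot_delta mxE eqxx.
  exact: ltr01.
have : 0 <= dot x ((B - A) *m x) by rewrite -quadE; case: hAB.
have -> : B - A = b *m (b - a) + (b - a) *m a.
  by rewrite mulmxBr mulmxBl !sqrtmx_sqr ?addrA ?subrK //; exact: Pos_psd.
rewrite mulmxDl dotDr -!mulmxA Sx dot_mulr.
rewrite [X in _ + X]dot_mulr sS Sx dotZl [dot (b^T *m x) _]dotZr -mulrDr.
rewrite -dot_mulr pmulr_lge0 // addr_gt0 //.
  by case/PosE: pb => _; exact.
by case/PosE: pa => _; exact.
Qed.

End SymFun.

(** * The Riemannian distance of positive definite matrices *)

Section RealAux.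
Variable R : realType.
Implicit Types x y u : R.

Lemma der_mono (f df : R -> R) a b :
  (forall x, is_derive x 1 f (df x)) ->
  (forall x, a < x < b -> 0 <= df x) ->
  forall x y, a <= x -> x <= y -> y <= b -> f x <= f y.
Proof.
move=> dfP df0 x y ax; rewrite le_eqVlt => /orP[/eqP->//|xy] yb.
have cf : {within `[x, y], continuous f}.
  apply: continuous_subspaceT => z; apply: differentiable_continuous.
  by apply/derivable1_diffP; have [] := dfP z.
have [c] := MVT xy (fun z _ => dfP z) cf.
rewrite in_itv /= => /andP[xc cy] e.
rewrite -subr_ge0 e mulr_ge0 ?subr_ge0 ?(ltW xy) // df0 //.
by rewrite (le_lt_trans ax xc) (lt_le_trans cy yb).
Qed.

Lemma sinh_ge x : 0 <= x -> x *+ 2 <= expR x - expR (- x).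
Proof.
move=> x0; pose f z : R := expR z - expR (- z) - z *+ 2.
have df z : is_derive z (1 : R) f (expR z + expR (- z) - 2).
  by apply: is_derive_eq; rewrite /GRing.scale /=; ring.
have h (z : R) : 0 < z < x -> 0 <= expR z + expR (- z) - 2.
  move=> _; have e : expR z * expR (- z) = 1 by rewrite expRxMexpNx_1.
  have := sqr_ge0 (expR z - expR (- z)); have := expR_gt0 z; have := expR_gt0 (- z).
  by set a := expR z in e *; set b := expR (- z) in e *; nra.
have := der_mono df h (lexx 0) x0 (lexx x).
rewrite /f oppr0 subrr mul0rn subrr => h'; lra.
Qed.

(** With w = u / 2 the right side is (e^w - e^-w)^2, so [sinh_ge] applies. *)
Lemma cosh_ge u : u ^+ 2 <= expR u + expR (- u) - 2.
Proof.
wlog u0 : u / 0 <= u => [h|].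
  have [/h//|/ltW] := leP 0 u; rewrite -oppr_ge0 => /h.
  by rewrite sqrrN opprK [expR (- u) + _]addrC.
have u2 : 0 <= u / 2 by rewrite divr_ge0.
have h := sinh_ge u2; set w := u / 2 in u2 h.
have eu : u = w + w by rewrite /w; field.
rewrite eu opprD !expRD.
have e : expR w * expR (- w) = 1 by rewrite expRxMexpNx_1.
set a := expR w in e h *; set b := expR (- w) in e h *.
have h2 : (w *+ 2) ^+ 2 <= (a - b) ^+ 2 by rewrite ler_pXn2r // nnegrE; lra.
rewrite -mulr2n; apply: le_trans h2 _; nra.
Qed.

(** For u >= 0 the left side is e^u (1 - e^-u)^2, and 0 <= 1 - e^-u <= u. *)
Lemma cosh_le u : expR u + expR (- u) - 2 <= u ^+ 2 * expR `|u|.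
Proof.
wlog u0 : u / 0 <= u => [h|].
  have [/h//|/ltW] := leP 0 u; rewrite -oppr_ge0 => /h.
  by rewrite sqrrN opprK normrN [expR (- u) + _]addrC.
rewrite ger0_norm //.
have e : expR u * expR (- u) = 1 by rewrite expRxMexpNx_1.
have h := expR_ge1Dx (- u); have ap := expR_gt0 u; have bp := expR_gt0 (- u).
have h1 : 1 - u <= expR (- u) by exact: h.
have h2 : expR (- u) <= 1 by rewrite -expR0 ler_expR oppr_le0.
set a := expR u in e ap *; set b := expR (- u) in e bp h1 h2 *.
have -> : a + b - 2 = a * (1 - b) ^+ 2.
  by rewrite sqrrB mulrDr mulrBr !(expr1n, mulr1) -mulrnAr expr2 !mulrA e; ring: e.
by rewrite mulrC ler_wpM2r ?(ltW ap) // ler_pXn2r ?nnegrE //; lra.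
Qed.

Lemma ln_dist x y : 0 < x -> 0 < y -> (ln x - ln y) ^+ 2 <= x / y + y / x - 2.
Proof.
move=> x0 y0; rewrite -ln_div //; set u := ln _.
have -> : x / y = expR u by rewrite lnK // posrE divr_gt0.
have -> : y / x = expR (- u) by rewrite expRN lnK ?invf_div // posrE divr_gt0.
exact: cosh_ge.
Qed.

Lemma ln_lip a x y : 0 < a -> a <= x -> a <= y -> `|ln x - ln y| <= a^-1 * `|x - y|.
Proof.
move=> a0; wlog xy : x y / y <= x => [h ax ay|ax ay].
  have [/h|/ltW/h] := leP y x; first exact.
  by rewrite distrC [`|x - y|]distrC; exact.
have y0 : 0 < y by exact: lt_le_trans ay.
have x0 : 0 < x by exact: lt_le_trans ax.
rewrite ger0_norm ?subr_ge0 ?ler_ln ?posrE // ger0_norm ?subr_ge0 // -ln_div //.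
have t0 : 0 < x / y by rewrite divr_gt0.
apply: (@le_trans _ _ (x / y - 1)).
  have := expR_ge1Dx (ln (x / y)); rewrite lnK ?posrE // => h; lra.
have -> : x / y - 1 = (x - y) / y by field; rewrite gt_eqF.
by rewrite mulrC ler_wpM2r ?subr_ge0 // lef_pV2 ?posrE.
Qed.

Lemma sqrt_lip a x y : 0 < a -> a <= x -> a <= y ->
  `|Num.sqrt x - Num.sqrt y| <= (Num.sqrt a)^-1 * `|x - y|.
Proof.
move=> a0 ax ay; have y0 : 0 <= y by apply: le_trans ay; exact: ltW.
have x0 : 0 <= x by apply: le_trans ax; exact: ltW.
have sa : 0 < Num.sqrt a by rewrite sqrtr_gt0.
have sx : Num.sqrt a <= Num.sqrt x by rewrite ler_wsqrtr.
have sy : Num.sqrt a <= Num.sqrt y by rewrite ler_wsqrtr.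
rewrite -[in `|x - y|](sqr_sqrtr x0) -[in `|_ - y|](sqr_sqrtr y0) subr_sqr normrM.
rewrite mulrC -mulrA ler_peMr // ger0_norm ?addr_ge0 ?sqrtr_ge0 //.
by rewrite ler_pdivlMr // mul1r; lra.
Qed.

Lemma cvg_seq_ge (v : nat -> R) l c : v @ \oo --> l -> (forall k, c <= v k) -> c <= l.
Proof.
move=> h hk; rewrite -(cvg_lim _ h) //; apply: limr_ge; first exact: cvgP h.
exact: nearW.
Qed.

End RealAux.

(** * The Frobenius norm and differences of functions of matrices *)

Section Frob.
Variable R : realType.

Definition mdot m n (A B : 'M[R]_(m, n)) : R := \tr (A^T *m B).
Definition nrm2 m n (A : 'M[R]_(m, n)) : R := mdot A A.

Lemma mdotE m n (A B : 'M[R]_(m, n)) : mdot A B = \sum_i \sum_j A i j * B i j.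
Proof.
rewrite /mdot /mxtrace exchange_big /=; apply: eq_bigr => j _; rewrite mxE.
by apply: eq_bigr => i _; rewrite mxE.
Qed.

Lemma mdotC m n (A B : 'M[R]_(m, n)) : mdot A B = mdot B A.
Proof. by rewrite !mdotE; apply: eq_bigr => i _; apply: eq_bigr => j _; rewrite mulrC. Qed.

Lemma mdotDr m n (A B C : 'M[R]_(m, n)) : mdot A (B + C) = mdot A B + mdot A C.
Proof. by rewrite /mdot mulmxDr raddfD. Qed.

Lemma mdotZr m n c (A B : 'M[R]_(m, n)) : mdot A (c *: B) = c * mdot A B.
Proof. by rewrite /mdot -scalemxAr linearZ. Qed.

Lemma mdotDl m n (A B C : 'M[R]_(m, n)) : mdot (B + C) A = mdot B A + mdot C A.
Proof. by rewrite !(mdotC _ A) mdotDr. Qed.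

Lemma mdotZl m n c (A B : 'M[R]_(m, n)) : mdot (c *: A) B = c * mdot A B.
Proof. by rewrite mdotC mdotZr mdotC. Qed.

Lemma mdotNr m n (A B : 'M[R]_(m, n)) : mdot A (- B) = - mdot A B.
Proof. by rewrite -scaleN1r mdotZr mulN1r. Qed.

Lemma mdotNl m n (A B : 'M[R]_(m, n)) : mdot (- A) B = - mdot A B.
Proof. by rewrite mdotC mdotNr mdotC. Qed.

Lemma mdot0r m n (A : 'M[R]_(m, n)) : mdot A 0 = 0.
Proof. by rewrite /mdot mulmx0 linear0. Qed.

Lemma mdot_sumr (I : Type) (r : seq I) m n (A : 'M[R]_(m, n)) (B : I -> 'M[R]_(m, n)) :
  mdot A (\sum_(i <- r) B i) = \sum_(i <- r) mdot A (B i).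
Proof.
elim: r => [|x r IH]; first by rewrite !big_nil mdot0r.
by rewrite !big_cons mdotDr IH.
Qed.

Lemma nrm2E m n (A : 'M[R]_(m, n)) : nrm2 A = \sum_i \sum_j A i j ^+ 2.
Proof. by rewrite /nrm2 mdotE; do 2!apply: eq_bigr => ? _; rewrite expr2. Qed.

Lemma nrm2_ge0 m n (A : 'M[R]_(m, n)) : 0 <= nrm2 A.
Proof. by rewrite nrm2E; do 2!apply: sumr_ge0 => ? _; rewrite sqr_ge0. Qed.

Lemma nrm2_entry m n (A : 'M[R]_(m, n)) i j : A i j ^+ 2 <= nrm2 A.
Proof.
rewrite nrm2E (bigD1 i) //= (bigD1 j) //= -addrA lerDl addr_ge0 //.
  by apply: sumr_ge0 => ? _; rewrite sqr_ge0.
by do 2!apply: sumr_ge0 => ? _; rewrite sqr_ge0.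
Qed.

Lemma nrm2_eq0 m n (A : 'M[R]_(m, n)) : nrm2 A = 0 -> A = 0.
Proof.
move=> A0; apply/matrixP => i j; rewrite mxE; apply/eqP.
by rewrite -sqrf_eq0 eq_le sqr_ge0 -{1}A0 nrm2_entry.
Qed.

Lemma nrm20 m n : nrm2 (0 : 'M[R]_(m, n)) = 0.
Proof. exact: mdot0r. Qed.

Lemma nrm2N m n (A : 'M[R]_(m, n)) : nrm2 (- A) = nrm2 A.
Proof. by rewrite /nrm2 mdotNr mdotNl opprK. Qed.

Lemma nrm2Z m n c (A : 'M[R]_(m, n)) : nrm2 (c *: A) = c ^+ 2 * nrm2 A.
Proof. by rewrite /nrm2 mdotZr mdotZl mulrA. Qed.

Lemma nrm2D m n (A B : 'M[R]_(m, n)) : nrm2 (A + B) = nrm2 A + mdot A B *+ 2 + nrm2 B.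
Proof.
by rewrite /nrm2 !(mdotDr, mdotDl) (mdotC B A) mulr2n !addrA.
Qed.

Lemma nrm2B m n (A B : 'M[R]_(m, n)) : nrm2 (A - B) = nrm2 A - mdot A B *+ 2 + nrm2 B.
Proof. by rewrite nrm2D nrm2N mdotNr mulNrn. Qed.

Lemma nrm2_stiefel m n p (U : 'M[R]_(m, n)) (A : 'M[R]_(n, p)) :
  Stiefel U -> nrm2 (U *m A) = nrm2 A.
Proof.
by move=> sU; rewrite /nrm2 /mdot trmx_mul -mulmxA (mulmxA U^T) sU mul1mx.
Qed.

Lemma mdot_orth m n (A B : 'M[R]_(m, n)) O : Orth O -> mdot (A *m O) (B *m O) = mdot A B.
Proof.
move=> oO; rewrite /mdot trmx_mul mxtrace_mulC -!mulmxA (mulmxA O) orth_mulV //.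
by rewrite mul1mx mxtrace_mulC.
Qed.

Lemma nrm2_orth m n (A : 'M[R]_(m, n)) O : Orth O -> nrm2 (A *m O) = nrm2 A.
Proof. exact: mdot_orth. Qed.

Lemma mdot_CS m n (A B : 'M[R]_(m, n)) : mdot A B ^+ 2 <= nrm2 A * nrm2 B.
Proof.
have h (C D : 'M[R]_(m, n)) : mdot C D = dot (mxvec C)^T (mxvec D)^T.
  rewrite mdotE dotE (reindex _ (curry_mxvec_bij _ _)) /= pair_bigA.
  by apply: eq_bigr => -[i j] _ /=; rewrite !mxE !mxvecE.
by rewrite /nrm2 !h dot_CS.
Qed.

Definition nrm m n (A : 'M[R]_(m, n)) : R := Num.sqrt (nrm2 A).

Lemma nrm_ge0 m n (A : 'M[R]_(m, n)) : 0 <= nrm A.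
Proof. exact: sqrtr_ge0. Qed.

Lemma sqr_nrm m n (A : 'M[R]_(m, n)) : nrm A ^+ 2 = nrm2 A.
Proof. by rewrite sqr_sqrtr // nrm2_ge0. Qed.

Lemma mdot_le m n (A B : 'M[R]_(m, n)) : `|mdot A B| <= nrm A * nrm B.
Proof.
rewrite -(@ler_pXn2r _ 2) ?nnegrE ?mulr_ge0 ?nrm_ge0 //.
by rewrite exprMn !sqr_nrm real_normK ?num_real // mdot_CS.
Qed.

Lemma nrm_triangle m n (A B : 'M[R]_(m, n)) : nrm (A + B) <= nrm A + nrm B.
Proof.
rewrite -(@ler_pXn2r _ 2) ?nnegrE ?addr_ge0 ?nrm_ge0 // sqr_nrm nrm2D sqrrD !sqr_nrm.
rewrite lerD2r lerD2l lerMn2r /=; apply: le_trans (ler_norm _) (mdot_le _ _).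
Qed.

Lemma nrmN m n (A : 'M[R]_(m, n)) : nrm (- A) = nrm A.
Proof. by rewrite /nrm nrm2N. Qed.

Lemma nrmZ m n c (A : 'M[R]_(m, n)) : nrm (c *: A) = `|c| * nrm A.
Proof. by rewrite /nrm nrm2Z sqrtrM ?sqr_ge0 // sqrtr_sqr. Qed.

Lemma nrm0 m n : nrm (0 : 'M[R]_(m, n)) = 0.
Proof. by rewrite /nrm nrm20 sqrtr0. Qed.

Lemma nrm_entry m n (A : 'M[R]_(m, n)) i j : `|A i j| <= nrm A.
Proof.
rewrite -(@ler_pXn2r _ 2) ?nnegrE ?nrm_ge0 // sqr_nrm real_normK ?num_real //.
exact: nrm2_entry.
Qed.

(** In eigenbases of the symmetric matrices A and B the operator X -> A X - X B is diagonal with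
    entries a_i - b_j. With X = 1 this compares functions of matrices that do not commute,
    eigenvalue by eigenvalue. *)
Lemma dblspec m n (O : 'M[R]_m) (Q : 'M[R]_n) (a : 'rV[R]_m) (b : 'rV[R]_n) :
  Orth O -> Orth Q -> forall X,
  nrm2 (O *m diag_mx a *m O^T *m X - X *m (Q *m diag_mx b *m Q^T)) =
  \sum_i \sum_j (O^T *m X *m Q) i j ^+ 2 * (a 0 i - b 0 j) ^+ 2.
Proof.
move=> oO oQ X; set C := O^T *m X *m Q.
have eX : X = O *m C *m Q^T.
  rewrite /C !mulmxA orth_mulV // mul1mx -mulmxA orth_mulV // mulmx1 //.
clearbody C; rewrite {1 2}eX -!mulmxA (mulmxA O^T) oO mul1mx (mulmxA Q^T) oQ mul1mx.
rewrite -mulmxBr nrm2_stiefel // (mulmxA (diag_mx a)) (mulmxA C) -mulmxBl.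
rewrite nrm2_orth; last exact: orth_trmx.
rewrite nrm2E; apply: eq_bigr => i _; apply: eq_bigr => j _.
by rewrite mul_diag_mx mul_mx_diag !mxE -exprMn; congr (_ ^+ 2); ring.
Qed.

Lemma loewner_eigen n (A O : 'M[R]_n) (d : 'rV[R]_n) c i : Orth O ->
  A = O *m diag_mx d *m O^T -> loewner c%:M A -> c <= d 0 i.
Proof.
move=> oO eA /(loewner_dot (O *m delta_mx i 0)).
rewrite {1}eA dot_eigen // mul_scalar_mx dotZr stiefel_dot //.
by rewrite -[X in dot _ X]mul1mx dot_delta mxE eqxx mulr1.
Qed.

Lemma loewner_eigen_le n (A O : 'M[R]_n) (d : 'rV[R]_n) c i : Orth O ->
  A = O *m diag_mx d *m O^T -> loewner A c%:M -> d 0 i <= c.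
Proof.
move=> oO eA /(loewner_dot (O *m delta_mx i 0)).
rewrite {1}eA dot_eigen // mul_scalar_mx dotZr stiefel_dot //.
by rewrite -[X in dot _ X]mul1mx dot_delta mxE eqxx mulr1.
Qed.

(** By [dblspec] both sides carry the same weights, so the Lipschitz constant for scalars passes to
    the Frobenius norm. *)
Lemma symfun_lip (f : R -> R) n (A B : 'M[R]_n) a L :
  A^T = A -> B^T = B -> loewner a%:M A -> loewner a%:M B ->
  (forall x y, a <= x -> a <= y -> `|f x - f y| <= L * `|x - y|) ->
  nrm2 (symfun f A - symfun f B) <= L ^+ 2 * nrm2 (A - B).
Proof.
move=> sA sB hA hB hf.
have [ O [x [oO eA fA]]] := symfun_spec sA; have [Q [y [oQ eB fB]]] := symfun_spec sB.
rewrite fA fB -[X in X - _]mulmx1 -[X in _ - X]mul1mx dblspec //.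
have -> : A - B = A *m 1%:M - 1%:M *m B by rewrite mulmx1 mul1mx.
rewrite [in leRHS]eA [in leRHS]eB dblspec // mulr_sumr; apply: ler_sum => i _.
rewrite mulr_sumr; apply: ler_sum => j _; rewrite [leRHS]mulrCA ler_wpM2l ?sqr_ge0 //.
rewrite -exprMn !mxE -[leLHS]real_normK ?num_real // -[leRHS]real_normK ?num_real //.
have xi := loewner_eigen i oO eA hA; have yj := loewner_eigen j oQ eB hB.
have h := hf _ _ xi yj.
rewrite ler_pXn2r ?nnegrE // normrM; apply: le_trans h _.
by rewrite ler_wpM2r // ler_norm.
Qed.

(** Both sides are sums with the weights (O^T Q)_ij^2, compared termwise by [ln_dist]. The traces on
    the right are easily computed along a geodesic. *)
Lemma nrm2_ln_le n (A B : 'M[R]_n) : Pos A -> Pos B ->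
  nrm2 (symfun (@ln R) A - symfun (@ln R) B) <=
  \tr (invmx A *m B) + \tr (invmx B *m A) - 2 * n%:R.
Proof.
move=> pA pB; have [ O [x [oO eA x0 fA]]] := Pos_spec pA.
have [Q [y [oQ eB y0 fB]]] := Pos_spec pB.
have trE (f g : R -> R) : \tr (symfun f A *m symfun g B) =
    \sum_i \sum_j (O^T *m Q) i j ^+ 2 * (f (x 0 i) * g (y 0 j)).
  rewrite fA fB -!mulmxA mxtrace_mulC -!mulmxA (mulmxA O^T Q) /mxtrace.
  apply: eq_bigr => i _; rewrite mul_diag_mx [LHS]mxE map_diagE mxE mulr_sumr.
  apply: eq_bigr => j _; rewrite mul_diag_mx [(\matrix_(_, _) _) j i]mxE map_diagE.
  rewrite (_ : (Q^T *m O) j i = (O^T *m Q) i j); last first.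
    by rewrite -[Q in RHS]trmxK -trmx_mul [RHS]mxE.
  by ring.
have -> : 2 * n%:R = \sum_i \sum_j (O^T *m Q) i j ^+ 2 * 2 :> R.
  have := trE (fun=> 1) (fun=> 1).
  rewrite (symfun_cst _ (Pos_sym pA)) (symfun_cst _ (Pos_sym pB)) mulmx1 mxtrace1 => ->.
  rewrite mulr_sumr; apply: eq_bigr => i _; rewrite mulr_sumr.
  by apply: eq_bigr => j _; ring.
have -> : invmx A *m B = symfun GRing.inv A *m symfun id B.
  by rewrite symfun_inv // symfun_id // Pos_sym.
have -> : \tr (invmx B *m A) = \tr (symfun id A *m symfun GRing.inv B).
  by rewrite symfun_inv // symfun_id ?Pos_sym // mxtrace_mulC.
rewrite !trE fA fB -[X in X - _]mulmx1 -[X in _ - X]mul1mx dblspec //.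
rewrite -big_split -sumrB /=; apply: ler_sum => i _.
rewrite -big_split -sumrB /=; apply: ler_sum => j _.
rewrite mulmx1 -mulrDr -mulrBr ler_wpM2l ?sqr_ge0 // !mxE.
apply: le_trans (ln_dist (x0 i) (y0 j)) _.
by rewrite [_ / y 0 j + _]addrC [(x 0 i)^-1 * _]mulrC.
Qed.

End Frob.

Section DistPos.
Variable R : realType.

(** The matrix A^(-1/2) P is orthogonal and diagonalizes the matrix whose logarithm defines the
    distance. Any P with A = P P^T will do, whence the invariance under congruence and inversion. *)
Lemma distPos_diag n (A B P : 'M[R]_n) (e : 'rV[R]_n) : Pos A -> P \in unitmx ->
  A = P *m P^T -> B = P *m diag_mx e *m P^T ->
  distPos A B ^+ 2 = \sum_i (ln (e 0 i)) ^+ 2.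
Proof.
move=> pA uP eA eB; rewrite /distPos sqr_nrm.
set C := invmx (sqrtmx A); have pS := sqrtmx_Pos pA.
have sC : C^T = C by exact/Pos_sym/Pos_inv.
pose V := C *m P.
have eCA : C *m A *m C = 1%:M.
  rewrite -(sqrtmx_sqr (Pos_psd pA)) !mulmxA mulVmx ?Pos_unit // mul1mx.
  by rewrite mulmxV // Pos_unit.
have oV : Orth V.
  by apply: mulmx1C; rewrite /V trmx_mul sC !mulmxA -(mulmxA C) -eA.
rewrite (_ : C *m B *m C = V *m diag_mx e *m V^T); last first.
  by rewrite eB /V trmx_mul sC !mulmxA.
rewrite /logmx symfun_orth // nrm2_orth; last exact: orth_trmx.
rewrite nrm2_stiefel // nrm2E; apply: eq_bigr => i _.
rewrite (bigD1 i) //= big1 ?addr0; first by rewrite !mxE eqxx mulr1n.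
by move=> j ji; rewrite !mxE eq_sym (negbTE ji) mulr0n expr0n.
Qed.

Lemma Pos_codiag n (A B : 'M[R]_n) : Pos A -> Pos B ->
  exists (P : 'M[R]_n) (e : 'rV[R]_n),
    [/\ P \in unitmx, A = P *m P^T, B = P *m diag_mx e *m P^T & forall i, 0 < e 0 i].
Proof.
move=> pA pB; set S := sqrtmx A; have pS : Pos S by exact: sqrtmx_Pos.
have uS := Pos_unit pS; have sS := Pos_sym pS.
have pC : Pos (invmx S *m B *m invmx S).
  have sC : (invmx S)^T = invmx S by exact/Pos_sym/Pos_inv.
  by rewrite -{2}sC; apply: Pos_congr; rewrite ?unitmx_inv.
have [ O [e [oO eC e0 _]]] := Pos_spec pC.
exists (S *m O), e; split=> //.
- by rewrite unitmx_mul uS orth_unit.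
- by rewrite trmx_mul mulmxA -(mulmxA S) orth_mulV // mulmx1 sS sqrtmx_sqr //; exact: Pos_psd.
- rewrite trmx_mul sS !mulmxA -(mulmxA S) -(mulmxA S) -eC !mulmxA mulmxV // mul1mx.
  by rewrite -mulmxA mulVmx // mulmx1.
Qed.

(* Along [G t = P diag(e^t) P^T], the increments of [log] over steps of size
   [1/m] are bounded by [2 sinh] of the logarithmic increments. *)
Theorem exponential_metric_increasing n (A B : 'M[R]_n) : Pos A -> Pos B ->
  nrm2 (symfun (@ln R) A - symfun (@ln R) B) <= distPos A B ^+ 2.
Proof.
move=> pA pB; have [P [e [uP eA eB e0]]] := Pos_codiag pA pB.
rewrite (distPos_diag pA uP eA eB); pose s i : R := ln (e 0 i).
rewrite (eq_bigr (fun i => s i ^+ 2)) //.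
pose G t := P *m diag_mx (\row_i expR (t * s i)) *m P^T.
have pG t : Pos (G t).
  apply: Pos_congr => //; rewrite -[diag_mx _]mulmx1 -trmx1 -[diag_mx _]mul1mx.
  by apply: orth_diag_Pos; [exact: orth1|move=> i; rewrite mxE expR_gt0].
have G0 : G 0 = A.
  rewrite /G (_ : \row_i _ = const_mx 1) ?diag_const_mx ?mulmx1 //.
  by apply/rowP => i; rewrite !mxE mul0r expR0.
have G1 : G 1 = B.
  rewrite /G (_ : \row_i _ = e) //.
  by apply/rowP => i; rewrite !mxE mul1r /s lnK // posrE.
have GV t u : invmx (G t) *m G u =
    invmx P^T *m diag_mx (\row_i expR ((u - t) * s i)) *m P^T.
  apply: (can_inj (mulKmx (Pos_unit (pG t)))); rewrite mulKVmx ?Pos_unit //.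
  rewrite /G !mulmxA; congr (_ *m _); rewrite mulmxK ?unitmx_tr // -!mulmxA.
  rewrite diag_mulE; congr (_ *m diag_mx _); apply/rowP => i; rewrite !mxE -expRD.
  by congr expR; ring.
have trG t u : \tr (invmx (G t) *m G u) = \sum_i expR ((u - t) * s i).
  rewrite GV mxtrace_mulC mulmxA mulmxV ?unitmx_tr // mul1mx /mxtrace.
  by apply: eq_bigr => i _; rewrite !mxE eqxx mulr1n.
pose L t := symfun (@ln R) (G t).
pose S := \sum_i `|s i|.
(* By [cosh_le] the term 2 cosh ((u - t) s_i) - 2 is at most (u - t)^2 s_i^2 times a factor that
   tends to 1 with the step. *)
have step t u : nrm2 (L u - L t) <= (u - t) ^+ 2 * expR (`|u - t| * S) * \sum_i s i ^+ 2.
  apply: le_trans (nrm2_ln_le (pG u) (pG t)) _; rewrite !trG.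
  rewrite -big_split /= (_ : 2 * n%:R = \sum_(i < n) 2); last first.
    by rewrite sumr_const card_ord -[RHS]mulr_natr.
  rewrite -sumrB mulr_sumr; apply: ler_sum => i _.
  have := cosh_le ((u - t) * s i); rewrite [expR _ + _]addrC.
  rewrite (_ : - ((u - t) * s i) = (t - u) * s i); last by ring.
  move/le_trans; apply; rewrite exprMn [leRHS]mulrAC ler_wpM2l //.
    by rewrite mulr_ge0 ?sqr_ge0.
  rewrite ler_expR normrM ler_wpM2l // /S (bigD1 i) //= lerDl.
  by apply: sumr_ge0.
set X := \sum_i s i ^+ 2 in step *.
have X0 : 0 <= X by apply: sumr_ge0 => i _; exact: sqr_ge0.
have S0 : 0 <= S by apply: sumr_ge0.
have main (m : nat) : nrm2 (L 1 - L 0) <= expR (S / m.+1%:R) * X.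
  have m0 : 0 < m.+1%:R :> R by [].
  pose c := m.+1%:R^-1 * Num.sqrt (expR (S / m.+1%:R) * X).
  pose Lk (k : nat) := L (k%:R / m.+1%:R).
  have st k : nrm (Lk k.+1 - Lk k) <= c.
    rewrite -(@ler_pXn2r _ 2) ?nnegrE ?nrm_ge0 ?mulr_ge0 ?sqrtr_ge0 ?invr_ge0 //.
    rewrite sqr_nrm exprMn sqr_sqrtr ?mulr_ge0 ?expR_ge0 //.
    apply: le_trans (step _ _) _.
    rewrite (_ : _ - _ = m.+1%:R^-1); last first.
      by rewrite -mulrBl -[k.+1%:R]natr1 addrAC subrr add0r mul1r.
    by rewrite ger0_norm ?invr_ge0 // [_^-1 * S]mulrC mulrA.
  have h k : nrm (Lk k - Lk 0%N) <= k%:R * c.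
    elim: k => [|k IH]; first by rewrite mul0r subrr nrm0.
    have -> : Lk k.+1 - Lk 0%N = (Lk k.+1 - Lk k) + (Lk k - Lk 0%N).
      by rewrite addrA subrK.
    apply: le_trans (nrm_triangle _ _) _.
    by rewrite -natr1 mulrDl mul1r addrC; apply: lerD.
  have := h m.+1; rewrite /Lk mul0r divff ?gt_eqF // /c mulVKf ?gt_eqF //.
  rewrite -(@ler_pXn2r _ 2) ?nnegrE ?nrm_ge0 ?sqrtr_ge0 //.
  by rewrite sqr_nrm sqr_sqrtr // mulr_ge0 ?expR_ge0.
have -> : symfun (@ln R) A - symfun (@ln R) B = - (L 1 - L 0) by rewrite /L G0 G1 opprB.
rewrite nrm2N.
have cv : (fun m : nat => expR (S / m.+1%:R) * X) @ \oo --> expR 0 * X.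
  apply: cvgM; last exact: cvg_cst.
  apply: (@cvg_comp _ _ _ (fun m : nat => S / m.+1%:R) (@expR R)) (@continuous_expR R 0).
  rewrite -(mulr0 S); apply: cvgM; first exact: cvg_cst.
  exact: cvg_harmonic.
rewrite -[leRHS]mul1r -[X in X * _]expR0.
exact: cvg_seq_ge cv _.
Qed.

End DistPos.

(** * Monotone limits in the Loewner order and Thompson's metric *)

Section SeqMx.
Variable R : realType.

Lemma mx_cvg_unique m n (u : nat -> 'M[R]_(m, n)) (A B : 'M[R]_(m, n)) :
  u @ \oo --> A -> u @ \oo --> B -> A = B.
Proof.
move=> /mx_cvgP hA /mx_cvgP hB; apply/matrixP => i j.
exact: cvg_unique (hA i j) (hB i j).
Qed.

Lemma cvg_quad n (u : nat -> 'M[R]_n) (A : 'M[R]_n) x :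
  u @ \oo --> A -> (fun k => dot x (u k *m x)) @ \oo --> dot x (A *m x).
Proof.
move=> h; apply: cvg_dot; first exact: cvg_cst.
by apply: cvg_mulmx => //; exact: cvg_cst.
Qed.

Lemma psd_cvg n (u : nat -> 'M[R]_n) (A : 'M[R]_n) :
  u @ \oo --> A -> (forall k, psd (u k)) -> psd A.
Proof.
move=> h pu; apply/psdE; split.
  apply: mx_cvg_unique (cvg_trmx h) _.
  by rewrite (_ : (fun k => (u k)^T) = u) //; apply/funext => k; exact: psd_sym.
move=> x; apply: (@cvg_seq_ge _ (fun k => dot x (u k *m x))).
  exact: cvg_quad.
move=> k; by have /psdE[] := pu k.
Qed.

Lemma loewner_cvg n (u v : nat -> 'M[R]_n) (A B : 'M[R]_n) :
  u @ \oo --> A -> v @ \oo --> B -> (forall k, loewner (u k) (v k)) -> loewner A B.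
Proof. by move=> hu hv; apply: psd_cvg; apply: cvgB. Qed.

Lemma polarize n (A : 'M[R]_n) i j : A^T = A ->
  let e := delta_mx i 0 : 'cV[R]_n in let f := delta_mx j 0 : 'cV[R]_n in
  A i j = (dot (e + f) (A *m (e + f)) - dot (e - f) (A *m (e - f))) / 4.
Proof.
move=> sA e f; rewrite !mulmxDr mulmxN !(dotDl, dotDr, dotNl, dotNr) !dot_delta.
have -> : A j i = A i j by rewrite -[in LHS]sA mxE.
by field.
Qed.

(** Each quadratic form is a bounded monotone real sequence, and [polarize] recovers the entries
    from the forms. *)
Lemma mono_cvg n (u : nat -> 'M[R]_n) (B : 'M[R]_n) :
  (forall k, (u k)^T = u k) -> (forall k, loewner (u k) (u k.+1)) ->
  (forall k, loewner (u k) B) -> exists A : 'M[R]_n, u @ \oo --> A.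
Proof.
move=> su um uB.
have cq x : cvg ((fun k => dot x (u k *m x)) @ \oo).
  apply: nondecreasing_is_cvgn.
    by apply/nondecreasing_seqP => k; exact: loewner_dot.
  by exists (dot x (B *m x)) => _ [k _ <-]; exact: loewner_dot.
exists (\matrix_(i, j) lim ((fun k => u k i j) @ \oo)); apply/mx_cvgP => i j.
rewrite mxE; pose e := delta_mx i 0 : 'cV[R]_n; pose f := delta_mx j 0 : 'cV[R]_n.
suff : cvg ((fun k => u k i j) @ \oo) by [].
rewrite (_ : (fun k => u k i j) = (fun k =>
  (dot (e + f) (u k *m (e + f)) - dot (e - f) (u k *m (e - f))) / 4)); last first.
  by apply/funext => k; exact: polarize.
by apply: is_cvgM; [exact: is_cvgB (cq _) (cq _)|exact: is_cvg_cst].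
Qed.

Lemma mono_cvg_dec n (u : nat -> 'M[R]_n) (B : 'M[R]_n) :
  (forall k, (u k)^T = u k) -> (forall k, loewner (u k.+1) (u k)) ->
  (forall k, loewner B (u k)) -> exists A : 'M[R]_n, u @ \oo --> A.
Proof.
move=> su um uB.
have [||k|A hA] := @mono_cvg n (fun k => - u k) (- B).
- by move=> k; rewrite raddfN /= su.
- by move=> k; rewrite /loewner opprK addrC; exact: um.
- by rewrite /loewner opprK addrC; exact: uB.
exists (- A); rewrite (_ : u = fun k => - (- u k)); first exact: cvgN.
by apply/funext => k; rewrite opprK.
Qed.

Lemma loewner_entry n (D : 'M[R]_n) c i j : loewner D c%:M -> loewner (- c%:M) D ->
  `|D i j| <= c.
Proof.
move=> h1 h2.
have sD : D^T = D.
  have : (c%:M - D)^T = c%:M - D by exact: (psd_sym h1).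
  by rewrite raddfB /= tr_scalar_mx => /addrI/oppr_inj.
rewrite (polarize i j sD); set e := delta_mx i 0; set f := delta_mx j 0.
have h x : `|dot x (D *m x)| <= c * dot x x.
  rewrite ler_norml; have := loewner_dot x h1; have := loewner_dot x h2.
  by rewrite mulNmx !mul_scalar_mx dotNr dotZr => -> ->.
have ee k : dot (delta_mx k 0 : 'cV[R]_n) (delta_mx k 0) = 1.
  by rewrite -[X in dot _ X]mul1mx dot_delta mxE eqxx.
rewrite normrM [`|4^-1|]ger0_norm ?invr_ge0 // ler_pdivrMr //.
apply: le_trans (ler_normB _ _) _; apply: le_trans (lerD (h _) (h _)) _.
by rewrite !(dotDl, dotDr, dotBl, dotBr, dotNl, dotNr) !ee (dotC f e); lra.
Qed.

Lemma loewner_scalar n (a b : R) : a <= b -> loewner (a%:M : 'M[R]_n) b%:M.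
Proof.
move=> ab; apply: loewner_sym; rewrite ?tr_scalar_mx // => x.
by rewrite !mul_scalar_mx !dotZr ler_wpM2r // dot_ge0.
Qed.

Lemma Pos_bounds n (A : 'M[R]_n) : Pos A ->
  exists a b : R, [/\ 0 < a, 0 < b, loewner a%:M A & loewner A b%:M].
Proof.
move=> /Pos_spec[ O [d [oO eA d0 _]]].
(* Sums stand in for extreme eigenvalues, and the added 1 keeps a and b positive at size 0. *)
pose a := (1 + \sum_i (d 0 i)^-1)^-1; pose b := 1 + \sum_i d 0 i.
have s0 : 0 <= \sum_i (d 0 i)^-1 by apply: sumr_ge0 => i _; rewrite invr_ge0 ltW.
have b0 : 0 <= \sum_i d 0 i by apply: sumr_ge0 => i _; rewrite ltW.
have sc (c : R) : c%:M = O *m diag_mx (const_mx c) *m O^T.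
  by rewrite diag_const_mx mul_mx_scalar -scalemxAl orth_mulV // scalemx1.
exists a, b; split.
- by rewrite invr_gt0; lra.
- by rewrite /b; lra.
- rewrite /loewner sc eA -mulmxBl -mulmxBr -raddfB; apply: orth_diag_psd => // i.
  rewrite !mxE subr_ge0 -[leRHS]invrK lef_pV2 ?posrE ?invr_gt0 //; last by lra.
  rewrite (bigD1 i) //= [leRHS]addrCA lerDl addr_ge0 //.
  by apply: sumr_ge0 => k _; rewrite invr_ge0 ltW.
- rewrite /loewner sc eA -mulmxBl -mulmxBr -raddfB; apply: orth_diag_psd => // i.
  rewrite !mxE subr_ge0 /b (bigD1 i) //= addrCA lerDl addr_ge0 //.
  by apply: sumr_ge0 => k _; rewrite ltW.
Qed.

Lemma Pos_bounds_fam N n (A : 'I_N -> 'M[R]_n) : (forall i, Pos (A i)) ->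
  exists a b : R, [/\ 0 < a, 0 < b, forall i, loewner a%:M (A i)
    & forall i, loewner (A i) b%:M].
Proof.
move=> pA; have /choice[f hf] : forall i, exists ab : R * R,
    [/\ 0 < ab.1, 0 < ab.2, loewner ab.1%:M (A i) & loewner (A i) ab.2%:M].
  by move=> i; have [a [b h]] := Pos_bounds (pA i); exists (a, b).
pose a := (1 + \sum_i (f i).1^-1)^-1; pose b := 1 + \sum_i (f i).2.
have f1 i : 0 < (f i).1 by case: (hf i).
have f2 i : 0 < (f i).2 by case: (hf i).
have s0 : 0 <= \sum_i (f i).1^-1 by apply: sumr_ge0 => i _; rewrite invr_ge0 ltW.
have b0 : 0 <= \sum_i (f i).2 by apply: sumr_ge0 => i _; rewrite ltW.
exists a, b; split.
- by rewrite invr_gt0; lra.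
- by rewrite /b; lra.
- move=> i; have [_ _ h _] := hf i; apply: (loewner_trans _ h); apply: loewner_scalar.
  rewrite -[leRHS]invrK lef_pV2 ?posrE ?invr_gt0 //; last by lra.
  rewrite (bigD1 i) //= [leRHS]addrCA lerDl addr_ge0 //.
  by apply: sumr_ge0 => k _; rewrite invr_ge0 ltW.
- move=> i; have [_ _ _ h] := hf i; apply: (loewner_trans h); apply: loewner_scalar.
  rewrite /b (bigD1 i) //= addrCA lerDl addr_ge0 //.
  by apply: sumr_ge0 => k _; rewrite ltW.
Qed.

(* A and B are at distance at most t for Thompson's metric iff th (expR t) A B. *)
Definition th n (k : R) (A B : 'M[R]_n) := loewner A (k *: B) /\ loewner B (k *: A).

Lemma th_bounds n (A B : 'M[R]_n) a b : 0 < a -> loewner a%:M A -> loewner a%:M B ->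
  loewner A b%:M -> loewner B b%:M -> 0 <= b -> th (b / a) A B.
Proof.
move=> a0 aA aB Ab Bb b0.
have h (X : 'M[R]_n) : loewner a%:M X -> loewner b%:M ((b / a) *: X).
  have ba : 0 <= b / a by rewrite divr_ge0 // ltW.
  move/(loewner_scale ba); rewrite scale_scalar_mx.
  by rewrite (_ : b / a * a = b) // divfK // gt_eqF.
by split; [exact: (loewner_trans Ab (h _ aB))|exact: (loewner_trans Bb (h _ aA))].
Qed.

(** Both A - B and B - A are at most (k - 1) b in the Loewner order: for bounded matrices, closeness
    in Thompson's metric controls the entries. *)
Lemma th_entry n (A B : 'M[R]_n) k b : 1 <= k -> th k A B ->
  loewner A b%:M -> loewner B b%:M -> forall i j, `|(A - B) i j| <= (k - 1) * b.
Proof.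
move=> k1 [h1 h2] Ab Bb i j; have k0 : 0 <= k - 1 by rewrite subr_ge0.
have e (X : 'M[R]_n) : loewner X b%:M -> loewner ((k - 1) *: X) ((k - 1) * b)%:M.
  by move/(loewner_scale k0); rewrite scale_scalar_mx.
apply: loewner_entry.
  apply: (loewner_trans _ (e _ Bb)).
  by move: h1; rewrite /loewner scalerBl scale1r opprB addrA subrK.
have : loewner (B - A) ((k - 1) * b)%:M.
  by apply: (loewner_trans _ (e _ Ab)); move: h2; rewrite /loewner scalerBl scale1r opprB addrA subrK.
by rewrite /loewner opprK opprB [in X in _ -> X]addrC.
Qed.

End SeqMx.

(** * The mean alm *)

Section GeomMean.
Variables (R : realType) (p : nat).

(** An exponential of a mean of logarithms, because the iteration of [alm] is linear in the
    logarithms ([alm_fac]). *)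
Definition gmv N (a : 'I_N -> R) : R := expR ((\sum_i ln (a i)) / N%:R).

Lemma gmv_gt0 N (a : 'I_N -> R) : 0 < gmv a.
Proof. exact: expR_gt0. Qed.

Lemma gmv_cst N (c : R) : (0 < N)%N -> 0 < c -> gmv (fun _ : 'I_N => c) = c.
Proof.
move=> N0 c0; rewrite /gmv sumr_const card_ord -[X in X / _]mulr_natr mulfK.
  by rewrite lnK.
by rewrite pnatr_eq0 -lt0n.
Qed.

(* [gm_diag] is consistency with scalars for simultaneously diagonalizable
   tuples; the matrix [P] need not be orthogonal. *)
Record is_gm N (G : ('I_N -> 'M[R]_p) -> 'M[R]_p) : Prop := IsGm {
  gm_pos : forall T, (forall i, Pos (T i)) -> Pos (G T);
  gm_mono : forall T T', (forall i, Pos (T i)) -> (forall i, Pos (T' i)) ->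
    (forall i, loewner (T i) (T' i)) -> loewner (G T) (G T');
  gm_hom : forall T a, (forall i, Pos (T i)) -> (forall i, 0 < a i) ->
    G (fun i => a i *: T i) = gmv a *: G T;
  gm_perm : forall T (s : 'S_N), (forall i, Pos (T i)) -> G (fun i => T (s i)) = G T;
  gm_congr : forall T P, (forall i, Pos (T i)) -> P \in unitmx ->
    G (fun i => P *m T i *m P^T) = P *m G T *m P^T;
  gm_inv : forall T, (forall i, Pos (T i)) -> G (fun i => invmx (T i)) = invmx (G T);
  gm_diag : forall T P (d : 'I_N -> 'rV[R]_p), (forall i, Pos (T i)) -> P \in unitmx ->
    (forall i j, 0 < d i 0 j) -> (forall i, T i = P *m diag_mx (d i) *m invmx P) ->
    G T = P *m diag_mx (\row_j gmv (fun i => d i 0 j)) *m invmx P }.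

(** Monotonicity applied to T_i <= k_i T'_i, with homogeneity to extract the scalars. The factors
    may differ from index to index, and this is where [step_diam] gains. *)
Lemma gm_th N (G : ('I_N -> 'M[R]_p) -> 'M[R]_p) T T' k : is_gm G ->
  (forall i, Pos (T i)) -> (forall i, Pos (T' i)) -> (forall i, 0 < k i) ->
  (forall i, th (k i) (T i) (T' i)) -> th (gmv k) (G T) (G T').
Proof.
move=> gG pT pT' k0 h; split; rewrite -(gm_hom gG) //; apply: (gm_mono gG) => // i.
- exact: Pos_scale.
- by case: (h i).
- exact: Pos_scale.
- by case: (h i).
Qed.

Lemma gm_cst N (G : ('I_N -> 'M[R]_p) -> 'M[R]_p) X : (0 < N)%N -> is_gm G ->
  Pos X -> G (fun=> X) = X.
Proof.
move=> N0 gG pX; have [ O [d [oO eX d0 _]]] := Pos_spec pX.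
rewrite (gm_diag gG (P := O) (d := fun=> d)) ?orth_unit //; last first.
  by move=> i; rewrite orth_inv.
rewrite orth_inv // [RHS]eX; congr (_ *m diag_mx _ *m _); apply/rowP => j.
by rewrite mxE gmv_cst.
Qed.

Lemma gm_bounds N (G : ('I_N -> 'M[R]_p) -> 'M[R]_p) T a b : (0 < N)%N -> is_gm G ->
  0 < a -> (forall i, loewner a%:M (T i)) -> (forall i, loewner (T i) b%:M) -> 0 < b ->
  loewner a%:M (G T) /\ loewner (G T) b%:M.
Proof.
move=> N0 gG a0 aT Tb b0.
have pT i : Pos (T i) by apply: Pos_loewner (aT i); exact: Pos_scalar.
split.
  rewrite -(gm_cst N0 gG (Pos_scalar p a0)); apply: (gm_mono gG) => // i.
  exact: Pos_scalar.
rewrite -(gm_cst N0 gG (Pos_scalar p b0)); apply: (gm_mono gG) => // i.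
exact: Pos_scalar.
Qed.

End GeomMean.

Lemma inv_mulmx (R : realType) n (A B : 'M[R]_n) : A \in unitmx -> B \in unitmx ->
  invmx (A *m B) = invmx B *m invmx A.
Proof.
move=> uA uB; have uAB : A *m B \in unitmx by rewrite unitmx_mul uA.
apply: (can_inj (mulKmx uAB)); rewrite mulmxV // -mulmxA (mulmxA B) mulmxV //.
by rewrite mul1mx mulmxV.
Qed.

Lemma Pos_congr_sym (R : realType) n (C A : 'M[R]_n) : C^T = C -> C \in unitmx ->
  Pos A -> Pos (C *m A *m C).
Proof. by move=> sC uC pA; rewrite -[X in _ *m X]sC; exact: Pos_congr. Qed.

Lemma psd_congr_sym (R : realType) n (C A : 'M[R]_n) : C^T = C ->
  psd A -> psd (C *m A *m C).
Proof. by move=> sC pA; rewrite -[X in _ *m X]sC; exact: psd_congr. Qed.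

Lemma loewner_congr_sym (R : realType) n (C A B : 'M[R]_n) : C^T = C ->
  loewner A B -> loewner (C *m A *m C) (C *m B *m C).
Proof.
by move=> sC h; rewrite -[X in _ *m A *m X]sC -[X in _ *m B *m X]sC; exact: loewner_congr.
Qed.

(** * The geometric mean of two matrices *)

Section Sharp.
Variables (R : realType) (p : nat).
Implicit Types A B X : 'M[R]_p.

(** The Riccati equation X A^-1 X = B, whitened by A^(1/2), asks for a square root, and the positive
    one is unique. The algebraic properties of [sharp] are checked on this equation. *)
Lemma sharp_uniq A B X : Pos A -> Pos X -> X *m invmx A *m X = B -> sharp A B = X.
Proof.
move=> pA pX <-; rewrite /sharp; set C := sqrtmx A; have pC : Pos C by exact: sqrtmx_Pos.
have uC := Pos_unit pC.
have eA : invmx A = invmx C *m invmx C.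
  by rewrite -(sqrtmx_sqr (Pos_psd pA)) inv_mulmx.
rewrite eA (_ : invmx C *m _ *m invmx C =
  (invmx C *m X *m invmx C) *m (invmx C *m X *m invmx C)); last by rewrite !mulmxA.
rewrite sqrtmx_uniq; first by rewrite !mulmxA mulmxV // mul1mx -mulmxA mulVmx // mulmx1.
have sC : (invmx C)^T = invmx C by exact/Pos_sym/Pos_inv.
by apply/psd_congr_sym/Pos_psd.
Qed.

Lemma sharpP A B : Pos A -> Pos B ->
  Pos (sharp A B) /\ sharp A B *m invmx A *m sharp A B = B.
Proof.
move=> pA pB; set C := sqrtmx A; have pC : Pos C by exact: sqrtmx_Pos.
have uC := Pos_unit pC; have sC := Pos_sym pC.
have siC : (invmx C)^T = invmx C by exact/Pos_sym/Pos_inv.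
have pD : Pos (invmx C *m B *m invmx C).
  by apply: Pos_congr_sym; rewrite ?unitmx_inv.
rewrite /sharp -/C; split.
  by apply: Pos_congr_sym => //; exact: sqrtmx_Pos.
have -> : invmx A = invmx C *m invmx C by rewrite -(sqrtmx_sqr (Pos_psd pA)) inv_mulmx.
set D := sqrtmx _.
rewrite -!mulmxA (mulmxA C (invmx C)) mulmxV // mul1mx (mulmxA (invmx C) C).
rewrite mulVmx // mul1mx (mulmxA D D) sqrtmx_sqr; last exact: Pos_psd.
by rewrite !mulmxA mulmxV // mul1mx -mulmxA mulVmx // mulmx1.
Qed.

Lemma sharp_Pos A B : Pos A -> Pos B -> Pos (sharp A B).
Proof. by move=> pA pB; case: (sharpP pA pB). Qed.

Lemma sharpC A B : Pos A -> Pos B -> sharp A B = sharp B A.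
Proof.
move=> pA pB; have [pX eX] := sharpP pA pB; apply/esym; apply: sharp_uniq => //.
move: pX eX; move: (sharp A B) => X pX eX; have uX := Pos_unit pX; have uA := Pos_unit pA.
rewrite -eX !inv_mulmx ?unitmx_mul ?unitmx_inv ?uX ?uA //.
by rewrite invmxK !mulmxA mulmxV // mul1mx -mulmxA mulVmx // mulmx1.
Qed.

Lemma sharp_congr A B P : Pos A -> Pos B -> P \in unitmx ->
  sharp (P *m A *m P^T) (P *m B *m P^T) = P *m sharp A B *m P^T.
Proof.
move=> pA pB uP; have [pX eX] := sharpP pA pB.
apply: sharp_uniq; try exact: Pos_congr.
rewrite !inv_mulmx ?unitmx_mul ?unitmx_tr ?uP ?Pos_unit //.
rewrite -!mulmxA (mulmxA P^T (invmx _)) mulmxV ?unitmx_tr // mul1mx.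
rewrite (mulmxA (invmx P) P) mulVmx // mul1mx -{3}eX !mulmxA.
by [].
Qed.

Lemma sharp_inv A B : Pos A -> Pos B -> sharp (invmx A) (invmx B) = invmx (sharp A B).
Proof.
move=> pA pB; have [pX eX] := sharpP pA pB.
apply: sharp_uniq; [exact: Pos_inv|exact: Pos_inv|].
move: pX eX; move: (sharp A B) => X pX eX; have uX := Pos_unit pX; have uA := Pos_unit pA.
by rewrite -eX !inv_mulmx ?unitmx_mul ?unitmx_inv ?uX ?uA // ?mulmxA.
Qed.

Lemma sharp_hom A B a b : Pos A -> Pos B -> 0 < a -> 0 < b ->
  sharp (a *: A) (b *: B) = Num.sqrt (a * b) *: sharp A B.
Proof.
move=> pA pB a0 b0; have [pX eX] := sharpP pA pB.
have ab : 0 < a * b by rewrite mulr_gt0.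
apply: sharp_uniq; [exact: Pos_scale| |].
  by apply: Pos_scale => //; rewrite sqrtr_gt0.
set s := Num.sqrt _; have ss : s * s = a * b by rewrite -expr2 sqr_sqrtr // ltW.
have ei : invmx (a *: A) = a^-1 *: invmx A.
  by rewrite invmxZ // unitmxZ ?Pos_unit // unitfE gt_eqF.
rewrite ei -!(scalemxAr, scalemxAl) !scalerA eX.
congr (_ *: _); rewrite (_ : _ * _ = s * s / a); last by ring.
by rewrite ss; field; rewrite gt_eqF.
Qed.

Lemma sharp_mono_r A B B' : Pos A -> Pos B -> Pos B' -> loewner B B' ->
  loewner (sharp A B) (sharp A B').
Proof.
move=> pA pB pB' h; rewrite /sharp; set C := sqrtmx A.
have pC : Pos C by exact: sqrtmx_Pos.
have sC := Pos_sym pC; have siC : (invmx C)^T = invmx C by exact/Pos_sym/Pos_inv.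
apply: loewner_congr_sym => //.
have ui : invmx C \in unitmx by rewrite unitmx_inv Pos_unit.
by apply: loewner_sqrtmx; [exact: Pos_congr_sym|exact: Pos_congr_sym|exact: loewner_congr_sym].
Qed.

Lemma sharp_mono A A' B B' : Pos A -> Pos A' -> Pos B -> Pos B' ->
  loewner A A' -> loewner B B' -> loewner (sharp A B) (sharp A' B').
Proof.
move=> pA pA' pB pB' hA hB; apply: (loewner_trans (sharp_mono_r pA pB pB' hB)).
by rewrite !(sharpC _ pB') //; exact: sharp_mono_r.
Qed.

(** The indicator function of the nonpositive reals gives 0 on A when computed with P; hence the
    orthogonal diagonalization of A has positive entries only. *)
Lemma conj_diag_Pos A P (d : 'rV[R]_p) : A^T = A -> P \in unitmx ->
  (forall j, 0 < d 0 j) -> A = P *m diag_mx d *m invmx P -> Pos A.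
Proof.
move=> sA uP d0 eA; have [ O [e [oO eA' fA]]] := symfun_spec sA.
pose f (x : R) : R := if 0 < x then 0 else 1.
have f0 : symfun f A = 0.
  rewrite (symfun_conj f sA uP eA) (_ : map_mx f d = 0) ?linear0 ?mulmx0 ?mul0mx //.
  by apply/rowP => j; rewrite !mxE /f d0.
rewrite eA'; apply: orth_diag_Pos => // i.
have := dot_eigen (map_mx f e) i oO; rewrite -fA f0 mul0mx dot0r mxE /f.
by case: ifP => // _ /eqP; rewrite eq_sym oner_eq0.
Qed.

(** A and B commute, so A B is symmetric and positive, and its square root solves the Riccati
    equation. *)
Lemma sharp_diag A B P (d e : 'rV[R]_p) : Pos A -> Pos B -> P \in unitmx ->
  (forall j, 0 < d 0 j) -> (forall j, 0 < e 0 j) ->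
  A = P *m diag_mx d *m invmx P -> B = P *m diag_mx e *m invmx P ->
  sharp A B = P *m diag_mx (\row_j Num.sqrt (d 0 j * e 0 j)) *m invmx P.
Proof.
move=> pA pB uP d0 e0 eA eB.
have mulPV (x y : 'rV[R]_p) : (P *m diag_mx x *m invmx P) *m (P *m diag_mx y *m invmx P)
    = P *m diag_mx (\row_j (x 0 j * y 0 j)) *m invmx P.
  by rewrite -!mulmxA (mulmxA (invmx P) P) mulVmx // mul1mx (mulmxA (diag_mx x)) diag_mulE.
have eAB : A *m B = P *m diag_mx (\row_j (d 0 j * e 0 j)) *m invmx P.
  by rewrite eA eB mulPV.
have eBA : B *m A = A *m B.
  rewrite eAB {1}eA eB mulPV; congr (_ *m diag_mx _ *m _).
  by apply/rowP => j; rewrite !mxE mulrC.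
have sAB : (A *m B)^T = A *m B by rewrite trmx_mul !Pos_sym.
have pAB : Pos (A *m B).
  by apply: (conj_diag_Pos sAB uP _ eAB) => j; rewrite mxE mulr_gt0.
have eS : sqrtmx (A *m B) = P *m diag_mx (\row_j Num.sqrt (d 0 j * e 0 j)) *m invmx P.
  rewrite /sqrtmx (symfun_conj _ sAB uP eAB); congr (_ *m diag_mx _ *m _).
  by apply/rowP => j; rewrite !mxE.
rewrite -eS; apply: sharp_uniq => //; first exact: sqrtmx_Pos.
have eiA : invmx A = P *m diag_mx (\row_j (d 0 j)^-1) *m invmx P.
  apply: (can_inj (mulKmx (Pos_unit pA))); rewrite mulmxV ?Pos_unit // {1}eA mulPV.
  rewrite (_ : \row_j _ = const_mx 1); first by rewrite diag_const_mx mulmx1 mulmxV.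
  by apply/rowP => j; rewrite !mxE mulfV // gt_eqF.
rewrite eS eiA !mulPV eB; congr (_ *m diag_mx _ *m _); apply/rowP => j; rewrite !mxE.
have de : 0 <= d 0 j * e 0 j by rewrite mulr_ge0 // ltW.
by rewrite mulrAC -expr2 sqr_sqrtr //; field; rewrite gt_eqF.
Qed.

Lemma sharp_is_gm : is_gm (fun T : 'I_2 -> 'M[R]_p => sharp (T ord0) (T ord_max)).
Proof.
have gm2 (a : 'I_2 -> R) : (forall i, 0 < a i) -> gmv a = Num.sqrt (a ord0 * a ord_max).
  move=> a0; rewrite /gmv !big_ord_recl big_ord0 addr0.
  rewrite (_ : lift ord0 ord0 = ord_max); last exact: val_inj.
  rewrite -lnM ?posrE // -[RHS]lnK ?posrE ?sqrtr_gt0 ?mulr_gt0 //.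
  have ab : 0 < a ord0 * a ord_max by rewrite mulr_gt0.
  congr expR; rewrite -[in LHS](sqr_sqrtr (ltW ab)) expr2 lnM ?posrE ?sqrtr_gt0 //.
  by field.
split.
- by move=> T pT; exact: sharp_Pos.
- by move=> T T' pT pT' h; exact: sharp_mono.
- by move=> T a pT a0; rewrite sharp_hom // gm2.
- move=> T s pT; have s01 : s ord0 != s ord_max by rewrite (inj_eq perm_inj).
  have o2 (i : 'I_2) : i = ord0 \/ i = ord_max.
    by case: i => -[|[|//]] h; [left|right]; exact: val_inj.
  have [e0|e0] := o2 (s ord0); have [e1|e1] := o2 (s ord_max); rewrite e0 e1 in s01 *.
  + by rewrite eqxx in s01.
  + by [].
  + exact: sharpC.
  + by rewrite eqxx in s01.
- by move=> T P pT uP; exact: sharp_congr.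
- by move=> T pT; exact: sharp_inv.
- move=> T P d pT uP d0 eT; rewrite (sharp_diag _ _ uP (d0 ord0) (d0 ord_max)) //.
  by congr (_ *m diag_mx _ *m _); apply/rowP => j; rewrite !mxE gm2.
Qed.

End Sharp.

(** * Convergence of the iteration defining [alm] *)

Section GeomSeq.
Variable R : realType.

(** As 2 C 2^-r decreases by C 2^-r at each step, u r - 2 C 2^-r is nondecreasing; it is also
    bounded. *)
Lemma geom_cvg (u : nat -> R) C : 0 <= C ->
  (forall r, `|u r.+1 - u r| <= C * 2^-1 ^+ r) -> cvg (u @ \oo).
Proof.
move=> C0 h; pose w r := u r - 2 * C * 2^-1 ^+ r.
have h0 : (fun r => 2 * C * 2^-1 ^+ r) @ \oo --> 2 * C * 0.
  apply: cvgM; first exact: cvg_cst.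
  by apply: cvg_expr; rewrite ger0_norm ?invr_ge0 // invf_lt1 // ltr1n.
have hr r : u r <= u 0%N + 2 * C - 2 * C * 2^-1 ^+ r.
  elim: r => [|r IH]; first by rewrite expr0 mulr1 addrK.
  have := h r; rewrite exprS; move: IH; set q := 2^-1 ^+ r; set x := u r.
  by set y := u r.+1; rewrite ler_norml => IH /andP[_ h1]; lra.
have q0 r : 0 <= 2^-1 ^+ r :> R by rewrite exprn_ge0 // invr_ge0.
have cw : cvg (w @ \oo).
  apply: nondecreasing_is_cvgn.
    apply/nondecreasing_seqP => r; rewrite /w exprS; have := h r.
    by rewrite ler_norml => /andP[h1 _]; set q := 2^-1 ^+ r in h1 *; lra.
  exists (u 0%N + 2 * C) => _ [r _ <-]; rewrite /w; have := hr r; have := q0 r.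
  set q := 2^-1 ^+ r => qq h1; have : 0 <= C * q by rewrite mulr_ge0.
  by lra.
rewrite (_ : u = fun r => w r + 2 * C * 2^-1 ^+ r).
  by apply: is_cvgD => //; apply: cvgP h0.
by apply/funext => r; rewrite /w subrK.
Qed.

Lemma expR_sub1_le (x y : R) : 0 <= x -> x <= y -> expR x - 1 <= x * expR y.
Proof.
move=> x0 xy; have h := expR_ge1Dx (- x); have ap := expR_gt0 x.
have e : expR x * expR (- x) = 1 by rewrite expRxMexpNx_1.
apply: (@le_trans _ _ (x * expR x)); last by rewrite ler_wpM2l // ler_expR.
have : expR x * (1 - x) <= 1 by rewrite -[leRHS]e ler_pM2l.
by lra.
Qed.

End GeomSeq.

Section AlmStep.
Variables (R : realType) (p : nat).

(** A permutation of a tuple induces one of the tuple with an entry removed, to which [gm_perm] of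
    the smaller mean applies. *)
Lemma lift_perm_ex M (s : 'S_M.+1) i :
  exists t : 'S_M, forall j, s (lift i j) = lift (s i) (t j).
Proof.
pose f j := odflt j (unlift (s i) (s (lift i j))).
have fE j : s (lift i j) = lift (s i) (f j).
  rewrite /f; case: unliftP => //= /perm_inj/eqP.
  by rewrite eq_sym (negbTE (neq_lift _ _)).
have finj : injective f.
  by move=> j k e; apply: (@lift_inj _ i); apply: (@perm_inj _ s); rewrite !fE e.
by exists (perm finj) => j; rewrite permE.
Qed.

Variables (k : nat) (G : ('I_k.+2 -> 'M[R]_p) -> 'M[R]_p).
Hypothesis gG : is_gm G.

Definition alm_step (S : 'I_k.+3 -> 'M[R]_p) (i : 'I_k.+3) : 'M[R]_p :=
  G (fun j : 'I_k.+2 => S (lift i j)).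

Lemma step_pos S : (forall i, Pos (S i)) -> forall i, Pos (alm_step S i).
Proof. by move=> pS i; apply: (gm_pos gG). Qed.

Lemma iter_pos r S : (forall i, Pos (S i)) -> forall i, Pos (iter r alm_step S i).
Proof. by move=> pS; elim: r => //= r IH; exact: step_pos. Qed.

Lemma iter_bounds r S a b : 0 < a -> 0 < b -> (forall i, loewner a%:M (S i)) ->
  (forall i, loewner (S i) b%:M) -> forall i,
  loewner a%:M (iter r alm_step S i) /\ loewner (iter r alm_step S i) b%:M.
Proof.
move=> a0 b0 aS Sb; elim: r => [//|r IH] i /=.
by apply: gm_bounds => // j; case: (IH (lift i j)).
Qed.

Lemma th_refl (A : 'M[R]_p) c : Pos A -> 1 <= c -> th c A A.
Proof.
move=> pA c1; have : loewner A (c *: A).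
  rewrite /loewner -{2}[A]scale1r -scalerBl; apply: psd_scale; last exact: Pos_psd.
  by rewrite subr_ge0.
by split.
Qed.

(** Up to the transposition of i and j, the tuples without entry i and without entry j differ at one
    place only. The factor is e^x there and 1 elsewhere, with geometric mean e^(x / k.+2). *)
Lemma step_diam S x : 0 <= x -> (forall i, Pos (S i)) ->
  (forall i j, th (expR x) (S i) (S j)) ->
  forall i j, th (expR (x / k.+2%:R)) (alm_step S i) (alm_step S j).
Proof.
move=> x0 pS h i j; have x1 : 0 <= x / k.+2%:R by rewrite divr_ge0.
have [<-|ij] := eqVneq i j.
  by apply: th_refl; [exact: step_pos|rewrite -[leLHS]expR0 ler_expR].
have [t ht] := lift_perm_ex (tperm i j) i; rewrite tpermL in ht.
rewrite {2}/alm_step -(gm_perm gG t) //.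
have [l hl] : exists l, lift i l = j.
  by case: (unliftP i j) => [l ->|e]; [exists l|rewrite e eqxx in ij].
pose c (l' : 'I_k.+2) : R := if l' == l then expR x else 1.
have -> : expR (x / k.+2%:R) = gmv c.
  rewrite /gmv (bigD1 l) //= big1 ?addr0 /c ?eqxx ?expRK // => l' nl.
  by rewrite (negbTE nl) ln1.
apply: (gm_th gG) => //.
  by move=> l'; rewrite /c; case: ifP => // _; exact: expR_gt0.
move=> l'; rewrite -ht /c; case: eqP => [->|nl].
  by rewrite hl tpermR; exact: h.
rewrite tpermD ?neq_lift //; first exact: th_refl.
by apply/eqP; rewrite -hl => /lift_inj e; apply: nl.
Qed.

(** [S j] is the mean of a constant tuple, so [gm_th] compares it with a mean of the S i. This
    bounds the increments of the sequences. *)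
Lemma step_next S x : (forall i, Pos (S i)) ->
  (forall i j, th (expR x) (S i) (S j)) ->
  forall i j, th (expR x) (alm_step S i) (S j).
Proof.
move=> pS h i j; rewrite -(gm_cst _ gG (pS j)) //.
rewrite -(@gmv_cst R k.+2 (expR x)) ?expR_gt0 //.
by apply: (gm_th gG) => // *; exact: expR_gt0.
Qed.

Lemma iter_diam r S x : 0 <= x -> (forall i, Pos (S i)) ->
  (forall i j, th (expR x) (S i) (S j)) ->
  forall i j, th (expR (x / k.+2%:R ^+ r)) (iter r alm_step S i) (iter r alm_step S j).
Proof.
move=> x0 pS h; elim: r => [|r IH] i j /=; first by rewrite expr0 divr1.
rewrite exprSr invfM mulrA; apply: step_diam => //.
- by rewrite divr_ge0 // exprn_ge0.
- exact: iter_pos.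
Qed.

Theorem alm_step_cvg T : (forall i, Pos (T i)) ->
  exists L : 'M[R]_p, Pos L /\ forall i, (fun r => iter r alm_step T i) @ \oo --> L.
Proof.
move=> pT; have [a [b [a0 b0 aT Tb]]] := Pos_bounds_fam pT.
pose x := Num.max 0 (ln (b / a)); have x0 : 0 <= x by rewrite le_max lexx.
have ex : b / a <= expR x.
  by rewrite -[leLHS]lnK ?posrE ?divr_gt0 // ler_expR le_max lexx orbT.
have hT i j : th (expR x) (T i) (T j).
  have le U V : loewner U ((b / a) *: V) -> Pos V -> loewner U (expR x *: V).
    move=> h pV; apply: (loewner_trans h).
    rewrite /loewner -scalerBl; apply: psd_scale; last exact: Pos_psd.
    by rewrite subr_ge0.
  have [h1 h2] := th_bounds a0 (aT i) (aT j) (Tb i) (Tb j) (ltW b0).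
  by split; apply: le.
pose S r := iter r alm_step T.
have bd r i : loewner a%:M (S r i) /\ loewner (S r i) b%:M by exact: iter_bounds.
pose xr r := x / k.+2%:R ^+ r.
have xr0 r : 0 <= xr r by rewrite divr_ge0 // exprn_ge0.
(* From k.+2 >= 2; it gives the rate asked for by [geom_cvg]. *)
have xr2 r : xr r <= x * 2^-1 ^+ r.
  rewrite /xr -exprVn ler_wpM2l // lerXn2r ?nnegrE ?invr_ge0 //.
  by rewrite lef_pV2 ?posrE // ler_nat.
have xrx r : xr r <= x.
  apply: le_trans (xr2 r) _; rewrite ler_piMr // exprn_ile1 ?invr_ge0 //.
  by rewrite invf_le1 // ler1n.
have C0 : 0 <= x * expR x * b by rewrite !mulr_ge0 ?expR_ge0 // ltW.
have ent r (A B : 'M[R]_p) i j : th (expR (xr r)) A B -> loewner A b%:M -> loewner B b%:M ->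
    `|(A - B) i j| <= x * expR x * b * 2^-1 ^+ r.
  move=> h hA hB; have e1 : 1 <= expR (xr r) by rewrite -[leLHS]expR0 ler_expR.
  apply: le_trans (th_entry e1 h hA hB i j) _.
  rewrite [leRHS]mulrAC ler_wpM2r ?(ltW b0) //.
  apply: le_trans (expR_sub1_le (xr0 r) (xrx r)) _.
  by rewrite [leRHS]mulrAC ler_wpM2r ?expR_ge0.
have cv i : exists L : 'M[R]_p, (fun r => S r i) @ \oo --> L.
  exists (\matrix_(l, m) lim ((fun r => S r i l m) @ \oo)); apply/mx_cvgP => l m.
  rewrite mxE; suff : cvg ((fun r => S r i l m) @ \oo) by [].
  apply: (geom_cvg C0) => r.
  have := @ent r (S r.+1 i) (S r i) l m; rewrite !mxE; apply.
  - apply: step_next; first exact: iter_pos.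
    exact: iter_diam.
  - by case: (bd r.+1 i).
  - by case: (bd r i).
have [L hL] := cv ord0; exists L; split.
  apply: (@Pos_loewner _ _ a%:M); first exact: Pos_scalar.
  apply: (loewner_cvg _ hL (u := fun=> a%:M)); first exact: cvg_cst.
  by move=> r; case: (bd r ord0).
move=> i; have [L' hL'] := cv i; suff -> : L = L' by [].
apply/eqP; rewrite -subr_eq0; apply/eqP/matrixP => l m; rewrite [RHS]mxE.
have h1 : (fun r => (S r ord0 - S r i) l m) @ \oo --> (L - L') l m.
  have /mx_cvgP h3 := hL; have /mx_cvgP h4 := hL'.
  rewrite (_ : (fun r => _) = (fun r => S r ord0 l m - S r i l m)).
    by rewrite !mxE; exact: cvgB (h3 l m) (h4 l m).
  by apply/funext => r; rewrite !mxE.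
have h0 : (fun r => x * expR x * b * 2^-1 ^+ r) @ \oo --> x * expR x * b * 0.
  apply: cvgM; first exact: cvg_cst.
  by apply: cvg_expr; rewrite ger0_norm ?invr_ge0 // invf_lt1 // ltr1n.
rewrite mulr0 in h0.
apply: cvg_unique h1 _ => //.
apply: (@squeeze_cvgr _ _ _ _ (fun r => - (x * expR x * b * 2^-1 ^+ r))
  (fun r => x * expR x * b * 2^-1 ^+ r)) => //.
apply: nearW => r; rewrite -ler_norml; apply: ent.
- exact: iter_diam.
- by case: (bd r ord0).
- by case: (bd r i).
rewrite -[X in _ --> X]oppr0; exact: cvgN.
Qed.

(** For scalars the iteration replaces each logarithm by the mean of the others: the overall mean m
    is kept and deviations are multiplied by -1 / k.+2. This closed formula serves both homogeneity
    and the diagonal case. *)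
Definition alm_fac (x : 'I_k.+3 -> R) r i : R :=
  let m := (\sum_j x j) / k.+3%:R in m + (- k.+2%:R^-1) ^+ r * (x i - m).

Lemma alm_fac0 x i : alm_fac x 0 i = x i.
Proof. by rewrite /alm_fac expr0 mul1r addrC subrK. Qed.

Lemma alm_facS x r i :
  (\sum_j alm_fac x r (lift i j)) / k.+2%:R = alm_fac x r.+1 i.
Proof.
have -> : \sum_j alm_fac x r (lift i j) = \sum_j x j - alm_fac x r i.
  have h : \sum_j alm_fac x r j = alm_fac x r i + \sum_j alm_fac x r (lift i j).
    by rewrite (bigD1_ord i).
  apply/eqP; rewrite eq_sym subr_eq addrC -h //; apply/eqP.
  pose m := (\sum_j x j) / k.+3%:R; pose q := (- k.+2%:R^-1 : R) ^+ r.
  rewrite [RHS](eq_bigr (fun j => (1 - q) * m + q * x j)); last first.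
    by move=> j _; rewrite /alm_fac -/m -/q; ring.
  rewrite big_split /= sumr_const card_ord -mulr_sumr -[_ *+ k.+3]mulr_natr.
  by rewrite -mulrA /m divfK ?pnatr_eq0 // -mulrDl subrK mul1r.
rewrite /alm_fac exprS; set s := \sum_j _; set q := _ ^+ r.
have -> : s - (s / k.+3%:R + q * (x i - s / k.+3%:R)) =
    s / k.+3%:R * k.+2%:R - q * (x i - s / k.+3%:R).
  have n3 : k.+2%:R + 1 != 0 :> R by rewrite natr1 pnatr_eq0.
  by rewrite -[k.+3%:R]natr1; move: n3; set K := k.+2%:R => n3; field.
have n2 : k.+2%:R != 0 :> R by rewrite pnatr_eq0.
by move: n2; set K := k.+2%:R => n2; set m := s / _; field.
Qed.

Lemma alm_fac_cvg x i : (fun r => expR (alm_fac x r i)) @ \oo --> expR ((\sum_j x j) / k.+3%:R).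
Proof.
apply: (@cvg_comp _ _ _ (fun r => alm_fac x r i) (@expR R)); last exact: continuous_expR.
set m := _ / _; have h : (fun r => m + (- k.+2%:R^-1) ^+ r * (x i - m)) @ \oo -->
    m + 0 * (x i - m).
  apply: cvgD; first exact: cvg_cst.
  apply: cvgM; last exact: cvg_cst.
  by apply: cvg_expr; rewrite normrN ger0_norm ?invr_ge0 // invf_lt1 // ltr1n.
by rewrite mul0r addr0 in h.
Qed.

Lemma gmv_alm_fac x r i :
  gmv (fun j => expR (alm_fac x r (lift i j))) = expR (alm_fac x r.+1 i).
Proof.
rewrite /gmv -alm_facS (eq_bigr (fun j => alm_fac x r (lift i j))) // => j _.
exact: expRK.
Qed.

(** Each property holds along the iterates, by induction on r for all positions at once, and passes
    to the limit. *)
Lemma alm_lim_is_gm (F : ('I_k.+3 -> 'M[R]_p) -> 'M[R]_p) :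
  (forall T, (forall i, Pos (T i)) -> forall i, (fun r => iter r alm_step T i) @ \oo --> F T) ->
  is_gm F.
Proof.
move=> hF.
have pF T : (forall i, Pos (T i)) -> Pos (F T).
  move=> pT; have [L [pL hL]] := alm_step_cvg pT.
  by rewrite (mx_cvg_unique (hF T pT ord0) (hL ord0)).
split=> //.
- move=> T T' pT pT' h; apply: (loewner_cvg (hF T pT ord0) (hF T' pT' ord0)) => r.
  move: ord0; elim: r => [//|r IH] i /=; apply: (gm_mono gG) => // j; exact: iter_pos.
- move=> T a pT a0; pose x i := ln (a i).
  have e r i : iter r alm_step (fun i => a i *: T i) i =
      expR (alm_fac x r i) *: iter r alm_step T i.
    elim: r i => [|r IH] i /=; first by rewrite alm_fac0 lnK // posrE.
    rewrite -gmv_alm_fac {1}/alm_step (_ : (fun j => _) = fun j : 'I_k.+2 =>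
      expR (alm_fac x r (lift i j)) *: iter r alm_step T (lift i j)); last first.
      by apply/funext => j; exact: IH.
    rewrite (gm_hom gG) // => j; first exact: iter_pos.
    exact: expR_gt0.
  have pT' i : Pos (a i *: T i) by exact: Pos_scale.
  apply: mx_cvg_unique (hF _ pT' ord0) _.
  rewrite (_ : (fun r => _) =
    fun r => expR (alm_fac x r ord0) *: iter r alm_step T ord0); last first.
    by apply/funext => r; exact: e.
  by apply: cvgZ; [exact: alm_fac_cvg|exact: hF].
- move=> T s pT; have pT' i : Pos (T (s i)) by [].
  apply: mx_cvg_unique (hF _ pT' ord0) _.
  rewrite (_ : (fun r => _) = fun r => iter r alm_step T (s ord0)); first exact: hF.
  apply/funext => r; move: ord0; elim: r => [//|r IH] i /=.
  have [t ht] := lift_perm_ex s i.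
  rewrite /alm_step -[RHS](gm_perm gG t); last by move=> j; exact: iter_pos.
  by congr G; apply/funext => j; rewrite IH ht.
- move=> T P pT uP; have pT' i : Pos (P *m T i *m P^T) by exact: Pos_congr.
  apply: mx_cvg_unique (hF _ pT' ord0) _.
  rewrite (_ : (fun r => _) = fun r => P *m iter r alm_step T ord0 *m P^T).
    apply: cvg_mulmx; last exact: cvg_cst.
    by apply: cvg_mulmx; [exact: cvg_cst|exact: hF].
  apply/funext => r; move: ord0; elim: r => [//|r IH] i /=.
  rewrite /alm_step -(gm_congr gG) //; last by move=> j; exact: iter_pos.
  by congr G; apply/funext => j; exact: IH.
- move=> T pT; have pT' i : Pos (invmx (T i)) by exact: Pos_inv.
  have e r i : iter r alm_step (fun i => invmx (T i)) i = invmx (iter r alm_step T i).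
    elim: r i => [//|r IH] i /=; rewrite /alm_step -(gm_inv gG).
      by congr G; apply/funext => j; exact: IH.
    by move=> j; exact: iter_pos.
  (* The iterates of T and of its inverses have product 1 for each r, and so have their limits. *)
  have uF := Pos_unit (pF T pT); apply: (can_inj (mulKmx uF)); rewrite mulmxV //.
  apply: mx_cvg_unique (cvg_mulmx (hF T pT ord0) (hF _ pT' ord0)) _.
  rewrite (_ : (fun r => _) = fun=> 1%:M); first exact: cvg_cst.
  by apply/funext => r; rewrite e mulmxV //; apply/Pos_unit/iter_pos.
- move=> T P d pT uP d0 eT.
  pose x j i := ln (d i 0 j).
  have e r i : iter r alm_step T i =
      P *m diag_mx (\row_j expR (alm_fac (x j) r i)) *m invmx P.
    elim: r i => [|r IH] i /=.
      rewrite eT; congr (_ *m diag_mx _ *m _); apply/rowP => j.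
      by rewrite mxE alm_fac0 lnK // posrE.
    rewrite /alm_step (gm_diag gG (P := P)
      (d := fun l => \row_j expR (alm_fac (x j) r (lift i l)))) //.
    + congr (_ *m diag_mx _ *m _); apply/rowP => j; rewrite !mxE -gmv_alm_fac.
      by congr gmv; apply/funext => l; rewrite mxE.
    + by move=> l; exact: iter_pos.
    + by move=> l j; rewrite mxE expR_gt0.
  apply: mx_cvg_unique (hF _ pT ord0) _.
  rewrite (_ : (fun r => _) = fun r =>
      P *m diag_mx (\row_j expR (alm_fac (x j) r ord0)) *m invmx P); last first.
    by apply/funext => r; exact: e.
  apply: cvg_mulmx; last exact: cvg_cst.
  apply: cvg_mulmx; first exact: cvg_cst.
  apply/mx_cvgP => l m; rewrite !mxE.
  rewrite (_ : (fun r => _) = fun r => expR (alm_fac (x m) r ord0) *+ (l == m)).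
    have [<-|_] := eqVneq l m; last by rewrite !mulr0n; exact: cvg_cst.
    rewrite !mulr1n; exact: alm_fac_cvg.
  by apply/funext => r; rewrite !mxE; case: eqVneq => // ->.
Qed.

End AlmStep.

Theorem alm_is_gm (R : realType) (p N : nat) : (2 <= N)%N -> is_gm (@alm R p N).
Proof.
case: N => [|[|k]] // _; elim: k => [|k IH]; first exact: sharp_is_gm.
apply: (alm_lim_is_gm IH) => T pT i; rewrite /alm /=.
case: xgetP => [L _ hL|h]; first exact: hL.
by have [L [_ hL]] := alm_step_cvg IH pT; case: (h L).
Qed.

(** * The mean ls *)

Section LsAux.
Variable R : realType.

Lemma symfun_le (f g : R -> R) n (A : 'M[R]_n) m M : A^T = A ->
  loewner m%:M A -> loewner A M%:M ->
  (forall x, m <= x -> x <= M -> f x <= g x) -> loewner (symfun f A) (symfun g A).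
Proof.
move=> sA hm hM fg; have [ O [d [oO eA e]]] := symfun_spec sA.
rewrite /loewner !e -mulmxBl -mulmxBr -raddfB; apply: orth_diag_psd => // i.
rewrite !mxE subr_ge0; apply: fg.
  exact: (loewner_eigen i oO eA hm).
exact: (loewner_eigen_le i oO eA hM).
Qed.

Lemma symfun_sub (f g : R -> R) n (A : 'M[R]_n) : A^T = A ->
  symfun f A - symfun g A = symfun (fun x => f x - g x) A.
Proof.
move=> sA; rewrite -scaleN1r symfun_scale // symfun_add //.
by congr (symfun _ A); apply/funext => x; rewrite mulN1r.
Qed.

Lemma cvg_nrm m n (u : nat -> 'M[R]_(m, n)) (A : 'M[R]_(m, n)) :
  u @ \oo --> A -> (fun k => nrm (u k - A)) @ \oo --> (0 : R).
Proof.
move=> h; have h2 : (fun k => nrm2 (u k - A)) @ \oo --> (0 : R).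
  have h0 : (fun k => u k - A) @ \oo --> (0 : 'M[R]_(m, n)).
    by rewrite -(subrr A); apply: cvgB => //; exact: cvg_cst.
  have h3 : (fun k => \sum_i ((u k - A)^T *m (u k - A)) i i) @ \oo --> \sum_(i < n) (0 : R).
    have h4 : (fun k => (u k - A)^T *m (u k - A)) @ \oo --> (0 : 'M[R]_(m, n))^T *m 0.
      by apply: cvg_mulmx => //; exact: cvg_trmx.
    by apply: cvg_sumr => i _; have /mx_cvgP/(_ i i) := h4; rewrite mulmx0 mxE.
  by rewrite big1 in h3.
rewrite -(sqrtr0 R); apply: (@cvg_comp _ _ _ (fun k => nrm2 (u k - A)) (@Num.sqrt R)).
  exact: h2.
exact: sqrt_continuous.
Qed.

Lemma nrm_cvg m n (u : nat -> 'M[R]_(m, n)) (A : 'M[R]_(m, n)) (e : nat -> R) :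
  e @ \oo --> (0 : R) -> (forall k, nrm (u k - A) <= e k) -> u @ \oo --> A.
Proof.
move=> he h; apply/mx_cvgP => i j.
have h0 : (fun k => u k i j - A i j) @ \oo --> (0 : R).
  apply: (@squeeze_cvgr _ _ _ _ (fun k => - e k) e) => //.
    apply: nearW => k; rewrite -ler_norml; apply: le_trans (h k).
    by have := nrm_entry (u k - A) i j; rewrite !mxE.
  by rewrite -[X in _ --> X]oppr0; exact: cvgN.
rewrite (_ : (fun k => u k i j) = fun k => (u k i j - A i j) + A i j); last first.
  by apply/funext => k; rewrite subrK.
by rewrite -[X in _ --> X]add0r; apply: cvgD => //; exact: cvg_cst.
Qed.

Lemma cvg_summx N m n (u : 'I_N -> nat -> 'M[R]_(m, n)) (A : 'I_N -> 'M[R]_(m, n)) :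
  (forall i, u i @ \oo --> A i) -> (fun k => \sum_i u i k) @ \oo --> \sum_i A i.
Proof.
move=> h; apply/mx_cvgP => i j; rewrite summxE.
rewrite (_ : (fun k => _) = fun k => \sum_l u l k i j).
  by apply: cvg_sumr => l _; have /mx_cvgP := h l; exact.
by apply/funext => k; rewrite summxE.
Qed.

(** The Lipschitz bound is asked for above a only, since [ln] and the inverse square root have none
    near 0. *)
Lemma symfun_cvg (f : R -> R) n (u : nat -> 'M[R]_n) (A : 'M[R]_n) a L : 0 <= L ->
  u @ \oo --> A -> (forall k, Pos (u k)) -> Pos A ->
  (forall k, loewner a%:M (u k)) -> loewner a%:M A ->
  (forall x y, a <= x -> a <= y -> `|f x - f y| <= L * `|x - y|) ->
  (fun k => symfun f (u k)) @ \oo --> symfun f A.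
Proof.
move=> L0 hu pu pA au aA hf; apply: (@nrm_cvg _ _ _ _ (fun k => L * nrm (u k - A))).
  rewrite -[X in _ --> X](mulr0 L); apply: cvgM; [exact: cvg_cst|exact: cvg_nrm].
move=> k; rewrite -(@ler_pXn2r _ 2) ?nnegrE ?nrm_ge0 ?mulr_ge0 ?nrm_ge0 //.
by rewrite exprMn !sqr_nrm; apply: (symfun_lip _ _ (au k) aA hf); exact: Pos_sym.
Qed.

(** The form at x is the trace inner product of D with x x^T, whose norm is |x|^2. *)
Lemma dot_nrm_le n (D : 'M[R]_n) x : dot x (D *m x) <= nrm D * dot x x.
Proof.
have -> : dot x (D *m x) = mdot (x *m x^T) D.
  rewrite /dot /mdot trmx_mul trmxK -mulmxA mxtrace_mulC /mxtrace big_ord1.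
  by rewrite -mulmxA.
apply: le_trans (ler_norm _) _; apply: le_trans (mdot_le _ _) _.
rewrite mulrC ler_wpM2l ?nrm_ge0 // le_eqVlt; apply/orP; left; apply/eqP.
rewrite /nrm (_ : nrm2 _ = dot x x ^+ 2) ?sqrtr_sqr ?ger0_norm ?dot_ge0 //.
rewrite /nrm2 /mdot trmx_mul trmxK -mulmxA mxtrace_mulC /mxtrace big_ord1.
rewrite (mulmxA x^T x) (_ : x^T *m x = (dot x x)%:M); last first.
  by apply/matrixP=> i j; rewrite !ord1 [RHS]mxE eqxx mulr1n.
by rewrite mul_scalar_mx -scalemxAl mxE -/(dot x x) expr2.
Qed.

Lemma distPos_ge0 n (A B : 'M[R]_n) : 0 <= distPos A B.
Proof. exact: sqrtr_ge0. Qed.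

Lemma distPos_congr n (A B P : 'M[R]_n) : Pos A -> Pos B -> P \in unitmx ->
  distPos (P *m A *m P^T) (P *m B *m P^T) = distPos A B.
Proof.
move=> pA pB uP; have [Q [e [uQ eA eB e0]]] := Pos_codiag pA pB.
apply/eqP; rewrite -(@eqrXn2 _ 2) ?distPos_ge0 //; apply/eqP.
rewrite (distPos_diag pA uQ eA eB).
apply: (@distPos_diag _ _ _ _ (P *m Q)).
- exact: Pos_congr.
- by rewrite unitmx_mul uP.
- by rewrite eA trmx_mul !mulmxA.
- by rewrite eB trmx_mul !mulmxA.
Qed.

Lemma distPos_inv n (A B : 'M[R]_n) : Pos A -> Pos B ->
  distPos (invmx A) (invmx B) = distPos A B.
Proof.
move=> pA pB; have [Q [e [uQ eA eB e0]]] := Pos_codiag pA pB.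
apply/eqP; rewrite -(@eqrXn2 _ 2) ?distPos_ge0 //; apply/eqP.
have iQ : invmx Q^T = (invmx Q)^T by rewrite trmx_inv.
rewrite (distPos_diag pA uQ eA eB) (@distPos_diag _ _ _ _ (invmx Q^T) (\row_i (e 0 i)^-1)).
- by apply: eq_bigr => i _; rewrite mxE lnV ?posrE // sqrrN.
- exact: Pos_inv.
- by rewrite unitmx_inv unitmx_tr.
- by rewrite eA inv_mulmx ?unitmx_tr // iQ trmxK.
- have ud : diag_mx e \in unitmx.
    by rewrite unitmxE det_diag unitfE; apply/prodf_neq0 => i _; rewrite gt_eqF.
  rewrite eB !inv_mulmx ?unitmx_mul ?unitmx_tr ?uQ // iQ trmxK mulmxA.
  congr (_ *m _ *m _); apply: (can_inj (mulKmx ud)); rewrite mulmxV // diag_mulE.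
  rewrite (_ : \row_i _ = const_mx 1) ?diag_const_mx //.
  by apply/rowP => i; rewrite !mxE mulfV // gt_eqF.
Qed.

End LsAux.

(** * The Karcher equation and power means *)

Section Ls.
Variables (R : realType) (p : nat).
Implicit Types A B X Y Z : 'M[R]_p.

Definition whiten X A : 'M[R]_p := invmx (sqrtmx X) *m A *m invmx (sqrtmx X).

Lemma whiten_Pos X A : Pos X -> Pos A -> Pos (whiten X A).
Proof.
move=> pX pA; apply: Pos_congr_sym => //; first exact/Pos_sym/Pos_inv/sqrtmx_Pos.
by rewrite unitmx_inv Pos_unit //; exact: sqrtmx_Pos.
Qed.

Lemma whitenK X A : Pos X -> sqrtmx X *m whiten X A *m sqrtmx X = A.
Proof.
move=> pX; have uC := Pos_unit (sqrtmx_Pos pX).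
by rewrite /whiten !mulmxA mulmxV // mul1mx -mulmxA mulVmx // mulmx1.
Qed.

Lemma whiten_congr X Y : Pos X -> whiten X (sqrtmx X *m Y *m sqrtmx X) = Y.
Proof.
move=> pX; have uC := Pos_unit (sqrtmx_Pos pX).
by rewrite /whiten !mulmxA mulVmx // mul1mx -mulmxA mulmxV // mulmx1.
Qed.

Lemma whiten_le X A B : Pos X -> loewner A B -> loewner (whiten X A) (whiten X B).
Proof. by move=> pX; apply: loewner_congr_sym; exact/Pos_sym/Pos_inv/sqrtmx_Pos. Qed.

Lemma whiten_id X : Pos X -> whiten X X = 1%:M.
Proof.
move=> pX; have uC := Pos_unit (sqrtmx_Pos pX).
rewrite /whiten -{2}(sqrtmx_sqr (Pos_psd pX)) !mulmxA mulVmx // mul1mx.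
by rewrite mulmxV.
Qed.

Definition karcher_eq N (T : 'I_N -> 'M[R]_p) X :=
  Pos X /\ \sum_i symfun (@ln R) (whiten X (T i)) = 0.

(** Whitening moves X to 1. There log preserves distances to 1 and does not increase the others, so
    the sum at Y is at least sum |l - L_i|^2, where l is the logarithm of the whitened Y. As the L_i
    add up to 0, this is N |l|^2 + sum |L_i|^2. *)
Lemma karcher_eq_min N (T : 'I_N -> 'M[R]_p) X : (0 < N)%N -> (forall i, Pos (T i)) ->
  karcher_eq T X ->
  unique_minimizer (@Pos R p) (fun X => \sum_(i < N) distPos X (T i) ^+ 2) X.
Proof.
move=> N0 pT [pX eX]; split=> // Y pY YX.
set L := fun i => symfun (@ln R) (whiten X (T i)) in eX *.
have dX i : distPos X (T i) ^+ 2 = nrm2 (L i) by rewrite /distPos sqr_nrm.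
rewrite (eq_bigr _ (fun i _ => dX i)).
set Z := whiten X Y; have pZ : Pos Z by exact: whiten_Pos.
pose l := symfun (@ln R) Z.
have uC := Pos_unit (sqrtmx_Pos pX).
have siC : (invmx (sqrtmx X))^T = invmx (sqrtmx X) by exact/Pos_sym/Pos_inv/sqrtmx_Pos.
have dY i : nrm2 (l - L i) <= distPos Y (T i) ^+ 2.
  rewrite -(distPos_congr pY (pT i) (P := invmx (sqrtmx X))) ?unitmx_inv // siC.
  apply: exponential_metric_increasing; exact: whiten_Pos.
apply: lt_le_trans (ler_sum _ (fun i _ => dY i)).
have -> : \sum_i nrm2 (l - L i) = N%:R * nrm2 l + \sum_i nrm2 (L i).
  rewrite (eq_bigr (fun i => nrm2 l - 2 * mdot l (L i) + nrm2 (L i))); last first.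
    by move=> i _; rewrite nrm2B mulr_natl.
  rewrite big_split /= big_split /= sumr_const card_ord mulr_natl.
  by rewrite sumrN -mulr_sumr -mdot_sumr eX mdot0r mulr0 subr0.
rewrite ltrDr mulr_gt0 ?ltr0n // lt_def nrm2_ge0 andbT.
apply/eqP => /nrm2_eq0 l0; apply: YX.
(* Z is recovered as the exponential of its logarithm 0. *)
have Z1 : Z = 1%:M.
  have sl : l^T = l by exact/symfun_sym/Pos_sym.
  rewrite -[LHS](symfun_id (Pos_sym pZ)) -(symfun_cst 1 (Pos_sym pZ)).
  rewrite (@symfun_eq_pos _ id (@expR R \o @ln R)) //; last by move=> x x0; rewrite /= lnK.
  rewrite -symfun_comp ?Pos_sym // -/l l0.
  have z0 : (0 : 'M[R]_p)^T = 0 by rewrite trmx0.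
  rewrite (symfun_cst _ (Pos_sym pZ)) -(symfun_cst 1 z0).
  rewrite -{1}(scale0r (0 : 'M[R]_p)) symfun_scaler //.
  apply: (f_equal (fun f => symfun f 0)); apply/funext => x.
  by rewrite mul0r expR0.
rewrite -(whitenK Y pX) -/Z Z1 mulmx1 sqrtmx_sqr //; exact: Pos_psd.
Qed.

Lemma ls_karcher N (T : 'I_N -> 'M[R]_p) X : (0 < N)%N -> (forall i, Pos (T i)) ->
  karcher_eq T X -> ls T = X.
Proof.
move=> N0 pT /(karcher_eq_min N0 pT)[pX hX]; rewrite /ls.
case: xgetP => [Y _ [pY hY]|h]; last by case: (h X).
have [//|/eqP YX] := eqVneq Y X.
have h1 := hX Y pY YX; have h2 := hY X pX (not_eq_sym YX).
by have := lt_trans h1 h2; rewrite ltxx.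
Qed.

(* The point with parameter 2^-k on the geodesic from X to A. *)
Definition geo k X A := iter k (sharp X) A.

Lemma geo_Pos k X A : Pos X -> Pos A -> Pos (geo k X A).
Proof. by move=> pX pA; elim: k => //= k IH; exact: sharp_Pos. Qed.

Lemma geo_mono k X X' A A' : Pos X -> Pos X' -> Pos A -> Pos A' ->
  loewner X X' -> loewner A A' -> loewner (geo k X A) (geo k X' A').
Proof.
move=> pX pX' pA pA' hX hA; elim: k => //= k IH.
by apply: sharp_mono => //; exact: geo_Pos.
Qed.

Lemma sharpE X A : sharp X A = sqrtmx X *m sqrtmx (whiten X A) *m sqrtmx X.
Proof. by []. Qed.

Lemma sharp_whiten X W : Pos X ->
  sharp X (sqrtmx X *m W *m sqrtmx X) = sqrtmx X *m sqrtmx W *m sqrtmx X.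
Proof. by move=> pX; rewrite sharpE whiten_congr. Qed.

Lemma sharp_id X : Pos X -> sharp X X = X.
Proof. by move=> pX; apply: sharp_uniq; rewrite // mulmxV ?mul1mx // Pos_unit. Qed.

Lemma geo_id k X : Pos X -> geo k X X = X.
Proof. by move=> pX; elim: k => //= k ->; exact: sharp_id. Qed.

Lemma geo_hom k X A c : Pos X -> Pos A -> 0 < c ->
  geo k (c *: X) (c *: A) = c *: geo k X A.
Proof.
move=> pX pA c0; elim: k => //= k ->; rewrite sharp_hom //; last exact: geo_Pos.
by rewrite -expr2 sqrtr_sqr ger0_norm // ltW.
Qed.

Definition root k : R -> R := iter k Num.sqrt.

Lemma rootE k x : 0 < x -> root k x = expR (ln x / 2 ^+ k).
Proof.
move=> x0; elim: k => [|k IH]; first by rewrite expr0 divr1 lnK.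
rewrite /root iterS -/(root k x) IH exprS invfM mulrCA.
set y := ln x / _; rewrite (_ : y = 2^-1 * y + 2^-1 * y); last by field.
by rewrite expRD -expr2 sqrtr_sqr ger0_norm ?expR_ge0 //; congr expR; field.
Qed.

(** After whitening X stands for 1 and all steps are functions of one matrix, so k of them take its
    root of order 2^k. *)
Lemma geoE k X A : Pos X -> Pos A ->
  geo k X A = sqrtmx X *m symfun (root k) (whiten X A) *m sqrtmx X.
Proof.
move=> pX pA; have pW := whiten_Pos pX pA; elim: k => [|k IH].
  rewrite /root /= (_ : symfun _ _ = whiten X A) ?whitenK //.
  by rewrite -[RHS](symfun_id (Pos_sym pW)).
have -> : geo k.+1 X A = sharp X (geo k X A) by [].
rewrite IH (sharp_whiten _ pX) [sqrtmx (symfun _ _)]symfun_comp; last exact: Pos_sym.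
have -> : root k.+1 = Num.sqrt \o root k by [].
reflexivity.
Qed.

(** Whitened by X, this is sqrt x <= (1 + x) / 2 on the spectrum. *)
Lemma sharp_le_avg X Y : Pos X -> Pos Y -> loewner (sharp X Y) (2^-1 *: (X + Y)).
Proof.
move=> pX pY; have pW := whiten_Pos pX pY; have sW := Pos_sym pW.
have -> : 2^-1 *: (X + Y) =
    sqrtmx X *m symfun (fun x => 2^-1 * (1 + x)) (whiten X Y) *m sqrtmx X.
  rewrite -symfun_scale // -symfun_add // symfun_cst // symfun_id //.
  rewrite -scalemxAr -scalemxAl mulmxDr mulmxDl whitenK // mulmx1 sqrtmx_sqr //.
  exact: Pos_psd.
rewrite sharpE; apply: loewner_congr_sym.
  exact/Pos_sym/sqrtmx_Pos.
have [a [b [a0 _ ha hb]]] := Pos_bounds pW.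
apply: (symfun_le sW ha hb) => x ax _; have x0 : 0 <= x by exact/ltW/(lt_le_trans a0).
have := sqr_ge0 (Num.sqrt x - 1); have := sqr_sqrtr x0.
by set s := Num.sqrt x; nra.
Qed.

Section Power.
Variables (N : nat) (N0 : (0 < N)%N).
Implicit Types T : 'I_N -> 'M[R]_p.

(** The power mean with parameter 2^-k is a fixed point of this map. Dyadic parameters are reached
    by iterating [sharp], whose monotonicity is inherited. *)
Definition pstep k T X : 'M[R]_p := N%:R^-1 *: \sum_(i < N) geo k X (T i).

Let Ni0 : 0 < N%:R^-1 :> R. Proof. by rewrite invr_gt0 ltr0n. Qed.

Lemma avg_cst A : N%:R^-1 *: \sum_(i < N) A = A.
Proof.
rewrite sumr_const card_ord -[A *+ N]scaler_nat scalerA mulVf ?scale1r //.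
by rewrite pnatr_eq0 -lt0n.
Qed.

Lemma pstep_mono k T T' X X' : (forall i, Pos (T i)) -> (forall i, Pos (T' i)) ->
  Pos X -> Pos X' -> (forall i, loewner (T i) (T' i)) -> loewner X X' ->
  loewner (pstep k T X) (pstep k T' X').
Proof.
move=> pT pT' pX pX' hT hX; apply: loewner_scale; first exact: ltW.
by apply: loewner_sum => i; exact: geo_mono.
Qed.

Lemma pstep_cst k X : Pos X -> pstep k (fun=> X) X = X.
Proof. by move=> pX; rewrite /pstep geo_id // avg_cst. Qed.

Lemma pstep_hom k T X c : (forall i, Pos (T i)) -> Pos X -> 0 < c ->
  pstep k (fun i => c *: T i) (c *: X) = c *: pstep k T X.
Proof.
move=> pT pX c0; rewrite /pstep (eq_bigr (fun i => c *: geo k X (T i))).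
  by rewrite -scaler_sumr !scalerA mulrC.
by move=> i _; rewrite geo_hom.
Qed.

Variables (a b : R).
Hypotheses (a0 : 0 < a) (b0 : 0 < b).
Definition bounded T := forall i, loewner a%:M (T i) /\ loewner (T i) b%:M.

Lemma bounded_Pos T : bounded T -> forall i, Pos (T i).
Proof.
by move=> bT i; have [h _] := bT i; apply: Pos_loewner h; exact: Pos_scalar.
Qed.

Lemma pstep_bounds k T X : bounded T -> loewner a%:M X -> loewner X b%:M ->
  loewner a%:M (pstep k T X) /\ loewner (pstep k T X) b%:M.
Proof.
move=> bT aX Xb; have pa := Pos_scalar p a0; have pb := Pos_scalar p b0.
have pT := bounded_Pos bT; have pX := Pos_loewner pa aX.
split.
  rewrite -{1}(pstep_cst k pa); apply: pstep_mono => // i.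
  by case: (bT i).
rewrite -(pstep_cst k pb); apply: pstep_mono => // i.
by case: (bT i).
Qed.

Hypothesis ab : loewner (a%:M : 'M[R]_p) b%:M.

(* Increases with r to the power mean of T with parameter 2^-k. *)
Definition piter k T r := iter r (pstep k T) a%:M.

Lemma piter_bounds k T r : bounded T ->
  loewner a%:M (piter k T r) /\ loewner (piter k T r) b%:M.
Proof.
move=> bT; elim: r => [|r [h1 h2]] /=; last exact: pstep_bounds.
by split => //; exact: loewner_refl.
Qed.

Lemma piter_Pos k T r : bounded T -> Pos (piter k T r).
Proof.
move=> bT; have [h _] := piter_bounds k r bT.
by apply: Pos_loewner h; exact: Pos_scalar.
Qed.

Lemma piter_mono k T T' r : bounded T -> bounded T' ->
  (forall i, loewner (T i) (T' i)) -> loewner (piter k T r) (piter k T' r).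
Proof.
move=> bT bT' hT; elim: r => [|r IH] /=; first exact: loewner_refl.
by apply: pstep_mono => //; try (exact: bounded_Pos); exact: piter_Pos.
Qed.

Lemma piter_inc k T r : bounded T -> loewner (piter k T r) (piter k T r.+1).
Proof.
move=> bT; elim: r => [|r IH].
  by have [] := piter_bounds k 1 bT.
rewrite [in X in loewner X _]/piter [in X in loewner _ X]/piter !iterS.
apply: pstep_mono => //; try (exact: bounded_Pos).
- exact: (piter_Pos k r bT).
- exact: (piter_Pos k r.+1 bT).
- by move=> i; exact: loewner_refl.
Qed.

Lemma mono_le_lim n (u : nat -> 'M[R]_n) (A : 'M[R]_n) :
  (forall k, loewner (u k) (u k.+1)) -> u @ \oo --> A -> forall k, loewner (u k) A.
Proof.
move=> um hu k.
have h s : loewner (u k) (u (s + k)%N).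
  by elim: s => [|s IH]; [exact: loewner_refl|exact: loewner_trans IH (um _)].
apply: (loewner_cvg (u := fun=> u k) (v := fun s => u (s + k)%N)) => //.
  exact: cvg_cst.
by rewrite cvg_shiftn.
Qed.

Lemma piter_cvg k T : bounded T -> exists Z, (fun r => piter k T r) @ \oo --> Z.
Proof.
move=> bT; apply: (@mono_cvg _ _ _ b%:M).
- by move=> r; exact/Pos_sym/piter_Pos.
- by move=> r; exact: piter_inc.
- by move=> r; case: (piter_bounds k r bT).
Qed.

Lemma lim_bounds k T Z : bounded T -> (fun r => piter k T r) @ \oo --> Z ->
  loewner a%:M Z /\ loewner Z b%:M.
Proof.
move=> bT hZ; split.
  apply: (loewner_cvg (u := fun=> a%:M) _ hZ); first exact: cvg_cst.
  by move=> r; case: (piter_bounds k r bT).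
apply: (loewner_cvg hZ (v := fun=> b%:M)); first exact: cvg_cst.
by move=> r; case: (piter_bounds k r bT).
Qed.

(** One inequality is monotonicity. For the other, joint homogeneity takes the place of continuity:
    Z <= c_r piter_r with c_r tending to 1, and T_i <= c_r T_i, so pstep Z <= c_r piter_(r+1). *)
Lemma piter_fix k T Z : bounded T -> (fun r => piter k T r) @ \oo --> Z ->
  pstep k T Z = Z.
Proof.
move=> bT hZ; have [aZ Zb] := lim_bounds bT hZ.
have pZ : Pos Z by apply: Pos_loewner aZ; exact: Pos_scalar.
have pT := bounded_Pos bT.
have hS : (fun r => piter k T r.+1) @ \oo --> Z by rewrite cvg_shiftS.
apply: loewner_anti; last first.
  apply: (loewner_cvg hS (v := fun=> pstep k T Z)); first exact: cvg_cst.
  move=> r; apply: pstep_mono => //; first exact: piter_Pos.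
    by move=> i; exact: loewner_refl.
  by apply: (mono_le_lim _ hZ) => s; exact: piter_inc.
(* Since a <= piter_r, a difference of norm v is at most (v / a) piter_r. *)
pose c r := 1 + nrm (piter k T r - Z) / a.
have c1 r : 1 <= c r by rewrite lerDl divr_ge0 ?nrm_ge0 // ltW.
have c0 r : 0 < c r by apply: lt_le_trans (c1 r).
have hc : (fun r => c r *: piter k T r.+1) @ \oo --> 1 *: Z.
  apply: cvgZ => //; rewrite -[X in _ --> X]addr0; apply: cvgD; first exact: cvg_cst.
  by rewrite -(mul0r a^-1); apply: cvgM; [exact: cvg_nrm|exact: cvg_cst].
rewrite scale1r in hc.
apply: (loewner_cvg _ hc (u := fun=> pstep k T Z)); first exact: cvg_cst.
move=> r; have pr := piter_Pos k r bT.
rewrite [piter k T r.+1]iterS -pstep_hom //; apply: pstep_mono => //.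
- by move=> i; exact: Pos_scale.
- exact: Pos_scale.
- move=> i; rewrite /loewner -{2}[T i]scale1r -scalerBl; apply: psd_scale; last exact: Pos_psd.
  by rewrite subr_ge0.
apply: loewner_sym; [exact: Pos_sym|by rewrite linearZ /= Pos_sym|move=> x].
have [har _] := piter_bounds k r bT; have := loewner_dot x har.
rewrite mul_scalar_mx dotZr -scalemxAl dotZr -/(piter k T r) => h1.
have h2 := dot_nrm_le (Z - piter k T r) x.
rewrite mulmxBl dotBr in h2; have h3 : nrm (Z - piter k T r) = nrm (piter k T r - Z).
  by rewrite -nrmN opprB.
rewrite h3 in h2; rewrite /c mulrDl mul1r -lerBlDl; apply: le_trans h2 _.
rewrite -mulrA ler_wpM2l ?nrm_ge0 // mulrC ler_pdivlMr // mulrC //.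
Qed.

(** By [sharp_le_avg] one halving more gives at most the average of Z and the previous point, so the
    step with k.+1 maps Z below itself, and the iteration started at a stays below Z. *)
Lemma pmean_dec k T Z Z' : bounded T -> (fun r => piter k T r) @ \oo --> Z ->
  (fun r => piter k.+1 T r) @ \oo --> Z' -> loewner Z' Z.
Proof.
move=> bT hZ hZ'; have [aZ Zb] := lim_bounds bT hZ.
have pZ : Pos Z by apply: Pos_loewner aZ; exact: Pos_scalar.
have pT := bounded_Pos bT; have fZ := piter_fix bT hZ.
have step : loewner (pstep k.+1 T Z) Z.
  apply: (@loewner_trans _ _ (N%:R^-1 *: \sum_(i < N) (2^-1 *: (Z + geo k Z (T i))))).
    apply: loewner_scale; first exact: ltW.
    by apply: loewner_sum => i; apply: sharp_le_avg => //; exact: geo_Pos.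
  rewrite -scaler_sumr big_split /= scalerA mulrC -scalerA scalerDr.
  rewrite -/(pstep k T Z) fZ avg_cst -mulr2n -[Z *+ 2]scaler_nat scalerA.
  by rewrite mulVf ?pnatr_eq0 // scale1r; exact: loewner_refl.
apply: (loewner_cvg hZ' (v := fun=> Z)); first exact: cvg_cst.
elim=> [//|r IH]; apply: (loewner_trans _ step).
rewrite /piter iterS; apply: pstep_mono => //; first exact: piter_Pos.
by move=> i; exact: loewner_refl.
Qed.

End Power.

(** With u = ln x / 2^k the middle term is 2^k (e^u - 1 - u), which lies between 0 and 2^k u^2
    e^|u|; the square contributes 4^-k. *)
Lemma root_ln k x l : 0 < x -> `|ln x| <= l ->
  0 <= 2 ^+ k * (root k x - 1) - ln x <= l ^+ 2 * expR l * 2^-1 ^+ k.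
Proof.
move=> x0 hl; rewrite rootE //; set y := ln x in hl *; have q0 : 0 < 2 ^+ k :> R by rewrite exprn_gt0.
set u := y / 2 ^+ k; have yu : y = 2 ^+ k * u by rewrite /u mulrC divfK ?gt_eqF.
have l0 : 0 <= l by apply: le_trans hl.
rewrite yu -mulrBr; apply/andP; split.
  by rewrite mulr_ge0 ?(ltW q0) // subr_ge0; have := expR_ge1Dx u; lra.
have ul : `|u| <= l * 2^-1 ^+ k.
  by rewrite /u normrM exprVn [`|(_ ^+ _)^-1|]ger0_norm ?invr_ge0 ?(ltW q0) // ler_wpM2r // invr_ge0 ltW.
have ul' : `|u| <= l.
  apply: le_trans ul _; rewrite ler_piMr // exprn_ile1 ?invr_ge0 //.
  by rewrite invf_le1 // ler1n.
have h1 : expR u - 1 - u <= u ^+ 2 * expR `|u|.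
  by apply: le_trans (cosh_le u); have := expR_ge1Dx (- u); lra.
apply: (@le_trans _ _ (2 ^+ k * (u ^+ 2 * expR l))).
  rewrite ler_pM2l //; apply: le_trans h1 _.
  by rewrite ler_wpM2l ?sqr_ge0 // ler_expR.
have h2 : u ^+ 2 <= (l * 2^-1 ^+ k) ^+ 2.
  by rewrite -[u ^+ 2]real_normK ?num_real // lerXn2r ?nnegrE ?mulr_ge0 ?exprn_ge0 ?invr_ge0.
apply: (@le_trans _ _ (2 ^+ k * ((l * 2^-1 ^+ k) ^+ 2 * expR l))).
  by rewrite ler_pM2l // ler_wpM2r ?expR_ge0.
rewrite exprVn le_eqVlt; apply/orP; left; apply/eqP.
by field; rewrite gt_eqF.
Qed.

Lemma invsqrt_lip (a x y : R) : 0 < a -> a <= x -> a <= y ->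
  `|(Num.sqrt x)^-1 - (Num.sqrt y)^-1| <= (Num.sqrt a)^-1 ^+ 3 * `|x - y|.
Proof.
move=> a0 ax ay; have x0 : 0 < x by exact: lt_le_trans ax.
have y0 : 0 < y by exact: lt_le_trans ay.
have sx : 0 < Num.sqrt x by rewrite sqrtr_gt0.
have sy : 0 < Num.sqrt y by rewrite sqrtr_gt0.
have sa : 0 < Num.sqrt a by rewrite sqrtr_gt0.
have -> : (Num.sqrt x)^-1 - (Num.sqrt y)^-1 =
    - ((Num.sqrt x)^-1 * (Num.sqrt y)^-1 * (Num.sqrt x - Num.sqrt y)).
  by field; rewrite !gt_eqF.
rewrite normrN normrM exprSr -mulrA.
apply: ler_pM => //; last exact: sqrt_lip.
rewrite ger0_norm ?mulr_ge0 ?invr_ge0 ?(ltW sx) ?(ltW sy) // expr2.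
by apply: ler_pM; rewrite ?invr_ge0 ?(ltW sx) ?(ltW sy) // lef_pV2 ?posrE // ler_wsqrtr.
Qed.

Lemma whiten_cvg (u : nat -> 'M[R]_p) X A a : 0 < a -> (forall k, Pos (u k)) -> Pos X ->
  (forall k, loewner a%:M (u k)) -> loewner a%:M X -> u @ \oo --> X ->
  (fun k => whiten (u k) A) @ \oo --> whiten X A.
Proof.
move=> a0 pu pX au aX hu.
have e Y : Pos Y -> invmx (sqrtmx Y) = symfun (fun x => (Num.sqrt x)^-1) Y.
  move=> pY; rewrite -symfun_inv; last exact: sqrtmx_Pos.
  by rewrite /sqrtmx symfun_comp ?Pos_sym.
have h : (fun k => invmx (sqrtmx (u k))) @ \oo --> invmx (sqrtmx X).
  rewrite e // (_ : (fun k => _) = fun k => symfun (fun x => (Num.sqrt x)^-1) (u k)).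
    apply: (@symfun_cvg _ _ _ _ _ a ((Num.sqrt a)^-1 ^+ 3)) => //.
    by move=> x y; exact: invsqrt_lip.
  by apply/funext => k; rewrite e.
apply: cvg_mulmx => //; apply: cvg_mulmx => //; exact: cvg_cst.
Qed.

Lemma sum_scalar N (c : R) : \sum_(i < N) (c%:M : 'M[R]_p) = (N%:R * c)%:M.
Proof.
rewrite sumr_const card_ord -raddfMn /=; congr (_%:M).
by rewrite mulr_natl.
Qed.

(** Whitened by Z k, the fixed point equation says that the matrices 2^k (B^(2^-k) - 1) add up to 0.
    By [root_ln] they exceed log B by at most c k, so the sum of the logarithms tends to 0. *)
Lemma pmean_lim_karcher N (T : 'I_N -> 'M[R]_p) a b (Z : nat -> 'M[R]_p) X :
  (0 < N)%N -> 0 < a -> 0 < b -> bounded a b T ->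
  (forall k, loewner a%:M (Z k)) -> (forall k, loewner (Z k) b%:M) ->
  (forall k, pstep k T (Z k) = Z k) -> Z @ \oo --> X -> karcher_eq T X.
Proof.
move=> N0 a0 b0 bT aZ Zb fZ hZ; have pT := bounded_Pos a0 bT.
have pZ k : Pos (Z k) by apply: Pos_loewner (aZ k); exact: Pos_scalar.
have aX : loewner a%:M X.
  by apply: (loewner_cvg (u := fun=> a%:M) _ hZ) => //; exact: cvg_cst.
have pX : Pos X by apply: Pos_loewner aX; exact: Pos_scalar.
split=> //.
pose B k i := whiten (Z k) (T i); have pB k i : Pos (B k i) by exact: whiten_Pos.
have ba : 0 < b / a by rewrite divr_gt0.
(* The spectra of the whitened matrices stay in [a / b, b / a] for all k: T i <= b <= (b / a) Z k,
   and similarly from below. *)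
have hi k i : loewner (B k i) (b / a)%:M.
  rewrite -scalemx1 -(whiten_id (pZ k)) (_ : _ *: whiten _ _ = whiten (Z k) ((b / a) *: Z k)).
    apply: whiten_le => //; have [_ h] := bT i; apply: (loewner_trans h).
    have := loewner_scale (ltW ba) (aZ k).
    by rewrite scale_scalar_mx divfK // gt_eqF.
  by rewrite /whiten -scalemxAr -scalemxAl.
have lo Y i : Pos Y -> loewner Y b%:M -> loewner (a / b)%:M (whiten Y (T i)).
  move=> pY Yb; rewrite -scalemx1 -(whiten_id pY).
  rewrite (_ : _ *: whiten _ _ = whiten Y ((a / b) *: Y)).
    apply: whiten_le => //; have [h _] := bT i; apply: (loewner_trans _ h).
    have ab : 0 <= a / b by rewrite divr_ge0 // ltW.
    by have := loewner_scale ab Yb; rewrite scale_scalar_mx divfK // gt_eqF.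
  by rewrite /whiten -scalemxAr -scalemxAl.
have Xb : loewner X b%:M.
  by apply: (loewner_cvg hZ (v := fun=> b%:M)) => //; exact: cvg_cst.
pose l := `|ln (b / a)|.
have hl x : a / b <= x -> x <= b / a -> 0 < x /\ `|ln x| <= l.
  move=> h1 h2; have abp : 0 < a / b by rewrite divr_gt0.
  have x0 : 0 < x by apply: lt_le_trans h1.
  split=> //; have e : ln (a / b) = - ln (b / a) by rewrite -lnV ?posrE // invf_div.
  have : ln x <= ln (b / a) by rewrite ler_ln ?posrE.
  have : ln (a / b) <= ln x by rewrite ler_ln ?posrE.
  rewrite e ler_norml /l => h3 h4.
  by rewrite (le_trans h4 (ler_norm _)) andbT (le_trans _ h3) // lerN2 ler_norm.
pose c k := l ^+ 2 * expR l * 2^-1 ^+ k.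
have sumroot k : \sum_i (2 ^+ k *: (symfun (root k) (B k i) - 1%:M)) = 0.
  have uC := Pos_unit (sqrtmx_Pos (pZ k)).
  have e1 : N%:R^-1 *: \sum_i symfun (root k) (B k i) = 1%:M.
    have := fZ k; rewrite /pstep (eq_bigr _ (fun i _ => geoE k (pZ k) (pT i))).
    rewrite -mulmx_suml -mulmx_sumr scalemxAl scalemxAr => e.
    by rewrite -[LHS](whiten_congr _ (pZ k)) e whiten_id.
  rewrite -scaler_sumr big_split /= sumrN sumr_const card_ord.
  have -> : \sum_(i < N) symfun (root k) (B k i) = N%:R *: 1%:M.
    by rewrite -e1 scalerA mulfV ?scale1r // pnatr_eq0 -lt0n.
  by rewrite scaler_nat subrr scaler0.
pose D k i := 2 ^+ k *: (symfun (root k) (B k i) - 1%:M) - symfun (@ln R) (B k i).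
have DE k i : D k i = symfun (fun x => 2 ^+ k * (root k x - 1) - ln x) (B k i).
  have sB := Pos_sym (pB k i).
  by rewrite /D -(symfun_cst 1 sB) symfun_sub // symfun_scale // symfun_sub.
have D0 k i : loewner 0 (D k i) /\ loewner (D k i) (c k)%:M.
  have sB := Pos_sym (pB k i); rewrite DE; split.
    have z : symfun (fun=> 0) (B k i) = 0 by rewrite (symfun_cst _ sB) raddf0.
    rewrite -[X in loewner X _]z.
    apply: (symfun_le sB (lo _ i (pZ k) (Zb k)) (hi k i)) => x h1 h2.
    by have [x0 /(root_ln k x0)/andP[]] := hl x h1 h2.
  rewrite -(symfun_cst (c k) sB).
  apply: (symfun_le sB (lo _ i (pZ k) (Zb k)) (hi k i)) => x h1 h2.
  by have [x0 /(root_ln k x0)/andP[]] := hl x h1 h2.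
have SD k : \sum_i D k i = - \sum_i symfun (@ln R) (B k i).
  by rewrite sumrB sumroot add0r.
have abp : 0 < a / b by rewrite divr_gt0.
have cv : (fun k => - \sum_i symfun (@ln R) (B k i)) @ \oo -->
    - \sum_i symfun (@ln R) (whiten X (T i)).
  apply: cvgN; apply: cvg_summx => i.
  apply: (@symfun_cvg _ _ _ _ _ (a / b) (a / b)^-1).
  - by rewrite invr_ge0 ltW.
  - have hw := whiten_cvg (A := T i) a0 pZ pX aZ aX hZ; exact: hw.
  - by move=> k; exact: pB.
  - exact: whiten_Pos.
  - by move=> k; exact: lo.
  - exact: lo.
  - by move=> x y; exact: ln_lip.
set S := \sum_i _ in cv *; apply/eqP; rewrite -oppr_eq0; apply/eqP.
apply: loewner_anti.
  apply: (loewner_cvg cv (v := fun k => (N%:R * c k) *: 1%:M)).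
    rewrite -[X in _ --> X](scale0r 1%:M); apply: cvgZ; last exact: cvg_cst.
    rewrite -(mulr0 N%:R); apply: cvgM; first exact: cvg_cst.
    rewrite -(mulr0 (l ^+ 2 * expR l)); apply: cvgM; first exact: cvg_cst.
    by apply: cvg_expr; rewrite ger0_norm ?invr_ge0 // invf_lt1 // ltr1n.
  move=> k; rewrite -SD scalemx1 -sum_scalar; apply: loewner_sum => i.
  by case: (D0 k i).
apply: (loewner_cvg (u := fun=> 0) _ cv); first exact: cvg_cst.
move=> k; rewrite -SD -[X in loewner X _](big1_eq (op := +%R) (index_enum 'I_N) xpredT).
by apply: loewner_sum => i; case: (D0 k i).
Qed.

(** The two solutions are limits, in r and then in k, of iterations that are comparable at each
    stage. With T' = T this also gives existence. *)
Theorem karcher_mono N (T T' : 'I_N -> 'M[R]_p) : (0 < N)%N ->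
  (forall i, Pos (T i)) -> (forall i, Pos (T' i)) -> (forall i, loewner (T i) (T' i)) ->
  exists X X', [/\ karcher_eq T X, karcher_eq T' X' & loewner X X'].
Proof.
move=> N0 pT pT' hT.
(* The lower bound of T and the upper bound of T' serve both tuples, so that both iterations start
   at the same a. *)
have [a [_ [a0 _ ha _]]] := Pos_bounds_fam pT.
have [_ [b [_ b0 _ hb]]] := Pos_bounds_fam pT'.
have bT : bounded a b T by move=> i; split => //; exact: loewner_trans (hT i) (hb i).
have bT' : bounded a b T' by move=> i; split => //; exact: loewner_trans (ha i) (hT i).
have ab : loewner (a%:M : 'M[R]_p) b%:M.
  have i : 'I_N := Ordinal N0.
  exact: loewner_trans (bT i).1 (bT i).2.
have main (S : 'I_N -> 'M[R]_p) : bounded a b S -> exists Z : nat -> 'M[R]_p,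
    (forall k, (fun r => piter a k S r) @ \oo --> Z k) /\ exists X, Z @ \oo --> X.
  move=> bS; have /choice[Z hZ] := fun k => piter_cvg N0 a0 b0 ab k bS.
  exists Z; split => //; apply: (@mono_cvg_dec _ _ _ a%:M).
  - move=> k; have [h _] := lim_bounds N0 a0 b0 ab bS (hZ k).
    by apply/Pos_sym/(Pos_loewner _ h)/Pos_scalar.
  - by move=> k; exact: (pmean_dec N0 a0 b0 ab bS (hZ k) (hZ k.+1)).
  - by move=> k; have [] := lim_bounds N0 a0 b0 ab bS (hZ k).
have [Z [hZ [X hX]]] := main T bT; have [Z' [hZ' [X' hX']]] := main T' bT'.
exists X, X'; split.
- apply: (pmean_lim_karcher N0 a0 b0 bT _ _ _ hX) => k.
  + by have [] := lim_bounds N0 a0 b0 ab bT (hZ k).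
  + by have [] := lim_bounds N0 a0 b0 ab bT (hZ k).
  + exact: (piter_fix N0 a0 b0 ab bT (hZ k)).
- apply: (pmean_lim_karcher N0 a0 b0 bT' _ _ _ hX') => k.
  + by have [] := lim_bounds N0 a0 b0 ab bT' (hZ' k).
  + by have [] := lim_bounds N0 a0 b0 ab bT' (hZ' k).
  + exact: (piter_fix N0 a0 b0 ab bT' (hZ' k)).
apply: (loewner_cvg hX hX') => k; apply: (loewner_cvg (hZ k) (hZ' k)) => r.
exact: (piter_mono N0 a0 b0 ab _ _ bT bT' hT).
Qed.

Lemma ls_spec N (T : 'I_N -> 'M[R]_p) : (0 < N)%N -> (forall i, Pos (T i)) ->
  karcher_eq T (ls T).
Proof.
move=> N0 pT; have [X [_ [kX _ _]]] := karcher_mono N0 pT pT (fun i => loewner_refl (T i)).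
by rewrite (ls_karcher N0 pT kX).
Qed.

Lemma ls_min N (T : 'I_N -> 'M[R]_p) X : (0 < N)%N -> (forall i, Pos (T i)) -> Pos X ->
  (forall Y, Pos Y -> \sum_i distPos X (T i) ^+ 2 <= \sum_i distPos Y (T i) ^+ 2) ->
  ls T = X.
Proof.
move=> N0 pT pX hX; have [pL hL] := karcher_eq_min N0 pT (ls_spec N0 pT).
have [//|/eqP/nesym XL] := eqVneq (ls T) X.
by have := lt_le_trans (hL X pX XL) (hX _ pL); rewrite ltxx.
Qed.

Lemma ls_le N (T : 'I_N -> 'M[R]_p) Y : (0 < N)%N -> (forall i, Pos (T i)) -> Pos Y ->
  \sum_i distPos (ls T) (T i) ^+ 2 <= \sum_i distPos Y (T i) ^+ 2.
Proof.
move=> N0 pT pY; have [pL hL] := karcher_eq_min N0 pT (ls_spec N0 pT).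
have [->//|/eqP YL] := eqVneq Y (ls T); exact/ltW/hL.
Qed.

Lemma conj_diag_mul (P : 'M[R]_p) (x y : 'rV[R]_p) : P \in unitmx ->
  (P *m diag_mx x *m invmx P) *m (P *m diag_mx y *m invmx P)
    = P *m diag_mx (\row_j (x 0 j * y 0 j)) *m invmx P.
Proof.
move=> uP; rewrite -!mulmxA (mulmxA (invmx P) P) mulVmx // mul1mx.
by rewrite (mulmxA (diag_mx x)) diag_mulE.
Qed.

Theorem ls_is_gm N : (0 < N)%N -> is_gm (@ls R p N).
Proof.
move=> N0; split.
- by move=> T pT; case: (ls_spec N0 pT).
- move=> T T' pT pT' h; have [X [X' [kX kX' hX]]] := karcher_mono N0 pT pT' h.
  by rewrite (ls_karcher N0 pT kX) (ls_karcher N0 pT' kX').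
- move=> T a pT a0; have [pL eL] := ls_spec N0 pT.
  set c := gmv a; have c0 : 0 < c := gmv_gt0 a.
  apply: ls_karcher => //; first by move=> i; exact: Pos_scale.
  split; first exact: Pos_scale.
  have e i : whiten (c *: ls T) (a i *: T i) = (a i / c) *: whiten (ls T) (T i).
    have sc0 : 0 < Num.sqrt c by rewrite sqrtr_gt0.
    have eS : invmx (sqrtmx (c *: ls T)) = (Num.sqrt c)^-1 *: invmx (sqrtmx (ls T)).
      rewrite (_ : sqrtmx _ = Num.sqrt c *: sqrtmx (ls T)).
        rewrite invmxZ // unitmxZ ?unitfE ?gt_eqF // Pos_unit //.
        exact: sqrtmx_Pos.
      rewrite /sqrtmx symfun_scaler ?Pos_sym // symfun_scale ?Pos_sym //.
      by apply: symfun_eq_pos => // x x0; rewrite sqrtrM // ltW.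
    rewrite /whiten eS -!(scalemxAr, scalemxAl) !scalerA; congr (_ *: _).
    rewrite -[in RHS](sqr_sqrtr (ltW c0)); field.
    by rewrite gt_eqF.
  rewrite (eq_bigr (fun i => (ln (a i / c))%:M + symfun (@ln R) (whiten (ls T) (T i)))).
    rewrite big_split /= eL addr0 -raddf_sum /= (_ : \sum_i _ = 0) ?raddf0 //.
    rewrite (eq_bigr (fun i => ln (a i) - ln c)); last by move=> i _; rewrite ln_div ?posrE.
    rewrite sumrB sumr_const card_ord expRK -[_ *+ N]mulr_natr divfK ?subrr //.
    by rewrite pnatr_eq0 -lt0n.
  move=> i _; have pW := whiten_Pos pL (pT i); have sW := Pos_sym pW.
  rewrite e symfun_scaler // -(symfun_cst _ sW) symfun_add //.
  by apply: symfun_eq_pos => // x x0; rewrite lnM // posrE divr_gt0.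
- move=> T s pT; have [pL eL] := ls_spec N0 pT.
  apply: ls_karcher => //; split => //.
  by rewrite -[RHS]eL [in RHS](reindex_inj (@perm_inj _ s)).
(* The square root of a congruent matrix has no simple form, so congruence invariance goes through
   the minimized sum, which [distPos_congr] preserves, and not through the Karcher equation. *)
- move=> T P pT uP; apply: ls_min => //.
  + by move=> i; exact: Pos_congr.
  + by apply: Pos_congr => //; case: (ls_spec N0 pT).
  move=> Y pY; pose Y0 := invmx P *m Y *m (invmx P)^T.
  have uiP : invmx P \in unitmx by rewrite unitmx_inv.
  have pY0 : Pos Y0 by exact: Pos_congr.
  have eY : Y = P *m Y0 *m P^T.
    rewrite /Y0 !mulmxA mulmxV // mul1mx -mulmxA -trmx_mul mulmxV //.
    by rewrite trmx1 mulmx1.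
  have pL : Pos (ls T) by case: (ls_spec N0 pT).
  have e1 (Z : 'M[R]_p) : Pos Z ->
      \sum_i distPos (P *m Z *m P^T) (P *m T i *m P^T) ^+ 2 = \sum_i distPos Z (T i) ^+ 2.
    by move=> pZ; apply: eq_bigr => i _; rewrite distPos_congr.
  by rewrite eY (e1 _ pL) (e1 _ pY0); exact: ls_le.
- move=> T pT; have pL : Pos (ls T) by case: (ls_spec N0 pT).
  apply: ls_min => //; try by [move=> i; exact: Pos_inv|exact: Pos_inv].
  move=> Y pY; have pY' : Pos (invmx Y) by exact: Pos_inv.
  rewrite -[Y]invmxK (eq_bigr (fun i => distPos (ls T) (T i) ^+ 2)); last first.
    by move=> i _; rewrite distPos_inv.
  rewrite [leRHS](eq_bigr (fun i => distPos (invmx Y) (T i) ^+ 2)); last first.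
    by move=> i _; rewrite distPos_inv.
  exact: ls_le.
- move=> T P d pT uP d0 eT.
  have sT i : (T i)^T = T i by exact: Pos_sym.
  have sfT f i : symfun f (T i) = P *m diag_mx (map_mx f (d i)) *m invmx P.
    exact: symfun_conj (sT i) uP (eT i).
  pose g := \row_j gmv (fun i => d i 0 j).
  (* The solution X is the exponential of the mean S of the logarithms; as a function of the
     symmetric S it is symmetric although P is not orthogonal. *)
  pose S := N%:R^-1 *: \sum_i symfun (@ln R) (T i).
  have sS : S^T = S.
    rewrite /S linearZ /= raddf_sum /=; congr (_ *: _); apply: eq_bigr => i _.
    exact: symfun_sym.
  have eS : S = P *m diag_mx (\row_j ((\sum_i ln (d i 0 j)) / N%:R)) *m invmx P.
    rewrite /S (eq_bigr _ (fun i _ => sfT (@ln R) i)) -mulmx_suml -mulmx_sumr.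
    rewrite scalemxAl scalemxAr; congr (_ *m _ *m _); apply/matrixP => l m.
    rewrite !mxE summxE mulr_sumr -mulrnAl -sumrMnl mulrC mulr_sumr.
    by apply: eq_bigr => i _; rewrite !mxE.
  have sX : (symfun (@expR R) S)^T = symfun (@expR R) S by exact: symfun_sym.
  have eX : symfun (@expR R) S = P *m diag_mx g *m invmx P.
    rewrite (symfun_conj _ sS uP eS); congr (_ *m diag_mx _ *m _).
    by apply/rowP => j; rewrite !mxE.
  rewrite -/g -eX; set X := symfun (@expR R) S in sX eX *.
  have g0 j : 0 < g 0 j by rewrite mxE gmv_gt0.
  have pX : Pos X by exact: conj_diag_Pos eX.
  apply: ls_karcher => //; split => //.
  have eC : invmx (sqrtmx X) = P *m diag_mx (\row_j (Num.sqrt (g 0 j))^-1) *m invmx P.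
    rewrite -symfun_inv; last exact: sqrtmx_Pos.
    rewrite /sqrtmx symfun_comp // (symfun_conj _ sX uP eX); congr (_ *m diag_mx _ *m _).
    by apply/rowP => j; rewrite !mxE.
  have eW i : whiten X (T i) = P *m diag_mx (\row_j (d i 0 j / g 0 j)) *m invmx P.
    rewrite /whiten eC eT !conj_diag_mul //; congr (_ *m diag_mx _ *m _).
    apply/rowP => j; rewrite !mxE -/(gmv _); set y := gmv _.
    have y0 : 0 < y := gmv_gt0 _.
    rewrite -[in RHS](sqr_sqrtr (ltW y0)); field.
    by rewrite gt_eqF // sqrtr_gt0.
  rewrite (eq_bigr (fun i => P *m diag_mx (\row_j (ln (d i 0 j) - ln (g 0 j))) *m invmx P)).
    rewrite -mulmx_suml -mulmx_sumr -raddf_sum /= (_ : \sum_i _ = 0) ?linear0 ?mulmx0 ?mul0mx //.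
    apply/rowP => j; rewrite summxE [RHS]mxE (eq_bigr (fun i => ln (d i 0 j) - ln (g 0 j))).
      rewrite sumrB sumr_const card_ord mxE expRK -[_ *+ N]mulr_natr divfK ?subrr //.
      by rewrite pnatr_eq0 -lt0n.
    by move=> i _; rewrite mxE.
  move=> i _; rewrite (symfun_conj _ (Pos_sym (whiten_Pos pX (pT i))) uP (eW i)).
  congr (_ *m diag_mx _ *m _); apply/rowP => j; rewrite !mxE.
  by rewrite ln_div // posrE ?gmv_gt0.
Qed.

End Ls.

(** * The Grassmann distance *)

Section Angles.
Variable R : realType.
Implicit Types x t th : R.

Lemma sin_lex x : 0 <= x -> sin x <= x.
Proof.
move=> x0; pose f z : R := z - sin z.
have df z : is_derive z (1 : R) f (1 - cos z).
  by apply: is_derive_eq; rewrite /GRing.scale /= ?mulr1.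
have h z : 0 < z < x -> 0 <= 1 - cos z by move=> _; rewrite subr_ge0 cos_le1.
have := der_mono df h (lexx 0) x0 (lexx x).
by rewrite /f sin0 subrr subr_ge0.
Qed.

Lemma cos_gex x : 0 <= x -> 1 - x ^+ 2 / 2 <= cos x.
Proof.
move=> x0; pose f z : R := cos z + z ^+ 2 / 2.
have df z : is_derive z (1 : R) f (z - sin z).
  by apply: is_derive_eq; rewrite /GRing.scale /=; field.
have h z : 0 < z < x -> 0 <= z - sin z.
  by move=> /andP[/ltW z0 _]; rewrite subr_ge0 sin_lex.
have := der_mono df h (lexx 0) x0 (lexx x).
by rewrite /f cos0 expr0n mul0r addr0; lra.
Qed.

Lemma sin_gex x : 0 <= x -> x - x ^+ 3 / 6 <= sin x.
Proof.
move=> x0; pose f z : R := sin z - z + z ^+ 3 / 6.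
have df z : is_derive z (1 : R) f (cos z - 1 + z ^+ 2 / 2).
  by apply: is_derive_eq; rewrite /GRing.scale /=; field.
have h z : 0 < z < x -> 0 <= cos z - 1 + z ^+ 2 / 2.
  by move=> /andP[/ltW z0 _]; have := cos_gex z0; lra.
have := der_mono df h (lexx 0) x0 (lexx x).
by rewrite /f sin0 expr0n mul0r addr0 subr0; lra.
Qed.

Lemma pihalf_le_pi : (pi : R) / 2 <= pi.
Proof. by have := @pi_ge0 R; lra. Qed.

Lemma cos_le x y : 0 <= x -> x <= y -> y <= pi -> cos y <= cos x.
Proof.
move=> x0 xy ypi; have [->//|xny] := eqVneq x y.
apply/ltW; rewrite ltr_cos ?in_itv /= ?lt_neqAle ?xny ?xy ?x0 ?(le_trans xy) //.
by rewrite (le_trans x0 xy).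
Qed.

Lemma le_tan th : 0 <= th <= pi / 2 -> th * cos th <= sin th.
Proof.
move=> /andP[t0 tp]; pose f z : R := sin z - z * cos z.
have df z : is_derive z (1 : R) f (z * sin z).
  by apply: is_derive_eq; rewrite /GRing.scale /=; ring.
have h z : 0 < z < th -> 0 <= z * sin z.
  move=> /andP[/ltW z0 zt]; apply: mulr_ge0 => //; apply: sin_ge0_pi; rewrite z0 /=.
  by have := @pi_ge0 R; lra.
have := der_mono df h (lexx 0) t0 (lexx th).
by rewrite /f sin0 mul0r subrr subr_ge0.
Qed.

(** With x = sin^2 th, [le_tan] gives th^2 <= x / (1 - x), which is at most x + 2 x^2 for x <= 1 /
    2. The shape y + 2 y^2 of later bounds stems from here. *)
Lemma sqr_angle_le th : 0 <= th <= pi / 2 -> sin th ^+ 2 <= 2^-1 ->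
  th ^+ 2 <= sin th ^+ 2 + 2 * (sin th ^+ 2) ^+ 2.
Proof.
move=> h hs; have ht := le_tan h; case/andP: h => t0 tp.
have c0 : 0 <= cos th by apply: cos_ge0_pihalf; have := @pi_ge0 R; lra.
have := cos2Dsin2 th; set c := cos th in c0 ht *; set s := sin th in hs ht * => e.
have h1 : (th * c) ^+ 2 <= s ^+ 2.
  by rewrite ler_pXn2r ?nnegrE ?mulr_ge0 //; apply: le_trans ht; rewrite mulr_ge0.
have ec : c ^+ 2 = 1 - s ^+ 2 by lra.
rewrite exprMn ec in h1; set x := s ^+ 2 in h1 hs *.
have x0 : 0 <= x by exact: sqr_ge0.
set y := th ^+ 2 in h1 *; have y0 : 0 <= y by exact: sqr_ge0.
clear -h1 hs x0 y0; nra.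
Qed.

Lemma sinc_le x t : 0 <= x -> x <= t -> t <= pi -> x * sin t <= t * sin x.
Proof.
move=> x0 xt tpi; have [t0|t0] := eqVneq t 0.
  by have -> : x = 0; [apply/eqP; rewrite eq_le x0 -t0 xt|rewrite sin0 t0 !mul0r].
have tp : 0 < t by rewrite lt_def t0 (le_trans x0 xt).
pose l := x / t; have l0 : 0 <= l by rewrite divr_ge0 // ltW.
have l1 : l <= 1 by rewrite ler_pdivrMr // mul1r.
have ex : x = l * t by rewrite divfK.
pose f z : R := sin (l * z) - l * sin z.
have df z : is_derive z (1 : R) f (l * (cos (l * z) - cos z)).
  by apply: is_derive_eq; rewrite /GRing.scale /=; ring.
have h z : 0 < z < t -> 0 <= l * (cos (l * z) - cos z).
  move=> /andP[/ltW z0 /ltW zt]; rewrite mulr_ge0 // subr_ge0; apply: cos_le.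
  - exact: mulr_ge0 l0 z0.
  - by rewrite ler_piMl.
  - exact: le_trans tpi.
have := der_mono df h (lexx 0) (ltW tp) (lexx t).
rewrite /f mulr0 sin0 mulr0 subrr subr_ge0 -ex => h1.
by rewrite {1}ex mulrAC mulrC ler_wpM2l // ltW.
Qed.

(* This is the tangent line inequality for the convex function acos ^ 2. *)
Lemma acos2_tangent t : 0 <= t <= pi / 2 ->
  exists k, forall th, 0 <= th <= pi / 2 -> t ^+ 2 + k * (cos t - cos th) <= th ^+ 2.
Proof.
move=> /andP[t0 tp]; have p2 := pihalf_le_pi.
move: t0; rewrite le_eqVlt => /orP[/eqP<-|t0].
  (* The limit at t = 0 of the slope 2 t / sin t used below. *)
  exists 2 => th /andP[th0 _]; rewrite expr0n add0r cos0; have := cos_gex th0; lra.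
have s0 : 0 < sin t by apply: sin_gt0_pi; rewrite t0 /= (le_lt_trans tp) // ltr_pdivrMr // ltr_pMr ?pi_gt0 // ltr1n.
exists (2 * t / sin t) => th /andP[th0 thp].
pose f z : R := sin t * z ^+ 2 + 2 * t * cos z.
have df z : is_derive z (1 : R) f (2 * (z * sin t - t * sin z)).
  by apply: is_derive_eq; rewrite /GRing.scale /=; ring.
suff : f t <= f th.
  rewrite /f => h; rewrite -(ler_pM2l s0) mulrDr.
  have -> : sin t * (2 * t / sin t * (cos t - cos th)) = 2 * t * (cos t - cos th).
    by field; rewrite gt_eqF.
  lra.
have [h|/ltW h] := leP t th.
  apply: (@der_mono _ f _ t th df _ t th) => // z /andP[/ltW z0 /ltW zt].
  by rewrite mulr_ge0 // subr_ge0 sinc_le ?(ltW t0) // (le_trans zt) // (le_trans thp).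
pose g z : R := - f z.
have dg z : is_derive z (1 : R) g (- (2 * (z * sin t - t * sin z))).
  by apply: is_deriveN; exact: df.
rewrite -lerN2; apply: (@der_mono _ g _ th t dg _ th t) => // z /andP[/ltW z0 /ltW zt].
rewrite -mulrN mulr_ge0 // opprB subr_ge0 sinc_le ?(le_trans th0) //.
exact: le_trans p2.
Qed.

Lemma acos_le x y : -1 <= x -> x <= y -> y <= 1 -> acos y <= acos x.
Proof.
move=> x1 xy y1; have hx : -1 <= x <= 1 by rewrite x1 (le_trans xy).
have hy : -1 <= y <= 1 by rewrite y1 (le_trans x1).
rewrite leNgt; apply/negP => h.
have := h; rewrite -ltr_cos ?in_itv /= ?acos_ge0 ?acos_lepi // !acosK ?in_itv //=.
by rewrite ltNge xy.
Qed.

Lemma acos_le_cos x th : 0 <= th <= pi -> -1 <= x <= 1 -> cos th <= x -> acos x <= th.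
Proof.
move=> ht /andP[x1 x2] h; rewrite -[leRHS]cosK ?in_itv //=.
by apply: acos_le => //; exact: cos_geN1.
Qed.

Lemma acos_pihalf x : 0 <= x <= 1 -> 0 <= acos x <= pi / 2.
Proof.
move=> /andP[x0 x1]; rewrite acos_ge0 ?(le_trans _ x0) ?x1 ?lerN10 //=.
by rewrite -acos0; apply: acos_le => //; rewrite lerN10.
Qed.

Section Sphere.
Variable n : nat.
Implicit Types u v w : 'cV[R]_n.

Lemma dot_itv u v : dot u u = 1 -> dot v v = 1 -> -1 <= dot u v <= 1.
Proof.
move=> u1 v1; have := dot_CS u v; rewrite u1 v1 mulr1 -ler_norml => h.
by rewrite -(@ler_pXn2r _ 2) ?nnegrE // expr1n real_normK ?num_real.
Qed.

(** The components of u and w orthogonal to v have lengths sin a and sin b; Cauchy-Schwarz for them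
    gives cos (a + b) <= <u, w>. *)
Lemma sphere_triangle u v w : dot u u = 1 -> dot v v = 1 -> dot w w = 1 ->
  acos (dot u w) <= acos (dot u v) + acos (dot v w).
Proof.
move=> u1 v1 w1; have uv := dot_itv u1 v1; have vw := dot_itv v1 w1.
have uw := dot_itv u1 w1; set a := acos (dot u v); set b := acos (dot v w).
have [a0 ap] : 0 <= a /\ a <= pi by rewrite acos_ge0 ?acos_lepi.
have [b0 bp] : 0 <= b /\ b <= pi by rewrite acos_ge0 ?acos_lepi.
have [ab|/ltW ab] := leP (a + b) pi; last exact: le_trans (acos_lepi uw) ab.
apply: acos_le_cos => //; first by rewrite addr_ge0.
have ca : cos a = dot u v by rewrite acosK ?in_itv.
have cb : cos b = dot v w by rewrite acosK ?in_itv.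
have sa : 0 <= sin a by rewrite sin_ge0_pi ?a0.
have sb : 0 <= sin b by rewrite sin_ge0_pi ?b0.
rewrite cosD ca cb.
pose x := u - dot u v *: v; pose y := w - dot v w *: v.
have exy : dot x y = dot u w - dot u v * dot v w.
  by rewrite /x /y !(dotBl, dotBr, dotZl, dotZr) v1; ring.
have exx : dot x x = sin a ^+ 2.
  rewrite sin2cos2 ca /x !(dotBl, dotBr, dotZl, dotZr) v1 u1 (dotC v u); ring.
have eyy : dot y y = sin b ^+ 2.
  rewrite sin2cos2 cb /y !(dotBl, dotBr, dotZl, dotZr) v1 w1 (dotC w v); ring.
have : `|dot x y| <= sin a * sin b.
  rewrite -(@ler_pXn2r _ 2) ?nnegrE ?mulr_ge0 // real_normK ?num_real //.
  by rewrite exprMn -exx -eyy dot_CS.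
by rewrite ler_norml exy => /andP[h _]; lra.
Qed.

End Sphere.
End Angles.

(** * Orthonormal bases, principal angles and the triangle inequality *)

Section Frames.
Variables (R : realType) (n p : nat).
Implicit Types U V W : 'M[R]_(n, p).

Lemma colspan_limg m (A : 'M[R]_(n, m)) :
  colspan A = limg (linfun (mulmx A : 'cV[R]_m -> 'cV[R]_n)).
Proof.
apply/eqP; rewrite eqEsubv; apply/andP; split.
  apply/span_subvP => v /mapP[j _ ->]; apply/memv_imgP; exists (delta_mx j 0).
    by rewrite memvf.
  by rewrite lfunE /= colE.
apply/subvP => v /memv_imgP[c _ ->]; rewrite lfunE /=.
have -> : A *m c = \sum_j c j 0 *: col j A.
  apply/colP => i; rewrite !mxE summxE; apply: eq_bigr => j _.
  by rewrite !mxE mulrC.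
apply: memv_suml => j _; apply: memvZ; apply: memv_span; apply: map_f.
by rewrite mem_enum.
Qed.

Lemma colspanP m (A : 'M[R]_(n, m)) v :
  reflect (exists c : 'cV[R]_m, v = A *m c) (v \in colspan A).
Proof.
rewrite colspan_limg; apply: (iffP memv_imgP) => [[c _]|[c ->]].
  by rewrite lfunE /= => ->; exists c.
by exists c; rewrite ?memvf // lfunE.
Qed.

Lemma colspan_sub m k (A : 'M[R]_(n, m)) (B : 'M[R]_(n, k)) :
  (colspan A <= colspan B)%VS <-> exists C, A = B *m C.
Proof.
split=> [/subvP h|[C ->]]; last first.
  by apply/subvP => v /colspanP[c ->]; apply/colspanP; exists (C *m c); rewrite mulmxA.
have /choice[f hf] : forall j, exists c : 'cV[R]_k, col j A = B *m c.
  by move=> j; apply/colspanP/h/colspanP; exists (delta_mx j 0); rewrite colE.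
exists (\matrix_(i, j) f j i 0); apply/matrixP => i j.
have /matrixP/(_ i 0) := hf j; rewrite !mxE => ->.
by apply: eq_bigr => l _; rewrite !mxE.
Qed.

Lemma colspan_inj_dim m (A : 'M[R]_(n, m)) : (forall c : 'cV[R]_m, A *m c = 0 -> c = 0) ->
  \dim (colspan A) = m.
Proof.
move=> h; rewrite colspan_limg limg_dim_eq; first by rewrite dimvf /dim /= muln1.
apply/eqP; rewrite -subv0; apply/subvP => c; rewrite memv_cap memv_ker lfunE /=.
by move=> /andP[_ /eqP/h ->]; rewrite memv0.
Qed.

Lemma stiefel_Gr U : Stiefel U -> Gr p (colspan U).
Proof.
move=> sU; apply: colspan_inj_dim => c h.
by rewrite -[c]mul1mx -sU -mulmxA h mulmx0.
Qed.

(** B (B^T B)^(-1/2) has orthonormal columns. *)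
Lemma colspan_stiefel_ex m (B : 'M[R]_(n, m)) : (forall c : 'cV[R]_m, B *m c = 0 -> c = 0) ->
  exists2 G : 'M[R]_m, Stiefel (B *m G) & colspan (B *m G) = colspan B.
Proof.
move=> h; pose G := B^T *m B.
have pG : Pos G.
  apply/PosE; split; first by rewrite trmx_mul trmxK.
  move=> x x0; rewrite -mulmxA -dot_mull dot_gt0.
  by apply: contra x0 => /eqP/h ->.
have pS := sqrtmx_Pos pG; have uS := Pos_unit pS.
exists (invmx (sqrtmx G)).
  rewrite /Stiefel trmx_mul Pos_sym; last exact: Pos_inv.
  rewrite -mulmxA (mulmxA B^T) -/G -{2}(sqrtmx_sqr (Pos_psd pG)) -!mulmxA mulmxV //.
  by rewrite mulmx1 mulVmx.
apply/eqP; rewrite eqEsubv; apply/andP; split; apply/colspan_sub.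
  by eexists; reflexivity.
by exists (sqrtmx G); rewrite -mulmxA mulVmx // mulmx1.
Qed.

Lemma Gr_frame (S : {vspace 'cV[R]_n}) : Gr p S -> exists2 U : 'M[R]_(n, p), Stiefel U & colspan U = S.
Proof.
move=> dS; have [b eb] : exists b : p.-tuple 'cV[R]_n, tval b = tval (vbasis S).
  by move: (vbasis S); rewrite dS => b; exists b.
have bS : basis_of S b by rewrite eb vbasisP.
pose B : 'M[R]_(n, p) := \matrix_(i, j) (tnth b j) i 0.
have colB j : col j B = tnth b j by apply/colP => i; rewrite !mxE.
have cB : colspan B = S.
  rewrite -(span_basis bS) /colspan; congr (<< _ >>)%VS.
  rewrite -[RHS]map_tnth_enum; apply: eq_map => j; exact: colB.
have inj (c : 'cV[R]_p) : B *m c = 0 -> c = 0.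
  have -> : B *m c = \sum_j c j 0 *: tnth b j.
    apply/colP => i; rewrite !mxE summxE; apply: eq_bigr => j _.
    by rewrite !mxE mulrC.
  move=> h; apply/colP => j; rewrite mxE.
  have /freeP fr := basis_free bS; apply: (fr (fun j => c j 0) _ j); rewrite -[RHS]h.
  by apply: eq_bigr => k _; rewrite (tnth_nth 0).
have [G sG eG] := colspan_stiefel_ex inj.
by exists (B *m G) => //; rewrite eG cB.
Qed.

Lemma colspan_eqP U V : Stiefel U -> Stiefel V ->
  colspan U = colspan V <-> exists2 O, Orth O & V = U *m O.
Proof.
move=> sU sV; split=> [e|[ O oO ->]]; last first.
  apply/eqP; rewrite eqEsubv; apply/andP; split; apply/colspan_sub.
    by exists O^T; rewrite -mulmxA orth_mulV // mulmx1.
  by exists O.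
have /colspan_sub[C eC] : (colspan V <= colspan U)%VS by rewrite e.
exists C => //; rewrite /Orth /Stiefel -[LHS]mul1mx.
move: sV; rewrite /Stiefel {1 2}eC trmx_mul -mulmxA (mulmxA U^T) sU !mul1mx.
by [].
Qed.

(* The distance of the column spans: the eigenvalues of N^T N, for N = U^T V,
   are the squared cosines of the principal angles. *)
Definition gd U V : R :=
  Num.sqrt (\tr (symfun (fun x => acos (Num.sqrt x) ^+ 2) ((U^T *m V)^T *m (U^T *m V)))).

Lemma gd_ge0 U V : 0 <= gd U V. Proof. exact: sqrtr_ge0. Qed.

Lemma trace_orth_diag m (O : 'M[R]_m) d : Orth O -> \tr (O *m diag_mx d *m O^T) = \sum_i d 0 i.
Proof. by move=> oO; rewrite mxtrace_mulC mulmxA oO mul1mx mxtrace_diag. Qed.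

Definition angle_range m (theta : 'rV[R]_m) := forall i, 0 <= theta 0 i <= pi / 2.

Lemma pihalf_itv t : 0 <= t <= pi / 2 -> t \in `[0, (pi : R)].
Proof. by move=> /andP[t0 t1]; rewrite in_itv /= t0 (le_trans t1) ?pihalf_le_pi. Qed.

Lemma cos_pihalf_ge0 (t : R) : 0 <= t <= pi / 2 -> 0 <= cos t.
Proof. by move=> h; apply: cos_ge0_pihalf; have := @pi_ge0 R; lra. Qed.

Lemma gd_decomp U V O Q (theta : 'rV[R]_p) : Orth O -> Orth Q -> angle_range theta ->
  U^T *m V = O *m diag_mx (map_mx cos theta) *m Q^T ->
  gd U V = Num.sqrt (\sum_i theta 0 i ^+ 2).
Proof.
move=> oO oQ ht eN; rewrite /gd eN; congr Num.sqrt.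
have -> : (O *m diag_mx (map_mx cos theta) *m Q^T)^T *m (O *m diag_mx (map_mx cos theta) *m Q^T)
    = Q *m diag_mx (map_mx (fun t => cos t ^+ 2) theta) *m Q^T.
  rewrite !trmx_mul trmxK tr_diag_mx -!mulmxA (mulmxA O^T) oO mul1mx.
  congr (_ *m _); rewrite mulmxA diag_mulE; congr (diag_mx _ *m _).
  by apply/rowP => i; rewrite !mxE -expr2.
rewrite symfun_orth // trace_orth_diag //; apply: eq_bigr => i _.
rewrite !mxE sqrtr_sqr ger0_norm; last exact/cos_pihalf_ge0/ht.
by rewrite cosK // pihalf_itv.
Qed.

Lemma stiefel_dot_le1 U V x : Stiefel U -> Stiefel V -> dot x x = 1 ->
  `|dot (U *m x) (V *m x)| <= 1.
Proof.
move=> sU sV x1; rewrite ler_norml; apply: dot_itv.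
  by rewrite stiefel_dot.
by rewrite stiefel_dot.
Qed.

Lemma delta_norm m (j : 'I_m) : dot (delta_mx j 0 : 'cV[R]_m) (delta_mx j 0) = 1.
Proof. by rewrite -[X in dot _ X]mul1mx dot_delta mxE eqxx. Qed.

Lemma stiefel_entry U V i : Stiefel U -> Stiefel V -> -1 <= (U^T *m V) i i <= 1.
Proof.
move=> sU sV; rewrite -ler_norml -dot_delta -mulmxA -dot_mull.
exact: stiefel_dot_le1 (delta_norm i).
Qed.

Lemma stiefel_diag_le1 U V O Q (s : 'rV[R]_p) i : Stiefel U -> Stiefel V -> Orth O -> Orth Q ->
  U^T *m V = O *m diag_mx s *m Q^T -> -1 <= s 0 i <= 1.
Proof.
move=> sU sV oO oQ e.
have -> : s 0 i = ((U *m O)^T *m (V *m Q)) i i.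
  rewrite trmx_mul -mulmxA (mulmxA U^T) e -!mulmxA oQ mulmx1 mulmxA oO mul1mx.
  by rewrite mxE eqxx.
by apply: stiefel_entry; apply: stiefel_mul.
Qed.

Lemma gd_spec U V : Stiefel U -> Stiefel V -> exists (O Q : 'M[R]_p) (theta : 'rV[R]_p),
  [/\ Orth O, Orth Q, angle_range theta, U^T *m V = O *m diag_mx (map_mx cos theta) *m Q^T
    & gd U V = Num.sqrt (\sum_i theta 0 i ^+ 2)].
Proof.
move=> sU sV; have [ O [Q [s [oO oQ e s0]]]] := svd (U^T *m V).
have s1 i := stiefel_diag_le1 i sU sV oO oQ e.
have ht : angle_range (map_mx acos s).
  by move=> i; rewrite mxE; apply: acos_pihalf; rewrite s0; case/andP: (s1 i).
have es : s = map_mx cos (map_mx acos s).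
  by apply/rowP => i; rewrite !mxE acosK // in_itv /=.
exists O, Q, (map_mx acos s); split => //; first by rewrite -es.
by apply: (gd_decomp oO oQ ht); rewrite -es.
Qed.

Lemma gd_orth U V O Q : Stiefel U -> Stiefel V -> Orth O -> Orth Q ->
  gd (U *m O) (V *m Q) = gd U V.
Proof.
move=> sU sV oO oQ; have [P [S [th [oP oS ht e ->]]]] := gd_spec sU sV.
apply: (gd_decomp (O := O^T *m P) (Q := Q^T *m S)) => //.
- by apply: orth_mul => //; exact: orth_trmx.
- by apply: orth_mul => //; exact: orth_trmx.
by rewrite [(U *m O)^T]trmx_mul -!mulmxA (mulmxA U^T) e trmx_mul trmxK !mulmxA.
Qed.

Lemma gd_sym U V : Stiefel U -> Stiefel V -> gd U V = gd V U.
Proof.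
move=> sU sV; have [P [S [th [oP oS ht e ->]]]] := gd_spec sU sV.
apply/esym; apply: (gd_decomp (O := S) (Q := P)) => //.
by rewrite -[LHS]trmxK trmx_mul trmxK e !trmx_mul trmxK tr_diag_mx mulmxA.
Qed.

(** The bases and the decomposition picked by [xget] are arbitrary; by [gd_orth] and [gd_decomp]
    each choice yields [gd U V]. *)
Lemma dGrE U V : Stiefel U -> Stiefel V -> dGr p (colspan U) (colspan V) = gd U V.
Proof.
move=> sU sV; rewrite /dGr; case: xgetP => [r -> [th]|].
  move=> [U1 [V1 [ O [Q [[sU1 eU] [sV1 eV] [oO oQ] ht e]]]]] ->.
  have [P oP ->] := (colspan_eqP sU1 sU).1 eU; have [S oS ->] := (colspan_eqP sV1 sV).1 eV.
  by rewrite gd_orth // (gd_decomp oO oQ ht e).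
have [ O [Q [th [oO oQ ht e eg]]]] := gd_spec sU sV.
move=> /(_ (gd U V)) []; exists th => //; exists U, V, O, Q; split => //.
Qed.

Lemma gd_angle U V O Q (theta : 'rV[R]_p) i : Orth O -> Orth Q -> angle_range theta ->
  U^T *m V = O *m diag_mx (map_mx cos theta) *m Q^T -> theta 0 i <= gd U V.
Proof.
move=> oO oQ ht e; rewrite (gd_decomp oO oQ ht e).
have t0 : 0 <= theta 0 i by case/andP: (ht i).
rewrite -[leLHS](ger0_norm t0) -sqrtr_sqr ler_wsqrtr // (bigD1 i) //= lerDl.
by apply: sumr_ge0 => ? _; rewrite sqr_ge0.
Qed.

Lemma align_ex U V : Stiefel U -> Stiefel V -> exists2 O, Orth O & psd (U^T *m (V *m O)).
Proof. by move=> sU sV; have [ O oO h] := polar (U^T *m V); exists O => //; rewrite mulmxA. Qed.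

(* The norm of avec U V is the distance of the columns of U and V in the product
   of p unit spheres; it depends on the choice of the bases. *)
Definition avec U V : 'rV[R]_p := \row_j acos ((U^T *m V) j j).

Lemma nrm2_row m (x : 'rV[R]_m) : nrm2 x = \sum_j x 0 j ^+ 2.
Proof. by rewrite nrm2E big_ord1. Qed.

Lemma nrm_row_le m (x y : 'rV[R]_m) : (forall j, 0 <= x 0 j <= y 0 j) -> nrm x <= nrm y.
Proof.
move=> h; rewrite /nrm ler_wsqrtr // !nrm2_row; apply: ler_sum => j _.
by case/andP: (h j) => h0 h1; rewrite ler_pXn2r ?nnegrE // (le_trans h0).
Qed.

Lemma gd_nrm U V O Q (theta : 'rV[R]_p) : Orth O -> Orth Q -> angle_range theta ->
  U^T *m V = O *m diag_mx (map_mx cos theta) *m Q^T -> gd U V = nrm theta.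
Proof. by move=> oO oQ ht e; rewrite (gd_decomp oO oQ ht e) /nrm nrm2_row. Qed.

Lemma avec_triangle U V W : Stiefel U -> Stiefel V -> Stiefel W ->
  nrm (avec U W) <= nrm (avec U V) + nrm (avec V W).
Proof.
move=> sU sV sW; apply: le_trans (nrm_triangle _ _); apply: nrm_row_le => j; rewrite !mxE.
have eE (A B : 'M[R]_(n, p)) : \sum_k A^T j k * B k j = dot (col j A) (col j B).
  by rewrite dotE; apply: eq_bigr => k _; rewrite !mxE.
have c1 (A : 'M[R]_(n, p)) : Stiefel A -> dot (col j A) (col j A) = 1.
  by move=> sA; rewrite colE stiefel_dot // delta_norm.
rewrite !eE sphere_triangle ?c1 // andbT acos_ge0 //; exact: dot_itv (c1 _ sU) (c1 _ sW).
Qed.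

Lemma orth_rowsum m (O : 'M[R]_m) j : Orth O -> \sum_i O i j ^+ 2 = 1.
Proof.
rewrite /Orth /Stiefel => /matrixP/(_ j j); rewrite !mxE eqxx /= mulr1n => <-.
by apply: eq_bigr => i _; rewrite mxE.
Qed.

Lemma orth_entry m (O : 'M[R]_m) i j : Orth O -> O i j <= 1.
Proof.
move=> oO; apply: le_trans (ler_norm _) _.
rewrite -(@ler_pXn2r _ 2) ?nnegrE // real_normK ?num_real // expr1n -(orth_rowsum j oO).
by rewrite (bigD1 i) //= lerDl; apply: sumr_ge0 => ? _; rewrite sqr_ge0.
Qed.

Lemma diag_congr_entry m (O : 'M[R]_m) d j :
  (O^T *m diag_mx d *m O) j j = \sum_i d 0 i * O i j ^+ 2.
Proof.
rewrite -mulmxA mxE; apply: eq_bigr => i _; rewrite mxE mul_diag_mx mxE; ring.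
Qed.

(** In the basis Q the cosines are averages of the d_i, with weights w_ij^2 that form a doubly
    stochastic matrix; convexity of acos^2, used through its tangent lines, does the rest. *)
Lemma avec_le U V Q : Stiefel U -> Stiefel V -> psd (U^T *m V) -> Orth Q ->
  nrm (avec (U *m Q) (V *m Q)) <= gd U V.
Proof.
move=> sU sV pN oQ; have [ O [d [oO e d0 _]]] := psd_spec pN.
have d1 i := stiefel_diag_le1 i sU sV oO oO e.
have ht : angle_range (map_mx acos d).
  by move=> i; rewrite mxE; apply: acos_pihalf; rewrite d0; case/andP: (d1 i).
have ed : d = map_mx cos (map_mx acos d).
  by apply/rowP => i; rewrite !mxE acosK // in_itv /=.
rewrite (@gd_decomp U V O O (map_mx acos d)) -?ed // /nrm ler_wsqrtr // nrm2_row.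
pose w := O^T *m Q; have ow : Orth w by apply: orth_mul => //; exact: orth_trmx.
have y_eq j : ((U *m Q)^T *m (V *m Q)) j j = \sum_i d 0 i * w i j ^+ 2.
  rewrite trmx_mul -mulmxA (mulmxA U^T) e -diag_congr_entry /w trmx_mul trmxK.
  by rewrite !mulmxA.
have w1 j : \sum_i w i j ^+ 2 = 1 by exact: orth_rowsum.
have w2 i : \sum_j w i j ^+ 2 = 1.
  have /orth_rowsum := orth_trmx ow => /(_ i) <-.
  by apply: eq_bigr => j _; rewrite [w^T _ _]mxE.
have tb j : avec (U *m Q) (V *m Q) 0 j ^+ 2 <= \sum_i acos (d 0 i) ^+ 2 * w i j ^+ 2.
  rewrite mxE; set y := (_ *m _) j j.
  have y01 : 0 <= y <= 1.
    have /andP[_ ->] := stiefel_entry j (stiefel_mul sU oQ) (stiefel_mul sV oQ).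
    by rewrite andbT /y y_eq; apply: sumr_ge0 => i _; rewrite mulr_ge0 ?sqr_ge0.
  have [k hk] := acos2_tangent (acos_pihalf y01).
  apply: le_trans (_ : \sum_i (acos y ^+ 2 + k * (cos (acos y) - d 0 i)) * w i j ^+ 2 <= _).
    rewrite (eq_bigr (fun i => (acos y ^+ 2 + k * y) * w i j ^+ 2 - k * (d 0 i * w i j ^+ 2))).
      rewrite sumrB -!mulr_sumr w1 -y_eq -/y; lra.
    move=> i _; rewrite acosK; first ring.
    by rewrite in_itv /=; case/andP: y01 => y0 ->; rewrite (le_trans _ y0) ?lerN10.
  apply: ler_sum => i _; rewrite ler_wpM2r ?sqr_ge0 //.
  have hi := ht i; rewrite mxE in hi; have := hk _ hi.
  have -> // : cos (acos (d 0 i)) = d 0 i by rewrite acosK // in_itv /=.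
apply: le_trans (ler_sum _ (fun j _ => tb j)) _; rewrite exchange_big /=.
by apply: ler_sum => i _; rewrite -mulr_sumr w2 mulr1 mxE.
Qed.

(** With Q the left singular vectors, the j-th cosine is cos th_j times an entry of an orthogonal
    matrix. *)
Lemma avec_ge U V : Stiefel U -> Stiefel V ->
  exists2 Q, Orth Q & gd U V <= nrm (avec (U *m Q) (V *m Q)).
Proof.
move=> sU sV; have [ O [Q [th [oO oQ ht e eg]]]] := gd_spec sU sV.
exists O => //; rewrite (gd_nrm oO oQ ht e); apply: nrm_row_le => j.
case/andP: (ht j) => t0 t1; rewrite t0 /= mxE.
have oW : Orth (Q^T *m O) by apply: orth_mul => //; exact: orth_trmx.
have e1 : ((U *m O)^T *m (V *m O)) j j = cos (th 0 j) * (Q^T *m O) j j.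
  rewrite trmx_mul -mulmxA (mulmxA U^T) e -!mulmxA mulmxA oO mul1mx.
  by rewrite mul_diag_mx !mxE.
have /andP[h1 h2] := stiefel_entry j (stiefel_mul sU oO) (stiefel_mul sV oO).
rewrite -[leLHS]cosK ?pihalf_itv ?t0 //; apply: acos_le => //.
rewrite e1 ler_piMr ?cos_pihalf_ge0 ?t0 //.
exact: orth_entry.
Qed.

(** V is aligned with U and W with V, so [avec_le] holds on both legs for every Q. The Q that
    [avec_ge] provides for U and W reduces the claim to the triangle inequality in a product of
    spheres. *)
Theorem gd_triangle U V W : Stiefel U -> Stiefel V -> Stiefel W ->
  gd U W <= gd U V + gd V W.
Proof.
move=> sU sV sW; have [ O oO pV] := align_ex sU sV.
have sVO := stiefel_mul sV oO; have [P oP pW] := align_ex sVO sW.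
have sWP := stiefel_mul sW oP; have o1 := @orth1 R p.
rewrite -(gd_orth sU sW o1 oP) -(gd_orth sU sV o1 oO) -(gd_orth sV sW oO oP) mulmx1.
have [Q oQ h] := avec_ge sU sWP; apply: le_trans h _.
apply: le_trans (@avec_triangle _ (V *m O *m Q) _ _ _ _) _; try exact: stiefel_mul.
by apply: lerD; apply: avec_le.
Qed.

Lemma gd_mul (P : 'M[R]_n) U V : Orth P -> gd (P *m U) (P *m V) = gd U V.
Proof. move=> oP; rewrite /gd; have -> // : (P *m U)^T *m (P *m V) = U^T *m V.
by rewrite trmx_mul -mulmxA (mulmxA P^T) oP mul1mx. Qed.

Lemma nrm2_proj U V : Stiefel U -> Stiefel V ->
  nrm2 (V - U *m (U^T *m V)) = p%:R - nrm2 (U^T *m V).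
Proof.
move=> sU sV; rewrite nrm2B nrm2_stiefel // mdotC /mdot trmx_mul -mulmxA.
have -> : \tr ((U^T *m V)^T *m (U^T *m V)) = nrm2 (U^T *m V) by [].
by rewrite {1}/nrm2 /mdot sV mxtrace1; ring.
Qed.

(** y is the sum of the sin^2 of the principal angles, to each of which [sqr_angle_le] applies. *)
Lemma gd_sin U V : Stiefel U -> Stiefel V ->
  let y := nrm2 (V - U *m (U^T *m V)) in y <= 2^-1 -> gd U V ^+ 2 <= y + 2 * y ^+ 2.
Proof.
move=> sU sV y y2; have [ O [Q [th [oO oQ ht e eg]]]] := gd_spec sU sV.
have ey : y = \sum_i sin (th 0 i) ^+ 2.
  rewrite /y nrm2_proj // e -mulmxA nrm2_stiefel // nrm2_orth; last exact: orth_trmx.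
  rewrite {1}/nrm2 /mdot tr_diag_mx diag_mulE mxtrace_diag.
  rewrite [RHS](eq_bigr (fun i => 1 - cos (th 0 i) ^+ 2)) => [|i _]; last by rewrite sin2cos2.
  rewrite sumrB sumr_const card_ord; congr (_ - _).
  by apply: eq_bigr => i _; rewrite !mxE expr2.
have le_y i : sin (th 0 i) ^+ 2 <= y.
  by rewrite ey (bigD1 i) //= lerDl; apply: sumr_ge0 => ? _; rewrite sqr_ge0.
have y0 : 0 <= y by exact: nrm2_ge0.
rewrite eg sqr_sqrtr; last by apply: sumr_ge0 => ? _; rewrite sqr_ge0.
apply: le_trans (_ : \sum_i (sin (th 0 i) ^+ 2 + 2 * y * sin (th 0 i) ^+ 2) <= _); last first.
  rewrite big_split /= -mulr_sumr -ey; lra.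
apply: ler_sum => i _; apply: le_trans (sqr_angle_le (ht i) (le_trans (le_y i) y2)) _.
rewrite lerD2l -mulrA ler_wpM2l // expr2 ler_wpM2r ?sqr_ge0 //.
Qed.

(** By Pythagoras |V - U|^2 is the y of [gd_sin] plus |U^T V - 1|^2. *)
Lemma gd_nrm2B U V : Stiefel U -> Stiefel V -> nrm2 (V - U) <= 2^-1 ->
  gd U V ^+ 2 <= nrm2 (V - U) + 2 * nrm2 (V - U) ^+ 2.
Proof.
move=> sU sV h; set x := nrm2 (V - U) in h *.
have yx : nrm2 (V - U *m (U^T *m V)) <= x.
  have e : nrm2 (V - U) = nrm2 (V - U *m (U^T *m V)) + nrm2 (U^T *m V - 1%:M).
    have eS (A : 'M[R]_(n, p)) : Stiefel A -> nrm2 A = p%:R by rewrite /nrm2 /mdot /Stiefel => ->; exact: mxtrace1.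
    have e1 : nrm2 (1%:M : 'M[R]_p) = p%:R by rewrite /nrm2 /mdot trmx1 mulmx1 mxtrace1.
    have e2 : mdot (U^T *m V) 1%:M = mdot V U by rewrite /mdot mulmx1 trmx_mul trmxK.
    rewrite nrm2_proj // !nrm2B !eS // e1 e2; ring.
  by rewrite /x e lerDl nrm2_ge0.
have y0 := nrm2_ge0 (V - U *m (U^T *m V)).
apply: le_trans (gd_sin sU sV (le_trans yx h)) _.
by rewrite lerD // ler_wpM2l // ler_pXn2r ?nnegrE ?nrm2_ge0.
Qed.

Lemma gd_eq0 U V : Stiefel U -> Stiefel V -> gd U V = 0 -> exists2 O, Orth O & V = U *m O.
Proof.
move=> sU sV g0; have [ O [Q [th [oO oQ ht e eg]]]] := gd_spec sU sV.
have t0 i : th 0 i = 0.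
  apply/eqP; rewrite eq_le -{1}g0 (gd_angle i oO oQ ht e).
  by case/andP: (ht i).
have eN : U^T *m V = O *m Q^T.
  rewrite e (_ : map_mx cos th = const_mx 1) ?diag_const_mx ?mulmx1 //.
  by apply/rowP => i; rewrite !mxE t0 cos0.
exists (U^T *m V); first by rewrite eN; apply: orth_mul => //; exact: orth_trmx.
apply/eqP; rewrite -subr_eq0; apply/eqP/nrm2_eq0; rewrite nrm2_proj // eN.
rewrite nrm2_orth; last exact: orth_trmx.
by rewrite /nrm2 /mdot oO mxtrace1 subrr.
Qed.

Lemma gd_refl U : Stiefel U -> gd U U = 0.
Proof.
move=> sU; have := @gd_decomp U U 1%:M 1%:M 0 (@orth1 _ _) (@orth1 _ _).
rewrite sU trmx1 mulmx1 mul1mx (_ : map_mx cos 0 = const_mx 1).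
  rewrite diag_const_mx => ->//; last by move=> i; rewrite mxE lexx divr_ge0 ?pi_ge0.
  by rewrite big1 ?sqrtr0 // => i _; rewrite mxE expr0n.
by apply/rowP => i; rewrite !mxE cos0.
Qed.

Lemma aligned_Pos U V : Stiefel U -> Stiefel V -> gd U V < pi / 2 -> psd (U^T *m V) ->
  Pos (U^T *m V).
Proof.
move=> sU sV g pN; apply: psd_unit_Pos => //.
have [ O [Q [th [oO oQ ht e eg]]]] := gd_spec sU sV.
rewrite e !unitmx_mul unitmx_tr !(orth_unit oO, orth_unit oQ) ?andbT ?andTb unitmxE det_diag unitfE.
apply/prodf_neq0 => i _; rewrite mxE gt_eqF //; apply: cos_gt0_pihalf.
case/andP: (ht i) => t0 _; have := gd_angle i oO oQ ht e.
have := @pi_gt0 R; lra.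
Qed.

End Frames.

(** * Interlacing and matrices with nonpositive determinant *)

Section Signed.
Variable R : realType.

Lemma det0_ker m (A : 'M[R]_m) : \det A = 0 -> exists2 c : 'cV[R]_m, c != 0 & A *m c = 0.
Proof.
rewrite -det_tr => /eqP/det0P[v v0 vA]; exists v^T; first by rewrite trmx_eq0.
by rewrite -[A]trmxK -trmx_mul vA trmx0.
Qed.

Lemma dot_diag m (d : 'rV[R]_m) c : dot c (diag_mx d *m c) = \sum_i d 0 i * c i 0 ^+ 2.
Proof. by rewrite dotE; apply: eq_bigr => i _; rewrite mul_diag_mx mxE; ring. Qed.

(** Cauchy interlacing by a dimension count: some z supported on the last m coordinates is a
    combination of the first j + 1 eigenvectors of the block and orthogonal to the first j
    eigenvectors of P. The form of P at z is then bounded from both sides. *)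
Lemma interlace m (P E : 'M[R]_(1 + m)) (F : 'M[R]_m) d mu : Orth E -> Orth F ->
  sorted_row d -> sorted_row mu -> P = E *m diag_mx d *m E^T ->
  drsubmx P = F *m diag_mx mu *m F^T ->
  forall j : 'I_m, mu 0 j <= d 0 (widen_ord (leqnSn m) j).
Proof.
move=> oE oF sd smu eP eD j; rewrite leNgt; apply/negP => h.
pose Z : 'M[R]_(1 + m, m) := col_mx 0 F.
(* Rows of index less than j state that z is orthogonal to those eigenvectors of P, rows of index
   greater than j that c vanishes there. Row j is zero, hence det G = 0 and c exists. *)
pose G := \matrix_(i < m, l < m) (if (i < j)%N then (E^T *m Z) (widen_ord (leqnSn m) i) l
  else if i == j then 0 else (i == l)%:R).
have detG : \det G = 0.
  rewrite (expand_det_row _ j) big1 // => l _.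
  by rewrite mxE ltnn eqxx mul0r.
have [c c0 Gc] := det0_ker detG.
have Gi i : \sum_l G i l * c l 0 = 0 by move/matrixP/(_ i 0): Gc; rewrite !mxE.
have cj (i : 'I_m) : (j < i)%N -> c i 0 = 0.
  move=> ji; have := Gi i; rewrite (bigD1 i) //= big1 => [|l li].
    rewrite mxE ltnNge (ltnW ji) /= ifN ?eqxx ?mul1r ?addr0 //.
    by apply: contraTneq ji => ->; rewrite ltnn.
  rewrite mxE ltnNge (ltnW ji) /= ifN; last by apply: contraTneq ji => ->; rewrite ltnn.
  by rewrite eq_sym (negbTE li) mul0r.
pose z := Z *m c; pose y := E^T *m z.
have yi (i : 'I_(1 + m)) : (i < j)%N -> y i 0 = 0.
  move=> ij; have im : (i < m)%N by exact: ltn_trans (ltn_ord j).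
  have := Gi (Ordinal im); rewrite /y /z mulmxA mxE => {2}<-.
  have wk : widen_ord (leqnSn m) (Ordinal im) = i by exact: val_inj.
  by apply: eq_bigr => l _; rewrite [G _ _]mxE /= ij wk.
have zz : dot z z = dot c c.
  by rewrite /z /Z mul_col_mx mul0mx /dot tr_col_mx mul_row_col trmx0 mul0mx add0r -/(dot _ _) stiefel_dot.
have yy : dot y y = dot c c by rewrite /y stiefel_dot //; exact: orth_trmx.
have cc : 0 < dot c c by rewrite dot_gt0.
have e1 : dot z (P *m z) = \sum_i mu 0 i * c i 0 ^+ 2.
  rewrite -dot_diag -[P]submxK /z /Z mul_col_mx mul0mx mul_block_col !mulmx0 !add0r.
  rewrite /dot tr_col_mx mul_row_col trmx0 mul0mx add0r -/(dot _ _) eD.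
  by rewrite -!mulmxA stiefel_dot // (mulmxA F^T) oF mul1mx.
have e2 : dot z (P *m z) = \sum_i d 0 i * y i 0 ^+ 2.
  by rewrite -dot_diag eP -!mulmxA dot_mulr.
have : mu 0 j * dot c c <= d 0 (widen_ord (leqnSn m) j) * dot c c.
  rewrite -{2}yy !dotE !mulr_sumr.
  apply: le_trans (_ : dot z (P *m z) <= _); [rewrite e1|rewrite e2];
    apply: ler_sum => i _; rewrite -expr2.
    have [ij|ji] := leqP i j; first by rewrite ler_wpM2r ?sqr_ge0 // smu.
    by rewrite cj // expr0n !mulr0.
  have [ij|ji] := leqP j i; first by rewrite ler_wpM2r ?sqr_ge0 // sd.
  by rewrite yi // expr0n !mulr0.
by rewrite ler_pM2r // leNgt h.
Qed.

(** From O (1 + O)^T = 1 + O, the determinant of 1 + O equals itself times det O < 0. So it is 0 and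
    -1 is an eigenvalue. *)
Lemma orth_det_neg m (O : 'M[R]_m) : Orth O -> \det O < 0 ->
  exists2 x : 'cV[R]_m, dot x x = 1 & O *m x = - x.
Proof.
move=> oO dO; have d1 : \det (1%:M + O) = 0.
  have e : \det (1%:M + O) = \det O * \det (1%:M + O).
    rewrite -[X in _ = _ * X]det_tr -det_mulmx raddfD /= trmx1 mulmxDr mulmx1 orth_mulV //.
    by rewrite addrC.
  have : (1 - \det O) * \det (1%:M + O) = 0 by rewrite mulrBl mul1r -e subrr.
  by move/eqP; rewrite mulf_eq0 gt_eqF ?subr_gt0 ?(lt_trans dO) //= => /eqP.
have [x x0 hx] := det0_ker d1; have xx : 0 < dot x x by rewrite dot_gt0.
have Ox : O *m x = - x by apply/eqP; rewrite -addr_eq0 addrC -{1}[x]mul1mx -mulmxDl hx.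
exists ((Num.sqrt (dot x x))^-1 *: x).
  rewrite dotZl dotZr mulrA -expr2 exprVn sqr_sqrtr ?ltW // mulVf // gt_eqF //.
by rewrite -scalemxAr Ox scalerN.
Qed.

Lemma orth_entry_ge m (O : 'M[R]_m) i j : Orth O -> -1 <= O i j.
Proof.
move=> oO; rewrite lerNl; apply: le_trans (ler_norm _) _; rewrite normrN.
rewrite -(@ler_pXn2r _ 2) ?nnegrE // real_normK ?num_real // expr1n -(orth_rowsum j oO).
by rewrite (bigD1 i) //= lerDl; apply: sumr_ge0 => ? _; rewrite sqr_ge0.
Qed.

Lemma acos_mul_ge (c o : R) : 0 <= c <= 1 -> -1 <= o <= 1 -> acos c <= acos (c * o).
Proof. by move=> /andP[c0 c1] /andP[x0 x1]; apply: acos_le; nra. Qed.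

Lemma eigen_mem m (E F : 'M[R]_m) (a b : 'rV[R]_m) : Orth E -> Orth F ->
  E *m diag_mx a *m E^T = F *m diag_mx b *m F^T -> forall i, exists j, a 0 i = b 0 j.
Proof.
move=> oE oF e i; pose w := F^T *m E *m delta_mx i (0 : 'I_1).
have ww : dot w w = 1.
  rewrite /w -mulmxA !stiefel_dot ?delta_norm //; exact: orth_trmx.
have [j wj] : exists j, w j 0 != 0.
  apply/existsP; rewrite -negb_forall; apply/negP => /forallP h.
  have w0 : w = 0 by apply/colP => j; rewrite [RHS]mxE; apply/eqP; exact: h.
  by move: ww; rewrite w0 dot0l => /esym/eqP; rewrite oner_eq0.
exists j; have key : diag_mx b *m w = a 0 i *: w.
  have -> : diag_mx b *m w = F^T *m (F *m diag_mx b *m F^T) *m E *m delta_mx i 0.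
    by rewrite /w !mulmxA oF mul1mx.
  rewrite -e -!mulmxA (mulmxA E^T) oE mul1mx (mulmxA F^T) scalemxAr -/w.
  rewrite /w -!mulmxA; congr (_ *m (_ *m _)).
  by apply/colP => k; rewrite mul_diag_mx !mxE; case: eqP => [->|] //=; rewrite !mulr0.
move/colP/(_ j): key; clearbody w; rewrite mul_diag_mx !mxE => h.
by apply: (mulIf wj).
Qed.

(* If det N < 0, the orthogonal factor of N fixes some x up to the sign -1; x is
   taken as one vector of the new basis, and interlacing bounds the others. *)
Lemma signed_diag m (N E F : 'M[R]_m) (al : 'rV[R]_m) : Orth E -> Orth F -> angle_range al ->
  N = E *m diag_mx (map_mx cos al) *m F^T -> \det N <= 0 ->
  exists (Q : 'M[R]_m) j, Orth Q /\
    \sum_i al 0 i ^+ 2 + pi ^+ 2 - 2 * pi * al 0 j <= \sum_i acos ((Q^T *m N *m Q) i i) ^+ 2.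
Proof.
move=> oE oF hal eN; have c01 i : 0 <= cos (al 0 i) <= 1.
  by rewrite cos_le1 cos_pihalf_ge0.
have cK i : acos (cos (al 0 i)) = al 0 i by rewrite cosK // pihalf_itv.
rewrite le_eqVlt => /orP[/eqP dN|dN].
  have [j hj] : exists j, cos (al 0 j) = 0.
    have : \det (diag_mx (map_mx cos al)) == 0.
      move/eqP: dN; rewrite eN !det_mulmx det_tr !mulf_eq0.
      have u (O : 'M[R]_m) : Orth O -> (\det O == 0) = false.
        by move=> /orth_unit; rewrite unitmxE unitfE => /negbTE.
      by rewrite (u _ oE) (u _ oF) orbF.
    rewrite det_diag => /prodf_eq0[j _].
    by rewrite mxE => /eqP hj; exists j.
  exists E, j; split => //.
  (* Now pi^2 - 2 pi al_j = 0, and the left singular vectors E already give the bound. *)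
  have -> : al 0 j = pi / 2 by rewrite -cK hj acos0.
  apply: le_trans (_ : \sum_i al 0 i ^+ 2 <= _); first lra.
  apply: ler_sum => i _; case/andP: (hal i) => a0 _.
  have oW : Orth (F^T *m E) by apply: orth_mul => //; exact: orth_trmx.
  have -> : (E^T *m N *m E) i i = cos (al 0 i) * (F^T *m E) i i.
    rewrite eN !mulmxA oE mul1mx -mulmxA mul_diag_mx !mxE //.
  have h := acos_mul_ge (c01 i) (_ : -1 <= (F^T *m E) i i <= 1).
  rewrite cK orth_entry ?orth_entry_ge // in h.
  by rewrite ler_pXn2r ?nnegrE ?h ?(le_trans a0) ?h.
case: m N E F al oE oF hal eN dN c01 cK => [|m] N E F al oE oF hal eN dN c01 cK.
  by move: dN; rewrite det_mx00 ltr10.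
(* Polar decomposition N = P O with det P >= 0, so the negative sign belongs to O. *)
pose P := E *m diag_mx (map_mx cos al) *m E^T; pose O := E *m F^T.
have oO : Orth O by apply: orth_mul => //; exact: orth_trmx.
have eNPO : N = P *m O by rewrite eN /P /O -!mulmxA (mulmxA E^T) oE mul1mx.
have pP : psd P by apply: orth_diag_psd => // i; rewrite mxE; case/andP: (c01 i).
have dO : \det O < 0.
  have dP : 0 <= \det P.
    rewrite /P !det_mulmx det_tr det_diag mulrAC -expr2 mulr_ge0 ?sqr_ge0 //.
    by apply: prodr_ge0 => i _; rewrite mxE; case/andP: (c01 i).
  rewrite ltNge; apply/negP => h; move: dN; rewrite eNPO det_mulmx ltNge.
  by rewrite mulr_ge0.
clearbody O; have [x x1 Ox] := orth_det_neg oO dO.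
have [H oH Hx] := householder x1.
have sP := psd_sym pP; have [E1 [d [oE1 eP sd]]] := spectral sP.
have dmem : forall i, exists j, d 0 i = cos (al 0 j).
  by move=> i; have [j ->] := eigen_mem oE1 oE (esym eP) i; exists j; rewrite mxE.
have d01 i : 0 <= d 0 i <= 1 by have [j ->] := dmem i.
pose P1 : 'M[R]_(1 + m) := H^T *m P *m H; pose O1 : 'M[R]_(1 + m) := H^T *m O *m H.
have oO1 : Orth O1.
  by apply: orth_mul => //; apply: orth_mul => //; exact: orth_trmx.
have pP1 : psd P1 by rewrite /P1 -{2}[H]trmxK; exact: psd_congr.
have O1e : O1 *m delta_mx 0 (0 : 'I_1) = - delta_mx 0 0.
  by rewrite /O1 -!mulmxA Hx Ox mulmxN -Hx mulmxA oH mul1mx.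
have O1te : O1^T *m delta_mx 0 (0 : 'I_1) = - delta_mx 0 0.
  by rewrite -[X in O1^T *m X]opprK -O1e mulmxN mulmxA oO1 mul1mx.
have cO i : O1 i 0 = -1 * (i == 0)%:R.
  by move/colP/(_ i): O1e; rewrite -colE !mxE eqxx andbT mulN1r.
have rO i : O1 0 i = -1 * (i == 0)%:R.
  by move/colP/(_ i): O1te; rewrite -colE !mxE eqxx andbT mulN1r.
have eO1 := block_corner cO rO.
have sD : (drsubmx P1)^T = drsubmx P1 by rewrite trmx_drsub (psd_sym pP1).
have [F1 [mu [oF1 eD smu]]] := spectral sD.
have eP1 : P1 = (H^T *m E1) *m diag_mx d *m (H^T *m E1)^T.
  by rewrite /P1 eP trmx_mul trmxK !mulmxA.
have oHE : Orth (H^T *m E1) by apply: orth_mul => //; exact: orth_trmx.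
have mud := interlace oHE oF1 sd smu eP1 eD.
pose B : 'M[R]_(1 + m) := block_mx 1%:M 0 0 F1.
have oB : Orth B by exact: orth_block.
have mu0 j : 0 <= mu 0 j.
  have := dot_eigen mu j oF1; rewrite -eD => <-.
  have /psdE[_ /(_ (col_mx 0 (F1 *m delta_mx j 0)))] := pP1.
  rewrite -{1}[P1]submxK mul_block_col !mulmx0 !add0r.
  by rewrite /dot tr_col_mx mul_row_col trmx0 mul0mx add0r.
(* The smallest eigenvalue of P; acos l = al_j is the angle that turns into pi - al_j. *)
pose l := d 0 ord_max.
have [j ej] := dmem ord_max.
have al_j : acos l = al 0 j by rewrite /l ej cK.
exists (H *m B), j; split; first exact: orth_mul.
have sum_al : \sum_i al 0 i ^+ 2 = \sum_i acos (d 0 i) ^+ 2.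
  have /(congr1 (fun A => \tr (symfun (fun x => acos x ^+ 2) A))) := eP.
  rewrite /P !symfun_orth // !trace_orth_diag //.
  under eq_bigr do rewrite !mxE cK; move=> ->.
  by apply: eq_bigr => i _; rewrite mxE.
pose W := B^T *m O1 *m B.
have oW : Orth W by apply: orth_mul => //; apply: orth_mul => //; exact: orth_trmx.
have eQ : (H *m B)^T *m N *m (H *m B) = (B^T *m P1 *m B) *m W.
  rewrite /W /P1 /O1 eNPO trmx_mul -!mulmxA; congr (_ *m (_ *m (_ *m _))).
  by rewrite (mulmxA B) orth_mulV // mul1mx (mulmxA H) orth_mulV // mul1mx.
pose b := B^T *m P1 *m B.
have eb : b = block_mx (ulsubmx P1) (ursubmx P1 *m F1) (F1^T *m dlsubmx P1) (diag_mx mu).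
  rewrite /b /B -[P1 in LHS]submxK tr_block_mx !mulmx_block !trmx0 trmx1.
  rewrite !(mul0mx, mulmx0, mul1mx, mulmx1, addr0, add0r); congr block_mx.
  by rewrite eD -!mulmxA oF1 mulmx1 mulmxA oF1 mul1mx.
have eW : W = block_mx (- 1)%:M 0 0 (F1^T *m drsubmx O1 *m F1).
  rewrite /W /B eO1 tr_block_mx !mulmx_block !trmx0 trmx1.
  by rewrite !(mul0mx, mulmx0, mul1mx, mulmx1, addr0, add0r) block_mxKdr.
have oHB : Orth (H *m B) by exact: orth_mul.
have a_l : l <= ulsubmx P1 0 0 <= 1.
  have -> : ulsubmx P1 0 0 = dot x (P *m x).
    have eu (A : 'M[R]_(1 + m)) : ulsubmx A 0 0 = A 0 0.
      by rewrite !mxE; congr (A _ _); exact: val_inj.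
    by rewrite eu -Hx dot_mull (mulmxA P) (mulmxA H^T) dot_delta /P1 -(mulmxA H^T).
  have hx : dot x (P *m x) = \sum_i d 0 i * (E1^T *m x) i 0 ^+ 2.
    by rewrite -dot_diag eP -!mulmxA dot_mulr.
  have hs : \sum_i (E1^T *m x) i 0 ^+ 2 = 1.
    rewrite -x1 -(stiefel_dot x x (orth_trmx oE1)) dotE.
    by apply: eq_bigr => i _; rewrite expr2.
  rewrite hx -hs -{1}[l]mulr1 -{1}hs mulr_sumr; apply/andP; split; apply: ler_sum => i _.
    by rewrite ler_wpM2r ?sqr_ge0 // sd // -ltnS.
  by rewrite ler_piMl ?sqr_ge0 //; case/andP: (d01 i).
case/andP: a_l => al0 al1.
have l01 : 0 <= l <= 1 by exact: d01.
have hsplit (f : 'I_(1 + m) -> R) :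
    \sum_(i < m.+1) f i = f (lshift m ord0) + \sum_(i < m) f (rshift 1 i).
  by transitivity (\sum_(i < 1 + m) f i) => //; rewrite big_split_ord /= big_ord1.
rewrite eQ -/b eb eW mulmx_block !mulmx0 !add0r !addr0.
rewrite [leRHS]hsplit.
rewrite (block_mxEul (ulsubmx P1 *m (- 1)%:M) (ursubmx P1 *m F1 *m (F1^T *m drsubmx O1 *m F1))
  (F1^T *m dlsubmx P1 *m (- 1)%:M) (diag_mx mu *m (F1^T *m drsubmx O1 *m F1)) ord0 ord0).
rewrite sum_al big_ord_recr /=.
(* The corner entry is - <x, P x>, and <x, P x> is at least l. *)
have h0 : (pi - acos l) ^+ 2 <= acos ((ulsubmx P1 *m (- 1)%:M) 0 0) ^+ 2.
  rewrite mul_mx_scalar mxE mulN1r acosN ?al1 ?(le_trans _ al0) //; last first.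
    by apply: le_trans (_ : 0 <= _); [rewrite lerN10|case/andP: l01].
  have h1 : acos (ulsubmx P1 0 0) <= acos l.
    by apply: acos_le => //; apply: le_trans (_ : 0 <= _); [rewrite lerN10|case/andP: l01].
  have [h2 h3] := andP (acos_pihalf l01).
  rewrite ler_pXn2r ?nnegrE //; lra.
(* Interlacing pairs the other entries with the remaining angles: mu_i <= d_i, and the orthogonal
   factor can only lower the cosine. *)
have hj i : acos (d 0 (widen_ord (leqnSn m) i)) ^+ 2 <=
    acos ((block_mx (ulsubmx P1 *m (- 1)%:M) (ursubmx P1 *m F1 *m (F1^T *m drsubmx O1 *m F1))
      (F1^T *m dlsubmx P1 *m (- 1)%:M) (diag_mx mu *m (F1^T *m drsubmx O1 *m F1)))
      (rshift 1 i) (rshift 1 i)) ^+ 2.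
  rewrite block_mxEdr mul_diag_mx mxE.
  have := d01 (widen_ord (leqnSn m) i); have := mud i; have := mu0 i.
  set c := d _ _ => m0 mc c1; set o := (_ *m F1) i i.
  have ho : -1 <= o <= 1.
    have -> : o = W (rshift 1 i) (rshift 1 i) by rewrite eW block_mxEdr.
    by rewrite orth_entry ?orth_entry_ge.
  case/andP: c1 => c0 c1; have m1 : 0 <= mu 0 i <= 1 by rewrite m0 (le_trans mc).
  have h1 := acos_mul_ge m1 ho.
  have h2 : acos c <= acos (mu 0 i) by apply: acos_le => //; apply: le_trans m0; rewrite lerN10.
  have c2 : 0 <= c <= 1 by rewrite c0.
  have /andP[h3 _] := acos_pihalf c2.
  rewrite ler_pXn2r ?nnegrE //; lra.
rewrite -/l -al_j; apply: le_trans (lerD h0 (ler_sum _ (fun i _ => hj i))).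
rewrite le_eqVlt; apply/orP; left; apply/eqP; ring.
Qed.

End Signed.

(** * Orientation, reflections and the midpoint inequality *)

Section Midpoint.
Variables (R : realType) (n p : nat).
Implicit Types U V W : 'M[R]_(n, p).

Lemma psd_det_ge0 m (A : 'M[R]_m) : psd A -> 0 <= \det A.
Proof.
move=> /psd_spec[ O [d [oO -> d0 _]]]; rewrite !det_mulmx det_tr det_diag mulrAC -expr2.
by rewrite mulr_ge0 ?sqr_ge0 // prodr_ge0.
Qed.

Lemma Pos_det_gt0 m (A : 'M[R]_m) : Pos A -> 0 < \det A.
Proof.
move=> pA; rewrite lt_def psd_det_ge0 ?andbT; last exact: Pos_psd.
by rewrite -unitfE -unitmxE Pos_unit.
Qed.

Lemma gd_orthr U V O : Stiefel U -> Stiefel V -> Orth O -> gd U (V *m O) = gd U V.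
Proof.
by move=> sU sV oO; rewrite -[U in LHS]mulmx1 gd_orth //; exact: orth1.
Qed.

Lemma gd_orthl U V O : Stiefel U -> Stiefel V -> Orth O -> gd (U *m O) V = gd U V.
Proof.
by move=> sU sV oO; rewrite -[V in LHS]mulmx1 gd_orth //; exact: orth1.
Qed.

Lemma gd_det U V : Stiefel U -> Stiefel V -> gd U V < pi / 2 -> \det (U^T *m V) != 0.
Proof.
move=> sU sV g; have [ O oO pN] := align_ex sU sV.
have g1 : gd U (V *m O) < pi / 2 by rewrite gd_orthr.
have := Pos_det_gt0 (aligned_Pos sU (stiefel_mul sV oO) g1 pN).
rewrite mulmxA det_mulmx => h; apply: contraTneq h => ->.
by rewrite mul0r ltxx.
Qed.

Lemma align_pos U V : Stiefel U -> Stiefel V -> gd U V < pi / 2 ->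
  exists O, [/\ Orth O, Stiefel (V *m O), Pos (U^T *m (V *m O)) & gd U (V *m O) = gd U V].
Proof.
move=> sU sV g; have [ O oO pN] := align_ex sU sV.
have e : gd U (V *m O) = gd U V by exact: gd_orthr.
exists O; split => //; first exact: stiefel_mul.
by apply: aligned_Pos => //; [exact: stiefel_mul|rewrite e].
Qed.

Lemma acos_aligned_le U V x : Stiefel U -> Stiefel V -> psd (U^T *m V) -> dot x x = 1 ->
  acos (dot (U *m x) (V *m x)) <= gd U V.
Proof.
move=> sU sV pN x1; have := stiefel_dot_le1 sU sV x1; rewrite ler_norml => h1.
have [gpi|/ltW gpi] := leP (gd U V) pi; last exact: le_trans (acos_lepi h1) gpi.
have [ O [d [oO e d0 _]]] := psd_spec pN.
have d1 i := stiefel_diag_le1 i sU sV oO oO e.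
have ed : d = map_mx cos (map_mx acos d).
  by apply/rowP => i; rewrite !mxE acosK // in_itv /=.
have ht : angle_range (map_mx acos d).
  by move=> i; rewrite mxE; apply: acos_pihalf; rewrite d0; case/andP: (d1 i).
apply: acos_le_cos => //; first by rewrite gd_ge0.
rewrite dot_mull mulmxA e -!mulmxA dot_mulr dot_diag.
have y1 : dot (O^T *m x) (O^T *m x) = 1 by rewrite stiefel_dot //; exact: orth_trmx.
rewrite -[leLHS]mulr1 -y1 dotE mulr_sumr; apply: ler_sum => i _; rewrite -expr2.
rewrite ler_wpM2r ?sqr_ge0 // ed mxE mxE; have ha := ht i; rewrite mxE in ha.
case/andP: ha => a0 _; apply: cos_le => //.
rewrite ed in e; have := gd_angle i oO oO ht e; by rewrite mxE.
Qed.

(** Otherwise the aligning rotation T has negative determinant, so T x = - x for a unit vector x.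
    Then U x is near W S x by way of V and near - W S x directly, and the three distances add up to
    at least pi. *)
Lemma orientation U V W : Stiefel U -> Stiefel V -> Stiefel W ->
  0 < \det (U^T *m V) -> 0 < \det (V^T *m W) ->
  gd U V + gd V W + gd U W < pi -> gd U W < pi / 2 -> 0 < \det (U^T *m W).
Proof.
move=> sU sV sW dUV dVW hsum hUW.
have [P oP pV] := align_ex sU sV; have sVP := stiefel_mul sV oP.
have dP : 0 < \det P.
  have := psd_det_ge0 pV; rewrite mulmxA det_mulmx pmulr_rge0 // le_eqVlt.
  case/orP => [/eqP d0|//]; have := orth_unit oP.
  by rewrite unitmxE -d0 unitr0.
have [S oS pW] := align_ex sVP sW; have sWS := stiefel_mul sW oS.
have dVPW : 0 < \det ((V *m P)^T *m W).
  by rewrite trmx_mul -mulmxA det_mulmx det_tr mulr_gt0.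
have dS : 0 < \det S.
  have := psd_det_ge0 pW; rewrite mulmxA det_mulmx pmulr_rge0 // le_eqVlt.
  case/orP => [/eqP d0|//]; have := orth_unit oS.
  by rewrite unitmxE -d0 unitr0.
rewrite lt_def gd_det //= leNgt; apply/negP => dUW.
have [T oT pT] := align_ex sU sWS; have sWST := stiefel_mul sWS oT.
have dT : \det T < 0.
  have := psd_det_ge0 pT; rewrite mulmxA det_mulmx (mulmxA U^T) det_mulmx.
  rewrite nmulr_rge0 ?nmulr_rlt0 // le_eqVlt; case/orP => [/eqP d0|//].
  by have := orth_unit oT; rewrite unitmxE d0 unitr0.
have [x x1 Tx] := orth_det_neg oT dT.
have h1 := acos_aligned_le sU sVP pV x1; have h2 := acos_aligned_le sVP sWS pW x1.
have h3 := acos_aligned_le sU sWST pT x1.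
rewrite gd_orthr // in h1; rewrite gd_orth // in h2.
rewrite -(mulmxA W) gd_orthr // in h3; last exact: orth_mul.
have n1 A : Stiefel A -> dot (A *m x) (A *m x) = 1 by move=> sA; rewrite stiefel_dot.
have ht := sphere_triangle (n1 _ _ sU) (n1 _ _ sVP) (n1 _ _ sWS).
have e3 : dot (U *m x) (W *m (S *m T) *m x) = - dot (U *m x) (W *m S *m x).
  by rewrite (mulmxA W) -(mulmxA _ T) Tx mulmxN dotNr.
rewrite e3 acosN in h3; last exact: dot_itv (n1 _ _ sU) (n1 _ _ sWS).
lra.
Qed.

(** Two coordinates of x + y are at least pi; the sqrt 2 in the admissible radius comes from
    here. *)
Lemma two_coordinates m (x y : 'rV[R]_m) i j : i != j ->
  pi <= x 0 i + y 0 i -> pi <= x 0 j + y 0 j -> Num.sqrt 2 * pi <= nrm x + nrm y.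
Proof.
move=> ij hi hj; have p0 := @pi_ge0 R; apply: le_trans (nrm_triangle x y).
rewrite -(@ler_pXn2r _ 2) ?nnegrE ?nrm_ge0 ?mulr_ge0 ?sqrtr_ge0 //.
rewrite sqr_nrm exprMn sqr_sqrtr // nrm2_row (bigD1 i) //= (bigD1 j) 1?eq_sym //= addrA.
rewrite ler_wpDr //; first by apply: sumr_ge0 => ? _; rewrite sqr_ge0.
have sq (z : R) : pi <= z -> pi ^+ 2 <= z ^+ 2.
  by move=> hz; rewrite ler_pXn2r ?nnegrE //; apply: le_trans hz.
by rewrite !mxE; have := sq _ hi; have := sq _ hj; lra.
Qed.

(** For orthonormal U, 1 on the span and -1 on its complement: the geodesic symmetry of the
    Grassmannian at span U. *)
Definition refl U : 'M[R]_n := 2 *: (U *m U^T) - 1%:M.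

Lemma refl_tr U : (refl U)^T = refl U.
Proof. by rewrite /refl linearB linearZ /= trmx_mul trmxK trmx1. Qed.

Lemma refl_fix U : Stiefel U -> refl U *m U = U.
Proof.
move=> sU; rewrite /refl mulmxBl -scalemxAl -mulmxA sU mulmx1 mul1mx.
by rewrite -[X in _ - X]scale1r -scalerBl (_ : 2 - 1 = 1) ?scale1r //; ring.
Qed.

Lemma refl_sqr U : Stiefel U -> refl U *m refl U = 1%:M.
Proof.
move=> sU; rewrite {2}/refl mulmxBr mulmx1 -scalemxAr mulmxA refl_fix //.
by rewrite /refl opprB addrC subrK.
Qed.

Lemma refl_orth U : Stiefel U -> Orth (refl U).
Proof. by move=> sU; rewrite /Orth /Stiefel refl_tr refl_sqr. Qed.

Lemma refl_mulr U O : Orth O -> refl (U *m O) = refl U.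
Proof. by move=> oO; rewrite /refl trmx_mul !mulmxA -(mulmxA U) orth_mulV // mulmx1. Qed.

(* The reflection of U through M is reached from U through W by a path of length
   f1 + f2.  Its principal angles with U are twice those of M and U as long as
   the latter are at most pi / 4; signed_diag handles one larger angle, and
   two_coordinates excludes two of them. *)
Theorem midpoint_ineq U M W : Stiefel U -> Stiefel M -> Stiefel W ->
  let f1 := gd W U in let f2 := gd (refl M *m W) U in let c := gd M U in let e := gd W M in
  f1 < pi / 2 -> f2 < pi / 2 -> c < pi / 2 -> e < pi / 2 ->
  f1 + e + c < pi -> f2 + e + c < pi -> f1 + f2 + 2 * c < Num.sqrt 2 * pi ->
  2 * c <= f1 + f2.
Proof.
move=> sU sM0 sW0 f1 f2 c e f1l f2l cl el s1 s2 s3.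
have p0 := @pi_gt0 R.
have [ O1 [oO1 sW pW eW]] := align_pos sU sW0 (ltac:(by rewrite gd_sym)).
have [ O2 [oO2 sM pM eM]] := align_pos sU sM0 (ltac:(by rewrite gd_sym)).
set W1 := W *m O1 in sW pW eW; set M1 := M *m O2 in sM pM eM.
rewrite [RHS]gd_sym // -/f1 in eW; rewrite [RHS]gd_sym // -/c in eM.
have es : refl M = refl M1 by rewrite refl_mulr.
set s := refl M in f2 f2l s2 s3 es *.
have os : Orth s by exact: refl_orth.
have ss : s *m s = 1%:M by exact: refl_sqr.
have ts : s^T = s by exact: refl_tr.
have sM1 : s *m M1 = M1 by rewrite es refl_fix.
have ssU : Stiefel (s *m U) by exact: stiefel_mul.
have eWsU : gd W1 (s *m U) = f2.
  have ssW : Stiefel (s *m W) by exact: stiefel_mul.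
  by rewrite -(gd_mul _ _ os) mulmxA ss mul1mx /W1 mulmxA gd_orthl.
have [ O3 [oO3 sV pV eV]] := align_pos sW ssU (ltac:(by rewrite eWsU)).
set V := s *m U *m O3 in sV pV eV; rewrite eWsU in eV.
have eWM : gd W1 M1 = e by rewrite gd_orth.
(* Signs of determinants are followed along the triangles W, U, M and W, M, s U; they give the
   alignment O3 of the last leg a positive determinant. *)
have dWM : 0 < \det (W1^T *m M1).
  apply: (@orientation W1 U M1) => //.
  - by rewrite -det_tr trmx_mul trmxK; exact: Pos_det_gt0.
  - exact: Pos_det_gt0.
  - by rewrite (gd_sym sW sU) eW eM eWM; clear -s1; lra.
  - by rewrite eWM.
have dMs : M1^T *m (s *m U) = M1^T *m U by rewrite mulmxA -{1}ts -trmx_mul sM1.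
have eMs : gd M1 (s *m U) = c.
  by rewrite -(gd_mul _ _ os) mulmxA ss mul1mx sM1 gd_sym.
have dWs : 0 < \det (W1^T *m (s *m U)).
  apply: (@orientation W1 M1 (s *m U)) => //.
  - by rewrite dMs -det_tr trmx_mul trmxK; exact: Pos_det_gt0.
  - by rewrite eWM eMs eWsU; clear -s2; lra.
  - by rewrite eWsU.
have dO3 : 0 < \det O3.
  by have := Pos_det_gt0 pV; rewrite mulmxA det_mulmx pmulr_rgt0.
(* Valid for every Q, in particular for the one that [signed_diag] will choose. *)
have path Q : Orth Q -> nrm (avec (U *m Q) (V *m Q)) <= f1 + f2.
  move=> oQ; apply: le_trans (@avec_triangle _ _ _ _ (W1 *m Q) _ _ _ _) _; try exact: stiefel_mul.
  rewrite -eW -eV; apply: lerD; apply: avec_le => //; exact: Pos_psd.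
have gUV : gd U V <= f1 + f2 by rewrite -eW -eV; exact: gd_triangle.
have [P [Q [th [oP oQ ht eN ec]]]] := gd_spec sM sU.
have ecn : c = nrm th by rewrite -eM gd_sym // (gd_nrm oP oQ ht eN).
(* By cos (2 t) = 2 cos^2 t - 1 the angles are doubled, possibly beyond pi / 2. *)
have eK : U^T *m (s *m U) = Q *m diag_mx (map_mx (fun t => cos (2 * t)) th) *m Q^T.
  have -> : U^T *m (s *m U) = 2 *: ((M1^T *m U)^T *m (M1^T *m U)) - 1%:M.
    rewrite es /refl mulmxBl mul1mx mulmxBr sU -scalemxAl -scalemxAr [(M1^T *m U)^T]trmx_mul trmxK.
    by rewrite !mulmxA.
  rewrite eN !trmx_mul trmxK tr_diag_mx -!mulmxA (mulmxA P^T) oP mul1mx.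
  rewrite -[X in _ - X](orth_mulV oQ) -[X in _ - _ *m X]mul1mx scalemxAr -mulmxBr.
  congr (_ *m _); rewrite mulmxA scalemxAl -mulmxBl; congr (_ *m _).
  rewrite diag_mulE; apply/matrixP => i j; rewrite !mxE mulrC -mulr_natl.
  by case: eqP => // _; rewrite ?mulr1n ?mulr0n; rewrite ?(mulr_natl, cos_mulr2n); ring.
(* The doubled angles folded back to [0, pi / 2], with [sg] carrying the sign of the cosine. *)
pose al : 'rV[R]_p := map_mx (fun t => if t <= pi / 4 then 2 * t else pi - 2 * t) th.
pose sg : 'rV[R]_p := map_mx (fun t => if t <= pi / 4 then 1 else -1) th.
have hal : angle_range al.
  by move=> i; have := ht i; rewrite mxE; move: (th 0 i) => t; clear -p0; case: (leP t (pi / 4)); lra.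
pose F : 'M[R]_p := (diag_mx sg *m Q^T *m O3)^T.
have osg : Orth (diag_mx sg).
  rewrite /Orth /Stiefel tr_diag_mx diag_mulE; apply/matrixP => i j; rewrite !mxE.
  by case: ifP => _; rewrite ?mulrNN mulr1.
have oF : Orth F.
  by apply: orth_trmx; apply: orth_mul => //; apply: orth_mul => //; exact: orth_trmx.
have eV' : U^T *m V = Q *m diag_mx (map_mx cos al) *m F^T.
  rewrite /V !mulmxA -(mulmxA U^T) eK /F trmxK !mulmxA -(mulmxA Q _ (diag_mx sg)).
  congr (_ *m _ *m _ *m _); rewrite diag_mulE; congr diag_mx; apply/rowP => i; rewrite !mxE.
  by case: ifP => _; rewrite ?mulr1 // cosB cospi sinpi; ring.
have gal : gd U V = nrm al by exact: gd_nrm oQ oF hal eV'.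
have n2c : nrm (2 *: th) = 2 * c by rewrite nrmZ ger0_norm // ecn.
have dN : \det (U^T *m V) = \det O3 * \prod_i cos (2 * th 0 i).
  have dQ : \det Q * \det Q = 1 by rewrite -[X in X * _]det_tr -det_mulmx oQ det1.
  rewrite /V (mulmxA U^T) eK !det_mulmx det_tr det_diag (mulrAC (\det Q)) dQ mul1r mulrC.
  by congr (_ * _); apply: eq_bigr => i _; rewrite mxE.
have [hsmall|/existsP[j0]] := boolP [forall i, th 0 i <= pi / 4].
  have -> : 2 * c = gd U V; last by [].
  rewrite gal -n2c; congr nrm; apply/rowP => i; rewrite !mxE.
  by move/forallP: hsmall => ->.
move=> hj0; have big i : ~~ (th 0 i <= pi / 4) -> al 0 i = pi - 2 * th 0 i.
  by rewrite mxE => /negbTE ->.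
(* If two angles are folded, al + 2 th = pi in both coordinates, and [two_coordinates] contradicts
   the bound sqrt 2 * pi. *)
have [/existsP[j1 /andP[j10 hj1]]|/existsPn one] :=
    boolP [exists j, (j != j0) && ~~ (th 0 j <= pi / 4)].
  have h := two_coordinates j10 (x := al) (y := 2 *: th).
  rewrite -gal n2c !big // !mxE !subrK in h; have {h} := h (lexx _) (lexx _); clear -gUV s3; lra.
have small i : i != j0 -> th 0 i <= pi / 4.
  by move=> ij; have := one i; rewrite ij negbK.
(* Only the angle at j0 is folded, so one cosine is at most 0 and the others are nonnegative. *)
have dN0 : \det (U^T *m V) <= 0.
  rewrite dN pmulr_rle0 // (bigD1 j0) //= mulr_le0_ge0 //.
    have -> : 2 * th 0 j0 = 2 * th 0 j0 - pi + pi by ring.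
    rewrite cosDpi oppr_le0; apply: cos_ge0_pihalf.
    by have := ht j0; move: hj0; rewrite -ltNge; clear -p0; lra.
  apply: prodr_ge0 => i ij; apply: cos_ge0_pihalf.
  by have := ht i; have := small i ij; clear -p0; lra.
have [Q1 [js [oQ1]]] := signed_diag oQ oF hal eV' dN0.
have -> : \sum_i acos ((Q1^T *m (U^T *m V) *m Q1) i i) ^+ 2 = nrm2 (avec (U *m Q1) (V *m Q1)).
  by rewrite nrm2_row; apply: eq_bigr => i _; rewrite [avec _ _ _ _]mxE [(U *m Q1)^T]trmx_mul !mulmxA.
(* [be] unfolds the angle js picked by [signed_diag]. If js = j0 it is 2 th; otherwise [be] and 2 th
   add up to pi in the coordinates js and j0. *)
move=> hq; pose be : 'rV[R]_p := \row_j (if j == js then pi - al 0 j else al 0 j).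
have ebe : nrm2 be = \sum_i al 0 i ^+ 2 + pi ^+ 2 - 2 * pi * al 0 js.
  rewrite nrm2_row (bigD1 js) //= [in RHS](bigD1 js) //= mxE eqxx.
  rewrite (eq_bigr (fun i => al 0 i ^+ 2)) => [|i /negbTE ij]; last by rewrite mxE ij.
  ring.
have hbe : nrm be <= f1 + f2.
  by apply: le_trans (path Q1 oQ1); rewrite /nrm ler_wsqrtr // ebe.
have [ej|jn] := eqVneq js j0.
  have -> : 2 * c = nrm be; last by [].
  rewrite -n2c; congr nrm; apply/rowP => i; rewrite [RHS]mxE ej mxE.
  have [->|ij] := eqVneq i j0; first by rewrite big // opprB addrC subrK.
  by rewrite mxE small.
have h := two_coordinates jn (x := be) (y := 2 *: th).
rewrite n2c !mxE eqxx (eq_sym j0) (negbTE jn) (small _ jn) (negbTE hj0) !subrK in h.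
have {h} := h (lexx _) (lexx _); clear -hbe s3; lra.
Qed.

End Midpoint.

(** * Geodesics and the Karcher mean on the Grassmannian *)

Section Geodesic.
Variables (R : realType) (n p : nat).
Implicit Types (U V a b : 'M[R]_(n, p)) (t s h : R).

Definition gcos t m (G : 'M[R]_m) := symfun (fun x => cos (t * Num.sqrt x)) G.

(** Geodesics and their derivatives have this form, and [frm_gram] reduces identities between them
    to scalar identities in an eigenvalue x of a^T a. *)
Definition frm U a (f g : R -> R) : 'M[R]_(n, p) :=
  U *m symfun f (a^T *m a) + a *m symfun g (a^T *m a).

(* The geodesic from U with velocity a.  The eigenvalue x = 0, where the quotient
   is 0 instead of t, is harmless since a vanishes on that eigenspace. *)
Definition gexp U a t := frm U a (fun x => cos (t * Num.sqrt x))
  (fun x => sin (t * Num.sqrt x) / Num.sqrt x).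

Definition gexp_der U a t := frm U a (fun x => - (Num.sqrt x * sin (t * Num.sqrt x)))
  (fun x => cos (t * Num.sqrt x)).

Lemma mxtrD m k (A B : 'M[R]_(m, k)) : (A + B)^T = A^T + B^T.
Proof. by apply/matrixP => i j; rewrite !mxE. Qed.

Lemma mxtrN m k (A : 'M[R]_(m, k)) : (- A)^T = - A^T.
Proof. by apply/matrixP => i j; rewrite !mxE. Qed.

Lemma gram_psd m k (A : 'M[R]_(m, k)) : psd (A^T *m A).
Proof.
apply/psdE; split; first by rewrite trmx_mul trmxK.
by move=> x; rewrite -mulmxA -dot_mull dot_ge0.
Qed.

Lemma frm_eq U a f g f' g' : (forall x, 0 <= x -> f x = f' x) ->
  (forall x, 0 <= x -> g x = g' x) -> frm U a f g = frm U a f' g'.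
Proof.
move=> hf hg; have pG := gram_psd a.
by rewrite /frm (symfun_eq_psd pG hf) (symfun_eq_psd pG hg).
Qed.

Lemma frm_mulr U a f g (h : R -> R) : frm U a f g *m symfun h (a^T *m a) =
  frm U a (fun x => f x * h x) (fun x => g x * h x).
Proof. by rewrite /frm mulmxDl -!mulmxA !symfun_mul //; exact/psd_sym/gram_psd. Qed.

Lemma frm_add U a f g f' g' :
  frm U a f g + frm U a f' g' = frm U a (fun x => f x + f' x) (fun x => g x + g' x).
Proof.
by rewrite /frm addrACA -!mulmxDr !symfun_add //; exact/psd_sym/gram_psd.
Qed.

Lemma frm_scale U a f g c :
  c *: frm U a f g = frm U a (fun x => c * f x) (fun x => c * g x).
Proof.
by rewrite /frm scalerDr !scalemxAr !symfun_scale //; exact/psd_sym/gram_psd.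
Qed.

Lemma frm_gram U a (f g f' g' : R -> R) : Stiefel U -> U^T *m a = 0 ->
  (frm U a f g)^T *m frm U a f' g' =
  symfun (fun x => f x * f' x + g x * (x * g' x)) (a^T *m a).
Proof.
move=> sU Ua; have pG := gram_psd a; have sG := psd_sym pG.
have aU : a^T *m U = 0 by rewrite -[a^T *m U]trmxK trmx_mul trmxK Ua trmx0.
rewrite /frm mxtrD !trmx_mul !symfun_sym // mulmxDl !mulmxDr.
rewrite -!mulmxA (mulmxA U^T U) sU mul1mx (mulmxA U^T a) Ua mul0mx mulmx0 addr0.
rewrite (mulmxA a^T U) aU mul0mx mulmx0 add0r (mulmxA a^T a).
rewrite -[X in _ *m (X *m symfun g' _)](symfun_id sG).
by rewrite !symfun_mul // symfun_add.
Qed.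

Lemma gexp_gram U a s t : Stiefel U -> U^T *m a = 0 ->
  (gexp U a s)^T *m gexp U a t = gcos (t - s) (a^T *m a).
Proof.
move=> sU Ua; rewrite frm_gram //; apply: symfun_eq_psd; first exact: gram_psd.
move=> x; rewrite le_eqVlt => /orP[/eqP<-|x0].
  by rewrite sqrtr0 !mulr0 cos0 mul0r mulr0 addr0 mulr1.
have y0 : 0 < Num.sqrt x by rewrite sqrtr_gt0.
move: y0 (sqr_sqrtr (ltW x0)); move: (Num.sqrt x) => y y0 <-; rewrite mulrBl cosB; field.
by rewrite gt_eqF.
Qed.

Lemma gcos0 m (G : 'M[R]_m) : psd G -> gcos 0 G = 1%:M.
Proof.
move=> pG; rewrite -(symfun_cst 1 (psd_sym pG)); apply: symfun_eq_psd => // x _.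
by rewrite mul0r cos0.
Qed.

Lemma gexp_stiefel U a t : Stiefel U -> U^T *m a = 0 -> Stiefel (gexp U a t).
Proof. by move=> sU Ua; rewrite /Stiefel gexp_gram // subrr gcos0 //; exact: gram_psd. Qed.

Lemma gram_spec a : exists (Q : 'M[R]_p) (y : 'rV[R]_p),
  [/\ Orth Q, forall i, 0 <= y 0 i, forall i, y 0 i <= nrm a,
      \sum_i y 0 i ^+ 2 = nrm2 a
    & forall f, symfun f (a^T *m a) = Q *m diag_mx (\row_i f (y 0 i ^+ 2)) *m Q^T].
Proof.
have [Q [d [oQ eG d0 hf]]] := psd_spec (gram_psd a).
have e : \sum_i d 0 i = nrm2 a by rewrite /nrm2 /mdot eG trace_orth_diag.
exists Q, (map_mx Num.sqrt d); split => //.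
- by move=> i; rewrite mxE sqrtr_ge0.
- move=> i; rewrite mxE /nrm ler_wsqrtr // -e (bigD1 i) //= lerDl.
  by apply: sumr_ge0 => j _.
- by rewrite -e; apply: eq_bigr => i _; rewrite mxE sqr_sqrtr.
move=> f; rewrite hf; congr (_ *m diag_mx _ *m _); apply/rowP => i.
by rewrite !mxE sqr_sqrtr.
Qed.

(** The principal angles are |t - s| y_i. They are at most pi / 2 as y_i <= |a| = 1, and have norm
    |t - s| as the y_i^2 add up to 1. *)
Lemma gexp_gd U a s t : Stiefel U -> U^T *m a = 0 -> nrm a = 1 -> `|t - s| <= pi / 2 ->
  gd (gexp U a s) (gexp U a t) = `|t - s|.
Proof.
move=> sU Ua a1 h; have [Q [y [oQ y0 y1 ey hf]]] := gram_spec a.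
rewrite (@gd_decomp _ _ _ _ _ Q Q (`|t - s| *: y)) //.
- rewrite (eq_bigr (fun i => `|t - s| ^+ 2 * y 0 i ^+ 2)) => [|i _]; last first.
    by rewrite mxE exprMn.
  by rewrite -mulr_sumr ey -sqr_nrm a1 expr1n mulr1 sqrtr_sqr normr_id.
- move=> i; rewrite mxE mulr_ge0 //=; apply: le_trans h.
  by rewrite ler_piMr // -a1.
rewrite gexp_gram // /gcos hf; congr (_ *m diag_mx _ *m _); apply/rowP => i.
rewrite !mxE sqrtr_sqr ger0_norm // -[LHS]cos_norm normrM (ger0_norm (y0 i)) //.
Qed.

Lemma gexp_refl U a m h : Stiefel U -> U^T *m a = 0 ->
  refl (gexp U a m) *m gexp U a (m + h) = gexp U a (m - h).
Proof.
move=> sU Ua; rewrite /refl mulmxBl mul1mx -scalemxAl -mulmxA gexp_gram //.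
have -> : m + h - m = h by ring.
rewrite frm_mulr frm_scale -scaleN1r frm_scale frm_add; apply: frm_eq => x x0.
  have -> : (m - h) * Num.sqrt x = m * Num.sqrt x - h * Num.sqrt x by ring.
  by rewrite (mulrDl m h) cosD cosB; ring.
have -> : (m - h) * Num.sqrt x = m * Num.sqrt x - h * Num.sqrt x by ring.
by rewrite (mulrDl m h) sinD sinB; ring.
Qed.

Lemma gexp_der_orth U a t : Stiefel U -> U^T *m a = 0 -> (gexp U a t)^T *m gexp_der U a t = 0.
Proof.
move=> sU Ua; have pG := gram_psd a; have sG := psd_sym pG.
have z : 0%:M = 0 :> 'M[R]_p by rewrite raddf0.
rewrite frm_gram // -[RHS]z -(symfun_cst 0 sG).
apply: symfun_eq_psd => // x x0.
have [->|x1] := eqVneq x 0; first by rewrite sqrtr0 !(mul0r, mulr0) oppr0 mulr0 addr0.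
have y0 : Num.sqrt x != 0 by rewrite gt_eqF // sqrtr_gt0 lt_def x1.
by move: y0 (sqr_sqrtr x0); move: (Num.sqrt x) => y y0 <-; field.
Qed.

Lemma gexp_der_gram U a t : Stiefel U -> U^T *m a = 0 ->
  (gexp_der U a t)^T *m gexp_der U a t = a^T *m a.
Proof.
move=> sU Ua; have pG := gram_psd a; have sG := psd_sym pG.
rewrite frm_gram // -[RHS](symfun_id sG); apply: symfun_eq_psd => // x x0.
rewrite mulrNN mulrACA -!expr2 sqr_sqrtr // sin2cos2; ring.
Qed.

Lemma gexp_rebase U a t h : Stiefel U -> U^T *m a = 0 ->
  gexp (gexp U a t) (gexp_der U a t) h = gexp U a (t + h).
Proof.
move=> sU Ua; have e := gexp_der_gram t sU Ua.
have -> b : b^T *m b = a^T *m a -> gexp (gexp U a t) b h =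
    gexp U a t *m gcos h (a^T *m a) +
    b *m symfun (fun x => sin (h * Num.sqrt x) / Num.sqrt x) (a^T *m a).
  by move=> eb; rewrite [LHS]/gexp [LHS]/frm eb.
2: exact: e.
rewrite !frm_mulr frm_add.
apply: frm_eq => x x0.
  have [->|x1] := eqVneq x 0; first by rewrite sqrtr0 !mulr0 mul0r oppr0 mul0r addr0 cos0 mulr1.
  have y0 : Num.sqrt x != 0 by rewrite gt_eqF // sqrtr_gt0 lt_def x1.
  by rewrite mulrDl cosD; field.
by rewrite mulrDl sinD; ring.
Qed.

Lemma gexp_opp U a t : gexp U (- a) t = gexp U a (- t).
Proof.
have e : (- a)^T *m (- a) = a^T *m a by
    rewrite (_ : (- a)^T = - a^T) ?mulNmx ?mulmxN ?opprK // mxtrN.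
have pG := gram_psd a; have sG := psd_sym pG.
rewrite /gexp /frm e; congr (_ *m _ + _).
  by apply: symfun_eq_psd => // x _; rewrite mulNr cosN.
rewrite mulNmx -mulmxN; congr (_ *m _); rewrite -scaleN1r symfun_scale //.
by apply: symfun_eq_psd => // x _; rewrite [- t * _]mulNr sinN; ring.
Qed.

Lemma diag_conj_mul m (O : 'M[R]_m) x y : Orth O ->
  O *m diag_mx x *m O^T *m (O *m diag_mx y *m O^T) = O *m diag_mx (\row_i (x 0 i * y 0 i)) *m O^T.
Proof. by move=> oO; rewrite -diag_mulE -!mulmxA (mulmxA O^T O) oO mul1mx. Qed.

(** After alignment V1 = U Ga + H, where Ga has eigenvalues cos th_i and H is orthogonal to U with
    singular values sin th_i; rescaling these to th_i / c gives the unit velocity a. *)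
Lemma gexp_ex U V : Stiefel U -> Stiefel V -> 0 < gd U V ->
  exists a O, [/\ U^T *m a = 0, nrm a = 1, Orth O & V *m O = gexp U a (gd U V)].
Proof.
move=> sU sV c0; set c := gd U V in c0 *.
have [ O [Q [th [oO oQ ht eN ec]]]] := gd_spec sU sV.
have oP : Orth (Q *m O^T) by apply: orth_mul => //; exact: orth_trmx.
set P := Q *m O^T in oP; pose V1 := V *m P; have sV1 : Stiefel V1 by exact: stiefel_mul.
pose Ga := O *m diag_mx (map_mx cos th) *m O^T.
have eG : U^T *m V1 = Ga.
  by rewrite /V1 /P /Ga !mulmxA eN -!mulmxA (mulmxA Q^T) oQ mul1mx.
pose H := V1 - U *m Ga.
have UH : U^T *m H = 0 by rewrite mulmxBr eG mulmxA sU mul1mx subrr.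
have tGa : Ga^T = Ga by exact: diag_sym.
have HH : H^T *m H = O *m diag_mx (map_mx (fun t => sin t ^+ 2) th) *m O^T.
  rewrite {1}/H mxtrD mxtrN mulmxBl [(U *m Ga)^T]trmx_mul -(mulmxA Ga^T) UH mulmx0 subr0 /H mulmxBr sV1.
  rewrite mulmxA -[V1^T *m U]trmxK trmx_mul trmxK eG tGa /Ga -(orth_mulV oO).
  set D := diag_mx (map_mx cos th).
  have -> : O *m D *m O^T *m (O *m D *m O^T) = O *m (D *m D) *m O^T.
    by rewrite -!mulmxA (mulmxA O^T O) oO mul1mx.
  rewrite -[X in X *m O^T - _]mulmx1 -mulmxBl -mulmxBr diag_mulE; congr (_ *m _ *m _).
  apply/matrixP => i j; rewrite !mxE; case: eqP => [->|] //; rewrite ?subr0 // !mulr1n.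
  by rewrite sin2cos2 expr2.
have csinc t : 0 <= t <= pi / 2 -> t != 0 -> sin t != 0.
  move=> /andP[t0 tp] tn; rewrite gt_eqF // sin_gt0_pi // lt_def tn t0 /=.
  by have := @pi_gt0 R; lra.
(* The value at t = 0 is 0, division by 0 being 0; H vanishes in these directions ([HO]). *)
pose q t := c^-1 * (t / sin t).
pose a := H *m (O *m diag_mx (map_mx q th) *m O^T).
have Ua : U^T *m a = 0 by rewrite /a mulmxA UH mul0mx.
have aa : a^T *m a = O *m diag_mx (map_mx (fun t => (t / c) ^+ 2) th) *m O^T.
  have -> : a^T *m a = O *m diag_mx (map_mx q th) *m O^T *m (H^T *m H) *m
      (O *m diag_mx (map_mx q th) *m O^T).
    by rewrite /a [(H *m _)^T]trmx_mul diag_sym !mulmxA.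
  rewrite HH !diag_conj_mul //.
  congr (_ *m diag_mx _ *m _); apply/rowP => i; rewrite !mxE /q.
  have [->|t0] := eqVneq (th 0 i) 0; first by rewrite !(mul0r, mulr0) expr0n.
  by have := csinc _ (ht i) t0 => s0; field; rewrite s0 gt_eqF.
have ec2 : c ^+ 2 = \sum_i th 0 i ^+ 2.
  by rewrite /c ec sqr_sqrtr // sumr_ge0 // => i _; rewrite sqr_ge0.
exists a, P; split => //.
  rewrite /nrm /nrm2 /mdot aa trace_orth_diag // (eq_bigr (fun i => c ^- 2 * th 0 i ^+ 2)).
    by rewrite -mulr_sumr -ec2 mulVf ?sqrtr1 // expf_neq0 // gt_eqF.
  by move=> i _; rewrite mxE exprMn exprVn mulrC.
have sq i : Num.sqrt ((th 0 i / c) ^+ 2) = th 0 i / c.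
  by rewrite sqrtr_sqr ger0_norm // divr_ge0 ?(ltW c0) //; case/andP: (ht i).
rewrite /gexp /frm aa !symfun_orth // -/V1.
have -> : V1 = U *m Ga + H by rewrite /H addrC subrK.
congr (_ + _).
  congr (_ *m (_ *m diag_mx _ *m _)); apply/rowP => i; rewrite !mxE sq mulrC divfK //.
  by rewrite gt_eqF.
rewrite /a -!mulmxA (mulmxA O^T O) oO mul1mx (mulmxA (diag_mx _) (diag_mx _)) diag_mulE.
have HO i : th 0 i = 0 -> H *m O *m delta_mx i (0 : 'I_1) = 0.
  move=> t0; apply/eqP; rewrite -dot_eq0 -!mulmxA dot_mull (mulmxA H^T) HH dot_eigen //.
  by rewrite mxE t0 sin0 expr0n.
rewrite !mulmxA -[X in X = _]mulmx1 -(orth_mulV oO) !mulmxA; congr (_ *m _).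
apply/matrixP => k i; rewrite mul_mx_diag !mxE sq.
have [t0|t0] := eqVneq (th 0 i) 0.
  have /colP/(_ k) := HO i t0; rewrite -colE !mxE => ->.
  by rewrite mul0r.
have s0 := csinc _ (ht i) t0.
have -> : c * (th 0 i / c) = th 0 i by rewrite mulrC divfK ?gt_eqF.
rewrite /q; field; by rewrite t0 s0 gt_eqF.
Qed.

Lemma gexp_eps U a t : U^T *m a = 0 -> nrm a = 1 -> 0 <= t ->
  [/\ nrm (1%:M - gcos t (a^T *m a)) <= t ^+ 2 / 2,
      \tr (1%:M - gcos t (a^T *m a)) <= t ^+ 2 / 2
    & nrm (t *: a - a *m symfun (fun x => sin (t * Num.sqrt x) / Num.sqrt x) (a^T *m a))
      <= t ^+ 3 / 6].
Proof.
move=> Ua a1 t0; have pG := gram_psd a; have sG := psd_sym pG.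
have [Q [y [oQ y0 y1 ey hf]]] := gram_spec a.
rewrite -sqr_nrm a1 expr1n in ey; rewrite a1 in y1.
have sq i : Num.sqrt (y 0 i ^+ 2) = y 0 i by rewrite sqrtr_sqr ger0_norm.
have y21 i : y 0 i ^+ 2 <= 1 by rewrite -(expr1n R 2) ler_pXn2r ?nnegrE.
have eE : 1%:M - gcos t (a^T *m a) = symfun (fun x => 1 - cos (t * Num.sqrt x)) (a^T *m a).
  rewrite -(symfun_cst 1 sG) -scaleN1r /gcos symfun_scale // symfun_add //.
  by apply: symfun_eq_psd => // x _; rewrite mulN1r.
have c_le i : 0 <= 1 - cos (t * y 0 i) <= t ^+ 2 / 2 * y 0 i ^+ 2.
  rewrite subr_ge0 cos_le1 /=; have := cos_gex (mulr_ge0 t0 (y0 i)); rewrite exprMn; lra.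
split.
- rewrite eE hf /nrm /nrm2 /mdot diag_sym diag_conj_mul // trace_orth_diag //.
  rewrite -[leRHS]ger0_norm ?divr_ge0 ?sqr_ge0 // -sqrtr_sqr ler_wsqrtr //.
  rewrite -[leRHS]mulr1 -[X in _ <= _ * X]ey mulr_sumr; apply: ler_sum => i _; rewrite !mxE sq.
  case/andP: (c_le i) => h0 h1; apply: le_trans (ler_pM h0 h0 h1 h1) _.
  rewrite -expr2 exprMn; apply: ler_wpM2l; first exact: sqr_ge0.
  by rewrite expr2 ler_piMl // sqr_ge0.
- rewrite eE hf trace_orth_diag // -[leRHS]mulr1 -[X in _ <= _ * X]ey mulr_sumr; apply: ler_sum => i _.
  by rewrite mxE sq; case/andP: (c_le i).
pose g x := t - sin (t * Num.sqrt x) / Num.sqrt x.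
have -> : t *: a - a *m symfun (fun x => sin (t * Num.sqrt x) / Num.sqrt x) (a^T *m a) =
    a *m symfun g (a^T *m a).
  rewrite -[t *: a]mulmx1 -scalemxAl scalemxAr -(symfun_cst 1 sG) symfun_scale //.
  rewrite -mulmxBr -scaleN1r symfun_scale // symfun_add //; congr (_ *m _).
  by apply: symfun_eq_psd => // x _; rewrite /g mulr1 mulN1r.
rewrite /nrm /nrm2 /mdot trmx_mul symfun_sym // -mulmxA (mulmxA a^T).
rewrite -{2}(symfun_id sG) !symfun_mul // hf trace_orth_diag //.
rewrite -[leRHS]ger0_norm ?divr_ge0 ?exprn_ge0 // -sqrtr_sqr ler_wsqrtr //.
rewrite -[leRHS]mulr1 -[X in _ <= _ * X]ey mulr_sumr; apply: ler_sum => i _; rewrite mxE /g sq.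
have [->|yn] := eqVneq (y 0 i) 0; first by rewrite expr0n mul0r !mulr0.
have yp : 0 < y 0 i by rewrite lt_def yn y0.
have -> : (t - sin (t * y 0 i) / y 0 i) * (y 0 i ^+ 2 * (t - sin (t * y 0 i) / y 0 i)) =
    (t * y 0 i - sin (t * y 0 i)) ^+ 2 by field.
have ty := mulr_ge0 t0 (y0 i); have h1 := sin_lex ty; have h2 := sin_gex ty.
rewrite -exprMn ler_pXn2r ?nnegrE ?subr_ge0 ?mulr_ge0 ?divr_ge0 ?exprn_ge0 //.
rewrite exprMn [y 0 i ^+ 3]exprS in h2.
have h3 : t ^+ 3 * (y 0 i * y 0 i ^+ 2) <= t ^+ 3 * y 0 i.
  by rewrite ler_wpM2l ?exprn_ge0 // ler_piMr.
lra.
Qed.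

Lemma tr_one_sub (A B : 'M[R]_p) :
  \tr (A *m B) = p%:R - \tr (1%:M - A) - \tr (1%:M - B) + \tr ((1%:M - A) *m (1%:M - B)).
Proof.
have tN (C : 'M[R]_p) : \tr (- C) = - \tr C by rewrite raddfN.
by rewrite mulmxBl !mulmxBr !mul1mx mulmx1 !(mxtraceD, tN) mxtrace1; ring.
Qed.

Lemma mdot_trC (A B : 'M[R]_p) : A^T = A -> \tr (A *m B) = mdot A B.
Proof. by move=> sA; rewrite /mdot sA. Qed.

(** By [gexp_eps] the squared chord between the two frames obeys the law of cosines up to (t + s)^4,
    and [gd_nrm2B] passes from the chord to the distance at the price of another fourth order
    term. *)
Theorem first_variation U a b t s : Stiefel U -> U^T *m a = 0 -> U^T *m b = 0 ->
  nrm a = 1 -> nrm b = 1 -> 0 <= t -> 0 <= s -> t + s <= 2^-1 ->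
  gd (gexp U a t) (gexp U b s) ^+ 2 <=
    t ^+ 2 + s ^+ 2 - 2 * (t * s) * mdot a b + 9 * (t + s) ^+ 4.
Proof.
move=> sU Ua Ub a1 b1 t0 s0 ts.
have [Ea ta ra] := gexp_eps Ua a1 t0; have [Eb tb rb] := gexp_eps Ub b1 s0.
have sV := gexp_stiefel t sU Ua; have sW := gexp_stiefel s sU Ub.
have pGa := gram_psd a; have pGb := gram_psd b.
set A := gcos t _ in Ea ta; set B := gcos s _ in Eb tb.
set x := a *m symfun _ _ in ra; set y := b *m symfun _ _ in rb.
have aU : x^T *m U = 0.
  by rewrite -[X in X = _]trmxK trmx_mul trmxK /x mulmxA Ua mul0mx trmx0.
have Uy : U^T *m y = 0 by rewrite /y mulmxA Ub mul0mx.
have sA : A^T = A by apply: symfun_sym; exact: psd_sym.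
have eg : mdot (gexp U a t) (gexp U b s) = \tr (A *m B) + mdot x y.
  rewrite /mdot /gexp /frm -/A -/B -/x -/y mxtrD trmx_mul sA mulmxDl !mulmxDr.
  rewrite -!mulmxA (mulmxA U^T U) sU mul1mx Uy mulmx0 addr0 (mulmxA x^T U) aU mul0mx add0r.
  by rewrite raddfD.
have hAB : p%:R - (t ^+ 2 + s ^+ 2) / 2 - t ^+ 2 * s ^+ 2 / 4 <= \tr (A *m B).
  have sEA : (1%:M - A)^T = 1%:M - A by rewrite mxtrD mxtrN trmx1 sA.
  rewrite tr_one_sub (mdot_trC _ sEA).
  have h := mdot_le (1%:M - A) (1%:M - B); rewrite ler_norml in h; case/andP: h => h _.
  have h2 := ler_pM (nrm_ge0 _) (nrm_ge0 _) Ea Eb.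
  move: h h2 ta tb; move: (mdot _ _) (nrm _ * nrm _) (\tr (1%:M - A)) (\tr (1%:M - B)).
  by clear => m1 m2 m3 m4; move: p%:R => P; lra.
have hxy : t * s * mdot a b - (t * (s ^+ 3 / 6) + s * (t ^+ 3 / 6) + t ^+ 3 / 6 * (s ^+ 3 / 6))
    <= mdot x y.
  pose u := t *: a - x; pose v := s *: b - y.
  have ex : x = t *: a - u by rewrite /u opprB addrC subrK.
  have ey : y = s *: b - v by rewrite /v opprB addrC subrK.
  have e : mdot x y = t * s * mdot a b - t * mdot a v - s * mdot u b + mdot u v.
    by rewrite {1}ex {1}ey !(mdotDl, mdotDr, mdotNl, mdotNr, mdotZl, mdotZr); ring.
  have h1 := mdot_le a v; have h2 := mdot_le u b; have h3 := mdot_le u v.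
  rewrite a1 mul1r ler_norml in h1; rewrite b1 mulr1 ler_norml in h2; rewrite ler_norml in h3.
  case/andP: h1 => _ h1; case/andP: h2 => _ h2; case/andP: h3 => h3 _.
  have h4 := ler_pM (nrm_ge0 _) (nrm_ge0 _) ra rb; rewrite -/u -/v in h4.
  have h5 := ler_wpM2l t0 (le_trans h1 rb); have h6 := ler_wpM2l s0 (le_trans h2 ra).
  rewrite e; move: h3 h4 h5 h6; move: (mdot a b) (mdot a v) (mdot u b) (mdot u v) (nrm u * nrm v).
  by clear => m1 m2 m3 m4 m5; lra.
pose z := nrm2 (gexp U b s - gexp U a t).
have eS (C : 'M[R]_(n, p)) : Stiefel C -> nrm2 C = p%:R.
  by rewrite /nrm2 /mdot /Stiefel => ->; exact: mxtrace1.
have ez : z = p%:R * 2 - mdot (gexp U a t) (gexp U b s) * 2.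
  rewrite /z nrm2B !eS // mdotC -mulr_natr; ring.
have ab1 : `|mdot a b| <= 1 by have := mdot_le a b; rewrite a1 b1 mulr1.
have z0 : 0 <= z by exact: nrm2_ge0.
pose w := t + s.
have hz : z <= t ^+ 2 + s ^+ 2 - 2 * (t * s) * mdot a b + w ^+ 4.
  rewrite ez eg.
  have h : t ^+ 2 * s ^+ 2 / 2 + 2 * (t * (s ^+ 3 / 6) + s * (t ^+ 3 / 6)
      + t ^+ 3 / 6 * (s ^+ 3 / 6)) <= w ^+ 4.
    rewrite /w; clear -t0 s0 ts.
    have p1 : 0 <= t * s by rewrite mulr_ge0.
    have p2 : t * s <= 1 by nra.
    have p3 : 0 <= t ^+ 3 * s by rewrite mulr_ge0 ?exprn_ge0.
    have p4 : 0 <= s ^+ 3 * t by rewrite mulr_ge0 ?exprn_ge0.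
    have p5 : 0 <= t ^+ 4 by rewrite exprn_ge0.
    have p6 : 0 <= s ^+ 4 by rewrite exprn_ge0.
    have p7 : t ^+ 3 * s ^+ 3 <= t ^+ 2 * s ^+ 2.
      have -> : t ^+ 3 * s ^+ 3 = (t * s) * (t ^+ 2 * s ^+ 2) by ring.
      by rewrite ler_piMl // mulr_ge0 ?sqr_ge0.
    have p8 : 0 <= t ^+ 2 * s ^+ 2 by rewrite mulr_ge0 ?sqr_ge0.
    have -> : (t + s) ^+ 4 = t ^+ 4 + 4 * (t ^+ 3 * s) + 6 * (t ^+ 2 * s ^+ 2)
      + 4 * (s ^+ 3 * t) + s ^+ 4 by ring.
    lra.
  move: h hAB hxy; move: (\tr _) (mdot x y) (mdot a b) (w ^+ 4); move: p%:R.
  by clear => P m1 m2 m3 m4; lra.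
have w0 : 0 <= w by rewrite addr_ge0.
have hzw : z <= 2 * w ^+ 2.
  have h1 : t ^+ 2 + s ^+ 2 - 2 * (t * s) * mdot a b <= w ^+ 2.
    have : - mdot a b <= 1 by move: ab1; rewrite ler_norml lerNl => /andP[].
    move/(ler_wpM2l (mulr_ge0 t0 s0)); rewrite /w; move: (mdot a b); clear => m; lra.
  have h2 : w ^+ 4 <= w ^+ 2.
    rewrite -[4%N]/(2 + 2)%N exprD ler_piMl ?sqr_ge0 //.
    by rewrite -(expr1n R 2) ler_pXn2r ?nnegrE //; clear -ts; rewrite /w; lra.
  move: hz h1 h2; move: (mdot a b) (w ^+ 2) (w ^+ 4) (z); clear => m1 m2 m3 m4; lra.
have z2 : z <= 2^-1.
  apply: le_trans hzw _; have : w ^+ 2 <= (2^-1) ^+ 2 by rewrite ler_pXn2r ?nnegrE.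
  by clear; lra.
apply: le_trans (gd_nrm2B sV sW z2) _; rewrite -/z -/w.
(* 2 z^2 <= 8 w^4 is added to the w^4 of [hz]: this is the 9. *)
have h3 : z ^+ 2 <= (2 * w ^+ 2) ^+ 2.
  by rewrite ler_pXn2r ?nnegrE // mulr_ge0 ?sqr_ge0.
have e4 : (2 * w ^+ 2) ^+ 2 = 4 * w ^+ 4 by ring.
rewrite e4 in h3; move: hz h3; move: (mdot a b) (w ^+ 4) (z ^+ 2) (z); clear => m1 m2 m3 m4; lra.
Qed.

End Geodesic.

(** Bisection: after k halvings the Lipschitz bound leaves an error (y - x) 2^-k. Midpoint convexity
    is known for short configurations only; the condition passes to both halves, since f at the
    midpoint is at most the average of f x and f y, both below M. *)
Lemma convex_from_midpoints (R : realType) (f : R -> R) (L M : R) :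
  (forall x y, 0 <= x -> x <= y -> y <= L -> `|f y - f x| <= y - x) ->
  (forall x y, 0 <= x -> x <= y -> y <= L -> f x < M -> f y < M ->
     2 * (f x + f y) + (y - x) < 4 * M -> 2 * f ((x + y) / 2) <= f x + f y) ->
  f 0 < M -> f L < M -> 2 * (f 0 + f L) + L < 4 * M ->
  forall l, 0 <= l <= 1 -> 0 <= L -> f (l * L) <= (1 - l) * f 0 + l * f L.
Proof.
move=> lip mid f0 fL fs l hl L0.
have key k : forall x y m, 0 <= x -> x <= y -> y <= L -> f x < M -> f y < M ->
    2 * (f x + f y) + (y - x) < 4 * M -> 0 <= m <= 1 ->
    f (x + m * (y - x)) <= (1 - m) * f x + m * f y + (y - x) * 2^-1 ^+ k.
  elim: k => [|k IH] x y m x0 xy yL fx fy fxy /andP[m0 m1].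
    have my : 0 <= m * (y - x) <= y - x by rewrite mulr_ge0 ?subr_ge0 //= ler_piMl ?subr_ge0.
    case/andP: my => my0 my1; set z := x + m * (y - x).
    have h1 : f z - f x <= z - x.
      by apply: le_trans (ler_norm _) _; apply: lip; rewrite /z; lra.
    have h2 : f z - f y <= y - z.
      apply: le_trans (ler_norm _) _; rewrite distrC; apply: lip; rewrite /z; lra.
    have h3 : (1 - m) * (f z - f x) <= (1 - m) * (z - x) by rewrite ler_wpM2l ?subr_ge0.
    have h4 : m * (f z - f y) <= m * (y - z) by rewrite ler_wpM2l.
    have h5 : (1 - m) * (z - x) + m * (y - z) <= y - x.
      rewrite /z; have : 0 <= (y - x) * ((1 - m) ^+ 2 + m ^+ 2).
        by rewrite mulr_ge0 ?subr_ge0 ?addr_ge0 ?sqr_ge0.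
      lra.
    rewrite expr0; clear -h3 h4 h5; lra.
  pose c := (x + y) / 2.
  have fc : 2 * f c <= f x + f y by exact: mid.
  have [hm|/ltW hm] := leP m 2^-1.
    have -> : x + m * (y - x) = x + (2 * m) * (c - x) by rewrite /c; field.
    have := IH x c (2 * m); rewrite exprS => h.
    have {}h : f (x + (2 * m) * (c - x)) <= (1 - 2 * m) * f x + 2 * m * f c + (c - x) * 2^-1 ^+ k.
      by apply: h => //; rewrite /c; lra.
    have h2 : (2 * m) * f c <= m * (f x + f y) by rewrite -mulrA mulrCA ler_wpM2l.
    have e : (c - x) * 2^-1 ^+ k = (y - x) * (2^-1 * 2^-1 ^+ k) by rewrite /c; field.
    clear -h h2 e; lra.
  have -> : x + m * (y - x) = c + (2 * m - 1) * (y - c) by rewrite /c; field.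
  have := IH c y (2 * m - 1); rewrite exprS => h.
  have {}h : f (c + (2 * m - 1) * (y - c)) <=
      (1 - (2 * m - 1)) * f c + (2 * m - 1) * f y + (y - c) * 2^-1 ^+ k.
    by apply: h => //; rewrite /c; lra.
  have h2 : (1 - m) * (2 * f c) <= (1 - m) * (f x + f y) by rewrite ler_wpM2l ?subr_ge0.
  have e : (y - c) * 2^-1 ^+ k = (y - x) * (2^-1 * 2^-1 ^+ k) by rewrite /c; field.
  clear -h h2 e; lra.
have lim : (fun k => (1 - l) * f 0 + l * f L + L * 2^-1 ^+ k) @ \oo
    --> (1 - l) * f 0 + l * f L + L * 0.
  apply: cvgD; first exact: cvg_cst.
  apply: cvgM; first exact: cvg_cst.
  by apply: cvg_expr; rewrite ger0_norm ?invr_ge0 // invf_lt1 // ltr1n.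
rewrite mulr0 addr0 in lim; apply: (cvg_seq_ge lim) => k.
have := key k 0 L l (lexx _) L0 (lexx _) f0 fL; rewrite add0r subr0; exact.
Qed.

(** For the step sizes v^3 and v^4 of [toward]: the fourth order error is small against their
    product, as is the square of the smaller step. *)
Lemma scale_bound (R : realType) (v : R) : 0 <= v <= 1 ->
  (v ^+ 4 + v ^+ 3) ^+ 4 <= 16 * v * (v ^+ 4 * v ^+ 3).
Proof.
move=> /andP[v0 v1]; have h : v ^+ 4 + v ^+ 3 <= 2 * v ^+ 3.
  by rewrite mulr_natl mulr2n lerD2r exprS ler_piMl // exprn_ge0.
have h2 : (v ^+ 4 + v ^+ 3) ^+ 4 <= (2 * v ^+ 3) ^+ 4.
  by rewrite ler_pXn2r ?nnegrE ?addr_ge0 ?mulr_ge0 ?exprn_ge0.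
apply: le_trans h2 _.
have -> : (2 * v ^+ 3) ^+ 4 = 16 * v * (v ^+ 4 * v ^+ 3) * v ^+ 4 by ring.
by rewrite ler_piMr ?mulr_ge0 ?exprn_ge0 // exprn_ile1.
Qed.

Lemma sqr_midpoint (R : realType) (x y z : R) : 0 <= z -> 2 * z <= x + y ->
  0 <= x ^+ 2 + y ^+ 2 - 2 * z ^+ 2.
Proof.
move=> z0 h; have h2 : (2 * z) ^+ 2 <= (x + y) ^+ 2.
  by rewrite ler_pXn2r ?nnegrE ?mulr_ge0 //; apply: le_trans h; rewrite mulr_ge0.
have := sqr_ge0 (x - y); lra.
Qed.

Lemma sqr_midpoint_eq (R : realType) (x y z : R) : 0 <= x -> 0 <= y -> 0 <= z ->
  2 * z <= x + y -> x ^+ 2 + y ^+ 2 - 2 * z ^+ 2 = 0 -> x = z /\ y = z.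
Proof.
move=> x0 y0 z0 h e; have h2 : (2 * z) ^+ 2 <= (x + y) ^+ 2.
  by rewrite ler_pXn2r ?nnegrE ?mulr_ge0 ?addr_ge0.
have exy : x = y.
  by apply/eqP; rewrite -subr_eq0 -sqrf_eq0 eq_le sqr_ge0 andbT; lra.
have : y ^+ 2 = z ^+ 2 by rewrite exy in e; lra.
by move/eqP; rewrite exy eqrXn2 // => /eqP ->.
Qed.

(** * Convexity of the distance; existence and uniqueness of the Karcher mean *)

Section Karcher.
Variables (R : realType) (n p : nat).
Implicit Types U V W C X Y S a b : 'M[R]_(n, p).

(** Twice the admissible radius ([radius_kappa]); 4 kappa = sqrt 2 * pi is the bound of
    [midpoint_ineq]. *)
Definition kappa : R := Num.sqrt 2 * pi / 4.

Lemma kappa_gt0 : 0 < kappa.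
Proof. by rewrite divr_gt0 ?mulr_gt0 ?sqrtr_gt0 ?pi_gt0. Qed.

Lemma kappa_le : kappa <= 3 * pi / 8.
Proof.
have h : Num.sqrt 2 <= 3 / 2 :> R.
  rewrite -(@ler_pXn2r _ 2) ?nnegrE ?sqrtr_ge0 ?divr_ge0 // sqr_sqrtr //.
  by rewrite expr2; lra.
rewrite /kappa; have := ler_wpM2r (@pi_ge0 R) h; lra.
Qed.

Lemma radius_kappa : pi / (4 * Num.sqrt 2) = kappa / 2.
Proof.
rewrite /kappa; have h : Num.sqrt 2 ^+ 2 = 2 :> R by rewrite sqr_sqrtr.
have s0 : Num.sqrt 2 != 0 :> R by rewrite gt_eqF // sqrtr_gt0.
move: h s0; move: (Num.sqrt 2) => s h s0.
by apply: (mulIf s0); rewrite (_ : s * pi / 4 / 2 * s = s ^+ 2 * pi / 8); [rewrite h; field|field].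
Qed.

Lemma gd_lip X Y S : Stiefel X -> Stiefel Y -> Stiefel S -> `|gd Y S - gd X S| <= gd X Y.
Proof.
move=> sX sY sS; have h1 := gd_triangle sX sY sS; have h2 := gd_triangle sY sX sS.
by rewrite (gd_sym sY sX) in h2; rewrite ler_norml; lra.
Qed.

Lemma kappa4 : Num.sqrt 2 * pi = 4 * kappa.
Proof. by rewrite /kappa; field. Qed.

(** [midpoint_ineq] with its distances named by variables, which linear arithmetic then treats as
    atoms. *)
Lemma midpoint_eq U M W W' f1 f2 c e : Stiefel U -> Stiefel M -> Stiefel W ->
  refl M *m W = W' -> gd W U = f1 -> gd W' U = f2 -> gd M U = c -> gd W M = e ->
  f1 < pi / 2 -> f2 < pi / 2 -> c < pi / 2 -> e < pi / 2 ->
  f1 + e + c < pi -> f2 + e + c < pi -> f1 + f2 + 2 * c < 4 * kappa ->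
  2 * c <= f1 + f2.
Proof.
move=> sU sM sW <- <- <- <- <-; rewrite -kappa4; exact: midpoint_ineq.
Qed.

Lemma midpoint_gd U a S (f : R -> R) x y c : Stiefel U -> U^T *m a = 0 -> nrm a = 1 ->
  Stiefel S -> (forall t, gd (gexp U a t) S = f t) -> c = (x + y) / 2 ->
  x <= y -> y - x <= kappa ->
  f x < pi / 2 -> f y < pi / 2 -> f c < pi / 2 ->
  f x + (y - x) / 2 + f c < pi -> f y + (y - x) / 2 + f c < pi ->
  f x + f y + 2 * f c < 4 * kappa -> 2 * f c <= f x + f y.
Proof.
move=> sU Ua a1 sS hf ec xy xyk; have sg t := gexp_stiefel t sU Ua.
have kl := kappa_le; have p0 := @pi_gt0 R.
have [h eh] : exists h, h = (y - x) / 2 by exists ((y - x) / 2).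
have h0 : 0 <= h by rewrite eh divr_ge0 // subr_ge0.
have ey : y = c + h by rewrite ec eh; clear -ec; field.
have ex : c - h = x by rewrite ec eh; clear -ec; field.
have er : refl (gexp U a c) *m gexp U a y = gexp U a x.
  by rewrite ey (gexp_refl c h sU Ua) ex.
have hp : h < pi / 2 by rewrite eh; clear -xyk kl p0; lra.
have gh : gd (gexp U a y) (gexp U a c) = h.
  have e : `|c - y| = h.
    have -> : c - y = - h by rewrite ey; clear -ec; ring.
    by rewrite normrN ger0_norm.
  by rewrite gexp_gd // e ltW.
move=> fx fy fc s1 s2 s3; rewrite [f x + _]addrC.
rewrite -eh in s1 s2; rewrite [f x + f y]addrC in s3.
exact: (midpoint_eq sS (sg c) (sg y) er (hf y) (hf x) (hf c) gh).
Qed.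

(** The points at times x and y are exchanged by the reflection through their midpoint, so the
    midpoint inequality applies along the geodesic; as the distance is 1-Lipschitz,
    [convex_from_midpoints] concludes. *)
Lemma geo_convex U a S (f : R -> R) L : Stiefel U -> U^T *m a = 0 -> nrm a = 1 -> Stiefel S ->
  (forall t, gd (gexp U a t) S = f t) -> 0 <= L <= kappa ->
  f 0 < kappa -> f L < kappa -> 2 * (f 0 + f L) + L < 4 * kappa ->
  forall l, 0 <= l <= 1 -> f (l * L) <= (1 - l) * f 0 + l * f L.
Proof.
move=> sU Ua a1 sS hf /andP[L0 Lk] f0 fL fs l hl.
have sg t := gexp_stiefel t sU Ua; have kl := kappa_le; have p0 := @pi_gt0 R.
have lip x y : 0 <= x -> x <= y -> y <= L -> `|f y - f x| <= y - x.
  move=> x0 xy yL; rewrite -!hf; apply: le_trans (gd_lip (sg x) (sg y) sS) _.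
  rewrite gexp_gd // ger0_norm ?subr_ge0 //.
  by clear -x0 xy yL Lk kl p0; lra.
apply: (@convex_from_midpoints R f L kappa lip _ f0 fL fs l hl L0) => x y x0 xy yL fx fy fxy.
have [c ec] : exists c, c = (x + y) / 2 by exists ((x + y) / 2).
have hx : f c - f x <= c - x.
  by apply: le_trans (ler_norm _) _; apply: lip; rewrite ?ec; clear -x0 xy yL; lra.
have hy : f c - f y <= y - c.
  by apply: le_trans (ler_norm _) _; rewrite distrC; apply: lip; rewrite ?ec; clear -x0 xy yL; lra.
rewrite -ec; apply: (midpoint_gd sU Ua a1 sS hf ec xy); move: hx hy fx fy fxy;
  move: (f c) (f x) (f y); rewrite ec; clear -x0 xy yL Lk kl p0; move=> m1 m2 m3; lra.
Qed.

Lemma gexp0 U a : gexp U a 0 = U.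
Proof.
have pG := gram_psd a; have sG := psd_sym pG.
have -> : gexp U a 0 = frm U a (fun=> 1) (fun=> 0).
  by apply: frm_eq => x _; rewrite mul0r ?cos0 // sin0 mul0r.
by rewrite /frm !symfun_cst // raddf0 mulmx0 addr0 mulmx1.
Qed.

Lemma gexp_gd0 U a t : Stiefel U -> U^T *m a = 0 -> nrm a = 1 -> 0 <= t <= pi / 2 ->
  gd U (gexp U a t) = t.
Proof.
move=> sU Ua a1 /andP[t0 tp]; rewrite -{1}(gexp0 U a) gexp_gd // ?subr0 ger0_norm //.
Qed.

Lemma small_exists (x y : R) : 0 < x -> 0 < y ->
  exists v, [/\ 0 < v, v <= 2^-1, v <= x & v <= y].
Proof.
move=> x0 y0; exists (Num.min 2^-1 (Num.min x y)).
by rewrite !lt_min !ge_min x0 y0 invr_gt0 ltr0n !lexx !orbT.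
Qed.

(** By convexity the distance to C decreases at rate at least k on the way from U to S. Along - b
    the distance to C grows at unit speed, so the triangle inequality opposes [first_variation] and
    forces <c, b> > 0. A second use of [first_variation], along b, then gains on the distance to
    S. *)
Lemma toward U b S r : Stiefel U -> U^T *m b = 0 -> nrm b = 1 -> Stiefel S ->
  0 < r < kappa / 2 -> gd (gexp U b r) S < r -> gd U S < 2 * r ->
  exists2 e, 0 < e <= r & gd (gexp U b e) S < gd U S.
Proof.
move=> sU Ub b1 sS /andP[r0 rk]; set C := gexp U b r => hC hS.
have sg t := gexp_stiefel t sU Ub; have sC : Stiefel C by exact: sg.
have kl := kappa_le; have p0 := @pi_gt0 R.
have gUC : gd U C = r by rewrite gexp_gd0 //; clear -r0 rk kl p0; lra.
set q := gd C S in hC *; set z := gd U S in hS *.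
have q0 : 0 <= q by exact: gd_ge0.
have zrq : r - q <= z.
  have := gd_triangle sU sS sC; rewrite gUC (gd_sym sS sC) -/q -/z; clear; lra.
have z0 : 0 < z by clear -zrq hC; lra.
have [c [ O1 [Uc c1 oO1 eS]]] := gexp_ex sU sS z0; rewrite -/z in eS.
have sA t := gexp_stiefel t sU Uc.
have [phi phiE] : exists phi, forall t, gd (gexp U c t) C = phi t by eexists.
have phi0 : phi 0 = r by rewrite -phiE gexp0.
have phiz : phi z = q by rewrite -phiE -eS gd_orthl // gd_sym.
have cvx := geo_convex (L := z) sU Uc c1 sC phiE; rewrite phi0 phiz in cvx.
have {}cvx l : 0 <= l <= 1 -> phi (l * z) <= (1 - l) * r + l * q.
  by apply: cvx; clear -rk r0 hC hS z0 q0; lra.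
pose k := (r - q) / z; have k0 : 0 < k by rewrite divr_gt0 // subr_gt0.
have ekz : k * z = r - q by rewrite divfK // gt_eqF.
have phid d : 0 <= d <= z -> phi d <= r - k * d.
  move=> /andP[d0 dz]; have := cvx (d / z); rewrite divfK ?gt_eqF // => h.
  have -> : r - k * d = (1 - d / z) * r + d / z * q by rewrite /k; field; rewrite gt_eqF.
  by apply: h; rewrite divr_ge0 ?(ltW z0) //= ler_pdivrMr // mul1r.
have Ub' : U^T *m - b = 0 by rewrite mulmxN Ub oppr0.
have b1' : nrm (- b) = 1 by rewrite nrmN.
pose beta := mdot c b.
have gS d : 0 <= d <= z -> gd (gexp U c d) S = z - d.
  move=> /andP[d0 dz]; rewrite -(gd_orthr (sA d) sS oO1) eS gexp_gd // ger0_norm ?subr_ge0 //.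
  by clear -hS rk kl p0 d0; lra.
have beta_gt0 : 0 < beta.
  (* 145 = 1 + 9 * 16: with d = v^4 and e = v^3, d^2 is v (d e) and 9 (d + e)^4 is at most 9 * 16 v
     (d e). *)
  have k145 : 0 < k / 145 by rewrite divr_gt0.
  have [v [v0 v2 vz vk]] := small_exists z0 k145.
  pose d := v ^+ 4; pose e := v ^+ 3.
  have v1 : v <= 1 by clear -v2; lra.
  have d0 : 0 < d by exact: exprn_gt0.
  have e0 : 0 < e by exact: exprn_gt0.
  have ed : d = v * e by rewrite /d /e exprS.
  have e8 : e <= 8^-1.
    rewrite /e; have : v ^+ 3 <= 2^-1 ^+ 3 by rewrite ler_pXn2r ?nnegrE // ltW.
    by rewrite [2^-1 ^+ 3]exprSr expr2; lra.
  have de : d <= e by rewrite ed ler_piMl // ltW.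
  have dz : d <= z.
    by apply: le_trans vz; rewrite /d exprS ler_piMr ?(ltW v0) // exprn_ile1 // ltW.
  have h1 := first_variation sU Uc Ub' c1 b1' (ltW d0) (ltW e0) (_ : d + e <= 2^-1).
  have {}h1 := h1 ltac:(clear -e8 de; lra).
  rewrite mdotNr -/beta in h1.
  set D := gd _ _ in h1.
  have h2 : e + k * d <= D.
    have hC' : gd (gexp U (- b) e) C = r + e.
      have pi2 := @pi_ge2 R.
      have re0 : 0 <= r + e by rewrite addr_ge0 // ltW.
      have rep : r + e <= pi / 2 by clear -rk kl e8 pi2; lra.
      by rewrite gexp_opp gexp_gd // opprK ger0_norm.
    have eD : gd (gexp U (- b) e) (gexp U c d) = D := gd_sym (gexp_stiefel e sU Ub') (sA d).
    have ht := gd_triangle (gexp_stiefel e sU Ub') (sA d) sC.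
    rewrite hC' eD phiE in ht; move: ht.
    have := phid d; rewrite dz (ltW d0) => /(_ isT); clear; lra.
  have h3 : (e + k * d) ^+ 2 <= D ^+ 2.
    have kd0 : 0 <= e + k * d by apply: addr_ge0; [exact: ltW|apply: mulr_ge0; exact: ltW].
    by rewrite ler_pXn2r ?nnegrE ?gd_ge0.
  have h4 : 2 * k * (e * d) <= d ^+ 2 + 2 * (d * e) * beta + 9 * (d + e) ^+ 4.
    have : 0 <= (k * d) ^+ 2 by exact: sqr_ge0.
    move: h1 h3; move: (D ^+ 2) ((d + e) ^+ 4); clear => D2 w; lra.
  have h5 : (d + e) ^+ 4 <= 16 * v * (d * e) by apply: scale_bound; rewrite v1 ltW.
  have de0 : 0 < d * e by exact: mulr_gt0.
  have h7 : 2 * k <= 2 * beta + 145 * v.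
    rewrite -(ler_pM2r de0).
    have e1 : d ^+ 2 = v * (d * e) by rewrite expr2 {1}ed; ring.
    move: h4 h5; rewrite e1; move: ((d + e) ^+ 4); clear => w; lra.
  by clear -h7 vk k0; lra.
have b145 : 0 < beta / 145 by rewrite divr_gt0.
have zr : 0 < Num.min z r by rewrite lt_min z0 r0.
have [v [v0 v2 vz vb]] := small_exists zr b145.
move: vz; rewrite le_min => /andP[vz vr].
(* The sizes are exchanged: e is now the smaller step, so that e^2 is absorbed and D < d. *)
pose d := v ^+ 3; pose e := v ^+ 4.
have v1 : v <= 1 by clear -v2; lra.
have d0 : 0 < d by exact: exprn_gt0.
have e0 : 0 < e by exact: exprn_gt0.
have ed : e = v * d by rewrite /d /e exprS.
have d8 : d <= 8^-1.
  rewrite /d; have : v ^+ 3 <= 2^-1 ^+ 3 by rewrite ler_pXn2r ?nnegrE // ltW.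
  by rewrite [2^-1 ^+ 3]exprSr expr2; lra.
have de : e <= d by rewrite ed ler_piMl // ltW.
have dv : d <= v by rewrite /d exprS ler_piMr ?(ltW v0) // exprn_ile1 // ltW.
have h1 := first_variation sU Uc Ub c1 b1 (ltW d0) (ltW e0) (_ : d + e <= 2^-1).
have {}h1 := h1 ltac:(clear -d8 de; lra).
rewrite -/beta in h1; set D := gd _ _ in h1.
have h5 : (d + e) ^+ 4 <= 16 * v * (d * e).
  by rewrite addrC (mulrC d); apply: scale_bound; rewrite v1 ltW.
have de0 : 0 < d * e by exact: mulr_gt0.
have Dd : D < d.
  rewrite -(@ltr_pXn2r _ 2) ?nnegrE ?gd_ge0 ?(ltW d0) //; apply: le_lt_trans h1 _.
  have e1 : e ^+ 2 = v * (d * e) by rewrite expr2 {1}ed; ring.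
  have h2 : 145 * v * (d * e) < 2 * beta * (d * e).
    by rewrite ltr_pM2r //; clear -vb b145; lra.
  move: h2 h5; rewrite e1; move: ((d + e) ^+ 4); clear => w; lra.
exists e.
  by rewrite e0 /=; clear -de dv vr; lra.
have h2 := gd_triangle (sg e) (sA d) sS.
have eD : gd (gexp U b e) (gexp U c d) = D := gd_sym (sg e) (sA d).
have dz : 0 <= d <= z by rewrite (ltW d0) (le_trans dv).
rewrite eD (gS d dz) in h2.
by clear -h2 Dd; lra.
Qed.

Definition cost N (S : 'I_N -> 'M[R]_(n, p)) X := \sum_i gd X (S i) ^+ 2.

Definition minimizer N (S : 'I_N -> 'M[R]_(n, p)) X :=
  Stiefel X /\ forall Y, Stiefel Y -> cost S X <= cost S Y.

Lemma sumr_lt (I : finType) (i0 : I) (f g : I -> R) : (forall i, f i < g i) ->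
  \sum_i f i < \sum_i g i.
Proof.
move=> h; rewrite (bigD1 i0) //= [ltRHS](bigD1 i0) //=; apply: ltr_leD; first exact: h.
by apply: ler_sum => i _; exact: ltW.
Qed.

Lemma sqr_lt (x y : R) : 0 <= x -> x < y -> x ^+ 2 < y ^+ 2.
Proof. by move=> x0 xy; rewrite ltr_pXn2r ?nnegrE // ltW // (le_lt_trans x0). Qed.

(* Moving a minimizer beyond the ball back to the sphere of radius r around C
   would decrease every distance. *)
Lemma minimizer_near N (S : 'I_N -> 'M[R]_(n, p)) C r X : (0 < N)%N ->
  (forall i, Stiefel (S i)) -> Stiefel C -> 0 < r -> r < kappa / 2 ->
  (forall i, gd C (S i) < r) -> minimizer S X -> gd C X <= r.
Proof.
move=> N0 sS sC r0 rk hS [sX mX]; rewrite leNgt; apply/negP => rx; set x := gd C X in rx.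
have kl := kappa_le; have p0 := @pi_gt0 R; pose i0 := Ordinal N0.
have x0 : 0 < x by exact: lt_trans rx.
(* Some S i lies within r of X, since otherwise C would have the smaller cost. *)
have x2r : x < 2 * r.
  have [/existsP[i hi]|/existsPn h] := boolP [exists i, gd X (S i) < r].
    have := gd_triangle sC (sS i) sX; rewrite (gd_sym (sS i) sX) -/x.
    by have := hS i; clear -hi; lra.
  have := mX C sC; rewrite leNgt => /negP[]; apply: sumr_lt => //= i.
  apply: sqr_lt; first exact: gd_ge0.
  by apply: lt_le_trans (hS i) _; rewrite leNgt.
have [a [ O1 [Ca a1 oO1 eX]]] := gexp_ex sC sX x0; rewrite -/x in eX.
have sg t := gexp_stiefel t sC Ca.
have [f fE] : exists f, forall i t, gd (gexp C a t) (S i) = f i t by eexists (fun i t => _).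
have fx i : f i x = gd X (S i) by rewrite -fE -eX gd_orthl.
have f0 i : f i 0 = gd C (S i) by rewrite -fE gexp0.
(* If f r >= f x, convexity from 0 gives f r <= f 0 < r. Then [toward] yields a point r - e with f
   (r - e) < f r, against convexity between r - e and x. *)
have decr i : f i r < f i x.
  have fr : f i r < 2 * r.
    have := gd_triangle (sg r) sC (sS i); rewrite fE (gd_sym (sg r) sC) gexp_gd0 //.
      by have := hS i; clear; lra.
    by clear -r0 rk kl p0; lra.
  rewrite ltNge; apply/negP => hf.
  have cv := geo_convex (L := x) sC Ca a1 (sS i) (fE i); rewrite f0 in cv.
  have hSi := hS i.
  have {}cv l : 0 <= l <= 1 -> f i (l * x) <= (1 - l) * gd C (S i) + l * f i x.
    by apply: cv; move: hf fr hSi; move: (f i x) (f i r) (gd C (S i)) => m1 m2 m3;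
       clear -rk x2r x0; lra.
  have hr : f i r < r.
    have := cv (r / x); rewrite divfK ?gt_eqF // => h.
    have l0 : 0 < r / x by rewrite divr_gt0.
    have l1 : r / x < 1 by rewrite ltr_pdivrMr // mul1r.
    have {}h := h ltac:(by rewrite !ltW).
    have h2 : (1 - r / x) * f i r <= (1 - r / x) * gd C (S i).
      have h3 : r / x * f i x <= r / x * f i r by rewrite ler_wpM2l // ltW.
      by move: h h3; move: (f i x) (f i r) (gd C (S i)) (r / x); clear => *; lra.
    rewrite ler_pM2l ?subr_gt0 // in h2; exact: le_lt_trans h2 _.
  pose Z := gexp C a r; pose b := - gexp_der C a r.
  have sZ : Stiefel Z by exact: sg.
  have Zb : Z^T *m b = 0 by rewrite mulmxN gexp_der_orth // oppr0.
  have b1 : nrm b = 1.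
    by rewrite /b nrmN /nrm /nrm2 /mdot gexp_der_gram // -/(mdot a a) -/(nrm2 a) -/(nrm a).
  have gZ t : gexp Z b t = gexp C a (r - t) by rewrite /b gexp_opp gexp_rebase.
  have [e /andP[e0 er] he] : exists2 e, 0 < e <= r & gd (gexp Z b e) (S i) < gd Z (S i).
    apply: (@toward Z b (S i) r) => //; first by rewrite r0.
      by rewrite gZ subrr gexp0.
    by rewrite fE.
  rewrite gZ !fE in he.
  pose U := gexp C a (r - e); pose c := gexp_der C a (r - e).
  have sU : Stiefel U by exact: sg.
  have Uc : U^T *m c = 0 by exact: gexp_der_orth.
  have c1 : nrm c = 1.
    by rewrite /c /nrm /nrm2 /mdot gexp_der_gram // -/(mdot a a) -/(nrm2 a) -/(nrm a).
  have gU t : gexp U c t = gexp C a (r - e + t) by rewrite gexp_rebase.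
  have [L eL] : exists L, L = x - (r - e) by exists (x - (r - e)).
  have fU t : gd (gexp U c t) (S i) = f i (r - e + t) by rewrite gU fE.
  have cv2 := geo_convex (L := L) sU Uc c1 (sS i) fU.
  rewrite addr0 (_ : r - e + L = x) in cv2; last by rewrite eL; clear -eL; ring.
  have L0 : 0 < L by rewrite eL; clear -rx e0; lra.
  have := cv2 _ _ _ _ (e / L); rewrite divfK ?gt_eqF // subrK => h.
  have m0 : 0 < e / L by rewrite divr_gt0.
  have m1 : e / L < 1 by rewrite ltr_pdivrMr // mul1r eL; clear -rx; lra.
  have {}h : f i r <= (1 - e / L) * f i (r - e) + e / L * f i x.
    apply: h; last (by rewrite !ltW); move: hf fr hr he; rewrite ?eL;
      move: (f i (r - e)) (f i r) (f i x) => v1 v2 v3; clear -rk x2r x0 r0 er e0 rx; lra.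
  have h2 : (1 - e / L) * f i (r - e) < (1 - e / L) * f i r by rewrite ltr_pM2l ?subr_gt0.
  have h3 : e / L * f i x <= e / L * f i r by rewrite ler_wpM2l // ltW.
  move: h h2 h3; move: (f i (r - e)) (f i r) (f i x) (e / L); clear => *; lra.
have := mX _ (sg r); rewrite leNgt => /negP[]; apply: sumr_lt => //= i.
by apply: sqr_lt; [exact: gd_ge0|rewrite fE -fx; exact: decr].
Qed.

Lemma cvg_nrm2 (T : Type) (F : set_system T) {FF : Filter F} m k
    (u : T -> 'M[R]_(m, k)) (A : 'M[R]_(m, k)) : u @ F --> A -> (fun t => nrm2 (u t)) @ F --> nrm2 A.
Proof.
move=> /mx_cvgP h; rewrite nrm2E (_ : (fun t => _) = fun t => \sum_i \sum_j u t i j ^+ 2).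
  by apply: cvg_sumr => i _; apply: cvg_sumr => j _; rewrite expr2; apply: cvgM; exact: h.
by apply/funext => t; rewrite nrm2E.
Qed.

Lemma stiefel_compact : compact [set X : 'M[R]_(n, p) | Stiefel X].
Proof.
apply: (@mx_compact _ _ _ _ 1) => [|X sX i j].
  rewrite (_ : mkset _ = (fun X : 'M[R]_(n, p) => nrm2 (X^T *m X - 1%:M)) @^-1` [set 0]).
    apply: closed_comp (@closed_eq _ _) => X _.
    apply: (@cvg_nrm2 _ (nbhs X) (nbhs_filter X)); apply: cvgB; last exact: cvg_cst.
    apply: (@cvg_mulmx R _ (nbhs X) _ _ _ _ trmx id); last exact: cvg_id.
    by apply: (@cvg_trmx R _ (nbhs X) _ _ _ id); exact: cvg_id.
  rewrite eqEsubset /Stiefel; split=> X /=; first by move=> ->; rewrite subrr nrm20.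
  by move/nrm2_eq0/eqP; rewrite subr_eq0 => /eqP.
rewrite -(@ler_pXn2r _ 2) ?nnegrE // real_normK ?num_real // expr1n.
move: sX; rewrite /mkset /Stiefel => /matrixP/(_ j j); rewrite !mxE eqxx mulr1n => <-.
rewrite (bigD1 i) //= mxE -expr2 lerDl; apply: sumr_ge0 => l _.
by rewrite mxE -expr2 sqr_ge0.
Qed.

Lemma gd_near X0 (e : R) : 0 < e ->
  \forall X \near X0, Stiefel X0 -> Stiefel X -> gd X0 X < e.
Proof.
move=> e0; have h : (fun X => nrm2 (X - X0)) @ X0 --> nrm2 (X0 - X0).
  by apply: (@cvg_nrm2 _ (nbhs X0) (nbhs_filter X0)); apply: cvgB; [exact: cvg_id|exact: cvg_cst].
rewrite subrr nrm20 in h; have q0 : 0 < Num.min 2^-1 (e ^+ 2 / 4).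
  by rewrite lt_min invr_gt0 ltr0n divr_gt0 ?exprn_gt0.
have /cvgrPdist_lt/(_ _ q0) := h; apply: filterS => X.
rewrite sub0r normrN ger0_norm ?nrm2_ge0 // lt_min => /andP[h1 h2] sX0 sX.
have h3 := gd_nrm2B sX0 sX (ltW h1); have y0 := nrm2_ge0 (X - X0).
rewrite -(@ltr_pXn2r _ 2) ?nnegrE ?gd_ge0 ?(ltW e0) //.
have e2 : 0 < e ^+ 2 by rewrite exprn_gt0.
move: h1 h2 h3 y0 e2; move: (nrm2 _) (gd _ _ ^+ 2) (e ^+ 2) => y g w; clear; nra.
Qed.

Lemma minimizer_exists N (S : 'I_N -> 'M[R]_(n, p)) C : Stiefel C ->
  (forall i, Stiefel (S i)) -> exists X, minimizer S X.
Proof.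
move=> sC sS; pose A := [set X : 'M[R]_(n, p) | Stiefel X].
have A0 : A !=set0 by exists C.
have cF : {within A, continuous (cost S)}.
  apply/subspace_continuousP => X0 sX0; apply: cvg_sumr => i _.
  suff h : (fun X => gd X (S i)) @ within A (nbhs X0) --> gd X0 (S i).
    by rewrite expr2; apply: cvgM.
  apply/cvgrPdist_lt => e e0; rewrite near_withinE; have := gd_near X0 e0.
  apply: filterS => X h sX; rewrite distrC; apply: le_lt_trans (h sX0 sX).
  exact: gd_lip.
have [X] := compact_EVT_min A0 stiefel_compact cF; rewrite inE => sX hX.
by exists X; split => // Y sY; apply: hX; rewrite inE.
Qed.

(** The geodesic from M to S is prolonged by h beyond S to a point P at distance c + h from M. By
    the midpoint inequality X is at distance c + h from P as well, so the path from X over S to P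
    has no corner. Hence X and M lie in the same direction from S at the same distance, and
    coincide. *)
Lemma strict_midpoint S X M Y (c d : R) : Stiefel S -> Stiefel X -> Stiefel M -> Stiefel Y ->
  refl M *m X = Y -> gd X M = d -> 0 < d < kappa / 2 -> c < kappa ->
  gd X S = c -> gd Y S = c -> gd M S = c -> False.
Proof.
move=> sS sX sM sY eY gXM /andP[d0 dk] ck gX gY gM.
have kl := kappa_le; have k0 := kappa_gt0; have p0 := @pi_gt0 R.
have c0 : 0 < c.
  rewrite lt_def -{2}gX gd_ge0 andbT; apply/eqP => c0.
  have := gd_triangle sX sS sM; rewrite gX (gd_sym sS sM) gM c0 gXM.
  by clear -d0; lra.
have [u [ O1 [Su u1 oO1 eM]]] := gexp_ex sS sM (ltac:(by rewrite gd_sym // gM)).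
have [v [ O2 [Sv v1 oO2 eX]]] := gexp_ex sS sX (ltac:(by rewrite gd_sym // gX)).
rewrite gd_sym // gM in eM; rewrite gd_sym // gX in eX.
have sgu t := gexp_stiefel t sS Su; have sgv t := gexp_stiefel t sS Sv.
have Su' : S^T *m - u = 0 by rewrite mulmxN Su oppr0.
have u1' : nrm (- u) = 1 by rewrite nrmN.
have ext h : 0 < h -> c + h < kappa -> h <= d -> gd X (gexp S u (- h)) = c + h.
  move=> h0 hk hd; pose P := gexp S u (- h); have sP : Stiefel P by exact: sgu.
  have gSP : gd S P = h.
    rewrite /P -gexp_opp gexp_gd0 // ltW //=; clear -hk c0 kl p0; lra.
  have gMP : gd M P = c + h.
    have ch0 : 0 <= c + h by rewrite addr_ge0 // ltW.
    have chp : c + h <= pi / 2 by clear -hk kl p0; lra.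
    by rewrite -(gd_orthl sM sP oO1) eM (gd_sym (sgu c) sP) gexp_gd // opprK ger0_norm.
  have gXP : gd X P <= c + h by have := gd_triangle sX sS sP; rewrite gX gSP.
  have gYP : gd Y P <= c + h by have := gd_triangle sY sS sP; rewrite gY gSP.
  have [f1 e1] : exists f1, gd X P = f1 by eexists.
  have [f2 e2] : exists f2, gd Y P = f2 by eexists.
  rewrite e1 in gXP *; rewrite e2 in gYP.
  have := midpoint_eq sP sM sX eY e1 e2 gMP gXM.
  move=> hm; have {}hm : 2 * (c + h) <= f1 + f2.
    by apply: hm; clear -gXP gYP hk dk kl p0 k0 hd; lra.
  by apply/eqP; rewrite eq_le gXP /=; clear -hm gYP; lra.
pose beta := mdot v u.
have beta1 : 1 <= beta.
  rewrite leNgt; apply/negP => b1.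
  have kc : 0 < kappa - c by rewrite subr_gt0.
  have dc : 0 < Num.min d c by rewrite lt_min d0.
  have mn : 0 < Num.min ((kappa - c) / 2) (Num.min d c) by rewrite lt_min dc divr_gt0.
  (* For h below this bound the error 9 h^2 is less than (1 - beta) / 2; any divisor above 18 would
     do. *)
  have b2 : 0 < (1 - beta) / 73 by rewrite divr_gt0 // subr_gt0.
  have [h [h0 h2]] := small_exists mn b2; rewrite !le_min => /and3P[hk hd hc] hb.
  pose h' := h / 2.
  have hh0 : 0 < h' by rewrite divr_gt0.
  have fv := first_variation sS Sv Su' v1 u1' (ltW hh0) (ltW hh0).
  have {}fv := fv ltac:(rewrite /h'; clear -h2; lra).
  rewrite mdotNr -/beta gexp_opp in fv.
  have gA : gd (gexp S v h') X = c - h'.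
    have ch0 : 0 <= c - h' by rewrite /h'; clear -hc h0; lra.
    have chp : c - h' <= pi / 2 by rewrite /h'; clear -h0 ck kl p0; lra.
    by rewrite -(gd_orthr (sgv h') sX oO2) eX gexp_gd // ger0_norm.
  have hl : h' + h' <= gd (gexp S v h') (gexp S u (- h')).
    have := gd_triangle sX (sgv h') (sgu (- h')).
    rewrite ext // ?(gd_sym sX) // ?gA; rewrite /h'; clear -hk hd h0; lra.
  have hs : (h' + h') ^+ 2 <= gd (gexp S v h') (gexp S u (- h')) ^+ 2.
    by rewrite ler_pXn2r ?nnegrE ?gd_ge0 // addr_ge0 // ltW.
  have {hs fv} := le_trans hs fv.
  have -> : h' + h' = h by rewrite /h'; clear -h0; field.
  have -> : h' ^+ 2 + h' ^+ 2 - 2 * (h' * h') * - beta = h ^+ 2 / 2 * (1 + beta).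
    by rewrite /h'; clear -h0; field.
  have -> : h ^+ 4 = h ^+ 2 * h ^+ 2 by rewrite -exprD.
  have -> : h ^+ 2 / 2 * (1 + beta) + 9 * (h ^+ 2 * h ^+ 2) =
      h ^+ 2 * ((1 + beta) / 2 + 9 * h ^+ 2) by clear -h0; field.
  rewrite -[leLHS]mulr1 ler_pM2l ?exprn_gt0 //.
  have : h ^+ 2 <= h by rewrite expr2 ler_piMl ?(ltW h0) //; clear -h2; lra.
  by move: (h ^+ 2) => w; clear -hb b1 h0; lra.
have euv : v = u.
  apply/eqP; rewrite -subr_eq0; apply/eqP/nrm2_eq0/eqP; rewrite eq_le nrm2_ge0 andbT.
  rewrite nrm2B -/beta -!sqr_nrm u1 v1 expr1n; clear -beta1; lra.
have := gXM; rewrite -(gd_orth sX sM oO2 oO1) eX eM euv gd_refl // => e.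
by rewrite -e ltxx in d0.
Qed.

(** At the midpoint of two minimizers, f1^2 + f2^2 - 2 c^2 is nonnegative for each S i, and
    minimality makes the sum 0. So the three distances agree, which [strict_midpoint] excludes. *)
Lemma minimizer_unique N (S : 'I_N -> 'M[R]_(n, p)) C r X Y : (0 < N)%N ->
  (forall i, Stiefel (S i)) -> Stiefel C -> 0 < r -> r < kappa / 2 ->
  (forall i, gd C (S i) < r) -> minimizer S X -> minimizer S Y ->
  exists2 O, Orth O & Y = X *m O.
Proof.
move=> N0 sS sC r0 rk hS mX mY; have kl := kappa_le; have p0 := @pi_gt0 R.
have k0 := kappa_gt0.
have nX := minimizer_near N0 sS sC r0 rk hS mX; have nY := minimizer_near N0 sS sC r0 rk hS mY.
case: mX => sX mX; case: mY => sY mY; apply: gd_eq0 => //; apply/eqP.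
rewrite eq_le gd_ge0 andbT leNgt; apply/negP => d0.
set d := gd X Y in d0.
have dr : d <= 2 * r.
  by have := gd_triangle sX sC sY; rewrite (gd_sym sX sC) -/d; clear -nX nY; lra.
have [a [ O1 [Xa a1 oO1 eY]]] := gexp_ex sX sY d0; rewrite -/d in eY.
have sg t := gexp_stiefel t sX Xa; pose M := gexp X a (d / 2).
have sM : Stiefel M by exact: sg.
have erf : refl M *m X = gexp X a d.
  have := gexp_refl (d / 2) (- (d / 2)) sX Xa.
  by rewrite subrr opprK -splitr gexp0.
have gXM : gd X M = d / 2 by rewrite gexp_gd0 //; clear -d0 dr rk kl p0; lra.
have gYE T : Stiefel T -> gd (gexp X a d) T = gd Y T by move=> sT; rewrite -eY gd_orthl.
have nM : gd C M <= r.
  have [f fE] : exists f, forall t, gd (gexp X a t) C = f t by eexists.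
  have f0 : f 0 = gd C X by rewrite -fE gexp0 gd_sym.
  have fd : f d = gd C Y by rewrite -fE gYE // gd_sym.
  have cv := geo_convex (L := d) sX Xa a1 sC fE; rewrite f0 fd in cv.
  have : f (2^-1 * d) <= (1 - 2^-1) * gd C X + 2^-1 * gd C Y.
    by apply: cv; move: nX nY; move: (gd C X) (gd C Y); clear -rk r0 d0 dr k0 => m1 m2; lra.
  rewrite [2^-1 * d]mulrC -fE gd_sym //; move: nX nY; move: (gd C X) (gd C Y) (gd _ _).
  by clear => m1 m2 m3; lra.
pose f1 i := gd X (S i); pose f2 i := gd Y (S i); pose c i := gd M (S i).
have bd T i : Stiefel T -> gd C T <= r -> gd T (S i) < 2 * r.
  move=> sT nT; have := gd_triangle sT sC (sS i); rewrite (gd_sym sT sC).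
  by have := hS i; clear -nT; lra.
have mid i : 2 * c i <= f1 i + f2 i.
  have b1 := bd X i sX nX; have b2 := bd Y i sY nY; have b3 := bd M i sM nM.
  have := midpoint_eq (sS i) sM sX erf (erefl (f1 i)) (gYE _ (sS i)) (erefl (c i)) gXM.
  rewrite -/(f1 i) -/(f2 i) -/(c i) in b1 b2 b3 *.
  by apply; move: b1 b2 b3; move: (f1 i) (f2 i) (c i); clear -rk kl p0 dr r0 d0 => m1 m2 m3; lra.
have fsq i : 0 <= f1 i ^+ 2 + f2 i ^+ 2 - 2 * c i ^+ 2.
  by apply: sqr_midpoint => //; exact: gd_ge0.
have sum0 : \sum_i (f1 i ^+ 2 + f2 i ^+ 2 - 2 * c i ^+ 2) = 0.
  apply/eqP; rewrite eq_le sumr_ge0 // andbT sumrB big_split /= -mulr_sumr.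
  have := mX M sM; have := mY M sM; rewrite /cost -/(f1 _) -/(f2 _).
  by move: (\sum_i f1 i ^+ 2) (\sum_i f2 i ^+ 2) (\sum_i c i ^+ 2); clear => m1 m2 m3; lra.
have all0 i : f1 i ^+ 2 + f2 i ^+ 2 - 2 * c i ^+ 2 = 0.
  by have /psumr_eq0P -> := sum0.
pose i := Ordinal N0.
have eqs : f1 i = c i /\ f2 i = c i.
  by apply: sqr_midpoint_eq => //; exact: gd_ge0.
case: eqs; rewrite /f1 /f2 /c => g1 g2; have b3 := bd M i sM nM.
have d2 : 0 < d / 2 < kappa / 2 by clear -d0 dr rk; lra.
have ck : gd M (S i) < kappa by move: b3; move: (gd _ _); clear -rk => m; lra.
have g3 : gd (gexp X a d) (S i) = gd M (S i) by rewrite gYE.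
exact: (strict_midpoint (sS i) sX sM (sg d) erf gXM d2 ck g1 g3 (erefl _)).
Qed.

Theorem karcher_frames N (S : 'I_N -> 'M[R]_(n, p)) C r : (0 < N)%N ->
  (forall i, Stiefel (S i)) -> Stiefel C -> r < pi / (4 * Num.sqrt 2) ->
  (forall i, gd C (S i) < r) ->
  exists W, [/\ minimizer S W, forall X, minimizer S X -> exists2 O, Orth O & X = W *m O
    & forall i, gd (S i) W < pi / 2].
Proof.
move=> N0 sS sC; rewrite radius_kappa => rk hS; have kl := kappa_le; have p0 := @pi_gt0 R.
have r0 : 0 < r by apply: le_lt_trans (hS (Ordinal N0)); exact: gd_ge0.
have [W mW] := minimizer_exists sC sS.
have nW := minimizer_near N0 sS sC r0 rk hS mW.
exists W; split => // [X mX|i].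
  exact: (minimizer_unique N0 sS sC r0 rk hS mW mX).
have sW := mW.1; have := gd_triangle (sS i) sC sW; rewrite (gd_sym (sS i) sC).
by have := hS i; clear -nW rk kl p0; lra.
Qed.

End Karcher.

(** * The Stiefel distance *)

Section Dini.
Variable R : realType.
Implicit Types (f F S Phi : R -> R) (t h e : R).

Lemma der_near f t e : derivable f t 1 -> 0 < e ->
  \forall h \near 0, `|f (t + h) - f t - h * derive1 f t| <= e * `|h|.
Proof.
move=> df e0; have := df; rewrite /derivable => /cvgrPdist_le /(_ e e0).
rewrite -/(derive f t 1) -derive1E near_withinE; apply: filterS => h hh.
have [->|h0] := eqVneq h 0; first by rewrite addr0 subrr mul0r subrr normr0 mulr0.
have := hh h0; rewrite /= /GRing.scale /= mulr1 [h + t]addrC => h1.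
have -> : f (t + h) - f t - h * derive1 f t = - (h * (derive1 f t - h^-1 * (f (t + h) - f t))).
  by field.
by rewrite normrN normrM mulrC ler_wpM2r.
Qed.

Lemma near0P (P : R -> Prop) : (\forall h \near 0, P h) ->
  exists2 d, 0 < d & forall h, `|h| < d -> P h.
Proof.
move=> /nbhs_ballP[d /= d0 hd]; exists d => // h hh; apply: hd.
by rewrite /ball /= sub0r normrN.
Qed.

(** [Phi] will contain [acos] and [gd], which need not be differentiable, so only right difference
    quotients and lower semicontinuity are asked of it. The supremum of the times up to which the
    estimate holds, with slack e t, is shown to be 1. *)
Lemma dini Phi F S :
  (forall t, 0 <= t <= 1 -> derivable F t 1 /\ derive1 F t = S t) ->
  (forall t e, 0 <= t < 1 -> 0 < e ->
     \forall h \near 0, 0 < h -> t + h <= 1 -> Phi (t + h) <= Phi t + (S t + e) * h) ->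
  (forall t e, 0 <= t <= 1 -> 0 < e ->
     \forall h \near 0, 0 <= t + h <= 1 -> Phi t <= Phi (t + h) + e) ->
  Phi 1 - Phi 0 <= F 1 - F 0.
Proof.
move=> dF hP cP.
suff main e : 0 < e -> Phi 1 - Phi 0 <= F 1 - F 0 + e.
  by apply/ler_addgt0Pr => e e0; exact: main.
move=> e0; pose good s := Phi s - Phi 0 <= F s - F 0 + e * s.
pose E := [set t : R | 0 <= t <= 1 /\ forall s, 0 <= s <= t -> good s].
have g0 : good 0 by rewrite /good !subrr mulr0 addr0.
have E0 : E 0.
  by split; [rewrite lexx ler01|move=> s s0; rewrite (_ : s = 0) //; apply/eqP; rewrite eq_le andbC].
have ubE : ubound E 1 by move=> t [/andP[]].
have sE : has_sup E by split; [exists 0|exists 1].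
set tau := sup E.
have t0 : 0 <= tau by apply: ub_le_sup => //; exact: sE.2.
have t1 : tau <= 1 by apply: ge_sup => //; exists 0.
have below s : 0 <= s < tau -> good s.
  move=> /andP[s0 st]; have ps : 0 < tau - s by rewrite subr_gt0.
  have [t [_ ht] lt] := sup_adherent ps sE.
  by apply: ht; rewrite s0 /= ltW //; move: lt; rewrite -/tau subKr.
have tau01 : 0 <= tau <= 1 by rewrite t0.
have [dFt _] := dF _ tau01.
have gt : good tau.
  move: (t0); rewrite le_eqVlt => /orP[/eqP <-//|tp].
  suff h n : 0 < n -> Phi tau - Phi 0 <= F tau - F 0 + e * tau + n.
    by rewrite /good; apply/ler_addgt0Pr => n n0; exact: h.
  move=> n0; have n2 : 0 < n / 2 by rewrite divr_gt0.
  have [d1 d10 h1] := near0P (cP _ _ tau01 n2).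
  have [d2 d20 h2] := near0P (der_near dFt ltr01).
  set K := `|derive1 F tau| + 1.
  have K0 : 0 < K by rewrite ltr_wpDl.
  pose d := Num.min (Num.min (d1 / 2) (d2 / 2)) (Num.min tau (n / 2 / K)).
  have d0 : 0 < d by rewrite !lt_min tp !divr_gt0.
  have [l1 l2 l3 l4] : [/\ d <= d1 / 2, d <= d2 / 2, d <= tau & d <= n / 2 / K].
    by rewrite /d !ge_min !lexx !orbT.
  have nd : `|- d| = d by rewrite normrN gtr0_norm.
  have := h1 (- d); rewrite nd => /(_ ltac:(lra)) {}h1.
  have := h2 (- d); rewrite nd mul1r => /(_ ltac:(lra)) {}h2.
  have {}h1 := h1 ltac:(lra).
  have g : good (tau - d) by apply: below; lra.
  have h3 : F (tau - d) <= F tau + n / 2.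
    have : d * K <= n / 2 by rewrite -ler_pdivlMr.
    have : - d * derive1 F tau <= d * `|derive1 F tau|.
      by rewrite mulNr -mulrN ler_pM2l // -normrN ler_norm.
    by move: h2; rewrite ler_norml /K => /andP[_]; lra.
  have ed : 0 < e * d by exact: mulr_gt0.
  by move: g; rewrite /good; lra.
have [t1'|] := ltP tau 1; last first.
  move=> h; have e1 : tau = 1 by apply/eqP; rewrite eq_le t1.
  by move: gt; rewrite /good e1 mulr1 => gt; lra.
exfalso; have e2 : 0 < e / 2 by rewrite divr_gt0.
have tau01' : 0 <= tau < 1 by rewrite t0.
have [d1 d10 h1] := near0P (hP _ _ tau01' e2); have [d2 d20 h2] := near0P (der_near dFt e2).
pose d := Num.min (Num.min (d1 / 2) (d2 / 2)) (1 - tau).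
have d0 : 0 < d by rewrite !lt_min subr_gt0 t1' !divr_gt0.
have [l1 l2 l3] : [/\ d <= d1 / 2, d <= d2 / 2 & d <= 1 - tau].
  by rewrite /d !ge_min !lexx !orbT.
have gh h : 0 < h -> h <= d -> good (tau + h).
  move=> hp hd; have nh : `|h| = h by rewrite gtr0_norm.
  have := h1 h; rewrite nh => /(_ ltac:(lra)) /(_ hp) /(_ ltac:(lra)) {}h1.
  have := h2 h; rewrite nh => /(_ ltac:(lra)) {}h2.
  have [_ eS] := dF _ tau01; rewrite eS ler_norml in h2; case/andP: h2 => h2 _.
  by move: gt; rewrite /good; lra.
have : E (tau + d).
  split=> [|s /andP[s0 sd]]; first by apply/andP; split; lra.
  have [sl|] := ltP s tau; first by apply: below; rewrite s0.
  rewrite le_eqVlt => /orP[/eqP <-//|ts].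
  rewrite (_ : s = tau + (s - tau)); last by rewrite addrC subrK.
  by apply: gh; lra.
move/(sup_upper_bound sE); rewrite -/tau; lra.
Qed.

Lemma antiderivative S : continuous S -> exists F,
  (forall t, 0 <= t <= 1 -> derivable F t 1 /\ derive1 F t = S t) /\
  (\int[lebesgue_measure]_(t in `[0%R, 1%R]) (S t)%:E)%E = (F 1 - F 0)%:E.
Proof.
(* Integrating from -1 and applying the theorem on [-1, 2] makes 0 and 1 interior points, with
   two-sided derivatives. *)
move=> cS; pose F x := (\int[lebesgue_measure]_(t in `[(-1)%R, x]) (S t))%R.
have intS : lebesgue_measure.-integrable `[(-1)%R, 2%R] (EFin \o S).
  apply: continuous_compact_integrable; first exact: segment_compact.
  exact: continuous_subspaceT.
have dF t : 0 <= t <= 1 -> derivable F t 1 /\ derive1 F t = S t.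
  move=> /andP[t0 t1]; apply: (@continuous_FTC1_closed _ S (-1) t 2) => //.
  - by lra.
  - by lra.
  - exact: cS.
have cF t : 0 <= t <= 1 -> {for t, continuous F}.
  by move=> /dF[/derivable1_diffP/differentiable_continuous].
exists F; split => //; rewrite EFinB; apply: continuous_FTC2 => //.
- exact: continuous_subspaceT.
- split.
  + by move=> x; rewrite in_itv /= => /andP[/ltW x0 /ltW x1]; case: (dF x) => //; rewrite x0.
  + by apply: cvg_at_right_filter; apply: cF; rewrite lexx ler01.
  + by apply: cvg_at_left_filter; apply: cF; rewrite lexx ler01.
by move=> x; rewrite in_itv /= => /andP[/ltW x0 /ltW x1]; case: (dF x) => //; rewrite x0.
Qed.

(** Common to both distances: each satisfies d^2 <= y + 2 y^2 for a squared chord y, so locally it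
    grows at the speed c of the chord, up to e. *)
Lemma speed_near (c e : R) : 0 <= c -> 0 < e -> \forall h \near (0 : R),
  forall d y : R, 0 <= d -> 0 <= y -> y <= (c * `|h|) ^+ 2 ->
  (y <= 2^-1 -> d ^+ 2 <= y + 2 * y ^+ 2) -> d <= (c + e) * `|h|.
Proof.
move=> c0 e0; pose K := c + 1; have K1 : 1 <= K by rewrite lerDr.
have K0 : 0 < K by apply: lt_le_trans K1.
(* For |h| < b, c |h| is at most 1 / 2 and 2 (c |h|)^2 at most e |h|. *)
pose b := Num.min (1 / (2 * K)) (e / (2 * K ^+ 2)).
have b0 : 0 < b by rewrite lt_min !divr_gt0 ?mulr_gt0 ?exprn_gt0.
apply/nbhs_ballP; exists b => //= h'; rewrite /ball /= sub0r normrN.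
have := normr_ge0 h'; move: `|h'| => h; rewrite le_eqVlt => /predU1P[<- _ d y d0 y0|].
  rewrite !mulr0 expr0n /= => yc hd; have y00 : y = 0 by apply/eqP; rewrite eq_le yc.
  have e2 : y ^+ 2 = 0 by rewrite y00 expr2 mulr0.
  have d2 : d ^+ 2 <= 0 by apply: le_trans (hd _) _; rewrite ?e2; lra.
  have : d ^+ 2 == 0 by rewrite eq_le d2 sqr_ge0.
  by rewrite sqrf_eq0 => /eqP ->.
move=> h0 hb d y d0 y0 yc hd.
rewrite lt_min in hb; case/andP: hb => hb1 hb2.
have hK : h * (2 * K) < 1 by rewrite -ltr_pdivlMr ?mulr_gt0.
have hK2 : h * (2 * K ^+ 2) < e by rewrite -ltr_pdivlMr ?mulr_gt0 ?exprn_gt0.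
have cK : c <= K by rewrite lerDl.
have ch0 : 0 <= c * h by rewrite mulr_ge0 // ltW.
have ch : c * h <= 2^-1.
  have h1 : c * h <= K * h by rewrite ler_pM2r.
  by clear -h1 hK; lra.
have ch2 : (c * h) ^+ 2 <= 4^-1.
  have : (c * h) ^+ 2 <= (2^-1) ^+ 2 by rewrite ler_pXn2r ?nnegrE.
  by rewrite expr2; lra.
have che : 2 * ((c * h) ^+ 2) <= e * h.
  have -> : 2 * (c * h) ^+ 2 = h * (2 * c ^+ 2) * h by ring.
  rewrite ler_pM2r //; apply: ltW; apply: le_lt_trans hK2.
  by rewrite ler_pM2l // ler_pM2l // ler_pXn2r ?nnegrE // ltW.
have {}hd := hd ltac:(apply: le_trans yc _; lra).
have ceh : 0 <= (c + e) * h by rewrite mulr_ge0 ?addr_ge0 // ltW.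
rewrite -(@ler_pXn2r _ 2) ?nnegrE //; apply: le_trans hd _.
have eh : 0 < e * h by exact: mulr_gt0.
have y2 : y ^+ 2 <= ((c * h) ^+ 2) ^+ 2 by rewrite ler_pXn2r ?nnegrE ?sqr_ge0.
set w := (c * h) ^+ 2 in yc ch2 che y2.
have w0 : 0 <= w by exact: sqr_ge0.
have -> : ((c + e) * h) ^+ 2 = w + 2 * (c * h) * (e * h) + (e * h) ^+ 2 by rewrite /w; ring.
have h1 : 2 * w ^+ 2 <= (e * h) ^+ 2.
  have : (2 * w) ^+ 2 <= (e * h) ^+ 2 by rewrite ler_pXn2r ?nnegrE ?mulr_ge0 // ltW.
  have -> : (2 * w) ^+ 2 = 4 * w ^+ 2 by ring.
  by have := sqr_ge0 w; clear; move: (w ^+ 2) (_ ^+ 2) => a b; lra.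
have h2 : 0 <= 2 * (c * h) * (e * h) by rewrite !mulr_ge0 // ltW.
lra.
Qed.

(* For D = g'(t) at U = g(t): A = |U^T D|, B = |D - U U^T D| is the speed of the
   column span, E = |D| bounds the speed of the columns, S is the canonical speed. *)
Lemma speed_mix (A B E S l : R) : 0 <= A -> 0 <= B -> 0 <= E -> 0 <= S -> 0 < l ->
  E ^+ 2 = A ^+ 2 + B ^+ 2 -> 2 * S ^+ 2 = A ^+ 2 + 2 * B ^+ 2 ->
  l * E + B <= (1 + l + l ^+ 2) * S.
Proof.
move=> A0 B0 E0 S0 l0 eE eS.
have SB : B <= S by rewrite -(@ler_pXn2r _ 2) ?nnegrE //; have := sqr_ge0 A; lra.
have EAS : E <= S + A.
  rewrite -(@ler_pXn2r _ 2) ?nnegrE ?addr_ge0 //.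
  have : 0 <= S * A by exact: mulr_ge0.
  have := sqr_ge0 A; lra.
have lA : l * A <= (S - B) + l ^+ 2 * S.
  have r0 : 0 <= (S - B) + l ^+ 2 * S.
    by rewrite addr_ge0 ?subr_ge0 // mulr_ge0 // sqr_ge0.
  rewrite -(@ler_pXn2r _ 2) ?nnegrE ?mulr_ge0 ?(ltW l0) //.
  have h1 : A ^+ 2 <= 4 * ((S - B) * S).
    have : 0 <= (S - B) * (S - B) by rewrite -expr2 sqr_ge0.
    lra.
  have h2 : l ^+ 2 * A ^+ 2 <= l ^+ 2 * (4 * ((S - B) * S)) by rewrite ler_wpM2l ?sqr_ge0.
  have := sqr_ge0 ((S - B) - l ^+ 2 * S); rewrite exprMn; lra.
have : l * E <= l * (S + A) by rewrite ler_pM2l.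
lra.
Qed.

End Dini.

(** * Lengths of curves against the Grassmann and the column distances *)

Section StiefelDistance.
Variables (R : realType) (n p : nat).
Implicit Types (U V Y W : 'M[R]_(n, p)) (g : R -> 'M[R]_(n, p)).

Lemma mat_der_near g t e : (forall i j, derivable (fun s => g s i j) t 1) -> 0 < e ->
  \forall h \near 0, nrm (g (t + h) - g t - h *: velocity g t) <= e * `|h|.
Proof.
(* There are n p <= k^2 entries; the 1 keeps k positive. *)
move=> dg e0; pose k : R := n%:R * p%:R + 1.
have k0 : 0 < k by rewrite ltr_wpDl // mulr_ge0.
have [e' e'0 eE] : exists2 e', 0 < e' & e = e' * k.
  by exists (e / k); rewrite ?divfK ?gt_eqF // divr_gt0.
have : \forall h \near (0 : R), forall (i : 'I_n) (j : 'I_p),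
    `|g (t + h) i j - g t i j - h * velocity g t i j| <= e' * `|h|.
  apply: (@filter_forall R 'I_n (fun i h => forall j : 'I_p,
    `|g (t + h) i j - g t i j - h * velocity g t i j| <= e' * `|h|) (nbhs (0 : R)) _ _) => i.
  apply: (@filter_forall R 'I_p (fun j h =>
    `|g (t + h) i j - g t i j - h * velocity g t i j| <= e' * `|h|) (nbhs (0 : R)) _ _) => j.
  have := der_near (dg i j) e'0.
  by apply: filterS => h; rewrite mxE.
apply: filterS => h hh.
have eh : 0 <= e' * `|h| by rewrite mulr_ge0 // ltW.
rewrite -(@ler_pXn2r _ 2) ?nnegrE ?nrm_ge0 ?mulr_ge0 ?(ltW e0) // sqr_nrm nrm2E.
apply: le_trans (_ : \sum_(i < n) \sum_(j < p) (e' * `|h|) ^+ 2 <= _).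
  apply: ler_sum => i _; apply: ler_sum => j _.
  have -> : (g (t + h) - g t - h *: velocity g t) i j =
    g (t + h) i j - g t i j - h * velocity g t i j by rewrite !mxE.
  by rewrite -[leLHS]real_normK ?num_real // ler_pXn2r ?nnegrE.
rewrite !sumr_const !card_ord -mulrnA -[leLHS]mulr_natr natrM.
have -> : (e * `|h|) ^+ 2 = (e' * `|h|) ^+ 2 * k ^+ 2 by rewrite eE; ring.
rewrite ler_wpM2l ?sqr_ge0 // /k sqrrD1.
have : 0 <= (n%:R * p%:R : R) by rewrite mulr_ge0.
by rewrite [p%:R * _]mulrC; move: (_ * _) => z z0; have := sqr_ge0 z; lra.
Qed.

End StiefelDistance.

Section StiefelLength.
Variables (R : realType) (n p : nat).
Implicit Types (U V Y W D : 'M[R]_(n, p)) (Q : 'M[R]_p) (g : R -> 'M[R]_(n, p)).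

(** x_j is the squared chord between the j-th columns and bounds the sin^2 of their angle. *)
Lemma avec_nrm2B U V : Stiefel U -> Stiefel V -> nrm2 (V - U) <= 2^-1 ->
  nrm2 (avec U V) <= nrm2 (V - U) + 2 * nrm2 (V - U) ^+ 2.
Proof.
move=> sU sV; set w := nrm2 (V - U) => w2.
have [x xE] : exists x : 'I_p -> R, forall j, x j = 2 * (1 - (U^T *m V) j j) by eexists.
have x0 j : 0 <= x j by rewrite xE mulr_ge0 // subr_ge0; case/andP: (stiefel_entry j sU sV).
have ew : w = \sum_j x j.
  have eS (A : 'M[R]_(n, p)) : Stiefel A -> nrm2 A = p%:R.
    by rewrite /nrm2 /mdot /Stiefel => ->; exact: mxtrace1.
  rewrite /w nrm2B !eS // (eq_bigr _ (fun i _ => xE i)) -mulr_sumr sumrB sumr_const card_ord.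
  have -> : \sum_i (U^T *m V) i i = mdot V U by rewrite mdotC.
  ring.
have xw j : x j <= w by rewrite ew (bigD1 j) //= lerDl sumr_ge0.
rewrite nrm2_row; apply: le_trans (_ : \sum_j (x j + 2 * w * x j) <= _); last first.
  by rewrite big_split /= -mulr_sumr -ew expr2 mulrA.
apply: ler_sum => j _; rewrite mxE; set c := (U^T *m V) j j.
have /andP[c1 c2] : -1 <= c <= 1 by exact: stiefel_entry.
have xj : x j = 2 * (1 - c) by exact: xE.
have xw' := le_trans (xw j) w2; have c0 : 0 <= c by lra.
have eA : cos (acos c) = c by apply: acosK; rewrite in_itv /= c1.
have sA : sin (acos c) ^+ 2 <= x j.
  rewrite sin2cos2 eA xj; have := sqr_ge0 (1 - c).
  have -> : (1 - c) ^+ 2 = 1 - 2 * c + c ^+ 2 by ring.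
  by lra.
have hA : 0 <= acos c <= pi / 2.
  by apply: acos_pihalf; rewrite c0.
apply: le_trans (sqr_angle_le hA (le_trans sA xw')) _.
rewrite lerD // -mulrA ler_wpM2l // expr2.
by rewrite ler_pM ?sqr_ge0 // (le_trans sA).
Qed.

Lemma avec_sym U V : avec U V = avec V U.
Proof. by apply/rowP => j; rewrite !mxE; congr acos; apply: eq_bigr => k _; rewrite !mxE mulrC. Qed.

Lemma St_metricE U D : St_metric U D = nrm2 D - 2^-1 * nrm2 (U^T *m D).
Proof.
rewrite /St_metric mulmxBr mulmxBl mulmx1 mxtraceD raddfN /= -scalemxAr -scalemxAl mxtraceZ.
by rewrite /nrm2 /mdot trmx_mul trmxK !mulmxA.
Qed.

Lemma nrm2_proj_split U D : Stiefel U ->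
  nrm2 D = nrm2 (U^T *m D) + nrm2 (D - U *m (U^T *m D)).
Proof.
move=> sU; rewrite nrm2B (nrm2_stiefel _ sU).
have -> : mdot D (U *m (U^T *m D)) = nrm2 (U^T *m D).
  by rewrite /nrm2 /mdot trmx_mul trmxK !mulmxA.
ring.
Qed.

Lemma nrm_proj_le U D : Stiefel U -> nrm (D - U *m (U^T *m D)) <= nrm D.
Proof.
move=> sU; rewrite -(@ler_pXn2r _ 2) ?nnegrE ?nrm_ge0 // !sqr_nrm (nrm2_proj_split D sU).
by rewrite lerDr nrm2_ge0.
Qed.

(** The columns move at speed |D| whatever the rotation Q, the span at the speed of the component of
    D orthogonal to it. *)
Lemma step_near g t e : (forall i j, derivable (fun s => g s i j) t 1) -> Stiefel (g t) -> 0 < e ->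
  \forall h \near (0 : R), Stiefel (g (t + h)) ->
    (forall Q, Orth Q ->
       nrm (avec (g t *m Q) (g (t + h) *m Q)) <= (nrm (velocity g t) + e) * `|h|) /\
    gd (g t) (g (t + h)) <= (nrm (velocity g t - g t *m ((g t)^T *m velocity g t)) + e) * `|h|.
Proof.
move=> dg st e0; set D := velocity g t; have e2 : 0 < e / 2 by rewrite divr_gt0.
have h1 := mat_der_near dg e2; rewrite -/D in h1; set B := nrm (D - _).
have cD : 0 <= nrm D + e / 2 by rewrite addr_ge0 ?nrm_ge0 // ltW.
have cB : 0 <= B + e / 2 by rewrite addr_ge0 ?nrm_ge0 // ltW.
have h2 := speed_near cD e2; have h3 := speed_near cB e2.
apply: filterS3 h1 h2 h3 => h h1 h2 h3 sh.
have bnd (x y : 'M[R]_(n, p)) : nrm (x - h *: y) <= e / 2 * `|h| ->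
    nrm2 x <= ((nrm y + e / 2) * `|h|) ^+ 2.
  move=> hx; rewrite -sqr_nrm ler_pXn2r ?nnegrE ?nrm_ge0 ?mulr_ge0 ?addr_ge0 ?nrm_ge0 ?(ltW e2) //.
  have := nrm_triangle (x - h *: y) (h *: y); rewrite subrK nrmZ => hh.
  by apply: le_trans hh _; rewrite mulrDl [`|h| * _]mulrC addrC lerD2l.
have de : e = e / 2 + e / 2 by lra.
split=> [Q oQ|].
  rewrite [X in nrm D + X]de addrA; apply: (h2 _ (nrm2 (g (t + h) - g t))); rewrite ?nrm_ge0 ?nrm2_ge0 //.
    exact: bnd.
  move=> w2; rewrite sqr_nrm; have := @avec_nrm2B (g t *m Q) (g (t + h) *m Q).
  by rewrite -mulmxBl nrm2_orth //; apply => //; exact: stiefel_mul.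
rewrite [X in B + X]de addrA.
apply: (h3 _ (nrm2 (g (t + h) - g t *m ((g t)^T *m g (t + h))))); rewrite ?gd_ge0 ?nrm2_ge0 //.
  apply: bnd; rewrite -/D; set V := g (t + h); set U := g t.
  have -> : V - U *m (U^T *m V) - h *: (D - U *m (U^T *m D)) =
      (V - U - h *: D) - U *m (U^T *m (V - U - h *: D)).
    have sU : U^T *m U = 1%:M by [].
    rewrite !mulmxBr sU mulmx1 -!scalemxAr scalerBr; clear.
    move: (U *m (U^T *m V)) (h *: D) (h *: (_ *m _)) => a b c.
    by apply/matrixP => i j; rewrite !mxE; ring.
  exact: le_trans (nrm_proj_le _ st) h1.
exact: gd_sin.
Qed.

(** [dini] for l times the column distance plus the Grassmann distance from Y: [step_near] gives the
    two speeds and [speed_mix] bounds their combination by the canonical speed. *)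
Lemma St_length_lb Y W g : St_curve Y W g -> exists2 L : R, St_length g = L%:E &
  forall Q l, Orth Q -> 0 < l -> l * nrm (avec (Y *m Q) (W *m Q)) + gd Y W <= (1 + l + l ^+ 2) * L.
Proof.
case=> g0 g1 sg dg; pose S t := Num.sqrt (St_metric (g t) (velocity g t)).
have cg t : g @ t --> g t.
  apply/mx_cvgP => i j; have [/(_ t)/derivable1_diffP/differentiable_continuous] := dg i j.
  exact.
have cv t : velocity g @ t --> velocity g t.
  apply/mx_cvgP => i j; have [_ /(_ t)] := dg i j; rewrite /continuous_at mxE.
  by under [X in _ -> X @ _ --> _]eq_fun do rewrite mxE.
have cS : continuous S.
  move=> t; rewrite /continuous_at /S; apply: continuous_cvg; first exact: sqrt_continuous.
  under eq_fun do rewrite St_metricE; rewrite St_metricE.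
  apply: cvgB; first by apply: cvg_nrm2; exact: cv.
  apply: cvgM; first exact: cvg_cst.
  by apply: cvg_nrm2; apply: cvg_mulmx; [apply: cvg_trmx; exact: cg|exact: cv].
have [F [dF iF]] := antiderivative cS.
exists (F 1 - F 0); first exact: iF.
move=> Q l oQ l0; pose c := 1 + l + l ^+ 2.
have c0 : 0 < c by rewrite !addr_gt0 ?exprn_gt0.
pose Phi t := l * nrm (avec (Y *m Q) (g t *m Q)) + gd Y (g t).
have i0 : 0 <= (0 : R) <= 1 by rewrite lexx ler01.
have i1 : 0 <= (1 : R) <= 1 by rewrite lexx ler01.
have sY : Stiefel Y by rewrite -g0; exact: sg.
have sYQ := stiefel_mul sY oQ.
have Phi0 : Phi 0 = 0.
  rewrite /Phi g0 gd_refl // addr0 (_ : avec _ _ = 0) ?nrm0 ?mulr0 //.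
  by apply/rowP => j; rewrite mxE sYQ !mxE eqxx acos1.
have : Phi 1 - Phi 0 <= c * F 1 - c * F 0.
  apply: (@dini _ Phi (fun t => c * F t) (fun t => c * S t)).
  - move=> t /dF[df eS]; have d1 : is_derive t 1 F (S t) by apply: DeriveDef; rewrite -?derive1E.
    have d2 : is_derive t 1 (c *: F) (c *: S t) by exact: is_deriveZ.
    split; first exact: (@ex_derive _ _ _ _ _ _ _ d2).
    by rewrite derive1E; exact: (@derive_val _ _ _ _ _ _ _ d2).
  - move=> t e /andP[t0 t1] e0; have st : Stiefel (g t) by apply: sg; rewrite t0 ltW.
    pose e' := e / (l + 1); have e'0 : 0 < e' by rewrite divr_gt0 // addr_gt0.
    have ee : e' * (l + 1) = e by rewrite divfK // gt_eqF // addr_gt0.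
    have := step_near (fun i j => (dg i j).1 t) st e'0; apply: filterS => h hh hp th.
    have sh : Stiefel (g (t + h)) by apply: sg; rewrite th addr_ge0 // ltW.
    have [/(_ Q oQ) h1 h2] := hh sh; rewrite gtr0_norm // in h1 h2.
    have h3 := avec_triangle sYQ (stiefel_mul st oQ) (stiefel_mul sh oQ).
    have h4 := gd_triangle sY st sh.
    set D := velocity g t in h1 h2 *; set A := nrm ((g t)^T *m D).
    set E := nrm D in h1; set B := nrm (D - _) in h2.
    have mix : l * E + B <= c * S t.
      have sp := nrm2_proj_split D st; rewrite -!sqr_nrm in sp.
      have Sp : S t ^+ 2 = nrm2 D - 2^-1 * nrm2 ((g t)^T *m D).
        rewrite sqr_sqrtr St_metricE // -!sqr_nrm sp -/A; have := sqr_ge0 A.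
        by have := sqr_ge0 B; rewrite -/B; lra.
      apply: (@speed_mix _ A) => //; rewrite ?nrm_ge0 ?sqrtr_ge0 //.
      by rewrite Sp -!sqr_nrm sp -/A -/B; clear; move: (A ^+ 2) (B ^+ 2) => a b; lra.
    have h1' : l * nrm (avec (g t *m Q) (g (t + h) *m Q)) <= l * ((E + e') * h) by rewrite ler_pM2l.
    have h3' : l * nrm (avec (Y *m Q) (g (t + h) *m Q)) <=
        l * (nrm (avec (Y *m Q) (g t *m Q)) + nrm (avec (g t *m Q) (g (t + h) *m Q))).
      by rewrite ler_pM2l.
    have mh : (l * E + B) * h <= c * S t * h by rewrite ler_pM2r.
    have -> : (c * S t + e) * h = c * S t * h + e' * (l + 1) * h by rewrite ee mulrDl.
    rewrite /Phi; move: h1' h2 h3' h4 mh; clear.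
    move: (nrm (avec _ _)) (nrm (avec _ _)) (nrm (avec _ _)) (gd _ _) (gd _ _) (gd _ _).
    by move=> a1 a2 a3 b1 b2 b3; lra.
  - move=> t e ht e0; have st : Stiefel (g t) by exact: sg.
    have := step_near (fun i j => (dg i j).1 t) st ltr01.
    set D := velocity g t; set B := nrm (D - _); pose k := l * (nrm D + 1) + (B + 1).
    have k0 : 0 < k by rewrite addr_gt0 ?mulr_gt0 ?ltr_wpDl ?nrm_ge0.
    have ek : 0 < e / k by rewrite divr_gt0.
    have hn : \forall h \near (0 : R), `|h| < e / k by exact: nbhs0_lt.
    move=> hst; apply: filterS2 hn hst => h hek hh th; have sh := sg _ th.
    have [/(_ Q oQ) h1 h2] := hh sh.
    have h3 := avec_triangle sYQ (stiefel_mul sh oQ) (stiefel_mul st oQ).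
    have h4 := gd_triangle sY sh st; rewrite [gd (g (t + h)) _]gd_sym // in h4.
    rewrite [avec (g (t + h) *m Q) _]avec_sym in h3.
    have h1' : l * nrm (avec (g t *m Q) (g (t + h) *m Q)) <= l * ((nrm D + 1) * `|h|) by rewrite ler_pM2l.
    have h3' : l * nrm (avec (Y *m Q) (g t *m Q)) <=
        l * (nrm (avec (Y *m Q) (g (t + h) *m Q)) + nrm (avec (g t *m Q) (g (t + h) *m Q))).
      by rewrite ler_pM2l // ; move: h3.
    have : k * `|h| <= e by rewrite mulrC -ler_pdivlMr // ltW.
    rewrite /Phi /k; move: h1' h2 h3' h4; clear; rewrite -/B.
    move: (nrm (avec _ _)) (nrm (avec _ _)) (nrm (avec _ _)) (gd _ _) (gd _ _) (gd _ _).
    by move=> a1 a2 a3 b1 b2 b3; lra.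
by rewrite Phi0 subr0 /Phi g1 -mulrBr.
Qed.

Lemma gd_le_dSt Y W : ((gd Y W)%:E <= dSt Y W)%E.
Proof.
apply: le_ereal_inf_tmp => _ [g cg <-]; have [L -> hL] := St_length_lb cg; rewrite lee_fin.
apply/ler_addgt0Pr => e e0; pose l := Num.min 1 (e / (2 * `|L| + 1)).
have L0 := normr_ge0 L; have k0 : 0 < 2 * `|L| + 1 by lra.
have l0 : 0 < l by rewrite lt_min ltr01 divr_gt0.
have [l1 l2] : l <= 1 /\ l <= e / (2 * `|L| + 1) by split; rewrite ge_min lexx ?orbT.
have := hL 1%:M l (@orth1 R p) l0; have : 0 <= l * nrm (avec (Y *m 1%:M) (W *m 1%:M)).
  by rewrite mulr_ge0 ?nrm_ge0 // ltW.
have h2 : l ^+ 2 * `|L| <= l * `|L| by rewrite ler_wpM2r // expr2 ler_piMl // ltW.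
have h1 : l * (2 * `|L| + 1) <= e by rewrite -ler_pdivlMr.
have h3 : (l + l ^+ 2) * L <= (l + l ^+ 2) * `|L|.
  by rewrite ler_wpM2l ?ler_norm // addr_ge0 ?sqr_ge0 // ltW.
by move: h1 h2 h3 l0; move: (nrm _) (gd _ _) => a b; lra.
Qed.

(** Curves of length close to d = [gd Y W] give l a + d <= (1 + l + l^2) d. The d cancels; dividing
    by l and letting l tend to 0 leaves a <= d. *)
Lemma dSt_avec Y W Q : dSt Y W = (gd Y W)%:E -> Orth Q -> nrm (avec (Y *m Q) (W *m Q)) <= gd Y W.
Proof.
move=> e oQ; set d := gd Y W in e *; set a := nrm _.
have d0 : 0 <= d by exact: gd_ge0.
have h l : 0 < l -> a <= (1 + l) * d.
  move=> l0; have c0 : 0 < 1 + l + l ^+ 2 by rewrite !addr_gt0 ?exprn_gt0.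
  have : l * a + d <= (1 + l + l ^+ 2) * d.
    apply/ler_addgt0Pr => ep ep0; pose e1 := ep / (1 + l + l ^+ 2).
    have e10 : 0 < e1 by rewrite divr_gt0.
    have [|_ [g cg <-]] := @lb_ereal_inf_adherent _ [set St_length g | g in St_curve Y W] e1 e10.
      by rewrite -/(dSt Y W) e.
    rewrite -/(dSt Y W) e -EFinD; have [L -> hL] := St_length_lb cg; rewrite lte_fin => hl.
    apply: le_trans (hL Q l oQ l0) _; rewrite -[ep](divfK (lt0r_neq0 c0)).
    by rewrite [_ / _ * _]mulrC -mulrDr ler_pM2l // ltW.
  by move=> hh; rewrite -(ler_pM2l l0); move: hh; lra.
apply/ler_addgt0Pr => ep ep0; have k0 : 0 < d + 1 by lra.
have := h (ep / (d + 1)) (divr_gt0 ep0 k0); rewrite mulrDl mul1r => /le_trans; apply.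
rewrite lerD2l mulrAC ler_pdivrMr // ler_wpM2l ?ltW //; lra.
Qed.

(** For the left singular vectors each column angle is at least th_j, and the bound forces equality.
    As cos th_j > 0, the orthogonal matrix Q^T P has diagonal 1, hence is 1, and P diagonalizes Y^T
    W with entries cos th_j. *)
Lemma avec_aligned Y W : Stiefel Y -> Stiefel W -> gd Y W < pi / 2 ->
  (forall Q, Orth Q -> nrm (avec (Y *m Q) (W *m Q)) <= gd Y W) -> psd (Y^T *m W).
Proof.
move=> sY sW dl hQ; have [P [Q [th [oP oQ ht e eg]]]] := gd_spec sY sW.
pose o := Q^T *m P; have oo : Orth o by apply: stiefel_mul => //; exact: orth_trmx.
have eN : (Y *m P)^T *m (W *m P) = diag_mx (map_mx cos th) *m o.
  by rewrite trmx_mul mulmxA -(mulmxA P^T) e /o !mulmxA oP mul1mx.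
have tl j : th 0 j < pi / 2 by apply: le_lt_trans dl; exact: gd_angle oP oQ ht e.
have cp j : 0 < cos (th 0 j).
  by apply: cos_gt0_pihalf; case/andP: (ht j) => t0 _; rewrite tl; have := @pi_gt0 R; lra.
have ave j : avec (Y *m P) (W *m P) 0 j = acos (cos (th 0 j) * o j j).
  by rewrite mxE eN mul_diag_mx !mxE.
have o1 j : -1 <= o j j <= 1.
  have [h1 h2] := (orth_entry j j oo, orth_entry_ge j j oo); by rewrite h1 h2.
have cb j : -1 <= cos (th 0 j) * o j j <= 1.
  have := stiefel_entry j (stiefel_mul sY oP) (stiefel_mul sW oP).
  by rewrite eN mul_diag_mx !mxE.
have ge j : th 0 j <= avec (Y *m P) (W *m P) 0 j.
  rewrite ave -{1}(cosK (pihalf_itv (ht j))); apply: acos_le.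
  - by case/andP: (cb j).
  - by rewrite -[leRHS]mulr1 ler_pM2l //; case/andP: (o1 j).
  - exact: cos_le1.
have eqn j : avec (Y *m P) (W *m P) 0 j = th 0 j.
  apply/eqP; rewrite eq_le ge andbT leNgt; apply/negP => lt.
  have := hQ P oP; rewrite leNgt (gd_nrm oP oQ ht e) => /negP; apply.
  rewrite -(@ltr_pXn2r _ 2) ?nnegrE ?nrm_ge0 // !sqr_nrm !nrm2_row.
  rewrite (bigD1 j) //= [ltRHS](bigD1 j) //=; apply: ltr_leD.
    by rewrite ltr_pXn2r ?nnegrE //; case/andP: (ht j) => t0 _ //; rewrite (le_trans t0).
  apply: ler_sum => i _; case/andP: (ht i) => t0 _.
  by rewrite ler_pXn2r ?nnegrE // (le_trans t0).
have d1 j : o j j = 1.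
  have := congr1 (@cos R) (eqn j); rewrite ave acosK; last by rewrite in_itv /= cb.
  by rewrite -[RHS]mulr1 => /(mulfI (lt0r_neq0 (cp j))).
have oE : o = 1%:M.
  apply/eqP; rewrite -subr_eq0; apply/eqP/nrm2_eq0; rewrite nrm2B.
  have -> : nrm2 o = p%:R by rewrite /nrm2 /mdot oo mxtrace1.
  have -> : nrm2 (1%:M : 'M[R]_p) = p%:R by rewrite /nrm2 /mdot trmx1 mulmx1 mxtrace1.
  have -> : mdot o 1%:M = p%:R.
    rewrite mdotC /mdot trmx1 mul1mx /mxtrace (eq_bigr (fun=> 1)) => [|i _]; last exact: d1.
    by rewrite sumr_const card_ord.
  ring.
have PQ : P = Q by rewrite -[LHS]mul1mx -(orth_trmx oQ) trmxK -mulmxA -/o oE mulmx1.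
rewrite e -PQ; apply: orth_diag_psd => // j; rewrite mxE; exact: ltW.
Qed.

Lemma trig_der (c k t : R) :
  is_derive t 1 (fun s => k * cos (c * s)) (- (k * c) * sin (c * t)) /\
  is_derive t 1 (fun s => k * sin (c * s)) (k * c * cos (c * t)).
Proof.
have h : is_derive t 1 (fun s : R => c * s) c by apply: is_derive_eq; rewrite /GRing.scale /= mulr1.
split; apply: is_derive_eq; rewrite /GRing.scale /=; ring.
Qed.

(** In an eigenbasis of a^T a the entry is a fixed linear combination of the scalar functions s -> f
    s x. *)
Lemma symfun_is_derive m (A : 'M[R]_(m, p)) (a : 'M[R]_(n, p)) (f f' : R -> R -> R) i j (t : R) :
  (forall x, is_derive t 1 (f ^~ x) (f' t x)) ->
  is_derive t 1 (fun s => (A *m symfun (f s) (a^T *m a)) i j)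
    ((A *m symfun (f' t) (a^T *m a)) i j).
Proof.
move=> df; have [Q [y [_ _ _ _ hf]]] := gram_spec a.
have eE (h : R -> R) : (A *m symfun h (a^T *m a)) i j =
    \sum_k ((A *m Q) i k * Q j k) * h (y 0 k ^+ 2).
  rewrite hf !mulmxA mxE; apply: eq_bigr => k _.
  rewrite mul_mx_diag [(\matrix_(_, _) _) _ _]mxE [_^T _ _]mxE [(\row_ _ _) _ _]mxE; ring.
rewrite eE.
have -> : (fun s => (A *m symfun (f s) (a^T *m a)) i j) =
    \sum_(k < p) ((A *m Q) i k * Q j k) *: (f ^~ (y 0 k ^+ 2)).
  by apply/funext => s; rewrite eE fct_sumE.
by apply: is_derive_sum => k; exact: is_deriveZ.
Qed.

Lemma frm_is_derive U a (f g f' g' : R -> R -> R) i j (t : R) :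
  (forall x, is_derive t 1 (f ^~ x) (f' t x)) -> (forall x, is_derive t 1 (g ^~ x) (g' t x)) ->
  is_derive t 1 (fun s => frm U a (f s) (g s) i j) (frm U a (f' t) (g' t) i j).
Proof.
move=> df dg; rewrite /frm mxE.
have -> : (fun s => (U *m symfun (f s) (a^T *m a) + a *m symfun (g s) (a^T *m a)) i j) =
    (fun s => (U *m symfun (f s) (a^T *m a)) i j) \+ (fun s => (a *m symfun (g s) (a^T *m a)) i j).
  by apply/funext => s; rewrite mxE.
by apply: is_deriveD; exact: symfun_is_derive.
Qed.

(** The velocity is orthogonal to the span, so the canonical speed is the Frobenius norm of the
    velocity, which is constantly d. *)
Lemma gexp_curve Y a d : Stiefel Y -> Y^T *m a = 0 -> nrm a = 1 -> 0 <= d ->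
  exists2 g, St_curve Y (gexp Y a d) g & St_length g = d%:E.
Proof.
move=> sY Ya a1 d0; have pG := gram_psd a; have sG := psd_sym pG.
pose r x : R := Num.sqrt x.
(* F2, G2 and F3, G3 are the first and second derivatives in t; the second ones give continuity of
   the velocity. *)
pose F1 t x := 1 * cos (d * r x * t); pose G1 t x := (r x)^-1 * sin (d * r x * t).
pose F2 t x := - (1 * (d * r x)) * sin (d * r x * t).
pose G2 t x := (r x)^-1 * (d * r x) * cos (d * r x * t).
pose F3 t x := - (1 * (d * r x)) * (d * r x) * cos (d * r x * t).
pose G3 t x := - ((r x)^-1 * (d * r x) * (d * r x)) * sin (d * r x * t).
pose g t := frm Y a (F1 t) (G1 t).
have gE t : g t = gexp Y a (d * t).
  by apply: frm_eq => x x0; rewrite /F1 /G1 ?mul1r ?[sin _ / _]mulrC -/(r x) mulrAC.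
have d1 i j (t : R) : is_derive t 1 (fun s => g s i j) (frm Y a (F2 t) (G2 t) i j).
  exact: (@frm_is_derive Y a F1 G1 F2 G2 i j t (fun x => (trig_der (d * r x) 1 t).1)
    (fun x => (trig_der (d * r x) (r x)^-1 t).2)).
have e1 i j : derive1 (fun s => g s i j) = (fun t => frm Y a (F2 t) (G2 t) i j).
  by apply/funext => t; rewrite derive1E; exact: (@derive_val _ _ _ _ _ _ _ (d1 i j t)).
have d2 i j (t : R) : is_derive t 1 (fun s => frm Y a (F2 s) (G2 s) i j) (frm Y a (F3 t) (G3 t) i j).
  exact: (@frm_is_derive Y a F2 G2 F3 G3 i j t
    (fun x => (trig_der (d * r x) (- (1 * (d * r x))) t).2)
    (fun x => (trig_der (d * r x) ((r x)^-1 * (d * r x)) t).1)).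
exists g.
  split; rewrite ?gE ?mulr0 ?mulr1 ?gexp0 //.
    by move=> t _; rewrite gE; exact: gexp_stiefel.
  move=> i j; split=> [t|]; first exact: (@ex_derive _ _ _ _ _ _ _ (d1 i j t)).
  rewrite e1 => t; apply: differentiable_continuous; apply/derivable1_diffP.
  exact: (@ex_derive _ _ _ _ _ _ _ (d2 i j t)).
rewrite /St_length.
have -> : (fun t => (Num.sqrt (St_metric (g t) (velocity g t)))%:E) = cst d%:E.
  apply/funext => t /=; have -> : velocity g t = frm Y a (F2 t) (G2 t).
    by apply/matrixP => i j; rewrite mxE e1.
  rewrite St_metricE /g /nrm2 /mdot !frm_gram //.
  have -> : symfun (fun x => F1 t x * F2 t x + G1 t x * (x * G2 t x)) (a^T *m a) = 0.
    have z0 : 0%:M = 0 :> 'M[R]_p by rewrite raddf0.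
    rewrite -[RHS]z0 -(symfun_cst 0 sG); apply: symfun_eq_psd => // x x0.
    have [z|rp] := eqVneq (r x) 0.
      by rewrite /F1 /F2 /G1 /G2 z invr0 !(mulr0, mul0r, oppr0, addr0).
    have rx : r x ^+ 2 = x by rewrite sqr_sqrtr.
    by rewrite /F1 /F2 /G1 /G2; move: (r x) rp rx => y y0 <-; field.
  have -> : symfun (fun x => F2 t x * F2 t x + G2 t x * (x * G2 t x)) (a^T *m a) = d ^+ 2 *: (a^T *m a).
    rewrite -[in RHS](symfun_id sG) symfun_scale //; apply: symfun_eq_psd => // x x0.
    have [z|rp] := eqVneq (r x) 0.
      have -> : x = 0 by rewrite -(sqr_sqrtr x0) -/(r x) z expr0n.
      by rewrite /F2 /G2 /r sqrtr0 !(mulr0, mul0r, oppr0, addr0).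
    have rx : r x ^+ 2 = x by rewrite sqr_sqrtr.
    rewrite /F2 /G2; move: (r x) rp rx => y y0 <-.
    transitivity (d ^+ 2 * y ^+ 2 * (cos (d * y * t) ^+ 2 + sin (d * y * t) ^+ 2)); first by field.
    by rewrite cos2Dsin2 mulr1.
  rewrite mulmx0 mxtrace0 mulr0 subr0 mxtraceZ -/(mdot a a) -/(nrm2 a) -sqr_nrm a1 expr1n mulr1.
  by rewrite sqrtr_sqr ger0_norm.
by rewrite integral_cst //= lebesgue_measure_itv /= lte01 oppr0 adde0 mule1.
Qed.

(** The geodesic of [gexp_ex] ends at W O for some rotation O. Both Y^T W and Y^T W O are positive
    semidefinite, so uniqueness of the polar decomposition gives O = 1. At distance 0 the curve is
    constant. *)
Lemma dSt_aligned Y W : Stiefel Y -> Stiefel W -> gd Y W < pi / 2 -> psd (Y^T *m W) ->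
  dSt Y W = (gd Y W)%:E.
Proof.
move=> sY sW dl pA; apply/eqP; rewrite eq_le gd_le_dSt andbT.
have PA := aligned_Pos sY sW dl pA; have uA := Pos_unit PA.
suff [g cg <-] : exists2 g, St_curve Y W g & St_length g = (gd Y W)%:E.
  by apply: ereal_inf_lbound; exists g.
have [d0|] := eqVneq (gd Y W) 0; last first.
  rewrite -[_ != _]andbT -(gd_ge0 Y W) eq_sym -lt_neqAle => d0.
  have [a [ O [Ya a1 oO eW]]] := gexp_ex sY sW d0.
  have [g cg lg] := gexp_curve sY Ya a1 (ltW d0); exists g => //.
  suff eO : O = 1%:M by move: cg; rewrite -eW eO mulmx1.
  have eP : Y^T *m W *m O = gcos (gd Y W) (a^T *m a).
    by rewrite -mulmxA eW -{1}(gexp0 Y a) ?gexp_gram ?subr0.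
  have pP : psd (gcos (gd Y W) (a^T *m a)).
    have [Q [y [oQ y0 y1 _ hf]]] := gram_spec a.
    rewrite /gcos hf; apply: orth_diag_psd => // i; rewrite mxE sqrtr_sqr ger0_norm //.
    apply: cos_ge0_pihalf; have := y0 i; have := y1 i; rewrite a1 => h1 h0.
    have : gd Y W * y 0 i <= gd Y W by rewrite ler_piMr // ltW.
    have : 0 <= gd Y W * y 0 i by rewrite mulr_ge0 // ltW.
    by have := @pi_gt0 R; lra.
  have e2 : Y^T *m W *m (Y^T *m W) = gcos (gd Y W) (a^T *m a) *m gcos (gd Y W) (a^T *m a).
    have oT : O *m O^T = 1%:M by have := orth_trmx oO; rewrite /Orth /Stiefel trmxK.
    have cE (A : 'M[R]_p) : A^T = A -> A *m O *m (A *m O)^T = A *m A.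
      by move=> sA; rewrite trmx_mul sA !mulmxA -(mulmxA A) oT mulmx1.
    by rewrite -(cE _ (psd_sym pA)) eP (psd_sym pP).
  have e3 : Y^T *m W = gcos (gd Y W) (a^T *m a) by rewrite -(sqrtmx_uniq pA) e2 sqrtmx_uniq.
  by rewrite -[ O](mulKmx uA) eP -e3 mulVmx.
have [ O oO eW] := gd_eq0 sY sW d0.
have eO : O = 1%:M.
  have eYW : Y^T *m W = O by rewrite eW mulmxA sY mul1mx.
  rewrite eYW in pA; rewrite -(sqrtmx_uniq pA) -{1}(psd_sym pA) oO.
  have p1 : psd (1%:M : 'M[R]_p) by have := gram_psd (1%:M : 'M[R]_p); rewrite trmx1 mulmx1.
  by rewrite -[1%:M in LHS](mulmx1 1%:M) sqrtmx_uniq.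
rewrite d0 eW eO mulmx1; exists (cst Y).
  split => // i j; split=> [t|]; first exact: derivable_cst.
  by have -> : derive1 (fun s => cst Y s i j) = cst 0; [apply/funext => t; exact: derive1_cst|exact: cst_continuous].
have v0 t : velocity (cst Y) t = 0 by apply/matrixP => i j; rewrite !mxE derive1_cst.
rewrite /St_length; under eq_integral do rewrite v0 /St_metric mulmx0 mxtrace0 sqrtr0.
exact: integral0.
Qed.

Theorem dSt_eqP Y W : Stiefel Y -> Stiefel W -> gd Y W < pi / 2 ->
  dSt Y W = (gd Y W)%:E <-> psd (Y^T *m W).
Proof.
move=> sY sW dl; split=> [e|]; last exact: dSt_aligned.
by apply: avec_aligned => // Q oQ; exact: dSt_avec.
Qed.

End StiefelLength.

(** * The mean of semidefinite matrices *)

Section Frames.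
Variables (R : realType) (n p N : nat).
Implicit Types (X W : 'M[R]_(n, p)) (T : 'M[R]_p) (A : 'M[R]_n)
  (S : 'I_N -> {vspace 'cV[R]_n}).

(** O T and T are positive square roots of the same matrix. *)
Lemma polar_uniq (O T : 'M[R]_p) : Pos T -> Orth O -> psd (O *m T) -> O = 1%:M.
Proof.
move=> pT oO pOT; have sT := psd_sym (Pos_psd pT); have uT := Pos_unit pT.
have e : O *m T *m (O *m T) = T *m T.
  by rewrite -{1}(psd_sym pOT) trmx_mul sT mulmxA -(mulmxA T) oO mulmx1.
have e1 : O *m T = T by rewrite -(sqrtmx_uniq pOT) e (sqrtmx_uniq (Pos_psd pT)).
by rewrite -[LHS](mulmxK uT) e1 mulmxV.
Qed.

Lemma dim_colspan m (B : 'M[R]_(n, m)) : \dim (colspan B) = \rank B.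
Proof.
have rB := row_base_free B^T; set C := (row_base B^T)^T.
have -> : colspan B = colspan C.
  apply/eqP; rewrite eqEsubv; apply/andP; split; apply/colspan_sub.
    have /submxP[D eD] : (B^T <= row_base B^T)%MS by rewrite eq_row_base.
    by exists D^T; rewrite -trmx_mul -eD trmxK.
  have /submxP[D eD] : (row_base B^T <= B^T)%MS by rewrite eq_row_base.
  by exists D^T; rewrite /C eD trmx_mul trmxK.
rewrite -(mxrank_tr B); apply: colspan_inj_dim => c eC.
have : c^T *m row_base B^T = 0 by rewrite -[_ *m _]trmxK trmx_mul trmxK eC trmx0.
by move/eqP; rewrite mulmx_free_eq0 // trmx_eq0 => /eqP.
Qed.

Lemma Splus_Gr A : Splus p A -> Gr p (colspan A).
Proof. by case=> _ rA; rewrite /Gr /= dim_colspan. Qed.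

Lemma frame_congr (U : 'M[R]_(n, p)) T : Stiefel U -> U^T *m (U *m T *m U^T) *m U = T.
Proof. by move=> sU; rewrite !mulmxA sU mul1mx -mulmxA sU mulmx1. Qed.

Lemma frame_colspan (U : 'M[R]_(n, p)) T : Stiefel U -> T \in unitmx -> colspan (U *m T *m U^T) = colspan U.
Proof.
move=> sU uT; apply/eqP; rewrite eqEsubv; apply/andP; split; apply/colspan_sub.
  by exists (T *m U^T); rewrite mulmxA.
by exists (U *m invmx T); rewrite mulmxA -(mulmxA _ U^T) sU mulmx1 mulmxK.
Qed.

Lemma frame_Splus (U : 'M[R]_(n, p)) T : Stiefel U -> Pos T -> Splus p (U *m T *m U^T).
Proof.
move=> sU pT; split; first exact/psd_congr/Pos_psd.
by rewrite -dim_colspan frame_colspan ?Pos_unit //; exact: stiefel_Gr.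
Qed.

Lemma colspan_proj (U : 'M[R]_(n, p)) m (B : 'M[R]_(n, m)) : Stiefel U -> (colspan B <= colspan U)%VS ->
  U *m (U^T *m B) = B.
Proof. by move=> sU /colspan_sub[C ->]; rewrite (mulmxA U^T) sU mul1mx. Qed.

Lemma Splus_frame (U : 'M[R]_(n, p)) A : Splus p A -> Stiefel U -> colspan U = colspan A ->
  Pos (U^T *m A *m U) /\ A = U *m (U^T *m A *m U) *m U^T.
Proof.
move=> [pA rA] sU eU; have sA := psd_sym pA.
have e1 : U *m (U^T *m A) = A by apply: colspan_proj => //; rewrite eU.
have e2 : A *m U *m U^T = A by have := congr1 trmx e1; rewrite !trmx_mul trmxK sA.
have eA : A = U *m (U^T *m A *m U) *m U^T by rewrite !mulmxA -(mulmxA U) e1 e2.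
split=> //; have pT : psd (U^T *m A *m U).
  by rewrite -{2}[U]trmxK; exact: psd_congr.
apply: psd_unit_Pos => //; rewrite -row_free_unit -row_leq_rank -{1}rA {1}eA.
exact: leq_trans (mxrankM_maxl _ _) (mxrankM_maxr _ _).
Qed.

(* U is a family of orthonormal bases of the subspaces S, aligned with the
   orthonormal basis W of their Karcher mean. *)
Record frames S (U : 'I_N -> 'M[R]_(n, p)) W : Prop := IsFrames {
  fr_stiefel : forall i, Stiefel (U i);
  fr_span : forall i, colspan (U i) = S i;
  fr_min : minimizer U W;
  fr_uniq : forall X, minimizer U X -> exists2 O, Orth O & X = W *m O;
  fr_gd : forall i, gd (U i) W < pi / 2;
  fr_aligned : forall i, psd ((U i)^T *m W) }.

(** The minimizer is found first and the bases are aligned with it afterwards; rotating the bases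
    changes neither the cost nor the minimizers. *)
Lemma frames_ex S C r : (0 < N)%N -> (forall i, Gr p (S i)) -> Gr p C ->
  r < pi / (4 * Num.sqrt 2) -> (forall i, dGr p C (S i) < r) -> exists (U : 'I_N -> 'M[R]_(n, p)) W, frames S U W.
Proof.
move=> N0 gS gC rk hS.
have /choice[V hV] : forall i : 'I_N, exists V : 'M[R]_(n, p), Stiefel V /\ colspan V = S i.
  by move=> i; have [V] := Gr_frame (gS i); exists V.
have sV i : Stiefel (V i) by case: (hV i).
have [C' sC' eC'] := Gr_frame gC.
have [|W [mW uW gW]] := karcher_frames N0 sV sC' rk.
  by move=> i; rewrite -dGrE // eC' (hV i).2.
have sW := mW.1.
have /choice[ O hO] : forall i : 'I_N, exists O : 'M[R]_p, Orth O /\ psd (W^T *m (V i *m O)).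
  by move=> i; have [ O oO] := align_ex sW (sV i); exists O.
have oO i : Orth (O i) by case: (hO i).
have sU i : Stiefel (V i *m O i) by exact: stiefel_mul (sV i) (oO i).
have cE X : Stiefel X -> cost (fun i => V i *m O i) X = cost V X.
  by move=> sX; apply: eq_bigr => i _; rewrite gd_orthr.
exists (fun i => V i *m O i), W; split => //.
- by move=> i; rewrite -(hV i).2; apply/esym/colspan_eqP => //; exists (O i).
- by split=> // Y sY; rewrite !cE //; exact: mW.2.
- by move=> X [sX mX]; apply: uW; split=> // Y sY; rewrite -!cE //; exact: mX.
- by move=> i; rewrite gd_orthl.
- by move=> i; rewrite -[_ *m W]trmxK trmx_mul trmxK; case: (hO i) => _ h; rewrite (psd_sym h).
Qed.

Variable M : ('I_N -> 'M[R]_p) -> 'M[R]_p.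
Hypothesis gM : is_gm M.

(** By [dSt_eqP] the distance condition makes (Y i)^T (Wi i) positive semidefinite. With the
    alignment of U i and W this forces Y i = U i P and Wi i = W P for one and the same rotation P,
    which cancels in T2. The choice of W0 leaves a congruence by Q0, absorbed by [gm_congr]. *)
Lemma is_gmeanP (A : 'I_N -> 'M[R]_n) (U : 'I_N -> 'M[R]_(n, p)) W B : (forall i, Splus p (A i)) ->
  frames (fun i => colspan (A i)) U W ->
  is_gmean M A B <-> B = W *m M (fun i => (U i)^T *m A i *m U i) *m W^T.
Proof.
move=> pA [sU eU mW uW gW aW]; have sW := mW.1.
have pT i : Pos ((U i)^T *m A i *m U i) := (Splus_frame (pA i) (sU i) (eU i)).1.
have eA i : A i = U i *m ((U i)^T *m A i *m U i) *m (U i)^T :=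
  (Splus_frame (pA i) (sU i) (eU i)).2.
split=> [[U' [R2 [W' [Y [Wi [W0 [h1 [sW' kW'] h3 [sW0 eW0] eB]]]]]]]|->].
  have sU' i : Stiefel (U' i) by case: (h1 i).
  have eU' i : colspan (U' i) = colspan (U i).
    by case: (h1 i) => _ pR e; rewrite eU e frame_colspan // Pos_unit.
  have fE X : Stiefel X -> \sum_(i < N) dGr p (colspan X) (colspan (U' i)) ^+ 2 = cost U X.
    by move=> sX; apply: eq_bigr => i _; rewrite eU' dGrE.
  have mW' : minimizer U W'.
    split=> // X sX; rewrite -!fE //; have [_ h] := kW'.
    have [e|/eqP ne] := eqVneq (colspan X) (colspan W'); first by rewrite e.
    by apply/ltW/h => //; exact: stiefel_Gr.
  have [ O' oO' eO'] := uW _ mW'.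
  have [Q0 oQ0 eQ0] : exists2 Q0, Orth Q0 & W0 = W *m Q0.
    by apply/colspan_eqP => //; rewrite eW0; apply/colspan_eqP => //; exists O'.
  have hP i : exists2 P, Orth P & Y i = U i *m P /\ Wi i = W *m P.
    have [[ O oO eY] [Q oQ eWi] ed] := h3 i.
    have [P oP eP] : exists2 P, Orth P & U' i = U i *m P by apply/colspan_eqP.
    have oPO : Orth (P *m O) by exact: orth_mul.
    have oOQ : Orth (O' *m Q) by exact: orth_mul.
    have eY' : Y i = U i *m (P *m O) by rewrite eY eP mulmxA.
    have eWi' : Wi i = W *m (O' *m Q) by rewrite eWi eO' mulmxA.
    exists (P *m O) => //; split => //; rewrite eWi'; congr (_ *m _).
    have : psd ((Y i)^T *m Wi i).
      apply/dSt_eqP; rewrite ?eY' ?eWi' ?gd_orth //; try exact: stiefel_mul.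
      rewrite -?eY' -?eWi' ed; congr (_%:E); rewrite dGrE // eO' gd_orthr // eP gd_orthl //.
    rewrite eY' eWi'; move: (P *m O) (O' *m Q) oPO oOQ => O1 O2 o1 o2 ps.
    have pS : Pos (O2^T *m ((U i)^T *m W) *m O2).
      by apply: Pos_congr_stiefel => //; exact: aligned_Pos.
    have : O1^T *m O2 = 1%:M.
      apply: (polar_uniq pS); first by apply: orth_mul => //; exact: orth_trmx.
      rewrite !mulmxA -(mulmxA O1^T) (orth_mulV o2) mulmx1.
      by move: ps; rewrite trmx_mul !mulmxA.
    by move/(congr1 (mulmx O1)); rewrite mulmxA (orth_mulV o1) mul1mx mulmx1.
  have eT i : W0^T *m Wi i *m ((Y i)^T *m A i *m Y i) *m (Wi i)^T *m W0 =
      Q0^T *m ((U i)^T *m A i *m U i) *m Q0.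
    have [P oP [-> ->]] := hP i; rewrite eQ0 !trmx_mul; have oP' := orth_mulV oP.
    rewrite !mulmxA -(mulmxA Q0^T W^T) sW mulmx1.
    rewrite -(mulmxA Q0^T P) oP' mulmx1 -!mulmxA (mulmxA P) oP' mul1mx.
    by rewrite (mulmxA W^T) sW mul1mx.
  rewrite eB eQ0; have -> : (fun i => (W *m Q0)^T *m Wi i *m ((Y i)^T *m A i *m Y i) *m
      (Wi i)^T *m (W *m Q0)) = (fun i => Q0^T *m ((U i)^T *m A i *m U i) *m Q0^T^T).
    by apply/funext => i; rewrite trmxK -eT eQ0.
  rewrite gm_congr //; last exact/orth_unit/orth_trmx.
  have oQ0' := orth_mulV oQ0.
  rewrite trmx_mul trmxK !mulmxA -(mulmxA W Q0) oQ0' mulmx1.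
  by rewrite -(mulmxA _ Q0) oQ0' mulmx1.
have uE X : Stiefel X -> \sum_(i < N) dGr p (colspan X) (colspan (U i)) ^+ 2 = cost U X.
  by move=> sX; apply: eq_bigr => i _; rewrite dGrE.
exists U, (fun i => (U i)^T *m A i *m U i), W, U, (fun=> W), W; split => //.
- split=> //; split; first exact: stiefel_Gr.
  (* Strictness: a span with the same cost would be that of a minimizer, hence of W. *)
  move=> S gS; have [X sX <-] := Gr_frame gS => ne; rewrite !uE //.
  rewrite lt_neqAle mW.2 // andbT; apply/eqP => ec; apply: ne.
  apply/esym/colspan_eqP => //; apply: uW; split=> // Z sZ; rewrite -ec; exact: mW.2.
- move=> i; split; first by exists 1%:M; [exact: orth1|rewrite mulmx1].
    by exists 1%:M; [exact: orth1|rewrite mulmx1].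
  by rewrite dGrE // dSt_aligned.
- move=> S2 T2; congr (_ *m M _ *m _); apply/funext => i.
  by rewrite /T2 /S2 sW mul1mx -[RHS]mulmxA sW mulmx1.
Qed.

Lemma gmeanE (A : 'I_N -> 'M[R]_n) (U : 'I_N -> 'M[R]_(n, p)) W : (forall i, Splus p (A i)) ->
  frames (fun i => colspan (A i)) U W ->
  gmean M A = W *m M (fun i => (U i)^T *m A i *m U i) *m W^T.
Proof.
move=> pA fr; rewrite /gmean; have h := is_gmeanP _ pA fr.
by case: xgetP => [B _ /h //|/(_ _ ((h _).2 erefl))].
Qed.

End Frames.

(** * Frames and functional calculus under the operations of the properties *)

Section Transport.
Variables (R : realType) (n p N : nat).
Hypothesis N0 : (0 < N)%N.
Implicit Types (X W : 'M[R]_(n, p)) (A : 'M[R]_n).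

Lemma dom_frames (A : 'I_N -> 'M[R]_n) : gmean_dom p A ->
  exists (U : 'I_N -> 'M[R]_(n, p)) W, frames (fun i => colspan (A i)) U W.
Proof.
by case=> pA [C [r [gC rk h]]]; apply: (frames_ex N0 _ gC rk h) => i; exact: Splus_Gr.
Qed.

Lemma colspan_scale c A : c != 0 -> colspan (c *: A) = colspan A.
Proof.
move=> c0; apply/eqP; rewrite eqEsubv; apply/andP; split; apply/colspan_sub.
  by exists c%:M; rewrite mul_mx_scalar.
by exists c^-1%:M; rewrite mul_mx_scalar scalerA mulVf // scale1r.
Qed.

Lemma Splus_scale c A : 0 < c -> Splus p A -> Splus p (c *: A).
Proof.
move=> c0 [pA rA]; split; first exact/psd_scale/pA/ltW.
by rewrite -dim_colspan colspan_scale ?gt_eqF // dim_colspan.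
Qed.

(** If A <= B, the kernel of B lies in that of A by [psd_dot0], and equal ranks give equal ranges.
    So comparable tuples share their frames, and order questions are questions about M. *)
Lemma loewner_colspan A B : Splus p A -> Splus p B -> loewner A B -> colspan A = colspan B.
Proof.
move=> pA pB AB; have [U sU eU] := Gr_frame (Splus_Gr pB).
have [pT eB] := Splus_frame pB sU eU; set T := U^T *m B *m U in pT eB.
have sA := psd_sym pA.1.
have kerA (x : 'cV[R]_n) : U^T *m x = 0 -> A *m x = 0.
  move=> Ux; have Bx : B *m x = 0 by rewrite eB -!mulmxA Ux !mulmx0.
  apply: (psd_dot0 pA.1); apply/eqP; rewrite eq_le.
  have /psdE[_ -> ] := pA.1; rewrite andbT.
  by apply: le_trans (loewner_dot x AB) _; rewrite Bx dot0r.
have kerM m (X : 'M[R]_(n, m)) : U^T *m X = 0 -> A *m X = 0.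
  move=> UX; apply/matrixP => i j; have := kerA (X *m delta_mx j 0).
  rewrite mulmxA UX mul0mx mulmxA -colE => /(_ erefl)/matrixP/(_ i 0).
  by rewrite !mxE.
have e : A *m (U *m U^T) = A.
  apply/eqP; rewrite eq_sym -subr_eq0 -{1}[A]mulmx1 -mulmxBr; apply/eqP/kerM.
  by rewrite mulmxBr mulmx1 mulmxA sU mul1mx subrr.
rewrite -eU; apply/eqP; rewrite eqEdim; apply/andP; split.
  have e2 := congr1 trmx e; rewrite !trmx_mul trmxK sA in e2.
  by apply/colspan_sub; exists (U^T *m A); rewrite mulmxA e2.
by rewrite !dim_colspan pA.2 (_ : \rank U = p) // -dim_colspan eU; exact: Splus_Gr.
Qed.

Lemma frames_perm S (U : 'I_N -> 'M[R]_(n, p)) W (s : 'S_N) :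
  frames S U W -> frames (fun i => S (s i)) (fun i => U (s i)) W.
Proof.
case=> sU eU mW uW gW aW.
have cE X : cost (fun i => U (s i)) X = cost U X.
  by rewrite /cost [RHS](reindex_inj (@perm_inj _ s)).
split=> //; first by split=> [|Y sY]; [exact: mW.1|rewrite !cE; exact: mW.2].
by move=> X [sX mX]; apply: uW; split=> // Y sY; rewrite -!cE; exact: mX.
Qed.

Lemma frames_orth S (U : 'I_N -> 'M[R]_(n, p)) W (P : 'M[R]_n) : Orth P -> frames S U W ->
  frames (fun i => colspan (P *m U i)) (fun i => P *m U i) (P *m W).
Proof.
move=> oP [sU eU mW uW gW aW]; have oP' := orth_mulV oP.
have cE X : cost (fun i => P *m U i) (P *m X) = cost U X.
  by apply: eq_bigr => i _; rewrite gd_mul.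
have PK X : P *m (P^T *m X) = X by rewrite mulmxA oP' mul1mx.
have sP X : Stiefel X -> Stiefel (P^T *m X) by apply: stiefel_mul; exact: orth_trmx.
split=> //.
- by move=> i; exact: stiefel_mul.
- split=> [|Y sY]; first exact/stiefel_mul/mW.1.
  by rewrite -(PK Y) !cE; apply: mW.2; exact: sP.
- move=> X [sX mX]; have [| O oO eX] := uW (P^T *m X); last first.
    by exists O => //; rewrite -(PK X) eX mulmxA.
  split=> [|Y sY]; first exact: sP.
  by rewrite -!cE PK; apply: mX; exact: stiefel_mul.
- by move=> i; rewrite gd_mul.
- by move=> i; rewrite trmx_mul mulmxA -(mulmxA _ P^T) oP mulmx1.
Qed.

(** The common subspace has cost 0, so W spans it; alignment makes the rotation between U i and W
    trivial. *)
Lemma frames_cst S (U : 'I_N -> 'M[R]_(n, p)) W : frames S U W ->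
  (forall i j, S i = S j) -> forall i, U i = W.
Proof.
case=> sU eU mW uW gW aW eS i; have sW := mW.1.
have g0 : gd W (U i) = 0.
  have c0 : cost U (U i) = 0.
    apply: big1 => j _; have [| O oO ->] := (colspan_eqP (sU i) (sU j)).1; first by rewrite !eU.
    by rewrite gd_orthr // gd_refl // expr0n.
  apply/eqP; rewrite -sqrf_eq0 eq_le sqr_ge0 andbT -c0; apply: le_trans (mW.2 _ (sU i)).
  by rewrite /cost (bigD1 i) //= lerDl; apply: sumr_ge0 => j _; exact: sqr_ge0.
have [ O oO eUO] := gd_eq0 sW (sU i) g0.
have : psd (O^T *m 1%:M) by have := aW i; rewrite eUO trmx_mul -mulmxA sW.
have p1 : Pos (1%:M : 'M[R]_p) by exact: Pos_scalar.
move/(polar_uniq p1 (orth_trmx oO)) => eO.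
by rewrite eUO -[ O]trmxK eO trmx1 mulmx1.
Qed.

Lemma penrose_uniq A (X Y : 'M[R]_n) : penrose A X -> penrose A Y -> X = Y.
Proof.
move=> [h1 h2 h3 h4] [k1 k2 k3 k4].
have e1 : A *m X = A *m Y.
  by rewrite -h3 -{1}k1 -(mulmxA _ A) trmx_mul h3 k3 mulmxA h1.
have e2 : X *m A = Y *m A.
  by rewrite -h4 -{1}k1 -mulmxA mulmxA trmx_mul h4 k4 -mulmxA (mulmxA A) h1.
by rewrite -h2 -mulmxA e1 mulmxA e2 k2.
Qed.

Lemma mppinv_frame (U : 'M[R]_(n, p)) (T : 'M[R]_p) : Stiefel U -> Pos T ->
  mppinv (U *m T *m U^T) = U *m invmx T *m U^T.
Proof.
move=> sU pT; have uT := Pos_unit pT; rewrite /mppinv.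
have e (B C : 'M[R]_p) : U *m B *m U^T *m (U *m C *m U^T) = U *m (B *m C) *m U^T.
  by rewrite !mulmxA -(mulmxA _ U^T) sU mulmx1.
have sP : (U *m 1%:M *m U^T)^T = U *m 1%:M *m U^T by rewrite mulmx1 trmx_mul trmxK.
have pn : penrose (U *m T *m U^T) (U *m invmx T *m U^T).
  by split; rewrite !e ?mulmxV ?mulVmx ?mul1mx.
by case: xgetP => [X _ h|/(_ _ pn)//]; exact: penrose_uniq h pn.
Qed.

(** W intertwines A with K, and the projection onto the complement intertwines A with 0, on which f
    vanishes. *)
Lemma symfun_frame (f : R -> R) (W : 'M[R]_(n, p)) (K : 'M[R]_p) : Stiefel W -> K^T = K ->
  f 0 = 0 -> symfun f (W *m K *m W^T) = W *m symfun f K *m W^T.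
Proof.
move=> sW sK f0; set A := W *m K *m W^T.
have sA : A^T = A by rewrite /A !trmx_mul trmxK sK mulmxA.
have e1 : symfun f A *m W = W *m symfun f K.
  by apply: symfun_intertwine => //; rewrite /A -mulmxA sW mulmx1.
have z0 : symfun f (0 : 'M[R]_n) = 0.
  rewrite -(scale0r A) symfun_scaler // (_ : (fun x => _) = fun=> f 0); last first.
    by apply/funext => x; rewrite mul0r.
  by rewrite symfun_cst // f0 raddf0 scale0r.
have e2 : symfun f A *m (1%:M - W *m W^T) = (1%:M - W *m W^T) *m symfun f 0.
  apply: symfun_intertwine => //; first by rewrite trmx0.
  by rewrite mulmx0 mulmxBr mulmx1 /A !mulmxA -(mulmxA _ W^T) sW mulmx1 subrr.
move: e2; rewrite z0 mulmx0 mulmxBr mulmx1 mulmxA e1 => /eqP; rewrite subr_eq0 => /eqP //.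
Qed.

Lemma gmv_powR (a : 'I_N -> R) : (forall i, 0 < a i) -> gmv a = (\prod_(i < N) a i) `^ N%:R^-1.
Proof.
move=> a0; have [h1 h2] : 0 < \prod_(i < N) a i /\ ln (\prod_(i < N) a i) = \sum_(i < N) ln (a i).
  elim/big_rec2 : _ => [|i y x _ [x0 <-]]; first by rewrite ln1.
  by rewrite mulr_gt0 // lnM ?posrE.
by rewrite /powR gt_eqF // h2 mulrC.
Qed.

Lemma codiag_Pos (T : 'I_N -> 'M[R]_p) : (forall i, Pos (T i)) ->
  (forall i j, T i *m T j = T j *m T i) ->
  exists (P : 'M[R]_p) (d : 'I_N -> 'rV[R]_p), [/\ P \in unitmx, forall i j, 0 < d i 0 j
    & forall i, T i = P *m diag_mx (d i) *m invmx P].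
Proof.
move=> pT cT; have : codiagonalizable [seq T i | i <- enum 'I_N].
  apply/codiagonalizableP; split=> [_ _ /mapP[i _ ->] /mapP[j _ ->]|_ /mapP[i _ ->]].
    exact: cT.
  have [ O [d [oO eT _ _]]] := Pos_spec (pT i); have uO := orth_unit (orth_trmx oO).
  exists O^T => //; apply/(similar_diagLR uO); exists d.
  by rewrite conjVmx // eT (orth_inv (orth_trmx oO)) trmxK.
case=> P uP /allP hP.
have /choice[d hd] : forall i : 'I_N, exists d : 'rV[R]_p, T i = invmx P *m diag_mx d *m P.
  move=> i; have /(similar_diagLR uP)[d ->] : similar_diag P (T i).
    by apply: hP; apply: map_f; rewrite mem_enum.
  by exists d; rewrite conjVmx.
exists (invmx P), d; split; rewrite ?unitmx_inv ?invmxK // => i j.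
have [ O [e [oO eT e0 _]]] := Pos_spec (pT i).
pose v : 'cV[R]_p := invmx P *m delta_mx j 0.
have v0 : v != 0.
  apply/eqP => /(congr1 (mulmx P)); rewrite mulmxA mulmxV // mul1mx mulmx0 => /matrixP/(_ j 0).
  by rewrite !mxE !eqxx => /eqP; rewrite oner_eq0.
have Tv : T i *m v = d i 0 j *: v.
  rewrite hd /v !mulmxA -(mulmxA _ P) mulmxV // mulmx1 -mulmxA scalemxAr; congr (_ *m _).
  apply/matrixP => k l; rewrite mul_diag_mx !mxE.
  by case: eqP => [->|_] //=; rewrite !mulr0.
have /PosE[_ /(_ v v0)] := pT i; rewrite Tv dotZr pmulr_lgt0 //.
by rewrite lt_def dot_eq0 v0 dot_ge0.
Qed.

Lemma loewner_nrm (D : 'M[R]_p) : D^T = D -> loewner D (nrm D)%:M.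
Proof.
move=> sD; apply: loewner_sym => //; first exact: tr_scalar_mx.
move=> x; rewrite mul_scalar_mx dotZr.
have h (B : 'M[R]_p) : mdot B (x *m x^T) = dot x (B^T *m x).
  by rewrite /mdot mulmxA mxtrace_mulC /mxtrace big_ord1.
have e : nrm (x *m x^T) = dot x x.
  rewrite /nrm (_ : nrm2 _ = dot x x ^+ 2) ?sqrtr_sqr ?ger0_norm ?dot_ge0 //.
  rewrite /nrm2 h trmx_mul trmxK -mulmxA.
  have -> : x^T *m x = (dot x x)%:M by rewrite [LHS]mx11_scalar.
  by rewrite mul_mx_scalar dotZr expr2.
by have := mdot_le D (x *m x^T); rewrite h sD e; apply: le_trans; exact: ler_norm.
Qed.

End Transport.

(** * The properties of the mean *)

Section Properties.
Variables (R : realType) (n p N : nat).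
Hypothesis N0 : (0 < N)%N.
Variable M : ('I_N -> 'M[R]_p) -> 'M[R]_p.
Hypothesis gM : is_gm M.
Implicit Types (A : 'I_N -> 'M[R]_n).

Lemma gmean_wd A : gmean_dom p A ->
  (exists! B : 'M[R]_n, is_gmean M A B) /\ Splus p (gmean M A).
Proof.
move=> dA; have pA := dA.1; have [U [W fr]] := dom_frames N0 dA.
have h B := is_gmeanP gM B pA fr; split.
  eexists; split; first exact/h.
  by move=> B /h ->.
rewrite (gmeanE gM pA fr); apply: frame_Splus; first exact: (fr_min fr).1.
apply: (gm_pos gM) => i; exact: (Splus_frame (pA i) (fr_stiefel fr i) (fr_span fr i)).1.
Qed.

Lemma gmean_hom A (a : 'I_N -> R) : gmean_dom p A -> (forall i, 0 < a i) ->
  gmean M (fun i => a i *: A i) = (\prod_(i < N) a i) `^ (N%:R^-1) *: gmean M A.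
Proof.
move=> dA a0; have pA := dA.1; have [U [W fr]] := dom_frames N0 dA.
have pA' i : Splus p (a i *: A i) by exact: Splus_scale.
have fr' : frames (fun i => colspan (a i *: A i)) U W.
  by rewrite (_ : (fun i => _) = fun i => colspan (A i)) //; apply/funext => i; rewrite colspan_scale ?gt_eqF.
rewrite (gmeanE gM pA fr) (gmeanE gM pA' fr').
have -> : (fun i => (U i)^T *m (a i *: A i) *m U i) = fun i => a i *: ((U i)^T *m A i *m U i).
  by apply/funext => i; rewrite -scalemxAr -scalemxAl.
rewrite (gm_hom gM) // => [|i]; last exact: (Splus_frame (pA i) (fr_stiefel fr i) (fr_span fr i)).1.
by rewrite gmv_powR // -scalemxAr -scalemxAl.
Qed.

Lemma gmean_perm A (s : 'S_N) : gmean_dom p A -> gmean M (fun i => A (s i)) = gmean M A.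
Proof.
move=> dA; have pA := dA.1; have [U [W fr]] := dom_frames N0 dA.
rewrite (gmeanE gM pA fr) (gmeanE gM (fun i => pA (s i)) (frames_perm s fr)).
rewrite (gm_perm gM (T := fun i => (U i)^T *m A i *m U i)) // => i.
exact: (Splus_frame (pA i) (fr_stiefel fr i) (fr_span fr i)).1.
Qed.

Lemma gmean_mono A A0 : gmean_dom p A -> (forall i, Splus p (A0 i)) ->
  (forall i, loewner (A i) (A0 i)) -> loewner (gmean M A) (gmean M A0).
Proof.
move=> dA pA0 le; have pA := dA.1; have [U [W fr]] := dom_frames N0 dA.
have fr' : frames (fun i => colspan (A0 i)) U W.
  rewrite (_ : (fun i => _) = fun i => colspan (A i)) //; apply/funext => i.
  by rewrite (loewner_colspan (pA i) (pA0 i) (le i)).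
rewrite (gmeanE gM pA fr) (gmeanE gM pA0 fr'); apply: loewner_congr.
apply: (gm_mono gM) => i.
- exact: (Splus_frame (pA i) (fr_stiefel fr i) (fr_span fr i)).1.
- exact: (Splus_frame (pA0 i) (fr_stiefel fr' i) (fr_span fr' i)).1.
- by rewrite -{2 4}[U i]trmxK; exact: loewner_congr.
Qed.

(** Near the limit T m <= k L with k close to 1, so by monotonicity and homogeneity M (T m) and M L
    agree up to the factor k. *)
Lemma gm_cvg_dec (T : nat -> 'I_N -> 'M[R]_p) (L : 'I_N -> 'M[R]_p) :
  (forall m i, Pos (T m i)) -> (forall i, Pos (L i)) ->
  (forall m i, loewner (T m.+1 i) (T m i)) -> (forall i, (fun m => T m i) @ \oo --> L i) ->
  (fun m => M (T m)) @ \oo --> M L.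
Proof.
move=> pT pL dT cT.
have TmT m k i : loewner (T (m + k)%N i) (T m i).
  by elim: k => [|k IH]; rewrite ?addn0 ?addnS; [exact: loewner_refl|exact: loewner_trans (dT _ _) IH].
have LT m i : loewner (L i) (T m i).
  apply: (@loewner_cvg _ _ (fun k => T (k + m)%N i) (fun=> T m i)); last by move=> k; rewrite addnC.
    by move: (cT i); rewrite -(cvg_shiftn m).
  exact: cvg_cst.
have [a [_ [a0 _ aL _]]] := Pos_bounds_fam pL.
have [_ [b [_ b0 _ Mb]]] := Pos_bounds (gm_pos gM (pT 0%N)).
have MTb m : loewner (M (T m)) b%:M.
  by apply: loewner_trans Mb; apply: (gm_mono gM) => // i; rewrite -[m]add0n.
have MLb : loewner (M L) b%:M.
  by apply: loewner_trans (MTb 0%N); apply: (gm_mono gM).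
apply/mx_cvgP => i j; apply/cvgrPdist_le => e e0.
(* Chosen so that the bound (k - 1) b of [th_entry] is e. *)
pose k := 1 + e / b; have k1 : 1 <= k by rewrite lerDl divr_ge0 // ltW.
have k0 : 0 < k by apply: lt_le_trans k1.
have q0 : 0 < (k - 1) * a by rewrite /k addrC addKr !mulr_gt0 ?invr_gt0.
have : \forall m \near \oo, forall l, nrm (T m l - L l) <= (k - 1) * a.
  apply: (@filter_forall _ 'I_N (fun l m => nrm (T m l - L l) <= (k - 1) * a) \oo _) => l.
  have /cvgrPdist_le/(_ _ q0) := cvg_nrm (cT l); apply: filterS => m.
  by rewrite sub0r normrN ger0_norm ?nrm_ge0.
apply: filterS => m hm.
have hk (X : 'M[R]_p) : Pos X -> loewner X (k *: X).
  move=> pX; rewrite /loewner -[X in _ - X]scale1r -scalerBl; apply: psd_scale; rewrite ?subr_ge0 //.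
  exact: Pos_psd.
have th_k l : th k (T m l) (L l).
  split; last exact: (loewner_trans (LT m l) (hk _ (pT m l))).
  have sD : (T m l - L l)^T = T m l - L l by exact: psd_sym (LT m l).
  have h1 := loewner_trans (loewner_nrm sD) (loewner_scalar _ (hm l)).
  have h2 : loewner ((k - 1) * a)%:M ((k - 1) *: L l).
    by rewrite -scale_scalar_mx; apply: loewner_scale; rewrite ?subr_ge0.
  have := loewner_trans h1 h2; rewrite /loewner scalerBl scale1r.
  by rewrite opprB addrA subrK.
have := gm_th gM (pT m) pL (fun=> k0) th_k; rewrite gmv_cst // => /(th_entry k1)/(_ (MTb m) MLb i j).
move=> hh; rewrite distrC; apply: le_trans (_ : _ <= (k - 1) * b) _; first by move: hh; rewrite !mxE.
by rewrite /k addrC addKr divfK // gt_eqF.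
Qed.

(** All terms lie above the A i, hence have the same ranges, and a single pair U, W serves the whole
    sequence. *)
Lemma gmean_cvg A (Am : nat -> 'I_N -> 'M[R]_n) : gmean_dom p A ->
  (forall m i, Splus p (Am m i)) -> (forall m i, loewner (Am m.+1 i) (Am m i)) ->
  (forall i, (fun m => Am m i) @ \oo --> A i) ->
  (fun m => gmean M (Am m)) @ \oo --> gmean M A.
Proof.
move=> dA pAm dAm cA; have pA := dA.1; have [U [W fr]] := dom_frames N0 dA.
have AmAm m k i : loewner (Am (m + k)%N i) (Am m i).
  by elim: k => [|k IH]; rewrite ?addn0 ?addnS; [exact: loewner_refl|exact: loewner_trans (dAm _ _) IH].
have AAm m i : loewner (A i) (Am m i).
  apply: (@loewner_cvg _ _ (fun k => Am (k + m)%N i) (fun=> Am m i)); last by move=> k; rewrite addnC.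
    by move: (cA i); rewrite -(cvg_shiftn m).
  exact: cvg_cst.
have frm m : frames (fun i => colspan (Am m i)) U W.
  rewrite (_ : (fun i => _) = fun i => colspan (A i)) //; apply/funext => i.
  by rewrite (loewner_colspan (pA i) (pAm m i) (AAm m i)).
rewrite (gmeanE gM pA fr); under eq_fun do rewrite (gmeanE gM (pAm _) (frm _)).
apply: cvg_mulmx; last exact: cvg_cst.
apply: cvg_mulmx; first exact: cvg_cst.
apply: gm_cvg_dec.
- by move=> m i; exact: (Splus_frame (pAm m i) (fr_stiefel fr i) (fr_span (frm m) i)).1.
- by move=> i; exact: (Splus_frame (pA i) (fr_stiefel fr i) (fr_span fr i)).1.
- by move=> m i; rewrite -{2 4}[U i]trmxK; exact: loewner_congr.
- move=> i; apply: cvg_mulmx; last exact: cvg_cst.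
  by apply: cvg_mulmx => //; exact: cvg_cst.
Qed.

Lemma gmean_congr A (mu : R) (P : 'M[R]_n) : gmean_dom p A -> 0 < mu -> Orth P ->
  gmean M (fun i => (mu *: P^T) *m A i *m (mu *: P)) = (mu *: P^T) *m gmean M A *m (mu *: P).
Proof.
move=> dA m0 oP; have pA := dA.1; have [U [W fr]] := dom_frames N0 dA.
have oPT := orth_trmx oP; have oP' := orth_mulV oP.
pose T i := (U i)^T *m A i *m U i; have sU := fr_stiefel fr.
have pT i : Pos (T i) := (Splus_frame (pA i) (sU i) (fr_span fr i)).1.
have m2 : 0 < mu ^+ 2 by exact: exprn_gt0.
have pT2 i : Pos (mu ^+ 2 *: T i) by exact: Pos_scale.
have eA i : (mu *: P^T) *m A i *m (mu *: P) = (P^T *m U i) *m (mu ^+ 2 *: T i) *m (P^T *m U i)^T.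
  rewrite {1}(Splus_frame (pA i) (sU i) (fr_span fr i)).2 -/(T i) trmx_mul trmxK.
  by rewrite -!(scalemxAl, scalemxAr) scalerA -expr2 !mulmxA.
have sPU i : Stiefel (P^T *m U i) by exact: stiefel_mul.
have pA' i : Splus p ((mu *: P^T) *m A i *m (mu *: P)) by rewrite eA; exact: frame_Splus.
have fr' : frames (fun i => colspan ((mu *: P^T) *m A i *m (mu *: P))) (fun i => P^T *m U i) (P^T *m W).
  rewrite (_ : (fun i => colspan _) = fun i => colspan (P^T *m U i)); first exact: frames_orth oPT fr.
  by apply/funext => i; rewrite eA frame_colspan // Pos_unit.
rewrite (gmeanE gM pA fr) (gmeanE gM pA' fr').
rewrite (_ : (fun i => (P^T *m U i)^T *m _ *m _) = fun i => mu ^+ 2 *: T i); last first.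
  by apply/funext => i; rewrite eA frame_congr.
rewrite (gm_hom gM) // gmv_cst // trmx_mul trmxK.
by rewrite -!(scalemxAl, scalemxAr) scalerA -expr2 !mulmxA.
Qed.

Lemma gmean_pinv A : gmean_dom p A -> mppinv (gmean M A) = gmean M (fun i => mppinv (A i)).
Proof.
move=> dA; have pA := dA.1; have [U [W fr]] := dom_frames N0 dA.
pose T i := (U i)^T *m A i *m U i; have sU := fr_stiefel fr.
have pT i : Pos (T i) := (Splus_frame (pA i) (sU i) (fr_span fr i)).1.
have eA i : mppinv (A i) = U i *m invmx (T i) *m (U i)^T.
  by rewrite {1}(Splus_frame (pA i) (sU i) (fr_span fr i)).2 -/(T i) (mppinv_frame (sU i) (pT i)).
have pTi i : Pos (invmx (T i)) by exact: Pos_inv.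
have pA' i : Splus p (mppinv (A i)) by rewrite eA; exact: frame_Splus.
have fr' : frames (fun i => colspan (mppinv (A i))) U W.
  rewrite (_ : (fun i => _) = fun i => colspan (A i)) //; apply/funext => i.
  by rewrite eA frame_colspan ?Pos_unit // (fr_span fr).
rewrite (gmeanE gM pA fr) (gmeanE gM pA' fr') mppinv_frame.
- rewrite (_ : (fun i => (U i)^T *m mppinv _ *m _) = fun i => invmx (T i)); last first.
    by apply/funext => i; rewrite eA frame_congr.
  by rewrite (gm_inv gM).
- exact: (fr_min fr).1.
- exact: (gm_pos gM).
Qed.

Lemma gmean_commute A : gmean_dom p A -> (forall i j, A i *m A j = A j *m A i) ->
  (forall i j, colspan (A i) = colspan (A j)) ->
  gmean M A = powmx (\prod_(i < N) A i) (N%:R^-1).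
Proof.
move=> dA cA eS; have pA := dA.1; have [U [W fr]] := dom_frames N0 dA.
have eU := frames_cst fr eS; have sW := (fr_min fr).1.
pose T i := W^T *m A i *m W.
have spA i : colspan W = colspan (A i) by rewrite -(eU i) (fr_span fr).
have pT i : Pos (T i) := (Splus_frame (pA i) sW (spA i)).1.
have eA i : A i = W *m T i *m W^T := (Splus_frame (pA i) sW (spA i)).2.
have AW i : A i *m W = W *m T i by rewrite {1}eA -mulmxA sW mulmx1.
have cT i j : T i *m T j = T j *m T i.
  have h k l : T k *m T l = W^T *m (A k *m A l) *m W.
    by rewrite [in RHS]mulmxA -(mulmxA _ (A l)) AW mulmxA.
  by rewrite !h cA.
have [P [d [uP d0 eT]]] := codiag_Pos pT cT.
rewrite (gmeanE gM pA fr) (_ : (fun i => _) = T); last by apply/funext => i; rewrite eU.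
clearbody T.
rewrite (gm_diag gM pT uP d0 eT).
have prodP (r : seq 'I_N) : [/\ (\prod_(i <- r) A i) *m W = W *m \prod_(i <- r) T i,
    \prod_(i <- r) T i = P *m diag_mx (\row_j \prod_(i <- r) d i 0 j) *m invmx P
    & (\prod_(i <- r) T i)^T = \prod_(i <- r) T i].
  elim: r => [|k r [IH1 IH2 IH3]].
    rewrite !big_nil; split; rewrite ?trmx1 ?mul1mx ?mulmx1 //.
    rewrite (_ : \row_j _ = const_mx 1); last by apply/rowP => j; rewrite !mxE big_nil.
    by rewrite diag_const_mx mulmx1 mulmxV.
  have eD : T k *m \prod_(i <- r) T i = P *m diag_mx (\row_j \prod_(i <- k :: r) d i 0 j) *m invmx P.
    rewrite IH2 eT !mulmxA mulmxKV // -(mulmxA P) diag_mulE; congr (P *m diag_mx _ *m _).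
    by apply/rowP => j; rewrite !mxE big_cons.
  have eD' : (\prod_(i <- r) T i) *m T k = T k *m \prod_(i <- r) T i.
    rewrite IH2 eT !mulmxA !mulmxKV // -!(mulmxA P) !diag_mulE; congr (P *m (diag_mx _ *m _)).
    by apply/rowP => j; rewrite !mxE mulrC.
  rewrite !big_cons -!mulmxE; split => //; first by rewrite -mulmxA IH1 !mulmxA AW.
  by rewrite trmx_mul IH3 (psd_sym (Pos_psd (pT k))).
have [e1 e2 e3] := prodP (index_enum 'I_N); set K := \prod_(i < N) T i in e1 e2 e3.
have -> : \prod_(i < N) A i = W *m K *m W^T.
  (* The factor W^T comes from the last matrix A l = W T_l W^T, so the product must be nonempty. *)
  have [r [l er]] : exists r (l : 'I_N), index_enum 'I_N = rcons r l.
    have : Ordinal N0 \in index_enum 'I_N by exact: mem_index_enum.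
    by case/lastP: (index_enum _) => [//|r l _]; exists r, l.
  by rewrite -e1 er -cats1 big_cat big_seq1 /= -!mulmxE -!mulmxA (mulmxA (A l)) AW -eA.
(* As N > 0, 0 to the power 1 / N is 0, which keeps the complement of the range in the kernel. *)
rewrite /powmx symfun_frame //; last first.
  by rewrite powR0 // invr_eq0 pnatr_eq0 -lt0n.
rewrite (symfun_conj _ e3 uP e2) (_ : map_mx _ _ = \row_j gmv (fun i => d i 0 j)) //.
by apply/rowP => j; rewrite !mxE gmv_powR.
Qed.

End Properties.

Theorem proposition5 (R : realType) (p n N : nat)
    (hp : (1 <= p <= n)%N) (hN : (2 <= N)%N)
    (M : ('I_N -> 'M[R]_p) -> 'M[R]_p)
    (hM : M = @alm R p N \/ M = @ls R p N) :
  (* well defined, with values in S+(p,n) *)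
  (forall A : 'I_N -> 'M[R]_n, gmean_dom p A ->
     (exists! B : 'M[R]_n, is_gmean M A B) /\ Splus p (gmean M A)) /\
  (* PP1' *)
  (forall A : 'I_N -> 'M[R]_n, gmean_dom p A ->
     (forall i j, A i *m A j = A j *m A i) ->
     (forall i j, colspan (A i) = colspan (A j)) ->
     gmean M A = powmx (\prod_(i < N) A i) (N%:R^-1)) /\
  (* PP2 *)
  (forall (A : 'I_N -> 'M[R]_n) (alpha : 'I_N -> R), gmean_dom p A ->
     (forall i, 0 < alpha i) ->
     gmean M (fun i => alpha i *: A i)
     = (\prod_(i < N) alpha i) `^ (N%:R^-1) *: gmean M A) /\
  (* PP3 *)
  (forall (A : 'I_N -> 'M[R]_n) (s : 'S_N), gmean_dom p A ->
     gmean M (fun i => A (s i)) = gmean M A) /\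
  (* PP4 *)
  (forall A A0 : 'I_N -> 'M[R]_n, gmean_dom p A ->
     (forall i, Splus p (A0 i)) -> (forall i, loewner (A i) (A0 i)) ->
     loewner (gmean M A) (gmean M A0)) /\
  (* PP5 *)
  (forall (A : 'I_N -> 'M[R]_n) (Am : nat -> 'I_N -> 'M[R]_n), gmean_dom p A ->
     (forall m i, Splus p (Am m i)) ->
     (forall m i, loewner (Am m.+1 i) (Am m i)) ->
     (forall i, (fun m => Am m i) @ \oo --> A i) ->
     (fun m => gmean M (Am m)) @ \oo --> gmean M A) /\
  (* PP6' *)
  (forall (A : 'I_N -> 'M[R]_n) (mu : R) (P : 'M[R]_n), gmean_dom p A ->
     0 < mu -> Orth P ->
     gmean M (fun i => (mu *: P^T) *m A i *m (mu *: P))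
     = (mu *: P^T) *m gmean M A *m (mu *: P)) /\
  (* PP7' *)
  (forall A : 'I_N -> 'M[R]_n, gmean_dom p A ->
     mppinv (gmean M A) = gmean M (fun i => mppinv (A i))).
Proof.
have N0 : (0 < N)%N by apply: leq_trans hN.
have gM : is_gm M by case: hM => ->; [exact: alm_is_gm|exact: ls_is_gm].
split; first by move=> A; exact: gmean_wd.
split; first by move=> A; exact: gmean_commute.
split; first by move=> A a; exact: gmean_hom.
split; first by move=> A s; exact: gmean_perm.
split; first by move=> A A0; exact: gmean_mono.
split; first by move=> A Am; exact: gmean_cvg.
split; first by move=> A mu P; exact: gmean_congr.
by move=> A; exact: gmean_pinv.
Qed.
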